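(* Let $f:T^2\to S^4$ be a minimal immersion of a $2$-torus into the unit $4$-sphere. Then $\operatorname{Ind}(f)\ge 6$, and equality holds if and only if $f$ is congruent to the Clifford torus in some great $S^3\subset S^4$.
   Context: $S^n\subset\mathbb R^{n+1}$ is the unit sphere. For an immersion $f:M\to S^n$ of a closed surface, $M$ carries the induced metric; $\perp\!M$ denotes the (real, rank $n-2$) normal bundle of $f$ in $S^n$, with its induced metric and normal connection $\nabla^\perp$. Let $\mathrm{II}$ be the $\perp\!M$-valued second fundamental form; $f$ is minimal if the mean curvature $H=\operatorname{trace}(\mathrm{II})$ vanishes identically. Let $\Delta^\perp$ be the Laplacian of $\nabla^\perp$ on sections of $\perp\!M$ (with the sign such that $\Delta^\perp$ is nonpositive), and let $\tilde{\mathcal A}$ be the symmetric endomorphism of $\perp\!M$ with $\langle\tilde{\mathcal A}(V),W\rangle=\langle\mathcal A(V),\mathcal A(W)\rangle$, where $\mathcal A(V)$ is the shape operator in the normal direction $V$ and endomorphisms of $TM$ carry the trace inner product. The Jacobi operator is $\mathcal L=\Delta^\perp+2+\tilde{\mathcal A}$ acting on smooth sections of $\perp\!M$, and the second variation of area in the normal direction $V$ is $Q(V,V)=-\int_M\langle\mathcal L(V),V\rangle\,dA$. The Morse index $\operatorname{Ind}(f)$ is the maximal dimension of a real vector space of smooth normal sections on which $Q$ is negative definite. A great $S^k\subset S^n$ is the intersection of $S^n$ with a $(k+1)$-dimensional linear subspace of $\mathbb R^{n+1}$. The Clifford torus is the embedded flat minimal torus $\{\tfrac1{\sqrt2}(\cos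 u,\sin u,\cos v,\sin v)\}\subset S^3$. Two immersions are congruent if they agree up to an isometry of the ambient sphere and a diffeomorphism of the domain. *)

(* Defs.v *)
From HB Require Import structures.
From mathcomp Require Import all_boot all_order all_algebra.
From mathcomp Require Import all_classical all_reals all_analysis.

Set Implicit Arguments.
Unset Strict Implicit.
Unset Printing Implicit Defensive.

Import Order.TTheory GRing.Theory Num.Theory.
Import numFieldNormedType.Exports.

Local Open Scope classical_set_scope.
Local Open Scope ring_scope.

(* The 2-torus is R^2/Z^2.  Maps out of it are Z^2-periodic maps on R * R, so
   (u, v) are global coordinates and all tensors are written in the frame
   d/du, d/dv.  Self-maps of the torus are represented by lifts to R * R. *)

Definition coord_vec (R : realType) (i : 'I_2) : R * R :=
  if i == ord0 then (1, 0) else (0, 1).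

Definition partial (R : realType) (W : normedModType R) (i : 'I_2)
  (f : R * R -> W) (p : R * R) : W := 'D_(coord_vec R i) f p.

Fixpoint Ck (R : realType) (W : normedModType R) (k : nat) (f : R * R -> W)
    : Prop :=
  match k with
  | 0 => continuous f
  | k'.+1 => (forall i p, derivable f p (coord_vec R i)) /\
             (forall i, Ck k' (partial i f))
  end.

Definition smooth (R : realType) (W : normedModType R) (f : R * R -> W) :
  Prop := forall k, Ck k f.

Definition lattice (R : realType) : set (R * R) :=
  [set p | p.1 \is a Num.int /\ p.2 \is a Num.int].

Definition periodic (R : realType) (W : Type) (f : R * R -> W) : Prop :=
  forall p q, lattice (p - q) -> f p = f q.

Definition torus_smooth_map (R : realType) (phi : R * R -> R * R) : Prop :=
  smooth phi /\ forall p q, lattice (p - q) -> lattice (phi p - phi q).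

Definition torus_diffeomorphism (R : realType) (phi : R * R -> R * R) : Prop :=
  torus_smooth_map phi /\
  exists psi : R * R -> R * R,
    [/\ torus_smooth_map psi,
        forall p, lattice (psi (phi p) - p) &
        forall p, lattice (phi (psi p) - p)].

(* The library norm on 'rV[R]_m is the sup norm, hence a separate Euclidean
   inner product. *)
Definition dot (R : realType) (m : nat) (x y : 'rV[R]_m) : R :=
  \sum_(a < m) x ord0 a * y ord0 a.

Definition sphere (R : realType) (n : nat) : set 'rV[R]_n.+1 :=
  [set x | dot x x = 1].
Arguments sphere : clear implicits.

Definition great_sphere (R : realType) (k n : nat) (S : set 'rV[R]_n.+1) :
    Prop :=
  exists W : {vspace 'rV[R]_n.+1},
    \dim W = k.+1 /\ S = sphere R n `&` [set x | x \in W].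

(* Geodesic distance on the unit sphere; on a great sphere it is also the
   intrinsic distance. *)
Definition sphere_dist (R : realType) (m : nat) (x y : 'rV[R]_m) : R :=
  acos (dot x y).

Definition isometry_onto (R : realType) (m m' : nat) (A : set 'rV[R]_m)
    (B : set 'rV[R]_m') (s : 'rV[R]_m -> 'rV[R]_m') : Prop :=
  set_bij A B s /\
  forall x y, A x -> A y -> sphere_dist (s x) (s y) = sphere_dist x y.

Definition congruent (R : realType) (n : nat) (f g : R * R -> 'rV[R]_n.+1) :
    Prop :=
  exists (s : 'rV[R]_n.+1 -> 'rV[R]_n.+1) (phi : R * R -> R * R),
    [/\ isometry_onto (sphere R n) (sphere R n) s,
        torus_diffeomorphism phi &
        forall p, f (phi p) = s (g p)].

Definition clifford_torus (R : realType) (p : R * R) : 'rV[R]_4 :=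
  (Num.sqrt 2)^-1 *:
  \row_(a < 4) [:: cos (2 * pi * p.1); sin (2 * pi * p.1);
                   cos (2 * pi * p.2); sin (2 * pi * p.2)]`_a.

Section Geometry.
Context {R : realType} {n : nat}.
Variable f : R * R -> 'rV[R]_n.+1.
Implicit Types (V W : R * R -> 'rV[R]_n.+1) (x : 'rV[R]_n.+1) (p : R * R).

Definition immersed_torus : Prop :=
  [/\ smooth f, periodic f, forall p, sphere R n (f p) &
      forall p, row_free (\matrix_(i < 2) partial i f p)].

Definition metric p : 'M[R]_2 :=
  \matrix_(i, j) dot (partial i f p) (partial j f p).

Definition inv_metric p : 'M[R]_2 := invmx (metric p).

Definition area_density p : R := Num.sqrt (\det (metric p)).

Definition christoffel (k i j : 'I_2) p : R :=
  2^-1 * \sum_(l < 2) inv_metric p k l *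
    (partial i (fun q => metric q j l) p
     + partial j (fun q => metric q i l) p
     - partial l (fun q => metric q i j) p).

Definition normal_at p x : Prop :=
  dot x (f p) = 0 /\ forall i, dot x (partial i f p) = 0.

(* Orthogonal projection of R^{n+1} onto the fibre at p of the normal bundle
   of f in S^n. *)
Definition normal_proj p x : 'rV[R]_n.+1 :=
  x - dot x (f p) *: f p
    - \sum_(i < 2) \sum_(j < 2)
        (inv_metric p i j * dot x (partial i f p)) *: partial j f p.

Definition normal_section V : Prop :=
  [/\ smooth V, periodic V & forall p, normal_at p (V p)].

Definition second_form (i j : 'I_2) p : 'rV[R]_n.+1 :=
  normal_proj p (partial i (partial j f) p).

Definition mean_curvature p : 'rV[R]_n.+1 :=
  \sum_(i < 2) \sum_(j < 2) inv_metric p i j *: second_form i j p.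

Definition minimal : Prop := forall p, mean_curvature p = 0.

Definition normal_connection (i : 'I_2) V p : 'rV[R]_n.+1 :=
  normal_proj p (partial i V p).

Definition normal_laplacian V p : 'rV[R]_n.+1 :=
  \sum_(i < 2) \sum_(j < 2) inv_metric p i j *:
    (normal_connection i (normal_connection j V) p
     - \sum_(k < 2) christoffel k i j p *: normal_connection k V p).

(* Matrix of the shape operator, acting on column vectors of components:
   < A(x) d_i, d_j > = < II(d_i, d_j), x >. *)
Definition shape_operator p x : 'M[R]_2 :=
  inv_metric p *m \matrix_(i, j) dot (second_form i j p) x.

(* tr (A B^* ), where B^* is the adjoint of B for the induced metric. *)
Definition endo_dot p (A B : 'M[R]_2) : R :=
  \tr (A *m (inv_metric p *m B^T *m metric p)).

(* The components of the vector representing the linear form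
   y |-> < A(x), A(y) >; see simons_operatorP and simons_operator_normal
   below. *)
Definition simons_operator p x : 'rV[R]_n.+1 :=
  \row_a endo_dot p (shape_operator p x) (shape_operator p (delta_mx ord0 a)).

Definition jacobi V p : 'rV[R]_n.+1 :=
  normal_laplacian V p + 2 *: V p + simons_operator p (V p).

(* [0, 1]^2 is a fundamental domain for Z^2, and dA = area_density du dv. *)
Definition second_variation V : R :=
  - \int[(lebesgue_measure \x lebesgue_measure)%E]_(p in `[0, 1] `*` `[0, 1])
      (dot (jacobi V p) (V p) * area_density p).

(* The span of B_0, ..., B_{k-1} is a k-dimensional space of normal sections on
   which the second variation is negative definite. *)
Definition negative_definite_family (k : nat)
    (B : 'I_k -> R * R -> 'rV[R]_n.+1) : Prop :=
  [/\ forall i, normal_section (B i),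
      forall c : 'I_k -> R, \sum_(i < k) c i *: B i = 0 -> forall i, c i = 0 &
      forall c : 'I_k -> R, \sum_(i < k) c i *: B i <> 0 ->
        second_variation (\sum_(i < k) c i *: B i) < 0].

Definition morse_index : \bar R :=
  ereal_sup [set (k%:R)%:E | k in
    [set k : nat | exists B : 'I_k -> R * R -> 'rV[R]_n.+1,
                     negative_definite_family B]].

Lemma dotC m (x y : 'rV[R]_m) : dot x y = dot y x.
Proof. by apply: eq_bigr => a _; rewrite mulrC. Qed.

Lemma dot_suml m (I : finType) (c : I -> R) (F : I -> 'rV[R]_m) y :
  dot (\sum_i c i *: F i) y = \sum_i c i * dot (F i) y.
Proof.
under [RHS]eq_bigr do rewrite big_distrr /=.
rewrite exchange_big; apply: eq_bigr => a _ /=.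
by rewrite summxE big_distrl; apply: eq_bigr => i _ /=; rewrite mxE -mulrA.
Qed.

Lemma dotBl m (x y z : 'rV[R]_m) : dot (x - y) z = dot x z - dot y z.
Proof. by rewrite -sumrB; apply: eq_bigr => a _; rewrite !mxE mulrBl. Qed.

Lemma dotZl m (c : R) (x z : 'rV[R]_m) : dot (c *: x) z = c * dot x z.
Proof. by rewrite [RHS]big_distrr; apply: eq_bigr => a _; rewrite mxE -mulrA. Qed.

Lemma normal_proj_normal p x : sphere R n (f p) ->
  (forall i, dot (f p) (partial i f p) = 0) -> metric p \in unitmx ->
  normal_at p (normal_proj p x).
Proof.
move=> ff fdf gU; split=> [|k].
  rewrite !dotBl dotZl ff mulr1 subrr sub0r pair_big dot_suml big1 ?oppr0 //=.
  by move=> [i j] _; rewrite (dotC _ (f p)) /= fdf mulr0.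
rewrite !dotBl dotZl fdf mulr0 subr0 pair_big dot_suml /=.
rewrite -(pair_big xpredT xpredT (fun i j => inv_metric p i j *
  dot x (partial i f p) * dot (partial j f p) (partial k f p))) /=.
rewrite (eq_bigr (fun i => dot x (partial i f p) * (1%:M : 'M[R]_2) i k)).
  rewrite (bigD1 k) //= big1 ?addr0; first by rewrite mxE eqxx mulr1 subrr.
  by move=> i /negPf ik; rewrite mxE ik mulr0.
move=> i _; rewrite -(mulVmx gU) mxE big_distrr; apply: eq_bigr => j _ /=.
by rewrite [metric p j k]mxE mulrA (mulrC (dot _ _)).
Qed.

Lemma shape_operator_sum p x :
  shape_operator p x
  = \sum_a x ord0 a *: shape_operator p (delta_mx ord0 a).
Proof.
under eq_bigr do rewrite /shape_operator scalemxAr.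
rewrite -mulmx_sumr; congr (_ *m _); apply/matrixP => i j.
rewrite [RHS]summxE [LHS]mxE [LHS]dotC.
have {1}-> : x = \sum_a x ord0 a *: delta_mx ord0 a := row_sum_delta x.
by rewrite dot_suml; apply: eq_bigr => a _; rewrite [RHS]mxE [in RHS]mxE [in RHS]dotC.
Qed.

Lemma simons_operatorP p x y :
  dot (simons_operator p x) y
  = endo_dot p (shape_operator p x) (shape_operator p y).
Proof.
rewrite (shape_operator_sum p y) /endo_dot linear_sum /=.
rewrite mulmx_sumr mulmx_suml mulmx_sumr linear_sum /=.
apply: eq_bigr => a _; rewrite mxE linearZ /=.
by rewrite -scalemxAr -scalemxAl -scalemxAr linearZ mulrC.
Qed.

Lemma simons_operator_normal p x : sphere R n (f p) ->
  (forall i, dot (f p) (partial i f p) = 0) -> metric p \in unitmx ->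
  normal_at p (simons_operator p x).
Proof.
move=> ff fdf gU.
have shape0 y : (forall z, normal_at p z -> dot z y = 0) ->
    dot (simons_operator p x) y = 0.
  move=> y0; rewrite simons_operatorP [shape_operator p y](_ : _ = 0).
    by rewrite /endo_dot trmx0 mulmx0 mul0mx mulmx0 mxtrace0.
  rewrite /shape_operator [X in _ *m X](_ : _ = 0) ?mulmx0 //.
  by apply/matrixP => i j; rewrite !mxE y0 //; exact: normal_proj_normal.
by split=> [|i]; apply: shape0 => z [].
Qed.

End Geometry.

(* Main.v *)
Require Import Defs.
From HB Require Import structures.
From mathcomp Require Import all_boot all_order all_algebra.
From mathcomp Require Import all_classical all_reals all_analysis.
From mathcomp Require Import ring lra.

Set Implicit Arguments.
Unset Strict Implicit.
Unset Printing Implicit Defensive.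

Import Order.TTheory GRing.Theory Num.Theory.
Import numFieldNormedType.Exports.

Local Open Scope classical_set_scope.
Local Open Scope ring_scope.

(** In isothermal coordinates [(x, y)], in which the metric is [E (dx^2 + dy^2)],
    a conformal immersion [f] into the sphere is minimal exactly when
    [f_xx + f_yy = - 2 E f] ([minimal_conformal]). Let [P] and [N] be the normal
    parts of [f_xx] and [f_xy]. The Codazzi equations say that [P - i N] is
    holomorphic, so that [|P|^2 - |N|^2 - 2 i <P, N>] is holomorphic on a torus
    and therefore constant; after a rotation of the coordinates [<P, N> = 0] and
    [|P|^2 - |N|^2 = k >= 0] ([principal_chart]).

    Lower bound. The second variation of a normal field [V] is
    [B (V, V) - 2 int E |V|^2] ([second_variation_conformal]). The form [B]
    vanishes on the normal parts of the constant vectors of [R^5]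
    ([hform_perp]), and [B (P, W) = - 2 k int <P, W> / E] ([hform_hopf]). If
    [k > 0], these normal parts and [P] span a space of dimension six on which
    the second variation is negative ([negative6]). If [k = 0], then [P] and [N]
    both lie in the kernel of [B] and the dimension is seven
    ([negative7_superminimal]). By Gauss-Bonnet [P] and [N] do not both vanish
    ([hopf1_neq0]).

    Equality. Let the index be six, so that [k > 0] and the kernel of [B]
    contains only normal parts of constants. It also contains the Hopf
    differential rotated by a quarter turn in the normal bundle
    ([vdens_rotated_hopf]), and this forces [f] into a great three-sphere
    ([great_sphere_or_negative7]). On multiples [h u] of the remaining constant
    unit normal [u] the second variation is [int (|dh|^2 - 2 E h^2)], which must
    be nonnegative when [int E h = 0]. The components of a translation field
    [f_x], balanced by an infinitesimal conformal motion of the sphere, have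
    this property, and the resulting inequality is an equality only if [E_x = 0]
    ([translation_invariance]). Hence [E] is constant, [f] is a product of two
    circles ([flat_form]), and characters of low frequency, tested in the same
    inequality, show that the periods of the two angles are those of the
    Clifford torus ([periods_injective]).

    Conversely, the second variation of the Clifford torus decouples into
    [2 int (|da|^2 - 2 a^2)] and [int (|db|^2 - b^2)], which are nonnegative
    outside the six Fourier modes of lowest frequency ([clifford_nonneg]).

    The analysis underneath is built on Fejer means: they give the spectral gap
    ([spectral_gap]) and solve Poisson's equation ([poisson]); a relaxed
    iteration then solves elliptic equations in divergence form
    ([elliptic_solution]); and a harmonic one-form, parallel for a flat
    conformal metric by a Bochner argument, provides isothermal coordinates
    ([isothermal]). *)

(** * Smooth functions on the plane *)
Section SmoothFunctions.
Context {R : realType}.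
Implicit Types (h k : R * R -> R) (p q : R * R) (i j : 'I_2).

Lemma ord2P (P : 'I_2 -> Prop) : P ord0 -> P ord_max -> forall i, P i.
Proof.
move=> P0 P1 i; case: (unliftP ord0 i) => [j ->|-> //].
by rewrite (ord1 j) (_ : lift ord0 0 = ord_max) //; apply: val_inj.
Qed.

Lemma partialE (W : normedModType R) i (h : R * R -> W) p :
  partial i h p = 'D_(coord_vec R i) h p.
Proof. by []. Qed.
Lemma slice0 (W : normedModType R) (h : R * R -> W) (s t : R) :
  (derivable h (s, t) (coord_vec R ord0) <-> derivable (fun x => h (x, t)) s 1)
  /\ partial ord0 h (s, t) = 'D_1 (fun x => h (x, t)) s.
Proof.
rewrite /derivable /partial /derive.
have -> : (fun x : R => x^-1 *: ((h \o shift (s, t)) (x *: coord_vec R ord0)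
    - h (s, t))) = (fun x => x^-1 *: (((fun x => h (x, t)) \o shift s) (x *: 1)
    - h (s, t))); last by [].
apply/funext => x; congr (_ *: (_ - _)) => /=; congr (h _).
by congr pair; rewrite /= scaler0 add0r.
Qed.

Lemma slice1 (W : normedModType R) (h : R * R -> W) (s t : R) :
  (derivable h (s, t) (coord_vec R ord_max)
   <-> derivable (fun x => h (s, x)) t 1)
  /\ partial ord_max h (s, t) = 'D_1 (fun x => h (s, x)) t.
Proof.
rewrite /derivable /partial /derive.
have -> : (fun x : R => x^-1 *: ((h \o shift (s, t)) (x *: coord_vec R ord_max)
    - h (s, t))) = (fun x => x^-1 *: (((fun x => h (s, x)) \o shift t) (x *: 1)
    - h (s, t))); last by [].
apply/funext => x; congr (_ *: (_ - _)) => /=; congr (h _).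
by congr pair; rewrite /= scaler0 add0r.
Qed.

Lemma is_derive_continuous (f : R -> R) (x d : R) : is_derive x 1 f d -> {for x, continuous f}.
Proof. by move=> D; exact/differentiable_continuous/derivable1_diffP/ex_derive. Qed.

Definition has_partials (W : normedModType R) (h : R * R -> W) :=
  forall i p, derivable h p (coord_vec R i).

Lemma is_derive_slice0 (W : normedModType R) (h : R * R -> W) (s t : R) :
  has_partials h -> is_derive s 1 (fun x => h (x, t)) (partial ord0 h (s, t)).
Proof.
move=> dh; have [[e _] ->] := slice0 h s t.
by apply: derivableP; apply: e; exact: dh.
Qed.

Lemma is_derive_slice1 (W : normedModType R) (h : R * R -> W) (s t : R) :
  has_partials h -> is_derive t 1 (fun x => h (s, x)) (partial ord_max h (s, t)).
Proof.
move=> dh; have [[e _] ->] := slice1 h s t.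
by apply: derivableP; apply: e; exact: dh.
Qed.

Lemma partials_of_slices (W : normedModType R) (h h0 h1 : R * R -> W) :
  (forall s t : R, is_derive s 1 (fun x => h (x, t)) (h0 (s, t))) ->
  (forall s t : R, is_derive t 1 (fun x => h (s, x)) (h1 (s, t))) ->
  [/\ has_partials h, partial ord0 h = h0 & partial ord_max h = h1].
Proof.
move=> d0 d1; split.
- move=> i [s t]; move: i; apply: ord2P.
    by apply: (slice0 h s t).1.2; have D := d0 s t; exact: ex_derive.
  by apply: (slice1 h s t).1.2; have D := d1 s t; exact: ex_derive.
- apply/funext => -[s t]; rewrite (slice0 h s t).2; have D := d0 s t.
  exact: derive_val.
- apply/funext => -[s t]; rewrite (slice1 h s t).2; have D := d1 s t.
  exact: derive_val.
Qed.

(** [Ck] asks for continuity of the derivatives of order exactly [k]; all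
    closure properties are proved for [C_le], which asks for it up to order
    [k] and so can be unfolded one derivative at a time. *)
Definition C_le (W : normedModType R) n (h : R * R -> W) :=
  forall m, (m <= n)%N -> Ck m h.

Lemma C_leS (W : normedModType R) n (h : R * R -> W) : C_le n.+1 h <->
  [/\ continuous h, has_partials h & forall i, C_le n (partial i h)].
Proof.
split=> [H|[c d H] [|m] // mn]; last by split=> // i; exact: H.
split; [exact: (H 0)|by have [] := H 1|].
by move=> i m mn; have [_] := H m.+1 mn; exact.
Qed.

Lemma smooth_C_le (W : normedModType R) (h : R * R -> W) :
  smooth h <-> forall n, C_le n h.
Proof. by split=> [H n m _|H n]; [exact: H|exact: (H n n)]. Qed.
Lemma smoothE (W : normedModType R) (h : R * R -> W) : smooth h <->
  [/\ continuous h, has_partials h & forall i, smooth (partial i h)].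
Proof.
split=> [H|[c d H] [|n] //]; last by split=> // i; exact: H.
split; [exact: (H 0)|by have [] := H 1|].
by move=> i n; have [_] := H n.+1; exact.
Qed.

Lemma smooth_continuous (W : normedModType R) (h : R * R -> W) :
  smooth h -> continuous h.
Proof. by case/smoothE. Qed.
Lemma smooth_partials (W : normedModType R) (h : R * R -> W) :
  smooth h -> has_partials h.
Proof. by case/smoothE. Qed.
Lemma smooth_partial (W : normedModType R) (h : R * R -> W) i :
  smooth h -> smooth (partial i h).
Proof. by case/smoothE. Qed.

(** Smoothness by coinduction, for functions whose derivatives are again given
    by the functions of a class but by no closed formula. *)
Lemma smooth_coind (W : normedModType R) (P : (R * R -> W) -> Prop) :
  (forall g, P g ->
    [/\ continuous g, has_partials g & forall i, P (partial i g)]) ->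
  forall g, P g -> smooth g.
Proof.
move=> HP g Pg n; elim: n g Pg => [|n IH] g /HP [] //.
by move=> _ d H; split=> // i; apply/IH/H.
Qed.

Lemma partial_cst (W : normedModType R) (c : W) i :
  partial i (fun=> c) = fun=> 0.
Proof. by apply/funext => p; rewrite /partial derive_cst. Qed.
Lemma C_le_cst (W : normedModType R) n (c : W) : C_le n (fun=> c).
Proof.
elim: n c => [|n IH] c; first by move=> [|m] // _; exact: cst_continuous.
apply/C_leS; split; first exact: cst_continuous.
  by move=> i p; exact: derivable_cst.
by move=> i; rewrite partial_cst.
Qed.

Lemma C_le_le (W : normedModType R) n (h : R * R -> W) :
  C_le n.+1 h -> C_le n h.
Proof. by move=> H m mn; apply: H; exact: leq_trans mn _. Qed.
Lemma partialD (W : normedModType R) (h k : R * R -> W) i :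
  has_partials h -> has_partials k ->
  partial i (fun p => h p + k p) = fun p => partial i h p + partial i k p.
Proof. by move=> dh dk; apply/funext => p; rewrite /partial deriveD. Qed.
Lemma partialN (W : normedModType R) (h : R * R -> W) i : has_partials h ->
  partial i (fun p => - h p) = fun p => - partial i h p.
Proof. by move=> dh; apply/funext => p; rewrite /partial deriveN. Qed.
Lemma partialM h k i : has_partials h -> has_partials k ->
  partial i (fun p => h p * k p)
  = fun p => partial i h p * k p + h p * partial i k p.
Proof.
move=> dh dk; apply/funext => p; rewrite /partial.
rewrite (@deriveM _ _ h k p (coord_vec R i) (dh i p) (dk i p)) /GRing.scale /=.
by rewrite addrC mulrC.
Qed.

Lemma C_leD (W : normedModType R) n (h k : R * R -> W) :
  C_le n h -> C_le n k -> C_le n (fun p => h p + k p).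
Proof.
elim: n h k => [|n IH] h k.
  move=> H K [|//] _ p; exact: cvgD (H 0 isT p) (K 0 isT p).
move=> /C_leS[ch dh H] /C_leS[ck dk K]; apply/C_leS; split.
- by move=> p; exact: cvgD (ch p) (ck p).
- by move=> i p; apply: (@derivableD _ _ _ h k).
- by move=> i; rewrite partialD //; exact: IH.
Qed.

Lemma C_leN (W : normedModType R) n (h : R * R -> W) :
  C_le n h -> C_le n (fun p => - h p).
Proof.
elim: n h => [|n IH] h.
  by move=> H [|//] _ p; exact: cvgN (H 0 isT p).
move=> /C_leS[ch dh H]; apply/C_leS; split.
- by move=> p; exact: cvgN (ch p).
- by move=> i p; apply: (@derivableN _ _ _ h).
- by move=> i; rewrite partialN //; exact: IH.
Qed.

Lemma C_leM n h k : C_le n h -> C_le n k -> C_le n (fun p => h p * k p).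
Proof.
elim: n h k => [|n IH] h k.
  move=> H K [|//] _ p; exact: cvgM (H 0 isT p) (K 0 isT p).
move=> Hh Kk; move/C_leS: (Hh) => [ch dh H]; move/C_leS: (Kk) => [ck dk K].
apply/C_leS; split.
- by move=> p; exact: cvgM (ch p) (ck p).
- by move=> i p; apply: (@derivableM _ _ h k).
- by move=> i; rewrite partialM //; apply: C_leD; apply: IH => //; exact: C_le_le.
Qed.

Lemma smooth_cst (W : normedModType R) (c : W) : smooth (fun _ : R * R => c).
Proof. by apply/smooth_C_le => n; exact: C_le_cst. Qed.
Lemma smoothD (W : normedModType R) (h k : R * R -> W) :
  smooth h -> smooth k -> smooth (fun p => h p + k p).
Proof. by move=> /smooth_C_le H /smooth_C_le K; apply/smooth_C_le => n; exact: C_leD. Qed.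
Lemma smoothN (W : normedModType R) (h : R * R -> W) :
  smooth h -> smooth (fun p => - h p).
Proof. by move=> /smooth_C_le H; apply/smooth_C_le => n; exact: C_leN. Qed.
Lemma smoothM h k : smooth h -> smooth k -> smooth (fun p => h p * k p).
Proof. by move=> /smooth_C_le H /smooth_C_le K; apply/smooth_C_le => n; exact: C_leM. Qed.
Lemma partial_comp (phi dphi : R -> R) (D : set R) h i :
  (forall x, D x -> is_derive x 1 phi (dphi x)) -> (forall p, D (h p)) ->
  has_partials h ->
  has_partials (phi \o h) /\
  partial i (phi \o h) = fun p => dphi (h p) * partial i h p.
Proof.
move=> dp Dh dh.
have [//||H0 H1 H2] := @partials_of_slices R^o (phi \o h)
  (fun p => dphi (h p) * partial ord0 h p)
  (fun p => dphi (h p) * partial ord_max h p).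
- move=> s t; apply: (@is_derive1_comp _ phi (fun x => h (x, t))).
    exact: dp.
  exact: is_derive_slice0.
- move=> s t; apply: (@is_derive1_comp _ phi (fun x => h (s, x))).
    exact: dp.
  exact: is_derive_slice1.
- by split; [exact: H0|elim/ord2P: i; [exact: H1|exact: H2]].
Qed.

Lemma C_le_comp (phi dphi : R -> R) (D : set R) n h :
  (forall x, D x -> is_derive x 1 phi (dphi x)) -> (forall p, D (h p)) ->
  smooth h -> C_le n (dphi \o h) -> C_le n.+1 (phi \o h).
Proof.
move=> dp Dh sh Hn; have dh := smooth_partials sh.
apply/C_leS; split.
- move=> p; apply: continuous_comp; first exact: smooth_continuous.
  exact: is_derive_continuous (dp _ (Dh p)).
- exact: (partial_comp ord0 dp Dh dh).1.
- move=> i; rewrite (partial_comp i dp Dh dh).2; apply: C_leM => //.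
  by move/smooth_C_le: (smooth_partial i sh).
Qed.

Lemma C_le0_comp (phi dphi : R -> R) (D : set R) h :
  (forall x, D x -> is_derive x 1 phi (dphi x)) -> (forall p, D (h p)) ->
  smooth h -> C_le 0 (phi \o h).
Proof.
move=> dp Dh sh [|//] _ p.
apply: continuous_comp; first exact: smooth_continuous.
exact: is_derive_continuous (dp _ (Dh p)).
Qed.

Lemma smooth_expR h : smooth h -> smooth (expR \o h).
Proof.
move=> sh; apply/smooth_C_le; elim=> [|n IH].
  exact: (@C_le0_comp _ expR setT).
exact: (@C_le_comp _ expR setT).
Qed.

Lemma smooth_sincos h : smooth h -> smooth (sin \o h) /\ smooth (cos \o h).
Proof.
move=> sh; rewrite !smooth_C_le.
suff H n : C_le n (sin \o h) /\ C_le n (cos \o h) by split=> n; apply (H n).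
elim: n => [|n [IHs IHc]]; split.
- exact: (@C_le0_comp _ cos setT).
- exact: (@C_le0_comp _ (fun x => - sin x) setT).
- exact: (@C_le_comp _ cos setT).
- by apply: (@C_le_comp _ (fun x => - sin x) setT) => //; exact: C_leN IHs.
Qed.

Lemma C_le_inv n h : C_le n h -> (forall p, h p != 0) ->
  C_le n (fun p => (h p)^-1).
Proof.
move=> sh h0; have dV (x : R) : x != 0 -> is_derive x 1 GRing.inv (- (x^-1 * x^-1)).
  move=> x0; have := @is_deriveV _ (@id R) x 1 1 x0 (is_derive_id _ _).
  by move/is_derive_eq; apply; rewrite /GRing.scale /= mulr1 expr2 invfM.
elim: n sh => [|n IH] sh.
  move=> [|//] _ p; apply: continuous_comp; first exact: (sh 0).
  exact: is_derive_continuous (dV _ (h0 p)).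
have {IH}IH := IH (C_le_le sh); move/C_leS: (sh) => [ch dh H]; apply/C_leS; split.
- move=> p; apply: continuous_comp; first exact: ch.
  exact: is_derive_continuous (dV _ (h0 p)).
- exact: (@partial_comp _ _ [set x | x != 0] h ord0 dV h0 dh).1.
- move=> i; have [_] := @partial_comp _ _ [set x | x != 0] h i dV h0 dh.
  rewrite /comp => ->; apply: C_leM => //.
  exact/C_leN/C_leM.
Qed.

Lemma smooth_inv h : smooth h -> (forall p, h p != 0) ->
  smooth (fun p => (h p)^-1).
Proof. by move=> /smooth_C_le H h0; apply/smooth_C_le => n; exact: C_le_inv. Qed.
Lemma smooth_sqrt h : smooth h -> (forall p, 0 < h p) ->
  smooth (fun p => Num.sqrt (h p)).
Proof.
move=> sh h0; apply/smooth_C_le; elim=> [|n IH].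
  exact: (@C_le0_comp _ _ [set x | 0 < x] h (@is_derive1_sqrt R)).
apply: (@C_le_comp _ _ [set x | 0 < x] n h (@is_derive1_sqrt R)) => //.
rewrite /comp; apply: C_le_inv.
  exact: C_leM (C_le_cst _) IH.
by move=> p; rewrite mulf_neq0 // gt_eqF // sqrtr_gt0.
Qed.

End SmoothFunctions.

Opaque partial.

Section MeanValue.
Context {R : realType}.
Implicit Types (h k : R * R -> R) (p q : R * R) (i j : 'I_2).

Lemma mvt_real (g dg : R -> R) (a b : R) :
  (forall x : R, is_derive x 1 g (dg x)) ->
  exists2 c, `|c - a| <= `|b - a| & g b - g a = dg c * (b - a).
Proof.
move=> dgP; have cg (x y : R) : {within `[x, y], continuous g}.
  apply: continuous_subspaceT => z; exact: is_derive_continuous (dgP z).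
have [ab|/ltW ba] := leP a b.
  have [c cab ->] := MVT_segment ab (fun x _ => dgP x) (cg a b).
  exists c => //; move: cab; rewrite in_itv /= => /andP[ac cb].
  by rewrite !ger0_norm ?subr_ge0 // lerB.
have [c cab E] := MVT_segment ba (fun x _ => dgP x) (cg b a).
exists c; last by rewrite -opprB E -mulrN opprB.
move: cab; rewrite in_itv /= => /andP[bc ca].
by rewrite (distrC c) (distrC b) !ger0_norm ?subr_ge0 // lerB.
Qed.

Lemma mvt0 h (a b t : R) : has_partials h ->
  exists2 c, `|c - a| <= `|b - a| &
    h (b, t) - h (a, t) = partial ord0 h (c, t) * (b - a).
Proof.
by move=> dh; exact: (mvt_real a b (fun x => is_derive_slice0 x t dh)).
Qed.

Lemma mvt1 h (s a b : R) : has_partials h ->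
  exists2 c, `|c - a| <= `|b - a| &
    h (s, b) - h (s, a) = partial ord_max h (s, c) * (b - a).
Proof.
by move=> dh; exact: (mvt_real a b (fun x => is_derive_slice1 s x dh)).
Qed.

Lemma continuous_at_box h p e : continuous h -> 0 < e ->
  exists2 d, 0 < d & forall q, `|q.1 - p.1| <= d -> `|q.2 - p.2| <= d ->
    `|h q - h p| < e.
Proof.
move=> ch e0; have /cvgrPdist_lt/(_ e e0) := ch p.
move/nbhs_ballP => [d /= d0 H]; exists (d / 2); first by rewrite divr_gt0.
have d2 : d / 2 < d by rewrite ltr_pdivrMr // ltr_pMr // ltr1n.
move=> q q1 q2; rewrite distrC; apply: H.
by split; rewrite /ball /= distrC; exact: le_lt_trans d2.
Qed.

(** The two mean values in the proof of Schwarz's theorem lie in arbitrarily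
    small boxes, and continuity identifies their limits. *)
Lemma eq_of_close h k p : continuous h -> continuous k ->
  (forall d, 0 < d -> exists q q' : R * R,
    [/\ `|q.1 - p.1| <= d, `|q.2 - p.2| <= d, `|q'.1 - p.1| <= d,
    `|q'.2 - p.2| <= d & h q = k q']) -> h p = k p.
Proof.
move=> ch ck H; apply/eqP; rewrite -subr_eq0 -normr_le0; apply/ler_addgt0Pr => e e0.
have e20 : 0 < e / 2 by rewrite divr_gt0.
have [d d0 Hd] := continuous_at_box p ch e20.
have [d' d'0 Hd'] := continuous_at_box p ck e20.
have m0 : 0 < Num.min d d' by rewrite lt_min d0.
have [q [q' [a1 a2 b1 b2 E]]] := H _ m0.
have {}a1 : `|q.1 - p.1| <= d by rewrite (le_trans a1) // ge_min lexx.
have {}a2 : `|q.2 - p.2| <= d by rewrite (le_trans a2) // ge_min lexx.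
have {}b1 : `|q'.1 - p.1| <= d' by rewrite (le_trans b1) // ge_min lexx orbT.
have {}b2 : `|q'.2 - p.2| <= d' by rewrite (le_trans b2) // ge_min lexx orbT.
rewrite add0r (_ : h p - k p = (k q' - k p) - (h q - h p)); last by rewrite E; ring.
rewrite (le_trans (ler_normB _ _)) // (splitr e) lerD // ltW //.
  exact: Hd'.
exact: Hd.
Qed.

(** Schwarz's theorem: the second difference over a small rectangle is a value
    of either mixed derivative, by the mean value theorem applied in either
    order. *)
Lemma partialC h i j : smooth h ->
  partial i (partial j h) = partial j (partial i h).
Proof.
move=> sh; move: i j.
have aux (a b c e : R) : a - b - (c - e) = a - c - (b - e) by ring.
suff H : partial ord0 (partial ord_max h) = partial ord_max (partial ord0 h).
  move=> i j; elim/ord2P: i; elim/ord2P: j; [reflexivity|exact: H| |reflexivity].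
  by symmetry; exact: H.
have sp i := smooth_partial i sh.
have dh := smooth_partials sh.
apply/funext => -[s t]; apply: eq_of_close.
- exact/smooth_continuous/smooth_partial.
- exact/smooth_continuous/smooth_partial.
move=> d d0.
have sub x y : has_partials (fun q => h (q.1 + x, q.2 + y) - h q) /\ forall i,
   partial i (fun q => h (q.1 + x, q.2 + y) - h q)
   = fun q => partial i h (q.1 + x, q.2 + y) - partial i h q.
  have [//|//|P0 P1 P2] := @partials_of_slices _ R (fun q => h (q.1 + x, q.2 + y) - h q)
   (fun q => partial ord0 h (q.1 + x, q.2 + y) - partial ord0 h q)
   (fun q => partial ord_max h (q.1 + x, q.2 + y) - partial ord_max h q).
  - move=> a b; apply: is_deriveB; last exact: is_derive_slice0.
    have := @is_derive1_comp _ (fun z => h (z, b + y)) (fun z => z + x) a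
    (partial ord0 h (a + x, b + y)) 1 (is_derive_slice0 _ _ dh).
    by rewrite mulr1; apply; exact: is_derive_shift.
  - move=> a b; apply: is_deriveB; last exact: is_derive_slice1.
    have := @is_derive1_comp _ (fun z => h (a + x, z)) (fun z => z + y) b
    (partial ord_max h (a + x, b + y)) 1 (is_derive_slice1 _ _ dh).
    by rewrite mulr1; apply; exact: is_derive_shift.
  by split=> [//|i]; elim/ord2P: i; [exact: P1|exact: P2].
have [d0P d0E] := sub 0 d; have [d1P d1E] := sub d 0.
(* The mixed second difference over a square, computed in both orders. *)
have [c cd] := mvt0 s (s + d) t d0P.
rewrite d0E /= addr0 (addrC s d) addrK => Ec.
have [c' cd'] := mvt1 c t (t + d) (smooth_partials (sp ord0)).
rewrite (addrC t d) addrK => Ec'.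
have [e ed] := mvt1 s t (t + d) d1P.
rewrite d1E /= addr0 (addrC t d) addrK => Ee.
have [e' ed'] := mvt0 s (s + d) e (smooth_partials (sp ord_max)).
rewrite (addrC s d) addrK => Ee'.
have sd : `|s + d - s| = d by rewrite (addrC s) addrK gtr0_norm.
have td : `|t + d - t| = d by rewrite (addrC t) addrK gtr0_norm.
rewrite sd in cd ed'; rewrite td in cd' ed.
exists (e', e), (c, c'); split; [exact: ed'|exact: ed|exact: cd|exact: cd'|].
apply: (mulIf (lt0r_neq0 d0)); apply: (mulIf (lt0r_neq0 d0)).
refine (etrans (congr1 (fun z => z * d) (esym Ee')) _).
refine (etrans _ (congr1 (fun z => z * d) Ec')).
move: Ec Ee; rewrite !addr0 (addrC d t) (addrC d s) => <- <-.
by rewrite aux.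
Qed.

End MeanValue.
Transparent partial.

(** * The ring of smooth functions on the torus *)
Section TorusFunctions.
Context {R : realType}.

Definition torus_pred : {pred R * R -> R} :=
  [pred h | `[< smooth h /\ Defs.periodic h >]].

Fact torus_subring : subring_closed torus_pred.
Proof.
split.
- by apply/asboolP; split; [exact: smooth_cst|].
- move=> h k /asboolP[sh ph] /asboolP[sk pk]; apply/asboolP; split.
    exact: (smoothD sh (smoothN sk)).
  by move=> p q pq; rewrite !fctE (ph p q pq) (pk p q pq).
- move=> h k /asboolP[sh ph] /asboolP[sk pk]; apply/asboolP; split.
    exact: (smoothM sh sk).
  by move=> p q pq; rewrite !fctE (ph p q pq) (pk p q pq).
Qed.

HB.instance Definition _ :=
  GRing.isSubringClosed.Build (R * R -> R) torus_pred torus_subring.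

(** Bundling smoothness and periodicity makes these functions a commutative
    ring, in which identities between tensors are ring identities. *)
Record torus_fun := TorusFun {
  torus_val :> R * R -> R; _ : torus_val \in torus_pred }.

HB.instance Definition _ := [isSub for torus_val].
HB.instance Definition _ := [Choice of torus_fun by <:].
HB.instance Definition _ :=
  [SubChoice_isSubComNzRing of torus_fun by <:].
End TorusFunctions.
Arguments torus_fun R : clear implicits.

Section TorusCalculus.
Context {R : realType}.
Notation A := (torus_fun R).
Implicit Types (h k : A) (p q : R * R) (i j : 'I_2).
End TorusCalculus.

(** * Integration and Sobolev inequalities *)
Section SquareIntegral.
Context {R : realType}.
Implicit Types (h k : R * R -> R) (p q : R * R).
Notation mu := (@lebesgue_measure R).
Notation TR := (measurableTypeR R).

Definition unit_square : set (R * R) := `[0, 1] `*` `[0, 1].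

Definition square_integral h : R :=
  \int[(lebesgue_measure \x lebesgue_measure)%E]_(p in `[0, 1] `*` `[0, 1]) h p.

Lemma measurable_square :
  measurable (`[0, 1]%classic `*` `[0, 1]%classic : set (TR * TR)).
Proof. by apply: measurableX; exact: measurable_itv. Qed.

(** Open sets of the plane are countable unions of grid boxes. *)
Lemma open_measurable_plane (U : set (R * R)) :
  open U -> measurable (U : set (TR * TR)).
Proof.
move=> oU.
pose side (z : int) (n : nat) : set R :=
  `](z%:~R - 1) / n.+1%:R, (z%:~R + 1) / n.+1%:R[%classic.
pose box (z : int * int * nat) : set (R * R) := side z.1.1 z.2 `*` side z.1.2 z.2.
have -> : U = \bigcup_z [set p | box z p /\ box z `<=` U].
  apply/seteqP; split=> [p Up|p [z _ [zp zU]]]; last exact: zU.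
  have /nbhs_ballP[d /= d0 dU] : nbhs p U by apply: open_nbhs_nbhs.
  pose n := Num.truncn (2 / d); have n0 : (0 : R) < n.+1%:R by rewrite ltr0n.
  have nd : 2 / n.+1%:R < d.
    by rewrite ltr_pdivrMr // mulrC -ltr_pdivrMr // truncnS_gt.
  have sideP (x : R) : side (Num.floor (x * n.+1%:R)) n x.
    rewrite /side /= in_itv /= ltr_pdivrMr // ltr_pdivlMr // ltrBlDr.
    have := floor_itv (x * n.+1%:R); rewrite -intrD1 => /andP[a ->].
    by rewrite andbT (le_lt_trans a) // ltrDl ltr01.
  have side_close (z : int) (x y : R) : side z n x -> side z n y -> `|x - y| < d.
    rewrite /side /= !in_itv /= => /andP[a b] /andP[a' b'].
    have E : (z%:~R + 1) / n.+1%:R = (z%:~R - 1) / n.+1%:R + 2 / n.+1%:R :> R.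
    by rewrite -mulrDl; congr (_ / _); ring.
    rewrite E in b b'; move: a b a' b' nd.
    move: (_ / _) (2 / _) => u w a b a' b' wd.
    by rewrite ltr_norml; apply/andP; split; lra.
  exists (Num.floor (p.1 * n.+1%:R), Num.floor (p.2 * n.+1%:R), n) => //.
  split; first by split; exact: sideP.
  move=> q [/= q1 q2]; apply: dU; split; rewrite /ball /=.
    exact: side_close (sideP _) q1.
  exact: side_close (sideP _) q2.
apply: countable_bigcupT_measurable; first exact: countableP.
move=> z; have [zU|zU] := pselect (box z `<=` U).
  rewrite (_ : [set p | _] = box z); last by apply/seteqP; split=> [p []|p].
  by apply: measurableX; exact: measurable_itv.
rewrite (_ : [set p | _] = set0) //; apply/seteqP; split=> // p [_ /zU].
by [].
Qed.

Lemma continuous_measurable_plane h : continuous h ->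
  measurable_fun (setT : set ((TR * TR)%type : measurableType _))
    (h : ((TR * TR)%type : measurableType _) -> R).
Proof.
move=> ch; apply: (measurability _ (measurable_realfun.RGenOpens.measurableE R)).
move=> _ [_ [a [b ->] <-]]; rewrite setTI; apply: open_measurable_plane.
by move/continuousP: ch; apply; exact: interval_open.
Qed.

Lemma compact_square : compact unit_square.
Proof. by apply: compact_setX; exact: segment_compact. Qed.
Lemma bounded_square h : continuous h ->
  exists2 M, 0 < M & forall p, unit_square p -> `|h p| <= M.
Proof.
move=> ch; have [|||c _ H] := @compact_EVT_max _ R (fun p => `|h p|) unit_square.
- by exists (0, 0); split; rewrite /= in_itv /= lexx ler01.
- exact: compact_square.
- apply: continuous_subspaceT => p; exact: cvg_norm (ch p).
exists (`|h c| + 1); first by rewrite ltr_wpDl.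
by move=> p Sp; rewrite (le_trans (H p _)) ?inE // lerDl.
Qed.

Lemma integrable_square h : continuous h ->
  (lebesgue_measure \x lebesgue_measure)%E.-integrable
    (`[0, 1]%classic `*` `[0, 1]%classic : set (TR * TR)) (EFin \o h).
Proof.
move=> ch; apply: measurable_bounded_integrable.
- exact: measurable_square.
- have E := @product_measure1E _ _ TR TR R mu mu _ _ (measurable_itv `[0, 1])
    (measurable_itv `[0, 1]).
  by rewrite [X in (X < _)%E]E /= lebesgue_measure_itv /= lte01 oppr0 adde0 mule1 ltry.
- by apply: measurable_funTS; exact: continuous_measurable_plane.
- have [M M0 H] := bounded_square ch; exists M; split; first exact: num_real.
  by move=> x Mx p Sp; exact: le_trans (H p Sp) (ltW Mx).
Qed.

Lemma antiderivative (f : R -> R) : continuous f ->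
  exists F : R -> R, forall x : R, is_derive x 1 F (f x).
Proof.
move=> cf; pose F (a x : R) := \int[mu]_(t in `[a, x]) f t.
have intf (a b : R) : mu.-integrable `[a, b] (EFin \o f).
  apply: continuous_compact_integrable; first exact: segment_compact.
  exact: continuous_subspaceT.
have dF (a x : R) : a < x -> is_derive x 1 (F a) (f x).
  move=> ax; have xx : x < x + 1 by rewrite ltrDl.
  have [dF eF] := continuous_FTC1_closed xx (intf a (x + 1)) ax (cf x).
  by apply: DeriveDef; [exact: dF|rewrite -derive1E; exact: eF].
have FB (a b x : R) : a <= b -> b <= x -> F a x - F b x = F a b.
  move=> ab bx; have := @Rintegral_itvB R f (BLeft a) (BRight x) b (intf a x).
  rewrite !bnd_simp => /(_ ab bx) E.
  have I : mu.-integrable `]b, x] (EFin \o f).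
    by apply: (integrableS _ _ _ (intf b x)) => //; exact: subset_itv_oc_cc.
  by rewrite /F -(Rintegral_itv_obnd_cbnd I) -E opprB addrCA subrr addr0.
exists (fun x => F (- (`|x| + 1)) x - F (- (`|x| + 1)) 0) => x.
pose c := - (`|x| + 3).
have cx : c < x by rewrite /c; have := ler_norm (- x); rewrite normrN; lra.
apply: (@near_eq_is_derive _ _ _ (fun y => F c y - F c 0)); last first.
  rewrite -[f x]subr0; apply: is_deriveB; exact: dF.
near=> y; have yx : `|y| <= `|x| + 1.
  have : `|x - y| < 1 by near: y; apply: nbhsx_ballx.
  by have := lerB_dist y x; rewrite distrC; lra.
have h1 : c <= - (`|y| + 1) by rewrite /c; lra.
have h2 : - (`|y| + 1) <= y by have := ler_norm (- y); rewrite normrN; lra.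
have h3 : - (`|y| + 1) <= 0 by have := normr_ge0 y; lra.
by have := FB _ _ _ h1 h2; have := FB _ _ _ h1 h3; lra.
Unshelve. all: by end_near. Qed.

Lemma integral01_FTC (F f : R -> R) : continuous f ->
  (forall x : R, is_derive x 1 F (f x)) ->
  (\int[mu]_(x in `[0%R, 1%R]) (f x)%:E = (F 1 - F 0)%:E)%E.
Proof.
move=> cf dF.
have cF : continuous F.
  move=> x; exact: is_derive_continuous (dF x).
rewrite (@continuous_FTC2 R f F) ?ltr01 //.
- exact: continuous_subspaceT.
- split; last exact: cvg_at_left_filter (cF 1).
    by move=> x _; have D := dF x; exact: ex_derive.
  exact: cvg_at_right_filter (cF 0).
- by move=> x _; rewrite derive1E; have D := dF x; exact: derive_val.
Qed.

Lemma monotone_of_derive (F f : R -> R) (a b : R) :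
  (forall x : R, is_derive x 1 F (f x)) -> (forall x, 0 <= f x) -> a <= b ->
  F a <= F b.
Proof.
move=> dF f0 ab; rewrite -subr_ge0.
by have [c _ ->] := mvt_real a b dF; rewrite mulr_ge0 // subr_ge0.
Qed.

(** One-dimensional Sobolev inequality, in a form that involves only squares. *)
Lemma sobolev1 (u v : R -> R) (a : R) :
  (forall x : R, is_derive x 1 u (v x)) -> continuous v -> 0 <= a <= 1 ->
  ((u a ^+ 2)%:E <=
   \int[mu]_(x in `[0%R, 1%R]) (2 * u x ^+ 2 + v x ^+ 2)%:E)%E.
Proof.
move=> du cv /andP[a0 a1].
have cu : continuous u.
  move=> x; exact: is_derive_continuous (du x).
have cu2 : continuous (fun x => u x ^+ 2).
  by move=> x; exact: cvgM (cu x) (cu x).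
have cv2 : continuous (fun x => v x ^+ 2).
  by move=> x; exact: cvgM (cv x) (cv x).
pose w x := u x ^+ 2 + v x ^+ 2.
have cw : continuous w by move=> x; exact: cvgD (cu2 x) (cv2 x).
have [W dW] := antiderivative cw.
have [U dU] := antiderivative cu2.
have w0 x : 0 <= w x by rewrite addr_ge0 ?sqr_ge0.
have du2 (x : R) : is_derive x 1 (fun x => u x ^+ 2) (2 * u x * v x).
  have -> : 2 * u x * v x = u x *: v x + u x *: v x.
    by rewrite /GRing.scale /= -mulrA mulr_natl mulr2n.
  exact: (@is_deriveM _ _ u u x 1 (v x) (v x)).
have WP (x : R) : is_derive x 1 (W - (fun x => u x ^+ 2)) (w x - 2 * u x * v x).
  exact: is_deriveB.
have WM (x : R) : is_derive x 1 (W + (fun x => u x ^+ 2)) (w x + 2 * u x * v x).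
  exact: is_deriveD.
have WP0 x : 0 <= w x - 2 * u x * v x.
  by have := sqr_ge0 (u x - v x); rewrite sqrrB /w -mulrA mulr_natl; lra.
have WM0 x : 0 <= w x + 2 * u x * v x.
  by have := sqr_ge0 (u x + v x); rewrite sqrrD /w -mulrA mulr_natl; lra.
have key x : 0 <= x <= 1 -> u a ^+ 2 <= u x ^+ 2 + (W 1 - W 0).
  move=> /andP[x0 x1].
  have W1 := monotone_of_derive dW w0 a1; have W2 := monotone_of_derive dW w0 a0.
  have W3 := monotone_of_derive dW w0 x1; have W4 := monotone_of_derive dW w0 x0.
  have [xa|/ltW ax] := leP x a.
    by have := monotone_of_derive WP WP0 xa; rewrite !fctE; lra.
  by have := monotone_of_derive WM WM0 ax; rewrite !fctE; lra.
have dUW (x : R) : is_derive x 1 (U + W) (2 * u x ^+ 2 + v x ^+ 2).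
  rewrite (_ : 2 * _ + _ = u x ^+ 2 + w x); first exact: is_deriveD.
  by rewrite /w mulr_natl mulr2n addrA.
rewrite (integral01_FTC _ dUW); last first.
  by move=> x; exact: cvgD (cvgM (cvg_cst _) (cu2 x)) (cv2 x).
rewrite lee_fin !fctE.
have dV (x : R) : is_derive x 1 (U + (fun x => (W 1 - W 0) * x)) (u x ^+ 2 + (W 1 - W 0)).
  apply: is_deriveD; rewrite -[X in is_derive _ _ _ X]mulr1.
  exact: (@is_deriveZ _ _ R id (W 1 - W 0) x 1 1 (is_derive_id _ _)).
have [|c] := MVT_segment ler01 (fun x _ => dV x).
  apply: continuous_subspaceT => x; exact: is_derive_continuous (dV x).
rewrite in_itv /= => /key; rewrite !fctE; lra.
Qed.
End SquareIntegral.

Section SquareIntegralTheory.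
Context {R : realType}.
Implicit Types (h k : R * R -> R) (p q : R * R).
Notation mu := (@lebesgue_measure R).
Notation TR := (measurableTypeR R).

Lemma square_integralD h k : continuous h -> continuous k ->
  square_integral (fun p => h p + k p) = square_integral h + square_integral k.
Proof.
move=> ch ck; apply: RintegralD; [exact: measurable_square|..];
  exact: integrable_square.
Qed.

Lemma square_integralZ (c : R) h : continuous h ->
  square_integral (fun p => c * h p) = c * square_integral h.
Proof.
move=> ch; apply: RintegralZl; [exact: measurable_square|].
exact: integrable_square.
Qed.

Lemma square_integral_cst (c : R) : square_integral (fun=> c) = c.
Proof.
have E := @product_measure1E _ _ TR TR R mu mu _ _ (measurable_itv `[0, 1])
    (measurable_itv `[0, 1]).
rewrite /square_integral Rintegral_cst; last exact: measurable_square.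
rewrite [X in fine X]E /= lebesgue_measure_itv /= lte01 oppr0 adde0 mule1.
by rewrite mulr1.
Qed.

Lemma square_integral_ge0 h : (forall p, unit_square p -> 0 <= h p) ->
  0 <= square_integral h.
Proof. by move=> h0; apply: Rintegral_ge0. Qed.

Let patched h := (EFin \o h) \_ (`[0, 1]%classic `*` `[0, 1]%classic : set (TR * TR)).

Let integrable_patched h : continuous h ->
  (lebesgue_measure \x lebesgue_measure)%E.-integrable setT (patched h).
Proof.
move=> ch; apply/(integrable_mkcond _ measurable_square).
exact: integrable_square.
Qed.

Let EFin_square h : continuous h ->
  ((square_integral h)%:E = \int[(mu \x mu)%E]_p patched h p)%E.
Proof.
move=> ch; rewrite /square_integral /Rintegral fineK.
  by rewrite integral_mkcond.
by apply: integrable_fin_num; [exact: measurable_square|exact: integrable_square].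
Qed.

Let patched_pair h s t : patched h (s, t) =
  ((fun s => ((fun t => (h (s, t))%:E) \_ `[0%R, 1%R]%classic) t)
    \_ `[0%R, 1%R]%classic) s.
Proof.
rewrite /patched !patchE /=; case: ifPn => [/set_mem[/= h1 h2]|H].
  by rewrite !mem_set.
case: ifPn => // /set_mem h1; case: ifPn => // /set_mem h2.
by move/negP: H; case; apply/mem_set.
Qed.

Let fubini_FE h s : fubini_F mu (patched h) s =
  ((fun s => \int[mu]_(t in `[0%R, 1%R]) (h (s, t))%:E)%E \_ `[0%R, 1%R]%classic) s.
Proof.
rewrite /fubini_F; under eq_integral do rewrite patched_pair.
rewrite [RHS]patchE; case: ifPn => H.
  rewrite [RHS]integral_mkcond; apply: eq_integral => t _.
  by rewrite [LHS]patchE H.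
rewrite integral0_eq // => t _; by rewrite patchE (negPf H).
Qed.

Let fubini_GE h t : fubini_G mu (patched h) t =
  ((fun t => \int[mu]_(s in `[0%R, 1%R]) (h (s, t))%:E)%E \_ `[0%R, 1%R]%classic) t.
Proof.
rewrite /fubini_G; under eq_integral do rewrite patched_pair.
rewrite [RHS]patchE; case: ifPn => H.
  rewrite [RHS]integral_mkcond; apply: eq_integral => s _.
  by rewrite !patchE H.
by rewrite integral0_eq // => s _; rewrite !patchE (negPf H) if_same.
Qed.

Lemma square_integral_iter h : continuous h -> ((square_integral h)%:E =
  \int[mu]_(s in `[0%R, 1%R]) \int[mu]_(t in `[0%R, 1%R]) (h (s, t))%:E)%E.
Proof.
move=> ch; rewrite EFin_square // -integral12_prod_meas1 /=; last first.
  exact: integrable_patched.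
under eq_integral do rewrite fubini_FE.
by rewrite [RHS]integral_mkcond.
Qed.

Lemma square_integral_iterC h : continuous h -> ((square_integral h)%:E =
  \int[mu]_(t in `[0%R, 1%R]) \int[mu]_(s in `[0%R, 1%R]) (h (s, t))%:E)%E.
Proof.
move=> ch; rewrite EFin_square // -integral21_prod_meas1 /=; last first.
  exact: integrable_patched.
under eq_integral do rewrite fubini_GE.
by rewrite [RHS]integral_mkcond.
Qed.

Lemma continuous_slices h : continuous h ->
  (forall t, continuous (fun s => h (s, t))) /\
  (forall s, continuous (fun t => h (s, t))).
Proof.
move=> ch; split=> [t s|s t].
  apply: (@continuous_comp _ _ _ (fun s : R => (s, t)) h _ _ (ch (s, t))).
  exact: (@cvg_pair _ _ _ _ (nbhs s) (nbhs t) _ _ _ id (fun=> t)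
    (@cvg_id _ _) (@cvg_cst _ t _ _ _)).
apply: (@continuous_comp _ _ _ (fun t : R => (s, t)) h _ _ (ch (s, t))).
exact: (@cvg_pair _ _ _ _ (nbhs s) (nbhs t) _ _ _ (fun=> s) id
  (@cvg_cst _ s _ _ _) (@cvg_id _ _)).
Qed.

Lemma lattice_int (a b : int) : lattice ((a%:~R, b%:~R) : R * R).
Proof. by split; rewrite intr_int. Qed.
Lemma square_integral_partial i h : smooth h -> Defs.periodic h ->
  square_integral (partial i h) = 0.
Proof.
move=> sh ph; have dh := smooth_partials sh; apply: EFin_inj.
have per1 s : h (s, 1) = h (s, 0).
  apply: ph; rewrite (_ : (s, 1) - (s, 0) = (0%:~R, 1%:~R)).
    exact: lattice_int.
  by congr pair; rewrite /= ?subrr ?subr0.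
have per0 t : h (1, t) = h (0, t).
  apply: ph; rewrite (_ : (1, t) - (0, t) = (1%:~R, 0%:~R)).
    exact: lattice_int.
  by congr pair; rewrite /= ?subrr ?subr0.
elim/ord2P: i.
  have ci := smooth_continuous (smooth_partial ord0 sh).
  rewrite square_integral_iterC // integral0_eq // => t _.
  rewrite (integral01_FTC ((continuous_slices ci).1 t)
    (fun s => is_derive_slice0 s t dh)).
  by rewrite per0 subrr.
have ci := smooth_continuous (smooth_partial ord_max sh).
rewrite square_integral_iter // integral0_eq // => s _.
rewrite (integral01_FTC ((continuous_slices ci).2 s)
  (fun t => is_derive_slice1 s t dh)).
by rewrite per1 subrr.
Qed.

(** A positive value would be bounded below on a small square, and so would the
    integral. *)
Lemma square_integral_eq0 h : continuous h ->
  (forall p, 0 <= h p) -> square_integral h = 0 ->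
  forall p, unit_square p -> h p = 0.
Proof.
move=> ch h0 E p Sp; apply/eqP/negPn/negP => hp.
have {hp}hp : 0 < h p by rewrite lt_neqAle eq_sym hp h0.
have e0 : 0 < h p / 2 by rewrite divr_gt0.
have [d d0 Hd] := continuous_at_box p ch e0.
have side (x : R) : x \in `[0, 1] ->
    exists a b : R, [/\ 0 <= a, a < b, b <= 1 & forall y, a <= y <= b -> `|y - x| <= d].
  rewrite in_itv /= => /andP[x0 x1]; pose m := Num.min d (1 / 2).
  have [m0 md m2] : [/\ 0 < m, m <= d & m <= 1 / 2].
    by rewrite lt_min d0 divr_gt0 //= !ge_min !lexx orbT.
  have [xh|xh] := leP x (1 / 2).
    exists x, (x + m); split=> //; try lra.
    by move=> y /andP[a b]; rewrite ger0_norm; lra.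
  exists (x - m), x; split=> //; try lra.
  by move=> y /andP[a b]; rewrite ler0_norm; lra.
have [a [b [a0 ab b1 Hab]]] := side _ Sp.1.
have [a' [b' [a0' ab' b1' Hab']]] := side _ Sp.2.
have : (0 < \int[(mu \x mu)%E]_(z in `[a, b]%classic `*` `[a', b']%classic)
    (h p / 2)%:E)%E.
  rewrite integral_cst; last by apply: measurableX; exact: measurable_itv.
  have E2 := @product_measure1E _ _ TR TR R mu mu _ _ (measurable_itv `[a, b])
    (measurable_itv `[a', b']).
  rewrite [X in (_ * X)%E]E2 /= !lebesgue_measure_itv /= !lte_fin ab ab'.
  by rewrite -!EFinD -!EFinM lte_fin !mulr_gt0 // subr_gt0.
rewrite ltNge => /negP; apply.
have sub : `[a, b]%classic `*` `[a', b']%classic `<=` unit_square.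
  move=> z [/=]; rewrite !in_itv /= => /andP[z1 z2] /andP[z3 z4].
  split; rewrite /= in_itv /=; apply/andP; split; lra.
have mR : measurable (`[a, b]%classic `*` `[a', b']%classic : set (TR * TR)).
  by apply: measurableX; exact: measurable_itv.
have I := integrable_square ch.
have I' := integrableS measurable_square mR sub I.
apply: (@le_trans _ _ (\int[(mu \x mu)%E]_(z in `[0%R, 1%R]%classic `*` `[0%R, 1%R]%classic) (h z)%:E)%E).
  apply: (@le_trans _ _ (\int[(mu \x mu)%E]_(z in `[a, b]%classic `*` `[a', b']%classic) (h z)%:E)%E).
    apply: ge0_le_integral => //.
    - by move=> z _; rewrite lee_fin ltW.
    - exact: (measurable_int _ I').
    move=> z [/=]; rewrite !in_itv /= => /Hab z1 /Hab' z2; rewrite lee_fin.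
    by have := Hd z z1 z2; rewrite ltr_norml => /andP[]; lra.
  apply: ge0_subset_integral => //; first exact: measurable_square.
    exact: (measurable_int _ I).
  by move=> z _; rewrite lee_fin.
have {E} := congr1 EFin E; rewrite /square_integral /Rintegral.
by rewrite fineK => [->//|]; apply: integrable_fin_num; [exact: measurable_square|].
Qed.

(** Sobolev inequality on the torus: the two variables are treated one after
    the other with [sobolev1]. *)
Lemma sobolev2 h p : smooth h -> unit_square p ->
  h p ^+ 2 <= square_integral (fun q => 4 * h q ^+ 2 + 2 * partial ord0 h q ^+ 2
    + 2 * partial ord_max h q ^+ 2 + partial ord0 (partial ord_max h) q ^+ 2).
Proof.
move: p => [s0 t0] sh [/=]; rewrite !in_itv /= => s01 t01.
have dh := smooth_partials sh; have ch := smooth_continuous sh.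
have s0h := smooth_partial ord0 sh; have s1h := smooth_partial ord_max sh.
have c0 := smooth_continuous s0h; have c1 := smooth_continuous s1h.
have c01 := smooth_continuous (smooth_partial ord0 s1h).
have csq k : continuous k -> continuous (fun q : R * R => k q ^+ 2 : R).
  by move=> ck q; exact: cvgM (ck q) (ck q).
pose g q := 4 * h q ^+ 2 + 2 * partial ord0 h q ^+ 2
    + 2 * partial ord_max h q ^+ 2 + partial ord0 (partial ord_max h) q ^+ 2.
have cZ (c : R) k : continuous k -> continuous (fun q => c * k q).
  by move=> ck q; exact: cvgM (cvg_cst _) (ck q).
have cD k1 k2 : continuous k1 -> continuous k2 -> continuous (fun q => k1 q + k2 q : R).
  by move=> ck1 ck2 q; exact: cvgD (ck1 q) (ck2 q).
have cA : continuous (fun q => 2 * h q ^+ 2 + partial ord0 h q ^+ 2).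
  exact: (cD _ _ (cZ 2 _ (csq _ ch)) (csq _ c0)).
have cB : continuous (fun q => 2 * partial ord_max h q ^+ 2
    + partial ord0 (partial ord_max h) q ^+ 2).
  exact: (cD _ _ (cZ 2 _ (csq _ c1)) (csq _ c01)).
have cg : continuous g.
  exact: (cD _ _ (cD _ _ (cD _ _ (cZ 4 _ (csq _ ch)) (cZ 2 _ (csq _ c0)))
    (cZ 2 _ (csq _ c1))) (csq _ c01)).
rewrite -lee_fin -/g square_integral_iterC //.
have := @sobolev1 R (fun t => h (s0, t)) (fun t => partial ord_max h (s0, t)) t0
  (fun t => is_derive_slice1 s0 t dh) ((continuous_slices c1).2 s0) t01.
move/le_trans; apply.
have ig := integrable_patched cg.
apply: ge0_le_integral => //.
- by move=> t _; rewrite lee_fin; apply: addr_ge0; [apply: mulr_ge0 => //|]; exact: sqr_ge0.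
- have I : mu.-integrable `[0%R, 1%R] (EFin \o (fun t => 2 * h (s0, t) ^+ 2
    + partial ord_max h (s0, t) ^+ 2)).
    apply: continuous_compact_integrable; first exact: segment_compact.
    apply: continuous_subspaceT => t.
    exact: ((continuous_slices (cD _ _ (cZ 2 _ (csq _ ch)) (csq _ c1))).2 s0 t).
  exact: measurable_int I.
- move=> mD Y mY; have M := measurable_fubini_G ig measurableT mY.
  rewrite setTI in M; have := measurableI _ _ mD M.
  congr (measurable _); apply/seteqP.
  by split=> t [Dt]; rewrite /preimage /= fubini_GE patchE mem_set.
move=> t _.
apply: (@le_trans _ _ (\int[mu]_(x in `[0%R, 1%R])
   (2 * (2 * h (x, t) ^+ 2 + partial ord0 h (x, t) ^+ 2) +
    (2 * partial ord_max h (x, t) ^+ 2 + partial ord0 (partial ord_max h) (x, t) ^+ 2))%:E)%E).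
  have int k : continuous k -> mu.-integrable `[0%R, 1%R] (fun x => (k (x, t))%:E).
    move=> ck; apply: (@continuous_compact_integrable _ (fun x => k (x, t))).
    exact: segment_compact.
    exact: continuous_subspaceT ((continuous_slices ck).1 t).
  under eq_integral do rewrite EFinD EFinM.
  rewrite integralD //=; last 2 first.
  - by have := int _ (cZ 2 _ cA); apply: eq_integrable => // x _; rewrite EFinM.
  - exact: int cB.
  rewrite integralZl //; last exact: int cA.
  rewrite EFinD EFinM leeD // ?lee_pmul2l //.
    exact: (@sobolev1 R (fun s => h (s, t)) (fun s => partial ord0 h (s, t)) s0
    (fun s => is_derive_slice0 s t dh) ((continuous_slices c0).1 t) s01).
  exact: (@sobolev1 R (fun s => partial ord_max h (s, t))
    (fun s => partial ord0 (partial ord_max h) (s, t)) s0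
    (fun s => is_derive_slice0 s t (smooth_partials s1h))
    ((continuous_slices c01).1 t) s01).
rewrite le_eqVlt; apply/orP; left; apply/eqP; apply: eq_integral => x _; congr EFin.
rewrite /g; move: (h _) (partial _ _ _) (partial _ _ _) (partial _ _ _) => a b c d.
ring.
Qed.

End SquareIntegralTheory.

(** * Calculus on the torus *)
Section TorusCalculus.
Context {R : realType}.
Notation A := (torus_fun R).
Implicit Types (h k : A) (p q : R * R) (i j : 'I_2).

Definition mk_torus (h : R * R -> R) (H : smooth h /\ Defs.periodic h) : A :=
  TorusFun (asboolT H : h \in torus_pred).

Lemma torusP h : smooth h /\ Defs.periodic h.
Proof. by case: h => h H; exact/asboolP. Qed.
Lemma torus_smooth h : smooth h. Proof. by have [] := torusP h. Qed.
Lemma torus_periodic h p q : lattice (p - q) -> h p = h q.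
Proof. by have [_] := torusP h; exact. Qed.
Lemma torus_continuous h : continuous h.
Proof. exact: smooth_continuous (torus_smooth h). Qed.
Lemma torus_partials h : has_partials h.
Proof. exact: smooth_partials (torus_smooth h). Qed.
Lemma torus_ext h k : (forall p, h p = k p) -> h = k.
Proof. by move=> hk; apply: val_inj; apply/funext. Qed.
Lemma torusD h k p : (h + k) p = h p + k p. Proof. by []. Qed.
Lemma torusN h p : (- h) p = - h p. Proof. by []. Qed.
Lemma torusB h k p : (h - k) p = h p - k p. Proof. by []. Qed.
Lemma torusM h k p : (h * k) p = h p * k p. Proof. by []. Qed.
Lemma torus0 p : (0 : A) p = 0. Proof. by []. Qed.
Lemma torus1 p : (1 : A) p = 1. Proof. by []. Qed.
Lemma torusX h n p : (h ^+ n) p = h p ^+ n.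
Proof. by elim: n => [|n IH]; rewrite ?expr0 // !exprS torusM IH. Qed.
Lemma torus_sum I (r : seq I) (P : pred I) (F : I -> A) p :
  (\sum_(i <- r | P i) F i) p = \sum_(i <- r | P i) F i p.
Proof.
exact: (big_morph (fun h : A => h p) (fun h k => torusD h k p) (torus0 p)).
Qed.
Lemma torus_eq h k : h = k -> forall p, h p = k p. Proof. by move=> ->. Qed.
Definition torusE := (torusD, torusN, torusM, torus0, torus1).

Lemma periodic_partial i (h : R * R -> R) : Defs.periodic h ->
  Defs.periodic (partial i h).
Proof.
move=> ph p q pq; rewrite /partial /derive.
have E (x : R) : h (x *: coord_vec R i + p) = h (x *: coord_vec R i + q).
  by apply: ph; rewrite opprD addrACA subrr add0r.
rewrite (_ : (fun x : R => x^-1 *: ((h \o shift p) (x *: coord_vec R i) - h p))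
  = (fun x => x^-1 *: ((h \o shift q) (x *: coord_vec R i) - h q))) //.
by apply/funext => x; rewrite /= E (ph _ _ pq).
Qed.

Definition td i h : A :=
  mk_torus (conj (smooth_partial i (torus_smooth h))
    (@periodic_partial i _ (@torus_periodic h))).

Fact td_additive i : zmod_morphism (td i).
Proof.
move=> h k; apply: torus_ext => p.
change (partial i (fun p => h p + - k p) p = partial i h p + - partial i k p).
have Hk : has_partials (fun p => - k p).
  by move=> i' p'; apply: derivableN; exact: torus_partials.
by rewrite (partialD i (@torus_partials h) Hk) (partialN i (@torus_partials k)).
Qed.
HB.instance Definition _ i := GRing.isZmodMorphism.Build A A (td i) (td_additive i).

Lemma tdM i h k : td i (h * k) = td i h * k + h * td i k.
Proof.
apply: torus_ext => p.
change (partial i (fun p => h p * k p) p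
  = partial i h p * k p + h p * partial i k p).
by rewrite (partialM i (@torus_partials h) (@torus_partials k)).
Qed.

Lemma tdC i j h : td i (td j h) = td j (td i h).
Proof.
by apply: torus_ext => p /=; rewrite partialC //; exact: torus_smooth.
Qed.

Fact tcst_subproof (c : R) :
  smooth (fun _ : R * R => c) /\ Defs.periodic (fun _ : R * R => c).
Proof. by split; [exact: smooth_cst|]. Qed.
Definition tcst (c : R) : A := mk_torus (tcst_subproof c).
Fact tcst_additive : zmod_morphism tcst.
Proof. by move=> a b; apply: torus_ext. Qed.
Fact tcst_multiplicative : monoid_morphism tcst.
Proof. by split=> [|a b]; apply: torus_ext. Qed.
HB.instance Definition _ := GRing.isZmodMorphism.Build R A tcst tcst_additive.
HB.instance Definition _ := GRing.isMonoidMorphism.Build R A tcst tcst_multiplicative.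

Lemma tcstE c p : tcst c p = c. Proof. by []. Qed.
Lemma td_cst i c : td i (tcst c) = 0.
Proof.
apply: torus_ext => p; change (partial i (fun=> c) p = 0).
by rewrite partial_cst.
Qed.

Definition tint h : R := square_integral h.

Fact tint_additive : zmod_morphism tint.
Proof.
move=> h k; have E1 := square_integralZ (-1) (@torus_continuous k).
have c1 : continuous (fun p => -1 * k p).
  by move=> p; exact: cvgM (cvg_cst _) (@torus_continuous k p).
have E2 := square_integralD (@torus_continuous h) c1.
transitivity (square_integral (fun p => h p + -1 * k p)).
  by congr square_integral; apply/funext => p; rewrite mulN1r.
by rewrite E2 E1 mulN1r.
Qed.
HB.instance Definition _ := GRing.isZmodMorphism.Build A R tint tint_additive.

Lemma tdD i h k : td i (h + k) = td i h + td i k. Proof. exact: raddfD. Qed.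
Lemma tdB i h k : td i (h - k) = td i h - td i k. Proof. exact: raddfB. Qed.
Lemma tdN i h : td i (- h) = - td i h. Proof. exact: raddfN. Qed.
Lemma tintD h k : tint (h + k) = tint h + tint k. Proof. exact: raddfD. Qed.
Lemma tintN h : tint (- h) = - tint h. Proof. exact: raddfN. Qed.
Lemma tintZ c h : tint (tcst c * h) = c * tint h.
Proof. exact: square_integralZ (@torus_continuous h). Qed.
Lemma tint_cst c : tint (tcst c) = c.
Proof. exact: square_integral_cst. Qed.
Lemma tint_td i h : tint (td i h) = 0.
Proof.
apply: square_integral_partial; first exact: torus_smooth.
exact: (@torus_periodic h).
Qed.

(** Integration by parts has no boundary term on the torus. *)
Lemma tint_parts i h k : tint (td i h * k) = - tint (h * td i k).
Proof. by apply/eqP; rewrite -addr_eq0 -raddfD /= -tdM tint_td. Qed.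
Lemma tint_ge0 h : (forall p, 0 <= h p) -> 0 <= tint h.
Proof. by move=> h0; apply: square_integral_ge0. Qed.
Lemma tint_le h k : (forall p, h p <= k p) -> tint h <= tint k.
Proof.
move=> hk; rewrite -subr_ge0 -raddfB; apply: tint_ge0 => p.
by rewrite torusB subr_ge0.
Qed.

Lemma fundamental_domain p : exists2 q, unit_square q & lattice (p - q).
Proof.
have H (x : R) : x - (Num.floor x)%:~R \in `[0, 1].
  rewrite in_itv /= subr_ge0 floor_le /= lerBlDr addrC.
  by rewrite -intrD1 ltW // floorD1_gt.
exists (p.1 - (Num.floor p.1)%:~R, p.2 - (Num.floor p.2)%:~R).
  by split; exact: H.
rewrite (_ : p - _ = ((Num.floor p.1)%:~R, (Num.floor p.2)%:~R)).
  exact: lattice_int.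
by case: p => a b; congr pair; rewrite /= opprB addrC subrK.
Qed.

Lemma tint_eq0 h : (forall p, 0 <= h p) -> tint h = 0 -> h = 0.
Proof.
move=> h0 E; apply: torus_ext => p; have [q Sq pq] := fundamental_domain p.
rewrite (torus_periodic _ pq).
by rewrite (square_integral_eq0 (@torus_continuous h) h0 E Sq).
Qed.

Lemma torus_bounded h : exists2 M, 0 < M & forall p, `|h p| <= M.
Proof.
have [M M0 H] := bounded_square (@torus_continuous h); exists M => // p.
by have [q Sq pq] := fundamental_domain p; rewrite (torus_periodic _ pq) H.
Qed.

Lemma torus_min h : exists q, forall p, h q <= h p.
Proof.
have [|||c _ H] := @compact_EVT_min _ R h unit_square.
- by exists (0, 0); split; rewrite /= in_itv /= lexx ler01.
- exact: compact_square.
- exact: continuous_subspaceT (@torus_continuous h).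
exists c => p; have [q Sq pq] := fundamental_domain p.
by rewrite (torus_periodic _ pq); apply: H; rewrite inE.
Qed.

Lemma torus_inv h : (forall p, h p != 0) ->
  exists k, h * k = 1 /\ forall p, k p = (h p)^-1.
Proof.
move=> h0.
have sk := smooth_inv (torus_smooth h) h0.
have pk : Defs.periodic (fun p => (h p)^-1).
  by move=> p q pq; rewrite (torus_periodic _ pq).
exists (mk_torus (conj sk pk)); split=> // ; apply: torus_ext => p.
by rewrite torusM /= mulfV.
Qed.

Lemma torus_sqrt h : (forall p, 0 < h p) ->
  exists k, k * k = h /\ forall p, 0 < k p.
Proof.
move=> h0.
have sk := smooth_sqrt (torus_smooth h) h0.
have pk : Defs.periodic (fun p => Num.sqrt (h p)).
  by move=> p q pq; rewrite (torus_periodic _ pq).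
exists (mk_torus (conj sk pk)); split=> [|p]; last by rewrite sqrtr_gt0.
by apply: torus_ext => p; rewrite torusM /= -expr2 sqr_sqrtr // ltW.
Qed.

Lemma torus_exp h : exists k, (forall p, 0 < k p) /\ forall i, td i k = td i h * k.
Proof.
have sk := smooth_expR (torus_smooth h).
have pk : Defs.periodic (expR \o h).
  by move=> p q pq; rewrite /= (torus_periodic _ pq).
exists (mk_torus (conj sk pk)); split=> [p|i]; first exact: expR_gt0.
apply: torus_ext => p; rewrite torusM /= mulrC.
by rewrite (@partial_comp _ expR expR setT h i _ _ (@torus_partials h)).2.
Qed.

Lemma torus_sobolev h p : h p ^+ 2 <= tint (tcst 4 * (h * h)
  + tcst 2 * (td ord0 h * td ord0 h) + tcst 2 * (td ord_max h * td ord_max h)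
  + td ord0 (td ord_max h) * td ord0 (td ord_max h)).
Proof.
have [q Sq pq] := fundamental_domain p; rewrite (torus_periodic _ pq).
apply: (le_trans (sobolev2 (torus_smooth h) Sq)).
rewrite le_eqVlt; apply/orP; left; apply/eqP; congr square_integral.
Qed.

Lemma torus_const h : (forall i, td i h = 0) -> exists c, h = tcst c.
Proof.
move=> dh; exists (h (0, 0)); apply: torus_ext => -[s t] /=.
have d0 : partial ord0 h = fun=> 0.
  by apply/funext => p; have := torus_eq (dh ord0) p.
have d1 : partial ord_max h = fun=> 0.
  by apply/funext => p; have := torus_eq (dh ord_max) p.
have [c _] := mvt0 0 s t (@torus_partials h); rewrite d0 mul0r.
move/eqP; rewrite subr_eq0 => /eqP ->.
have [c' _] := mvt1 0 0 t (@torus_partials h); rewrite d1 mul0r.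
by move/eqP; rewrite subr_eq0 => /eqP ->.
Qed.

End TorusCalculus.

(** * Vector fields and charts *)
Section Derivations.
Context {R : realType}.
Notation A := (torus_fun R).

(** First-order differential operators on the torus, that is, vector fields. *)
Record derivation := Derivation {
  dfun :> A -> A;
  deriv_additive : zmod_morphism dfun;
  derivM : forall h k, dfun (h * k) = dfun h * k + h * dfun k;
  deriv_cst : forall c, dfun (tcst c) = 0 }.

HB.instance Definition _ (D : derivation) :=
  GRing.isZmodMorphism.Build A A D (deriv_additive D).

Implicit Types (D : derivation) (h k : A).

Section Vectors.
Context {n : nat}.
Implicit Types U V W : 'rV[A]_n.

(** Locked: unification would otherwise look for sums and products inside. *)
Definition vdot U V : A := locked (\sum_a U ord0 a * V ord0 a).
Definition vderiv D V : 'rV[A]_n := locked (map_mx D V).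
Definition vcst (a : 'rV[R]_n) : 'rV[A]_n := map_mx tcst a.

Lemma vdot_sum U V : vdot U V = \sum_a U ord0 a * V ord0 a.
Proof. by rewrite /vdot -lock. Qed.
Lemma vderiv_entry D V i a : vderiv D V i a = D (V i a).
Proof. by rewrite /vderiv -lock mxE. Qed.
Lemma vdotC U V : vdot U V = vdot V U.
Proof. by rewrite !vdot_sum; apply: eq_bigr => a _; rewrite mulrC. Qed.
Lemma vdotDl U V W : vdot (U + V) W = vdot U W + vdot V W.
Proof. by rewrite !vdot_sum -big_split; apply: eq_bigr => a _ /=; rewrite mxE mulrDl. Qed.
Lemma vdotNl U W : vdot (- U) W = - vdot U W.
Proof. by rewrite !vdot_sum -sumrN; apply: eq_bigr => a _; rewrite mxE mulNr. Qed.
Lemma vdotBl U V W : vdot (U - V) W = vdot U W - vdot V W.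
Proof. by rewrite vdotDl vdotNl. Qed.
Lemma vdotZl h V W : vdot (h *: V) W = h * vdot V W.
Proof. by rewrite !vdot_sum [RHS]big_distrr; apply: eq_bigr => a _ /=; rewrite mxE mulrA. Qed.
Lemma vdot0l V : vdot 0 V = 0.
Proof. by rewrite !vdot_sum big1 // => a _; rewrite mxE mul0r. Qed.
Lemma vdotDr U V W : vdot W (U + V) = vdot W U + vdot W V.
Proof. by rewrite ![vdot W _]vdotC vdotDl. Qed.
Lemma vdotNr U W : vdot W (- U) = - vdot W U.
Proof. by rewrite ![vdot W _]vdotC vdotNl. Qed.
Lemma vdotBr U V W : vdot W (U - V) = vdot W U - vdot W V.
Proof. by rewrite ![vdot W _]vdotC vdotBl. Qed.
Lemma vdotZr h V W : vdot W (h *: V) = h * vdot W V.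
Proof. by rewrite ![vdot W _]vdotC vdotZl. Qed.

Definition vdotE := (vdotDl, vdotDr, vdotBl, vdotBr, vdotNl, vdotNr, vdotZl, vdotZr).

Lemma vderivD D U V : vderiv D (U + V) = vderiv D U + vderiv D V.
Proof. by apply/matrixP => i j; rewrite !(vderiv_entry, mxE) raddfD. Qed.
Lemma vderivZ D h V : vderiv D (h *: V) = D h *: V + h *: vderiv D V.
Proof. by apply/matrixP => i j; rewrite !(vderiv_entry, mxE) derivM. Qed.
Lemma vderiv_cst D a : vderiv D (vcst a) = 0.
Proof. by apply/matrixP => i j; rewrite !(vderiv_entry, mxE) deriv_cst. Qed.
Lemma deriv_vdot D U V :
  D (vdot U V) = vdot (vderiv D U) V + vdot U (vderiv D V).
Proof.
rewrite !vdot_sum raddf_sum -big_split; apply: eq_bigr => a _ /=.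
by rewrite derivM !vderiv_entry.
Qed.

Lemma vdot_eval U V p : (vdot U V) p
  = dot (map_mx (fun h : A => h p) U) (map_mx (fun h : A => h p) V).
Proof. by rewrite vdot_sum torus_sum; apply: eq_bigr => a _; rewrite torusM !mxE. Qed.
Lemma vdot_ge0 V p : 0 <= vdot V V p.
Proof.
by rewrite vdot_sum torus_sum sumr_ge0 // => a _; rewrite torusM -expr2 sqr_ge0.
Qed.

Lemma vdot_eq0P V p : vdot V V p = 0 -> forall a, V ord0 a p = 0.
Proof.
move=> /eqP; rewrite vdot_sum torus_sum psumr_eq0; last first.
  by move=> a _; rewrite torusM -expr2 sqr_ge0.
move=> /allP H a; apply/eqP; rewrite -[_ == _]orbb -mulf_eq0 -torusM.
by apply: (H a); rewrite mem_index_enum.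
Qed.

Lemma vdot_eq0 V : vdot V V = 0 -> V = 0.
Proof.
move=> E; apply/matrixP => i a; rewrite mxE ord1; apply: torus_ext => p.
by rewrite (@vdot_eq0P V p) // E.
Qed.

Lemma vdot_vcst a b : vdot (vcst a) (vcst b) = tcst (dot a b).
Proof.
by rewrite vdot_sum /dot rmorph_sum; apply: eq_bigr => c _; rewrite !mxE rmorphM.
Qed.
End Vectors.
End Derivations.
Arguments derivation R : clear implicits.

Section Charts.
Context {R : realType}.
Notation A := (torus_fun R).
Implicit Types (h k : A).

(** The differentials [dx], [dy] of a pair of multivalued coordinates on the
    torus whose period lattice need not be the standard one. *)
Record chart := Chart {
  cxs : A; cxt : A; cys : A; cyt : A;
  chart_closedx : td ord_max cxs = td ord0 cxt;
  chart_closedy : td ord_max cys = td ord0 cyt;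
  chart_det : forall p, 0 < (cxs * cyt - cxt * cys) p }.

Variable c : chart.
Notation xs := (cxs c).
Notation xt := (cxt c).
Notation ys := (cys c).
Notation yt := (cyt c).

Definition jac : A := xs * yt - xt * ys.
Lemma jac_neq0 p : jac p != 0. Proof. by rewrite gt_eqF // chart_det. Qed.
Definition ijac : A := sval (cid (torus_inv jac_neq0)).
Lemma jacV : jac * ijac = 1. Proof. by rewrite /ijac; case: cid => k []. Qed.

Definition chart_field (u v : A) (h : A) : A :=
  ijac * (u * td ord0 h + v * td ord_max h).

Fact chart_field_derivation u v :
  [/\ zmod_morphism (chart_field u v),
    forall h k, chart_field u v (h * k)
    = chart_field u v h * k + h * chart_field u v k &
    forall c, chart_field u v (tcst c) = 0].
Proof.
split=> [h k|h k|d]; rewrite /chart_field.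
- by rewrite !raddfB; ring.
- by rewrite !tdM; ring.
- by rewrite !td_cst; ring.
Qed.

Definition mk_field u v : derivation R :=
  let: And3 a b d := chart_field_derivation u v in Derivation a b d.

(** The coordinate vector fields dual to [dx], [dy]. *)
Definition Dx := mk_field yt (- ys).
Definition Dy := mk_field (- xt) xs.

Lemma DxE h : Dx h = ijac * (yt * td ord0 h - ys * td ord_max h).
Proof.
by rewrite /Dx /mk_field; case: chart_field_derivation => /= *;
   rewrite /chart_field mulNr.
Qed.
Lemma DyE h : Dy h = ijac * (xs * td ord_max h - xt * td ord0 h).
Proof.
by rewrite /Dy /mk_field; case: chart_field_derivation => /= *;
   rewrite /chart_field mulNr addrC.
Qed.

Lemma td0E h : td ord0 h = xs * Dx h + ys * Dy h.
Proof.
rewrite -[LHS]mul1r -jacV DxE DyE; move: (td _ h) (td _ h) => u v.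
by rewrite /jac; ring.
Qed.
Lemma td1E h : td ord_max h = xt * Dx h + yt * Dy h.
Proof.
rewrite -[LHS]mul1r -jacV DxE DyE; move: (td _ h) (td _ h) => u v.
by rewrite /jac; ring.
Qed.

Lemma DxyC h : Dx (Dy h) = Dy (Dx h).
Proof.
(* Commutation of the partial derivatives says that the bracket is killed by
   the invertible matrix of the coframe. *)
have E : jac * (Dx (Dy h) - Dy (Dx h)) = 0.
  have := tdC ord0 ord_max h; rewrite [in LHS]td0E [in RHS]td1E.
  rewrite (td0E h) (td1E h).
  have cx : xt * Dx xs + yt * Dy xs = xs * Dx xt + ys * Dy xt.
    by rewrite -td1E -td0E chart_closedx.
  have cy : xt * Dx ys + yt * Dy ys = xs * Dx yt + ys * Dy yt.
    by rewrite -td1E -td0E chart_closedy.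
  rewrite !raddfD /= !derivM => E.
  have -> : jac * (Dx (Dy h) - Dy (Dx h)) = (xs * (Dx xt * Dx h + xt * Dx (Dx h)
    + (Dx yt * Dy h + yt * Dx (Dy h))) + ys * (Dy xt * Dx h + xt * Dy (Dx h) +
    (Dy yt * Dy h + yt * Dy (Dy h)))) - (xt * (Dx xs * Dx h + xs * Dx (Dx h)
    + (Dx ys * Dy h + ys * Dx (Dy h))) + yt * (Dy xs * Dx h + xs * Dy (Dx h) +
    (Dy ys * Dy h + ys * Dy (Dy h)))) + (xt * Dx xs + yt * Dy xs
    - (xs * Dx xt + ys * Dy xt)) * Dx h + (xt * Dx ys + yt * Dy ys -
    (xs * Dx yt + ys * Dy yt)) * Dy h by rewrite /jac; ring.
  by rewrite E cx cy; ring.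
apply: subr0_eq.
by rewrite -[LHS]mul1r -jacV mulrAC E mul0r.
Qed.

Lemma vDxyC n (V : 'rV[A]_n) : vderiv Dx (vderiv Dy V) = vderiv Dy (vderiv Dx V).
Proof. by apply/matrixP => i j; rewrite !vderiv_entry DxyC. Qed.

(** Integration against the area form [dx dy]. *)
Definition cint h : R := tint (jac * h).

Fact cint_additive : zmod_morphism cint.
Proof. by move=> h k; rewrite /cint mulrBr raddfB. Qed.
HB.instance Definition _ := GRing.isZmodMorphism.Build A R cint cint_additive.

Lemma cintZ d h : cint (tcst d * h) = d * cint h.
Proof. by rewrite /cint mulrCA tintZ. Qed.
Lemma cint_Dx h : cint (Dx h) = 0.
Proof.
rewrite /cint DxE mulrA jacV mul1r.
have -> : yt * td ord0 h - ys * td ord_max h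
  = td ord0 (yt * h) - td ord_max (ys * h) + (td ord_max ys - td ord0 yt) * h.
  by rewrite !tdM; ring.
by rewrite chart_closedy subrr mul0r addr0 raddfB /= !tint_td subr0.
Qed.

Lemma cint_Dy h : cint (Dy h) = 0.
Proof.
rewrite /cint DyE mulrA jacV mul1r.
have -> : xs * td ord_max h - xt * td ord0 h
  = td ord_max (xs * h) - td ord0 (xt * h) + (td ord0 xt - td ord_max xs) * h.
  by rewrite !tdM; ring.
by rewrite chart_closedx subrr mul0r addr0 raddfB /= !tint_td subr0.
Qed.

Lemma cint_parts_x h k : cint (Dx h * k) = - cint (h * Dx k).
Proof. by apply/eqP; rewrite -addr_eq0 -raddfD /= -derivM cint_Dx. Qed.
Lemma cint_parts_y h k : cint (Dy h * k) = - cint (h * Dy k).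
Proof. by apply/eqP; rewrite -addr_eq0 -raddfD /= -derivM cint_Dy. Qed.
Lemma cint_ge0 h : (forall p, 0 <= h p) -> 0 <= cint h.
Proof.
by move=> h0; apply: tint_ge0 => p; rewrite torusM mulr_ge0 // ltW // chart_det.
Qed.

Lemma cint_eq0 h : (forall p, 0 <= h p) -> cint h = 0 -> h = 0.
Proof.
move=> h0 E; have {E} E : jac * h = 0.
  by apply: tint_eq0 E => p; rewrite torusM mulr_ge0 // ltW // chart_det.
by rewrite -[h]mul1r -jacV mulrAC E mul0r.
Qed.

Lemma cint_gt0 h : (forall p, 0 <= h p) -> h <> 0 -> 0 < cint h.
Proof.
move=> h0 hn; rewrite lt_neqAle cint_ge0 // andbT eq_sym.
by apply/eqP => E; exact: hn (cint_eq0 h0 E).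
Qed.

Lemma cint_sqr_eq0 h : cint (h * h) = 0 -> h = 0.
Proof.
move=> /cint_eq0 E; apply: torus_ext => p; apply/eqP.
rewrite -[_ == _]orbb -mulf_eq0 -torusM E // => q.
by rewrite torusM -expr2 sqr_ge0.
Qed.

Lemma cint_le h k : (forall p, h p <= k p) -> cint h <= cint k.
Proof.
move=> hk; rewrite -subr_ge0 -raddfB; apply: cint_ge0 => p.
by rewrite torusB subr_ge0.
Qed.

Lemma chart_const h : Dx h = 0 -> Dy h = 0 -> exists d, h = tcst d.
Proof.
move=> hx hy; apply: torus_const => i; elim/ord2P: i.
  by rewrite td0E hx hy !mulr0 addr0.
by rewrite td1E hx hy !mulr0 addr0.
Qed.

(** Liouville: both functions are harmonic, so their Dirichlet integrals
    vanish. *)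
Lemma cauchy_riemann_const u v : Dx u = - Dy v -> Dy u = Dx v ->
  (exists d, u = tcst d) /\ exists d, v = tcst d.
Proof.
move=> e1 e2; have lap0 : Dx (Dx v) + Dy (Dy v) = 0.
  rewrite -e2 (_ : Dy v = - Dx u) ?raddfN /= ?DxyC ?subrr //.
  by rewrite e1 opprK.
have E : cint (Dx v * Dx v + Dy v * Dy v) = 0.
  rewrite raddfD /= cint_parts_x cint_parts_y -opprD -raddfD /= -mulrDr lap0.
  by rewrite mulr0 raddf0 oppr0.
have sq0 h p : 0 <= (h * h) p by rewrite torusM -expr2 sqr_ge0.
have Z : Dx v * Dx v + Dy v * Dy v = 0.
  by apply: cint_eq0 E => p; rewrite torusD addr_ge0.
have Zp p : Dx v p = 0 /\ Dy v p = 0.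
  have := torus_eq Z p; rewrite torusD torus0 => /eqP.
  rewrite paddr_eq0 // !torusM !mulf_eq0 !orbb => /andP[/eqP -> /eqP ->].
  by [].
have vx : Dx v = 0 by apply: torus_ext => p; case: (Zp p).
have vy : Dy v = 0 by apply: torus_ext => p; case: (Zp p).
split; apply: chart_const => //; first by rewrite e1 vy oppr0.
by rewrite e2 vx.
Qed.

Definition lap h := Dx (Dx h) + Dy (Dy h).

End Charts.
Arguments chart R : clear implicits.

(** * Minimal surfaces in isothermal coordinates *)
Section FrameCalculus.

(** The algebra of vector fields acting on functions [A] and on vector-valued
    functions [V], isolated from the analysis so that the identities of surface
    theory become identities in an abstract differential ring. *)
Record vfield (A : comNzRingType) (V : lmodType A) := VField {
  vf :> A -> A; vfv : V -> V;
  vfD : forall h k, vf (h + k) = vf h + vf k;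
  vfM : forall h k, vf (h * k) = vf h * k + h * vf k;
  vfvD : forall U W, vfv (U + W) = vfv U + vfv W;
  vfvZ : forall h W, vfv (h *: W) = vf h *: W + h *: vfv W }.

Record frame (A : comNzRingType) (V : lmodType A) := Frame {
  fdot : V -> V -> A;
  fX : vfield V; fY : vfield V;
  fdotC : forall U W, fdot U W = fdot W U;
  fdotDl : forall U U' W, fdot (U + U') W = fdot U W + fdot U' W;
  fdotZl : forall h U W, fdot (h *: U) W = h * fdot U W;
  fX_dot : forall U W, fX (fdot U W) = fdot (vfv fX U) W + fdot U (vfv fX W);
  fY_dot : forall U W, fY (fdot U W) = fdot (vfv fY U) W + fdot U (vfv fY W);
  fXY : forall h, fX (fY h) = fY (fX h);
  fXYv : forall U, vfv fX (vfv fY U) = vfv fY (vfv fX U);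
  f2reg : forall h : A, h + h = 0 -> h = 0 }.

Section VField.
Variables (A : comNzRingType) (V : lmodType A) (D : vfield V).
Implicit Types (h k : A) (U W : V).
Lemma vf0 : D 0 = 0.
Proof. by apply: (addrI (D 0)); rewrite -vfD !addr0. Qed.
Lemma vfN h : D (- h) = - D h.
Proof. by apply/eqP; rewrite -addr_eq0 -vfD addNr vf0. Qed.
Lemma vf1 : D 1 = 0.
Proof. by apply: (addrI (D 1)); rewrite addr0 -[in RHS](mulr1 1) vfM mulr1 mul1r. Qed.
Lemma vfnat m : D m%:R = 0.
Proof. by elim: m => [|m IH]; rewrite ?vf0 // -natr1 vfD IH vf1 addr0. Qed.
Lemma vfv0 : vfv D 0 = 0.
Proof. by apply: (addrI (vfv D 0)); rewrite -vfvD !addr0. Qed.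
Lemma vfvN U : vfv D (- U) = - vfv D U.
Proof. by apply/eqP; rewrite -addr_eq0 -vfvD addNr vfv0. Qed.
Lemma vfvB U W : vfv D (U - W) = vfv D U - vfv D W.
Proof. by rewrite vfvD vfvN. Qed.
End VField.

Variables (A : comNzRingType) (V : lmodType A) (F : frame V).
Notation "<< u , v >>" := (fdot F u v).
Notation dx := (fX F).
Notation dy := (fY F).
Notation Dx := (vfv (fX F)).
Notation Dy := (vfv (fY F)).

Lemma fdotNl U W : <<- U, W>> = - <<U, W>>.
Proof. by rewrite -scaleN1r fdotZl mulN1r. Qed.
Lemma fdotBl U U' W : <<U - U', W>> = <<U, W>> - <<U', W>>.
Proof. by rewrite fdotDl fdotNl. Qed.
Lemma fdotDr U U' W : <<W, U + U'>> = <<W, U>> + <<W, U'>>.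
Proof. by rewrite ![<<W, _>>]fdotC fdotDl. Qed.
Lemma fdotNr U W : <<W, - U>> = - <<W, U>>.
Proof. by rewrite ![<<W, _>>]fdotC fdotNl. Qed.
Lemma fdotBr U U' W : <<W, U - U'>> = <<W, U>> - <<W, U'>>.
Proof. by rewrite fdotDr fdotNr. Qed.
Lemma fdotZr h U W : <<W, h *: U>> = h * <<W, U>>.
Proof. by rewrite ![<<W, _>>]fdotC fdotZl. Qed.
Lemma fdot0l W : <<0, W>> = 0. Proof. by rewrite -(scale0r 0) fdotZl mul0r. Qed.

Definition fdotE := (fdotDl, fdotDr, fdotBl, fdotBr, fdotNl, fdotNr, fdotZl, fdotZr).
Definition fvE := (vfvD, vfvB, vfvN, vfvZ).

Definition flap h := dx (dx h) + dy (dy h).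
Definition fvlap U := locked (Dx (Dx U) + Dy (Dy U)).
Lemma fvlapE U : fvlap U = Dx (Dx U) + Dy (Dy U).
Proof. by rewrite /fvlap -lock. Qed.
Lemma fvlapD U W : fvlap (U + W) = fvlap U + fvlap W.
Proof. by rewrite !fvlapE !vfvD addrACA. Qed.
Lemma fvlapN U : fvlap (- U) = - fvlap U.
Proof. by rewrite !fvlapE !vfvN opprD. Qed.
Lemma fvlapB U W : fvlap (U - W) = fvlap U - fvlap W.
Proof. by rewrite fvlapD fvlapN. Qed.
Lemma fdot_vlapZ h U W : <<fvlap (h *: U), W>> =
  flap h * <<U, W>> + 2 * (dx h * <<Dx U, W>> + dy h * <<Dy U, W>>)
  + h * <<fvlap U, W>>.
Proof. by rewrite !fvlapE /flap !fvE !fdotE; ring. Qed.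
Lemma fvlap_X U : fvlap (Dx U) = Dx (fvlap U).
Proof. by rewrite !fvlapE vfvD -!fXYv. Qed.
Lemma fvlap_Y U : fvlap (Dy U) = Dy (fvlap U).
Proof. by rewrite !fvlapE vfvD !fXYv. Qed.

(** A minimal surface in the unit sphere, in isothermal coordinates and with
    conformal factor [e ^ 2]. *)
Record conformal_minimal (f : V) (e ie : A) : Prop := {
  cm_inv : e * ie = 1;
  cm_unit : <<f, f>> = 1;
  cm_xx : <<Dx f, Dx f>> = e * e;
  cm_yy : <<Dy f, Dy f>> = e * e;
  cm_xy : <<Dx f, Dy f>> = 0;
  cm_lap : fvlap f = - (2 * (e * e)) *: f }.

Section MinimalSurface.
Variables (f : V) (e ie : A).
Hypothesis cm : conformal_minimal f e ie.
Notation fx := (Dx f).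
Notation fy := (Dy f).
Notation fxx := (Dx (Dx f)).
Notation fxy := (Dx (Dy f)).
Notation fyy := (Dy (Dy f)).

Let einv : e * ie = 1 := cm_inv cm.
Let ff : <<f, f>> = 1 := cm_unit cm.
Let xx : <<fx, fx>> = e * e := cm_xx cm.
Let yy : <<fy, fy>> = e * e := cm_yy cm.
Let xy : <<fx, fy>> = 0 := cm_xy cm.

(** Logarithmic derivatives of the conformal factor, which are the Christoffel
    symbols of the metric. *)
Definition conf_s := locked (ie * dx e).
Definition conf_t := locked (ie * dy e).
Notation s := conf_s.
Notation t := conf_t.
Notation E := (e * e).
Notation iE := (ie * ie).

(** Normal parts of the second derivatives: the Hopf differential is
    [(hopf1 - i hopf2) / 2]. *)
Definition hopf1 : V := locked (fxx - s *: fx + t *: fy + E *: f).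
Definition hopf2 : V := locked (fxy - t *: fx - s *: fy).
Notation P := hopf1.
Notation N := hopf2.

Lemma hopf1E : P = fxx - s *: fx + t *: fy + E *: f.
Proof. by rewrite /hopf1 -lock. Qed.
Lemma hopf2E : N = fxy - t *: fx - s *: fy.
Proof. by rewrite /hopf2 -lock. Qed.

Definition normal (W : V) := [/\ <<W, f>> = 0, <<W, fx>> = 0 & <<W, fy>> = 0].

Let half h : h + h = 0 -> h = 0 :> A := @f2reg _ _ F h.

Lemma dxe : dx e = e * s. Proof. by rewrite /conf_s -lock mulrA einv mul1r. Qed.
Lemma dye : dy e = e * t. Proof. by rewrite /conf_t -lock mulrA einv mul1r. Qed.
Lemma diE (D : vfield V) : D ie = - (ie * (ie * D e)).
Proof.
have : D (e * ie) = 0 by rewrite einv vf1.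
rewrite vfM => H.
rewrite -[LHS]mul1r -einv; have -> : e * ie * D ie = ie * (D e * ie + e * D ie)
  - ie * (D e * ie) by ring.
by rewrite H; ring.
Qed.
Lemma dxie : dx ie = - (ie * s). Proof. by rewrite diE /conf_s -lock. Qed.
Lemma dyie : dy ie = - (ie * t). Proof. by rewrite diE /conf_t -lock. Qed.
Lemma conf_st : dy s = dx t.
Proof. by rewrite /conf_s /conf_t -!lock !vfM !diE fXY; ring. Qed.

Let fyE : Dy fx = fxy. Proof. by rewrite fXYv. Qed.
Let fyyE : fyy = - (2 * E) *: f - fxx.
Proof. by rewrite -(cm_lap cm) !fvlapE addrAC subrr add0r. Qed.

Let f_fx : <<f, fx>> = 0.
Proof.
apply: half; have := fX_dot F f f; rewrite ff vf1.
by rewrite [<<fx, f>>]fdotC.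
Qed.
Let f_fy : <<f, fy>> = 0.
Proof.
apply: half; have := fY_dot F f f; rewrite ff vf1.
by rewrite [<<fy, f>>]fdotC.
Qed.
Let fx_f : <<fx, f>> = 0. Proof. by rewrite fdotC. Qed.
Let fy_f : <<fy, f>> = 0. Proof. by rewrite fdotC. Qed.
Let yx : <<fy, fx>> = 0. Proof. by rewrite fdotC. Qed.

Let cancel2 (u v : A) : u + u = v + v -> u = v.
Proof.
move=> H; apply/subr0_eq/half.
by rewrite addrACA H -opprD subrr.
Qed.

Let fxx_f : <<fxx, f>> = - E.
Proof.
have := fX_dot F fx f; rewrite fx_f vf0 xx => /esym/eqP.
by rewrite addr_eq0 => /eqP.
Qed.
Let fxy_f : <<fxy, f>> = 0.
Proof.
have := fX_dot F fy f; rewrite fy_f vf0 yx addr0.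
by move=> <-.
Qed.
Let fxx_fx : <<fxx, fx>> = E * s.
Proof.
apply: cancel2; have := fX_dot F fx fx; rewrite xx vfM dxe.
by rewrite [<<fx, fxx>>]fdotC => <-; ring.
Qed.
Let fxy_fx : <<fxy, fx>> = E * t.
Proof.
apply: cancel2; have := fY_dot F fx fx; rewrite xx vfM dye fyE.
by rewrite [<<fx, fxy>>]fdotC => <-; ring.
Qed.
Let fxy_fy : <<fxy, fy>> = E * s.
Proof.
apply: cancel2; have := fX_dot F fy fy; rewrite yy vfM dxe.
by rewrite [<<fy, fxy>>]fdotC => <-; ring.
Qed.
Let fxx_fy : <<fxx, fy>> = - (E * t).
Proof.
have := fX_dot F fx fy; rewrite xy vf0 [<<fx, fxy>>]fdotC fxy_fx.
by move=> /esym/eqP; rewrite addr_eq0 => /eqP.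
Qed.

Let dots := (ff, xx, yy, xy, yx, f_fx, f_fy, fx_f, fy_f, fxx_f, fxy_f, fxx_fx,
  fxy_fx, fxy_fy, fxx_fy).

Lemma normal_hopf1 : normal P.
Proof. by split; rewrite hopf1E !fdotE !dots; ring. Qed.
Lemma normal_hopf2 : normal N.
Proof. by split; rewrite hopf2E !fdotE !dots; ring. Qed.
Lemma fxxE : fxx = P + s *: fx - t *: fy - E *: f.
Proof.
rewrite hopf1E; move: fxx (s *: fx) (t *: fy) (E *: f) => u v w z.
by rewrite (addrAC _ z v) (addrAC _ w v) subrK (addrAC _ z (- w)) !addrK.
Qed.
Lemma fxyE : fxy = N + t *: fx + s *: fy.
Proof.
by rewrite hopf2E addrAC subrK subrK.
Qed.

Lemma normalD U W : normal U -> normal W -> normal (U + W).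
Proof. by move=> [a b d] [a' b' d']; split; rewrite fdotDl ?a ?a' ?b ?b' ?d ?d' addr0. Qed.
Lemma normalZ h U : normal U -> normal (h *: U).
Proof. by move=> [a b d]; split; rewrite fdotZl ?a ?b ?d mulr0. Qed.

Section Normal.
Variable W : V.
Hypothesis nW : normal W.
Let Wf : <<W, f>> = 0. Proof. by case: nW. Qed.
Let Wx : <<W, fx>> = 0. Proof. by case: nW. Qed.
Let Wy : <<W, fy>> = 0. Proof. by case: nW. Qed.
Let fW : <<f, W>> = 0. Proof. by rewrite fdotC. Qed.
Let xW : <<fx, W>> = 0. Proof. by rewrite fdotC. Qed.
Let yW : <<fy, W>> = 0. Proof. by rewrite fdotC. Qed.
Lemma fxx_normal : <<fxx, W>> = <<P, W>>.
Proof. by rewrite fxxE !fdotE fW xW yW; ring. Qed.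
Lemma fxy_normal : <<fxy, W>> = <<N, W>>.
Proof. by rewrite fxyE !fdotE xW yW; ring. Qed.
Lemma fyy_normal : <<fyy, W>> = - <<P, W>>.
Proof. by rewrite fyyE !fdotE fW fxx_normal; ring. Qed.
Lemma nWx_f : <<Dx W, f>> = 0.
Proof. by have := fX_dot F W f; rewrite Wf vf0 Wx addr0. Qed.
Lemma nWy_f : <<Dy W, f>> = 0.
Proof. by have := fY_dot F W f; rewrite Wf vf0 Wy addr0. Qed.
Lemma nWx_fx : <<Dx W, fx>> = - <<P, W>>.
Proof.
have := fX_dot F W fx; rewrite Wx vf0 [<<W, _>>]fdotC fxx_normal.
by move/esym/eqP; rewrite addr_eq0 => /eqP.
Qed.
Lemma nWx_fy : <<Dx W, fy>> = - <<N, W>>.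
Proof.
have := fX_dot F W fy; rewrite Wy vf0 [<<W, _>>]fdotC fxy_normal.
by move/esym/eqP; rewrite addr_eq0 => /eqP.
Qed.
Lemma nWy_fx : <<Dy W, fx>> = - <<N, W>>.
Proof.
have := fY_dot F W fx; rewrite Wx vf0 [<<W, _>>]fdotC fyE fxy_normal.
by move/esym/eqP; rewrite addr_eq0 => /eqP.
Qed.
Lemma nWy_fy : <<Dy W, fy>> = <<P, W>>.
Proof.
have := fY_dot F W fy; rewrite Wy vf0 [<<W, _>>]fdotC fyy_normal.
by move/esym/eqP; rewrite subr_eq0 => /eqP.
Qed.

Let fxxE' := fxx_normal. Let fxyE' := fxy_normal. Let fyyE' := fyy_normal.

(** The Codazzi equations: the Hopf differential is holomorphic. *)
Lemma codazzi : <<Dx P, W>> = - <<Dy N, W>> /\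
  <<Dy P, W>> = <<Dx N, W>>.
Proof.
have lapx : <<Dx fxx, W>> = - <<Dx fyy, W>>.
  rewrite fyyE vfvB vfvZ !fdotE fW xW; ring.
have xyy : Dx fyy = Dy fxy by rewrite -fXYv.
have xxy : Dy fxx = Dx fxy by rewrite -fXYv fyE.
have Px : <<Dx P, W>> = <<Dx fxx, W>> - s * <<P, W>> + t * <<N, W>>.
  by rewrite {1}hopf1E !fvE !fdotE fW xW yW fxxE' fxyE'; ring.
have Py : <<Dy P, W>> = <<Dy fxx, W>> - s * <<N, W>> - t * <<P, W>>.
  by rewrite {1}hopf1E !fvE !fdotE fW xW yW fyE fyyE' fxyE'; ring.
have Nx : <<Dx N, W>> = <<Dx fxy, W>> - t * <<P, W>> - s * <<N, W>>.
  by rewrite {1}hopf2E !fvE !fdotE xW yW fxxE' fxyE'; ring.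
have Ny : <<Dy N, W>> = <<Dy fxy, W>> - t * <<N, W>> + s * <<P, W>>.
  by rewrite {1}hopf2E !fvE !fdotE xW yW fyE fyyE' fxyE'; ring.
split; first by rewrite Px Ny lapx xyy; ring.
by rewrite Py Nx xxy; ring.
Qed.

(** Obtained by differentiating the Codazzi equations; by the Gauss equation
    the coefficient is [- 2 (|P|^2 + |N|^2) / E]. *)
Lemma lap_hopf : <<fvlap P, W>> = - 2 * (E + dx s + dy t) * <<P, W>> /\
  <<fvlap N, W>> = - 2 * (E + dx s + dy t) * <<N, W>>.
Proof.
have lapf : <<fvlap f, W>> = 0 by rewrite (cm_lap cm) fdotZl fW mulr0.
have lapx : <<fvlap fx, W>> = 0.
  by rewrite fvlap_X (cm_lap cm) vfvZ !fdotE fW xW; ring.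
have lapy : <<fvlap fy, W>> = 0.
  by rewrite fvlap_Y (cm_lap cm) vfvZ !fdotE fW yW; ring.
have lapxx : <<fvlap fxx, W>> = - (2 * E) * <<P, W>>.
  by rewrite !fvlap_X (cm_lap cm) !vfvZ vfvD !vfvZ !fdotE fW xW fxxE'; ring.
have lapxy : <<fvlap fxy, W>> = - (2 * E) * <<N, W>>.
  rewrite fvlap_X fvlap_Y (cm_lap cm) !vfvZ vfvD !vfvZ !fdotE fW xW yW fxyE'.
  by ring.
split.
  rewrite {1}hopf1E !fvlapD fvlapN !fdotDl fdotNl !fdot_vlapZ lapxx lapx lapy lapf.
  by rewrite !fW !xW !yW fyE fxxE' fxyE' fyyE' conf_st; ring.
rewrite {1}hopf2E !fvlapD !fvlapN !fdotDl !fdotNl !fdot_vlapZ lapxy lapx lapy.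
by rewrite !xW !yW fyE fxxE' fxyE' fyyE' conf_st; ring.
Qed.

End Normal.

(** Gauss equation. *)
Lemma gauss : E * (dx s + dy t) = <<P, P>> + <<N, N>> - E * E.
Proof.
have [Pf Px Py] := normal_hopf1; have [Nf Nx Ny] := normal_hopf2.
have H1 := fY_dot F fxx fy; have H2 := fX_dot F fxy fy.
have xxy : Dy fxx = Dx fxy by rewrite -fXYv fyE.
rewrite fxx_fy vfN vfM vfM dye xxy in H1; rewrite fxy_fy vfM vfM dxe in H2.
have NN : <<fxy, fxy>> = <<N, N>> + E * t * t + E * s * s.
  rewrite {1}fxyE !fdotDl !fdotZl ![<<_, fxy>>]fdotC fxy_fx fxy_fy.
  by rewrite (fxy_normal normal_hopf2); ring.
have PP : <<fxx, fxx>> = <<P, P>> + E * t * t + E * s * s + E * E.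
  rewrite {1}fxxE !fdotBl !fdotDl !fdotZl ![<<_, fxx>>]fdotC fxx_fx fxx_fy fxx_f.
  by rewrite (fxx_normal normal_hopf1); ring.
have yyx : <<fxx, fyy>> = E * E - <<P, P>> - E * t * t - E * s * s.
  by rewrite fyyE !fdotE fxx_f PP; ring.
rewrite yyx in H1; rewrite NN in H2.
have -> : E * (dx s + dy t) = ((e * s * e + e * (e * s)) * s + E * dx s)
  - - ((e * t * e + e * (e * t)) * t + E * dy t) - 2 * E * (s * s + t * t) by ring.
by rewrite H1 H2; ring.
Qed.

Lemma iEK h : iE * (E * h) = h.
Proof.
by rewrite -[RHS]mul1r -[in RHS](mul1r 1) -einv; ring.
Qed.

Lemma gauss' : E + dx s + dy t = iE * (<<P, P>> + <<N, N>>).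
Proof.
rewrite -[LHS]iEK; congr (_ * _); rewrite -addrA mulrDr gauss; ring.
Qed.

(** The Hopf differential squares to a holomorphic quartic differential. *)
Lemma hopf_quartic :
  dx (<<P, P>> - <<N, N>>) = - dy (<<P, N>> + <<P, N>>) /\
  dy (<<P, P>> - <<N, N>>) = dx (<<P, N>> + <<P, N>>).
Proof.
have [c1 c2] := codazzi normal_hopf1; have [c3 c4] := codazzi normal_hopf2.
rewrite !vfD !vfN !fX_dot !fY_dot.
rewrite ![<<P, Dx _>>]fdotC ![<<N, Dx _>>]fdotC ![<<P, Dy _>>]fdotC ![<<N, Dy _>>]fdotC.
by rewrite c1 c2 -c4 c3; split; ring.
Qed.

(** Density of the second variation without its term [- 2 E <<U, W>>];
    derivatives are taken in the ambient space. *)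
Definition vdens U W := <<Dx U, Dx W>> + <<Dy U, Dy W>>
  - 4 * (iE * (<<P, U>> * <<P, W>> + <<N, U>> * <<N, W>>)).

Lemma vdensC U W : vdens U W = vdens W U.
Proof.
by rewrite /vdens [<<Dx U, _>>]fdotC [<<Dy U, _>>]fdotC ![_ * <<_, W>>]mulrC.
Qed.

Lemma vdensDl U U' W : vdens (U + U') W = vdens U W + vdens U' W.
Proof. by rewrite /vdens !vfvD !fdotE; ring. Qed.
Lemma vdens_div U W : vdens U W = dx <<Dx U, W>> + dy <<Dy U, W>>
  - (<<fvlap U, W>> + 4 * (iE * (<<P, U>> * <<P, W>> + <<N, U>> * <<N, W>>))).
Proof. by rewrite /vdens fX_dot fY_dot !fvlapE fdotDl; ring. Qed.

(** Up to a divergence, the components of the Hopf differential are eigenfields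
    for the weight [1 / E], with opposite eigenvalues once it is diagonalized.
    *)
Lemma vdens_hopf W : normal W ->
  vdens P W = dx <<Dx P, W>> + dy <<Dy P, W>>
    - 2 * (iE * ((<<P, P>> - <<N, N>>) * <<P, W>> + 2 * <<P, N>> * <<N, W>>)) /\
  vdens N W = dx <<Dx N, W>> + dy <<Dy N, W>>
    + 2 * (iE * ((<<P, P>> - <<N, N>>) * <<N, W>> - 2 * <<P, N>> * <<P, W>>)).
Proof.
move=> nW; have [lP lN] := lap_hopf nW.
rewrite !vdens_div lP lN gauss' [<<N, P>>]fdotC.
move: (dx _) (dx _) (dy _) (dy _) => ? ? ? ?.
by split; ring.
Qed.

Section NormalPartOfConstant.
Variable a : V.
Hypotheses (ax : Dx a = 0) (ay : Dy a = 0).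

Definition height := <<a, f>>.
Definition slope1 := iE * <<a, fx>>.
Definition slope2 := iE * <<a, fy>>.
Definition perp := locked (a - height *: f - slope1 *: fx - slope2 *: fy).
Lemma perpE : perp = a - height *: f - slope1 *: fx - slope2 *: fy.
Proof. by rewrite /perp -lock. Qed.
Notation al := height.
Notation pa := slope1.
Notation qa := slope2.

Let EK h : E * (iE * h) = h. Proof. by rewrite mulrCA iEK. Qed.
Let afx : <<a, fx>> = E * pa. Proof. by rewrite EK. Qed.
Let afy : <<a, fy>> = E * qa. Proof. by rewrite EK. Qed.
Lemma height_x : dx al = E * pa.
Proof. by rewrite /height fX_dot ax fdot0l add0r afx. Qed.
Lemma height_y : dy al = E * qa.
Proof. by rewrite /height fY_dot ay fdot0l add0r afy. Qed.
Lemma lap_height : flap al = - (2 * E * al).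
Proof.
rewrite /flap /height !(fX_dot, fY_dot) ax ay !fdot0l !add0r !(fX_dot, fY_dot).
by rewrite ax ay !fdot0l !add0r -fdotDr -fvlapE (cm_lap cm) fdotZr mulNr.
Qed.

Let afxx : <<a, fxx>> = <<a, P>> + s * (E * pa) - t * (E * qa) - E * al.
Proof. by rewrite {1}fxxE !fdotE afx afy. Qed.
Let afxy : <<a, fxy>> = <<a, N>> + t * (E * pa) + s * (E * qa).
Proof. by rewrite {1}fxyE !fdotE afx afy. Qed.
Let afyy : <<a, fyy>> = - <<a, P>> - s * (E * pa) + t * (E * qa) - E * al.
Proof. by rewrite fyyE !fdotE afxx -/height; ring. Qed.

Let dE1 h : dx (iE * h) = iE * dx h - 2 * s * (iE * h).
Proof. by rewrite !vfM dxie; ring. Qed.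
Let dE2 h : dy (iE * h) = iE * dy h - 2 * t * (iE * h).
Proof. by rewrite !vfM dyie; ring. Qed.
Lemma slopes : [/\
  dx pa = iE * <<a, P>> - s * pa - t * qa - al,
  dy qa = - (iE * <<a, P>>) - s * pa - t * qa - al,
  dx qa = iE * <<a, N>> + t * pa - s * qa &
  dy pa = iE * <<a, N>> - t * pa + s * qa].
Proof.
have X h k l : iE * (h + k * (E * l)) = iE * h + k * l.
  by rewrite -[in RHS](iEK l); ring.
rewrite {1}/slope1 {1}/slope2 {4}/slope2 {5}/slope1.
rewrite !dE1 !dE2 -/slope1 -/slope2 !fX_dot !fY_dot ax ay !fdot0l !add0r fyE.
rewrite afxx afxy afyy; split.
- have -> : iE * (<<a, P>> + s * (E * pa) - t * (E * qa) - E * al)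
    = iE * <<a, P>> + s * (iE * (E * pa)) - t * (iE * (E * qa)) - iE * (E * al) by ring.
  by rewrite !iEK; ring.
- have -> : iE * (- <<a, P>> - s * (E * pa) + t * (E * qa) - E * al)
    = - (iE * <<a, P>>) - s * (iE * (E * pa)) + t * (iE * (E * qa)) - iE * (E * al) by ring.
  by rewrite !iEK; ring.
- have -> : iE * (<<a, N>> + t * (E * pa) + s * (E * qa))
    = iE * <<a, N>> + t * (iE * (E * pa)) + s * (iE * (E * qa)) by ring.
  by rewrite !iEK; ring.
- have -> : iE * (<<a, N>> + t * (E * pa) + s * (E * qa))
    = iE * <<a, N>> + t * (iE * (E * pa)) + s * (iE * (E * qa)) by ring.
  by rewrite !iEK; ring.
Qed.

Lemma normal_perp : normal perp.
Proof.
by split; rewrite perpE !fdotE ?afx ?afy !dots -?/height; ring.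
Qed.

Lemma perp_normal W : normal W -> <<perp, W>> = <<a, W>>.
Proof.
move=> [Wf Wx Wy]; rewrite perpE !fdotE ![<<f, W>>]fdotC ![<<fx, W>>]fdotC.
by rewrite [<<fy, W>>]fdotC Wf Wx Wy; ring.
Qed.

Lemma perp_xy W : normal W ->
  <<Dx perp, W>> = - (pa * <<P, W>> + qa * <<N, W>>) /\
  <<Dy perp, W>> = - (pa * <<N, W>> - qa * <<P, W>>).
Proof.
move=> nW; have [Wf Wx Wy] := nW.
rewrite perpE !fvE ax ay fyE !fdotE fdot0l ![<<f, W>>]fdotC ![<<fx, W>>]fdotC.
rewrite ![<<fy, W>>]fdotC Wf Wx Wy (fxx_normal nW) (fxy_normal nW) (fyy_normal nW).
by split; ring.
Qed.

Lemma lap_perp W : normal W -> <<fvlap perp, W>> =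
  - (4 * (iE * (<<P, perp>> * <<P, W>> + <<N, perp>> * <<N, W>>))).
Proof.
move=> nW; have [Wf Wx Wy] := nW; have [d1 d2 d3 d4] := slopes.
have lapf : <<fvlap f, W>> = 0 by rewrite (cm_lap cm) fdotZl fdotC Wf mulr0.
have lapx : <<fvlap fx, W>> = 0.
  by rewrite fvlap_X (cm_lap cm) vfvZ !fdotE ![<<_, W>>]fdotC Wf Wx; ring.
have lapy : <<fvlap fy, W>> = 0.
  by rewrite fvlap_Y (cm_lap cm) vfvZ !fdotE ![<<_, W>>]fdotC Wf Wy; ring.
have lapa : <<fvlap a, W>> = 0 by rewrite !fvlapE ax ay !vfv0 addr0 fdot0l.
rewrite ![<<_, perp>>]fdotC (perp_normal normal_hopf1) (perp_normal normal_hopf2).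
rewrite perpE !fvlapB !fdotBl !fdot_vlapZ lapa lapf lapx lapy fyE d1 d2 d3 d4.
rewrite ![<<f, W>>]fdotC ![<<fx, W>>]fdotC ![<<fy, W>>]fdotC Wf Wx Wy.
rewrite (fxx_normal nW) (fxy_normal nW) (fyy_normal nW); ring.
Qed.

(** Normal parts of constant vectors are eigenfields of the Jacobi operator
    with eigenvalue 2, so that [vdens] reduces to a divergence. *)
Lemma vdens_perp W : normal W ->
  vdens perp W = dx <<Dx perp, W>> + dy <<Dy perp, W>>.
Proof. by move=> nW; rewrite vdens_div lap_perp // addNr subr0. Qed.

(** [iE * <<a, P>>] and [iE * <<a, N>>] are divergences. *)
Lemma hopf_div : dx pa - dy qa = 2 * (iE * <<a, P>>) /\
  dy pa + dx qa = 2 * (iE * <<a, N>>).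
Proof. by have [-> -> -> ->] := slopes; split; ring. Qed.

(** The derivatives of [perp] give [pa P + qa N = 0] and [pa N - qa P = 0],
    which decouple when [P] and [N] are orthogonal. *)
Lemma perp_eq0 : perp = 0 -> <<P, N>> = 0 ->
  [/\ pa * <<P, P>> = 0, qa * <<P, P>> = 0 & a = al *: f + pa *: fx + qa *: fy].
Proof.
move=> a0 PN; have [h1 h2] := perp_xy normal_hopf1.
rewrite a0 !vfv0 !fdot0l [<<N, P>>]fdotC PN in h1 h2.
split.
- have -> : pa * <<P, P>> = - (- (pa * <<P, P>> + qa * 0)) by ring.
  by rewrite -h1 oppr0.
- have -> : qa * <<P, P>> = - (pa * 0 - qa * <<P, P>>) by ring.
  by rewrite -h2.
- rewrite -[LHS]subr0 -a0.
  by rewrite perpE -!addrA -!opprD subKr addrA.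
Qed.
End NormalPartOfConstant.

End MinimalSurface.
End FrameCalculus.

(** * The energy Hessian and adapted normal frames *)
Section NormalFrame.
Variables (A : comNzRingType) (V : lmodType A) (F : frame V).
Variables (f : V) (e ie : A).
Hypothesis cm : conformal_minimal F f e ie.
Notation "<< u , v >>" := (fdot F u v).
Notation dx := (fX F).
Notation dy := (fY F).
Notation Dx := (vfv (fX F)).
Notation Dy := (vfv (fY F)).
Notation fx := (Dx f).
Notation fy := (Dy f).
Notation P := (hopf1 F f e ie).
Notation N := (hopf2 F f e ie).
Notation E := (e * e).
Notation iE := (ie * ie).
Notation normal := (normal F f).
Notation vdens := (vdens F f e ie).

(** Polarization of [|d Y|^2 - 2 E |Y|^2], the density of the energy Hessian of
    [f]. *)
Definition edens Y Z := <<Dx Y, Dx Z>> + <<Dy Y, Dy Z>> - 2 * E * <<Y, Z>>.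

Lemma edens_div Y Z : edens Y Z = dx <<Dx Y, Z>> + dy <<Dy Y, Z>>
  - (<<fvlap F Y, Z>> + 2 * E * <<Y, Z>>).
Proof. by rewrite /edens fX_dot fY_dot !fvlapE fdotDl; ring. Qed.

Let ff : <<f, f>> = 1 := cm_unit cm.
Let half h : h + h = 0 -> h = 0 :> A := @f2reg _ _ F h.
Let f_fx : <<f, fx>> = 0.
Proof. by apply: half; have := fX_dot F f f; rewrite ff vf1 [<<fx, f>>]fdotC. Qed.
Let f_fy : <<f, fy>> = 0.
Proof. by apply: half; have := fY_dot F f f; rewrite ff vf1 [<<fy, f>>]fdotC. Qed.

Section EnergyHessian.
Variables (g : V) (G : A) (a : V).
Hypothesis lapg : fvlap F g = - G *: f - 2 * E *: g.
Hypothesis f_g : <<f, g>> = 0.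
Hypothesis g_tangent : forall W, normal W -> <<W, g>> = 0.
Hypotheses (ax : Dx a = 0) (ay : Dy a = 0).
Notation al := (height F f a).
Notation pp := (perp F f ie a).

(** The derivative [g] of [f] along a translation of the domain is a Jacobi
    field of the energy, while the infinitesimal conformal motions
    [a - <<a, f>> f] of the sphere decrease it. *)
Lemma energy_hessian (Y := g + (a - al *: f)) :
  edens Y Y = dx <<Dx Y, Y>> + dy <<Dy Y, Y>> - 2 * E * <<pp, pp>>.
Proof.
have nperp := normal_perp cm a.
have ppa : <<pp, pp>> = <<a, pp>> by rewrite (perp_normal _ _ nperp).
have [pf px py] := nperp; have pg := g_tangent nperp.
rewrite edens_div; congr (_ - _).
have cf : <<f, a - al *: f>> = 0.
  by rewrite !fdotE ff /height [<<f, a>>]fdotC; ring.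
have L2 Z : <<fvlap F (a - al *: f), Z>> =
    2 * E * (<<pp, Z>> + 2 * (al * <<f, Z>>) - <<a - al *: f, Z>>).
  have lapa : <<fvlap F a, Z>> = 0 by rewrite fvlapE ax ay !vfv0 addr0 fdot0l.
  rewrite fvlapB fdotBl fdot_vlapZ lapa (lap_height cm ax ay) (cm_lap cm).
  rewrite (height_x cm ax) (height_y cm ay) perpE !fdotE.
  by ring.
have Yf : <<f, Y>> = 0 by rewrite /Y fdotDr f_g cf addr0.
have Yp : <<pp, Y>> = <<a, pp>>.
  by rewrite /Y !fdotDr fdotNr fdotZr pf pg [<<pp, a>>]fdotC; ring.
have YY : <<Y, Y>> = <<g, Y>> + <<a - al *: f, Y>> by rewrite {1}/Y fdotDl.
rewrite {1}/Y fvlapD fdotDl L2 lapg fdotBl !fdotZl Yf Yp ppa YY.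
by ring.
Qed.
End EnergyHessian.

(** Along a minimal surface whose normal bundle carries a global frame adapted
    to the Hopf differential. *)
Section AdaptedFrame.
Variables (n1 n2 : V) (rho irho sg : A).
Hypotheses (nn1 : normal n1) (nn2 : normal n2).
Hypotheses (n11 : <<n1, n1>> = 1) (n22 : <<n2, n2>> = 1) (n12 : <<n1, n2>> = 0).
Hypotheses (hP : P = rho *: n1) (hN : N = sg *: n2) (rr : rho * irho = 1).
Hypothesis parseval : forall U W, <<U, W>> = <<U, f>> * <<W, f>>
  + iE * (<<U, fx>> * <<W, fx>>) + iE * (<<U, fy>> * <<W, fy>>)
  + <<U, n1>> * <<W, n1>> + <<U, n2>> * <<W, n2>>.

Let n21 : <<n2, n1>> = 0. Proof. by rewrite fdotC. Qed.
Let P1 : <<P, n1>> = rho. Proof. by rewrite hP fdotZl n11 mulr1. Qed.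
Let P2 : <<P, n2>> = 0. Proof. by rewrite hP fdotZl n12 mulr0. Qed.
Let N1 : <<N, n1>> = 0. Proof. by rewrite hN fdotZl n21 mulr0. Qed.
Let N2 : <<N, n2>> = sg. Proof. by rewrite hN fdotZl n22 mulr1. Qed.

Notation ox := (<<Dx n1, n2>>).
Notation oy := (<<Dy n1, n2>>).

Let x11 : <<Dx n1, n1>> = 0.
Proof. by apply: half; have := fX_dot F n1 n1; rewrite n11 vf1 [<<n1, Dx n1>>]fdotC. Qed.
Let y11 : <<Dy n1, n1>> = 0.
Proof. by apply: half; have := fY_dot F n1 n1; rewrite n11 vf1 [<<n1, Dy n1>>]fdotC. Qed.
Let x22 : <<Dx n2, n2>> = 0.
Proof. by apply: half; have := fX_dot F n2 n2; rewrite n22 vf1 [<<n2, Dx n2>>]fdotC. Qed.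
Let y22 : <<Dy n2, n2>> = 0.
Proof. by apply: half; have := fY_dot F n2 n2; rewrite n22 vf1 [<<n2, Dy n2>>]fdotC. Qed.
Let x21 : <<Dx n2, n1>> = - ox.
Proof.
have := fX_dot F n2 n1; rewrite n21 vf0 [<<n2, Dx n1>>]fdotC => /esym/eqP.
by rewrite addr_eq0 => /eqP.
Qed.
Let y21 : <<Dy n2, n1>> = - oy.
Proof.
have := fY_dot F n2 n1; rewrite n21 vf0 [<<n2, Dy n1>>]fdotC => /esym/eqP.
by rewrite addr_eq0 => /eqP.
Qed.

Let x1f := nWx_f nn1. Let y1f := nWy_f nn1. Let x2f := nWx_f nn2. Let y2f := nWy_f nn2.
Let x1x : <<Dx n1, fx>> = - rho. Proof. by rewrite (nWx_fx e ie nn1) P1. Qed.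
Let x1y : <<Dx n1, fy>> = 0. Proof. by rewrite (nWx_fy e ie nn1) N1 oppr0. Qed.
Let y1x : <<Dy n1, fx>> = 0. Proof. by rewrite (nWy_fx e ie nn1) N1 oppr0. Qed.
Let y1y : <<Dy n1, fy>> = rho. Proof. by rewrite (nWy_fy cm nn1) P1. Qed.
Let x2x : <<Dx n2, fx>> = 0. Proof. by rewrite (nWx_fx e ie nn2) P2 oppr0. Qed.
Let x2y : <<Dx n2, fy>> = - sg. Proof. by rewrite (nWx_fy e ie nn2) N2. Qed.
Let y2x : <<Dy n2, fx>> = - sg. Proof. by rewrite (nWy_fx e ie nn2) N2. Qed.
Let y2y : <<Dy n2, fy>> = 0. Proof. by rewrite (nWy_fy cm nn2) P2. Qed.
Let dots := (x11, y11, x22, y22, x21, y21, x1f, y1f, x2f, y2f, x1x, x1y, y1x, y1y,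
  x2x, x2y, y2x, y2y).

Let codazzi1 : dx rho = sg * oy /\ dy rho = - (sg * ox).
Proof.
have [] := codazzi cm nn1; rewrite hP hN !vfvZ !fdotDl !fdotZl n11 n21 !dots.
move=> h1 h2; split.
  have -> : dx rho = dx rho * 1 + rho * 0 by ring.
  by rewrite h1; ring.
have -> : dy rho = dy rho * 1 + rho * 0 by ring.
by rewrite h2; ring.
Qed.
Let codazzi2 : dx sg = rho * oy /\ dy sg = - (rho * ox).
Proof.
have [] := codazzi cm nn2; rewrite hP hN !vfvZ !fdotDl !fdotZl n12 n22 !dots.
move=> h1 h2; split.
  have -> : dx sg = dx sg * 1 + sg * 0 by ring.
  by rewrite -h2; ring.
have -> : dy sg = - - (dy sg * 1 + sg * 0) by ring.
by rewrite -h1; ring.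
Qed.

Let rho_reg h : rho * h = 0 -> h = 0.
Proof. by move=> H; rewrite -[h]mul1r -rr mulrAC H mul0r. Qed.

Let div0 : dx ox + dy oy = 0.
Proof.
have [r1 r2] := codazzi1; have [s1 s2] := codazzi2.
apply: rho_reg; have := fXY F sg; rewrite s2 s1 vfN !vfM r1 r2 => H.
have -> : rho * (dx ox + dy oy) = (- (sg * ox) * oy + rho * dy oy)
  - - (sg * oy * ox + rho * dx ox) by ring.
by rewrite H subrr.
Qed.

Let curl : dx oy - dy ox = - (2 * (iE * (rho * sg))).
Proof.
rewrite fX_dot fY_dot fXYv opprD addrACA subrr add0r.
by rewrite (parseval (Dy n1) (Dx n2)) (parseval (Dx n1) (Dy n2)) !dots; ring.
Qed.

Let lap22 : <<fvlap F n2, n2>> = - (2 * (iE * (sg * sg)) + ox * ox + oy * oy).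
Proof.
have X := fX_dot F (Dx n2) n2; have Y := fY_dot F (Dy n2) n2.
rewrite x22 vf0 (parseval (Dx n2) (Dx n2)) !dots in X.
rewrite y22 vf0 (parseval (Dy n2) (Dy n2)) !dots in Y.
move/esym/eqP: X; rewrite addr_eq0 => /eqP X.
move/esym/eqP: Y; rewrite addr_eq0 => /eqP Y.
by rewrite fvlapE fdotDl X Y; ring.
Qed.
Let lap11 : <<fvlap F n1, n1>> = - (2 * (iE * (rho * rho)) + ox * ox + oy * oy).
Proof.
have X := fX_dot F (Dx n1) n1; have Y := fY_dot F (Dy n1) n1.
rewrite x11 vf0 (parseval (Dx n1) (Dx n1)) !dots in X.
rewrite y11 vf0 (parseval (Dy n1) (Dy n1)) !dots in Y.
move/esym/eqP: X; rewrite addr_eq0 => /eqP X.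
move/esym/eqP: Y; rewrite addr_eq0 => /eqP Y.
by rewrite fvlapE fdotDl X Y; ring.
Qed.
Let lap21 : <<fvlap F n2, n1>> = 0.
Proof.
have X := fX_dot F (Dx n2) n1; have Y := fY_dot F (Dy n2) n1.
rewrite x21 vfN (parseval (Dx n2) (Dx n1)) !dots in X.
rewrite y21 vfN (parseval (Dy n2) (Dy n1)) !dots in Y.
rewrite fvlapE fdotDl; have -> : 0 = - (dx ox + dy oy) by rewrite div0 oppr0.
by rewrite opprD X Y; ring.
Qed.
Let lap12 : <<fvlap F n1, n2>> = 0.
Proof.
have X := fX_dot F (Dx n1) n2; have Y := fY_dot F (Dy n1) n2.
rewrite (parseval (Dx n1) (Dx n2)) !dots in X.
rewrite (parseval (Dy n1) (Dy n2)) !dots in Y.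
by rewrite fvlapE fdotDl -div0 X Y; ring.
Qed.

Let flap_rho : flap F rho = rho * (ox * ox + oy * oy) - 2 * (iE * (rho * (sg * sg))).
Proof.
have [r1 r2] := codazzi1; have [s1 s2] := codazzi2.
rewrite /flap r1 r2 vfN !vfM s1 s2.
have -> : rho * oy * oy + sg * dx oy - (- (rho * ox) * ox + sg * dy ox)
  = rho * (ox * ox + oy * oy) + sg * (dx oy - dy ox) by ring.
by rewrite curl; ring.
Qed.
Let flap_sg : flap F sg = sg * (ox * ox + oy * oy) - 2 * (iE * (sg * (rho * rho))).
Proof.
have [r1 r2] := codazzi1; have [s1 s2] := codazzi2.
rewrite /flap s1 s2 vfN !vfM r1 r2.
have -> : sg * oy * oy + rho * dx oy - (- (sg * ox) * ox + rho * dy ox)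
  = sg * (ox * ox + oy * oy) + rho * (dx oy - dy ox) by ring.
by rewrite curl; ring.
Qed.

Let normal_parseval U W : normal W ->
  <<U, W>> = <<U, n1>> * <<W, n1>> + <<U, n2>> * <<W, n2>>.
Proof. by move=> [a b d]; rewrite parseval a b d; ring. Qed.

(** The Hopf differential rotated by a quarter turn in the normal bundle is
    again in the kernel of [L - 2]; its real and imaginary parts are
    [rho n2] and [- sg n1]. *)
Lemma vdens_rotated_hopf W : normal W ->
  vdens (rho *: n2) W = dx <<Dx (rho *: n2), W>> + dy <<Dy (rho *: n2), W>> /\
  vdens (sg *: n1) W = dx <<Dx (sg *: n1), W>> + dy <<Dy (sg *: n1), W>>.
Proof.
have [r1 r2] := codazzi1; have [s1 s2] := codazzi2.
move=> nW; rewrite !vdens_div.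
rewrite (normal_parseval (fvlap F (rho *: n2)) nW).
rewrite (normal_parseval (fvlap F (sg *: n1)) nW).
rewrite (normal_parseval P nW) (normal_parseval N nW) P1 P2 N1 N2 !fdotZr P1 P2 N1 N2.
rewrite !fdot_vlapZ flap_rho flap_sg lap11 lap12 lap21 lap22 n11 n12 n21 n22 !dots.
rewrite r1 r2 s1 s2.
move: (dx _) (dy _) (dx _) (dy _) => ? ? ? ?.
by split; ring.
Qed.

(** Comparison of the slopes makes the heights of [a] and [b] harmonic; being
    eigenfunctions of the Laplacian as well, they vanish. *)
Lemma rotated_hopf_const a b : Dx a = 0 -> Dy a = 0 -> Dx b = 0 -> Dy b = 0 ->
  rho *: n2 = perp F f ie a -> sg *: n1 = perp F f ie b ->
  [/\ a = rho *: n2, <<a, f>> = 0, dx rho = 0, dy rho = 0 & sg = 0].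
Proof.
move=> ax ay bx by_ Ka Sb.
have [r1 r2] := codazzi1; have [s1 s2] := codazzi2.
have [Kx1 Ky1] := perp_xy cm ax ay nn1; have [Kx2 Ky2] := perp_xy cm ax ay nn2.
have [Sx1 Sy1] := perp_xy cm bx by_ nn1; have [Sx2 Sy2] := perp_xy cm bx by_ nn2.
rewrite -Ka !vfvZ !fdotDl !fdotZl n22 n21 !dots P1 P2 N1 N2 in Kx1 Ky1 Kx2 Ky2.
rewrite -Sb !vfvZ !fdotDl !fdotZl n11 n12 !dots P1 P2 N1 N2 in Sx1 Sy1 Sx2 Sy2.
have rho_inj h k : rho * h = rho * k -> h = k.
  by move=> H; rewrite -[h]mul1r -[k]mul1r -rr mulrAC H mulrAC.
have qa : slope2 F f ie a = slope1 F f ie b.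
  apply: rho_inj.
  have -> : rho * slope2 F f ie a = - (slope1 F f ie a * 0 - slope2 F f ie a * rho) by ring.
  rewrite -Ky1.
  have -> : rho * slope1 F f ie b = - - (slope1 F f ie b * rho + slope2 F f ie b * 0) by ring.
  by rewrite -Sx1 s1; ring.
have pa : slope1 F f ie a = - slope2 F f ie b.
  apply: rho_inj.
  have -> : rho * slope1 F f ie a = - - (slope1 F f ie a * rho + slope2 F f ie a * 0) by ring.
  rewrite -Kx1.
  have -> : rho * - slope2 F f ie b = - - (slope1 F f ie b * 0 - slope2 F f ie b * rho) by ring.
  by rewrite -Sy1 s2; ring.
have einv := cm_inv cm.
have E_reg h : E * h = 0 -> h = 0.
  by move=> H; rewrite -[h](iEK cm) H mulr0.
have zero v : flap F v = - (2 * E * v) -> flap F v = 0 -> v = 0.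
  move=> -> H; apply: half; apply: E_reg.
  have -> : E * (v + v) = - - (2 * E * v) by ring.
  by rewrite H oppr0.
have al0 : height F f a = 0.
  apply: (zero _ (lap_height cm ax ay)).
  rewrite /flap (height_x cm ax) (height_y cm ay) qa pa.
  by rewrite mulrN vfN -(height_y cm by_) -(height_x cm bx) fXY addNr.
have be0 : height F f b = 0.
  apply: (zero _ (lap_height cm bx by_)).
  rewrite /flap (height_x cm bx) (height_y cm by_) -qa.
  have -> : slope2 F f ie b = - slope1 F f ie a by rewrite pa opprK.
  by rewrite mulrN vfN -(height_y cm ay) -(height_x cm ax) fXY subrr.
have pa0 : slope1 F f ie a = 0.
  by apply: E_reg; rewrite -(height_x cm ax) al0 vf0.
have qa0 : slope2 F f ie a = 0.
  by apply: E_reg; rewrite -(height_y cm ay) al0 vf0.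
have pb0 : slope1 F f ie b = 0 by rewrite -qa.
have qb0 : slope2 F f ie b = 0 by apply/eqP; rewrite -oppr_eq0 -pa pa0.
have aE : a = rho *: n2.
  by rewrite Ka perpE al0 pa0 qa0 !scale0r !subr0.
have bE : b = sg *: n1.
  by rewrite Sb perpE be0 pb0 qb0 !scale0r !subr0.
have sg0 : sg = 0.
  apply: rho_reg; have <- : <<b, Dx fx>> = rho * sg.
    by rewrite bE fdotZl [<<n1, _>>]fdotC (fxx_normal e ie nn1) P1 mulrC.
  have H : <<b, fx>> = 0.
    have -> : <<b, fx>> = E * slope1 F f ie b by rewrite /slope1 mulrCA (iEK cm).
    by rewrite pb0 mulr0.
  by have := fX_dot F b fx; rewrite H vf0 bx fdot0l add0r.
split=> //.
- by rewrite r1 sg0 mul0r.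
- by rewrite r2 sg0 mul0r oppr0.
Qed.
End AdaptedFrame.
End NormalFrame.

(** * The second variation of area *)
Section VectorFields.
Context {R : realType} {m : nat}.
Notation A := (torus_fun R).
Implicit Types (U V : 'rV[A]_m).

Definition veval V (p : R * R) : 'rV[R]_m := map_mx (fun h : A => h p) V.

Lemma veval_entry V p a : veval V p ord0 a = V ord0 a p.
Proof. by rewrite mxE. Qed.
Lemma dot_veval U V p : dot (veval U p) (veval V p) = vdot U V p.
Proof. by rewrite vdot_eval. Qed.
Lemma vevalD U V p : veval (U + V) p = veval U p + veval V p.
Proof. by apply/matrixP => i j; rewrite !mxE. Qed.
Lemma vevalN U p : veval (- U) p = - veval U p.
Proof. by apply/matrixP => i j; rewrite !mxE. Qed.
Lemma vevalB U V p : veval (U - V) p = veval U p - veval V p.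
Proof. by rewrite vevalD vevalN. Qed.
Lemma vevalZ h V p : veval (h *: V) p = h p *: veval V p.
Proof. by apply/matrixP => i j; rewrite !mxE. Qed.
Lemma veval_sum (I : finType) (F : I -> 'rV[A]_m) p :
  veval (\sum_i F i) p = \sum_i veval (F i) p.
Proof.
by apply/matrixP => i j; rewrite mxE !summxE torus_sum; apply: eq_bigr => k _;
  rewrite mxE.
Qed.

Lemma veval_inj U V : (forall p, veval U p = veval V p) -> U = V.
Proof.
move=> H; apply/matrixP => i j; rewrite ord1; apply: torus_ext => p.
by rewrite -!veval_entry H.
Qed.

Definition Dt i : derivation R :=
  Derivation (td_additive i) (@tdM R i) (@td_cst R i).

Lemma continuous_rV (V : R * R -> 'rV[R]_m) :
  (forall a, continuous (fun p => V p ord0 a)) -> continuous V.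
Proof.
move=> cV; have -> : V = fun p => \sum_(a < m) V p ord0 a *: delta_mx ord0 a.
  by apply/funext => p; exact: row_sum_delta.
elim: (index_enum _) => [|a s IH].
  rewrite (_ : (fun _ => _) = fun=> 0); first exact: cst_continuous.
  by apply/funext => p; rewrite big_nil.
rewrite (_ : (fun _ => _) = fun p => V p ord0 a *: delta_mx ord0 a
  + \sum_(j <- s) V p ord0 j *: delta_mx ord0 j); last first.
  by apply/funext => p; rewrite big_cons.
by move=> p; apply: cvgD; [exact: cvgZr_tmp (cV a p)|exact: IH].
Qed.

Lemma smooth_entry (V : R * R -> 'rV[R]_m) a :
  smooth V -> smooth (fun p => V p ord0 a).
Proof.
move=> sV; pose C (h : R * R -> R) := exists2 W : R * R -> 'rV[R]_m,
  smooth W & h = fun p => W p ord0 a.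
apply: (@smooth_coind _ _ C); last by exists V.
move=> _ [W sW ->]; have [cW dW pW] := (smoothE W).1 sW; split.
- move=> p; apply: (@continuous_comp _ _ _ W (fun M : 'rV[R]_m => M ord0 a)).
    exact: cW.
  exact: coord_continuous.
- by move=> i p; apply: (derivable_mxP W p (coord_vec R i)).1.
- move=> i; exists (partial i W) => //; apply/funext => p.
  by rewrite partialE partialE derive_mx ?mxE.
Qed.

Lemma smooth_rV (V : R * R -> 'rV[R]_m) :
  (forall a, smooth (fun p => V p ord0 a)) -> smooth V.
Proof.
move=> sV; pose C (W : R * R -> 'rV[R]_m) := forall a, smooth (fun p => W p ord0 a).
apply: (@smooth_coind _ _ C) => // W sW.
have dW : has_partials W.
  move=> i p; apply/derivable_mxP => k j; rewrite ord1.
  exact: smooth_partials (sW j) i p.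
split=> // [|i a].
  by apply: continuous_rV => a; exact: smooth_continuous.
rewrite (_ : (fun p => _) = partial i (fun p => W p ord0 a)).
  exact: smooth_partial.
by apply/funext => p; rewrite partialE partialE derive_mx ?mxE.
Qed.

Lemma smooth_veval V : smooth (veval V).
Proof.
apply: smooth_rV => a; rewrite (_ : (fun p => _) = V ord0 a).
  exact: torus_smooth.
by apply/funext => p; rewrite mxE.
Qed.

Lemma periodic_veval V : Defs.periodic (veval V).
Proof.
by move=> p q pq; apply/matrixP => i j; rewrite !mxE (torus_periodic _ pq).
Qed.

Lemma veval_surj (V : R * R -> 'rV[R]_m) : smooth V -> Defs.periodic V ->
  exists VA, V = veval VA.
Proof.
move=> sV pV; have H a : smooth (fun p => V p ord0 a) /\
    Defs.periodic (fun p => V p ord0 a).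
  by split; [exact: smooth_entry|move=> p q pq; rewrite (pV p q pq)].
exists (\row_a mk_torus (H a)); apply/funext => p; apply/matrixP => i j.
by rewrite !mxE ord1.
Qed.

Lemma partial_veval i V : partial i (veval V) = veval (vderiv (Dt i) V).
Proof.
apply/funext => p; apply/matrixP => k a; rewrite ord1 !mxE vderiv_entry.
rewrite partialE derive_mx; last first.
  exact: smooth_partials (@smooth_veval V) i p.
rewrite mxE -partialE; congr (partial i _ p).
by apply/funext => q; rewrite mxE.
Qed.

End VectorFields.

Opaque partial.

Section Gram.
Context {R : realType} {n : nat}.

Lemma sum2 (V : nmodType) (F : 'I_2 -> V) : \sum_(i < 2) F i = F ord0 + F ord_max.
Proof.
rewrite big_ord_recl big_ord_recl big_ord0 addr0; congr (_ + F _).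
exact: val_inj.
Qed.

Lemma sum22 (V : nmodType) (F : 'I_2 -> 'I_2 -> V) : \sum_(i < 2) \sum_(j < 2) F i j
  = F ord0 ord0 + F ord0 ord_max + (F ord_max ord0 + F ord_max ord_max).
Proof. by rewrite !sum2. Qed.
Lemma dotDl m (x y z : 'rV[R]_m) : dot (x + y) z = dot x z + dot y z.
Proof. by rewrite -big_split; apply: eq_bigr => a _ /=; rewrite mxE mulrDl. Qed.
Lemma dotDr m (x y z : 'rV[R]_m) : dot z (x + y) = dot z x + dot z y.
Proof. by rewrite ![dot z _]dotC dotDl. Qed.
Lemma dotBr m (x y z : 'rV[R]_m) : dot z (x - y) = dot z x - dot z y.
Proof. by rewrite ![dot z _]dotC dotBl. Qed.
Lemma dotZr m c (x z : 'rV[R]_m) : dot z (c *: x) = c * dot z x.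
Proof. by rewrite ![dot z _]dotC dotZl. Qed.
Lemma dot0l m (z : 'rV[R]_m) : dot 0 z = 0.
Proof. by apply: big1 => a _; rewrite mxE mul0r. Qed.
Lemma dot_ge0 m (x : 'rV[R]_m) : 0 <= dot x x.
Proof. by apply: sumr_ge0 => a _; rewrite -expr2 sqr_ge0. Qed.
Lemma dot_eq0 m (x : 'rV[R]_m) : dot x x = 0 -> x = 0.
Proof.
move=> /eqP; rewrite psumr_eq0 => [/allP H|a _]; last by rewrite -expr2 sqr_ge0.
apply/matrixP => i a; rewrite mxE ord1; apply/eqP.
by rewrite -[_ == _]orbb -mulf_eq0; apply: (H a); rewrite mem_index_enum.
Qed.

Lemma dot_sum22 m (c : 'I_2 -> 'I_2 -> R) (X : 'I_2 -> 'I_2 -> 'rV[R]_m) y :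
  dot (\sum_i \sum_j c i j *: X i j) y = \sum_i \sum_j c i j * dot (X i j) y.
Proof. by rewrite !sum22 3!dotDl !dotZl. Qed.

Fact trace_sqr (h S : 'I_2 -> 'I_2 -> R) :
  h ord_max ord0 = h ord0 ord_max -> S ord_max ord0 = S ord0 ord_max ->
  \sum_i \sum_j h i j * (\sum_k \sum_l h k l * (S j k * S i l))
  = \sum_i \sum_j (\sum_k h i k * S k j) * (\sum_k h j k * S k i).
Proof. by move=> hC SC; rewrite !sum22 !sum2 hC SC; ring. Qed.

Fact dot_comb m (x y a b c : 'rV[R]_m) s k l k' l' :
  dot (x - s *: a - (k *: b + l *: c + (k' *: b + l' *: c))) y
  = dot x y - s * dot a y
    - (k * dot b y + l * dot c y + (k' * dot b y + l' * dot c y)).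
Proof. by rewrite 2!dotBl 3!dotDl !dotZl. Qed.
Lemma gram_gt0 m (M : 'M[R]_(2, m)) : row_free M ->
  0 < dot (row ord0 M) (row ord0 M) * dot (row ord_max M) (row ord_max M)
    - dot (row ord0 M) (row ord_max M) * dot (row ord0 M) (row ord_max M).
Proof.
move=> Mf; set u := row ord0 M; set v := row ord_max M.
have free a b : a *: u + b *: v = 0 -> a = 0 /\ b = 0.
  move=> E; pose c : 'rV[R]_2 := \row_i (if i == ord0 then a else b).
  have : c *m M = 0.
    rewrite -[RHS]E mulmx_sum_row sum2 !mxE /=; congr (_ *: _ + _ *: _).
  move/(congr1 (fun x => x *m pinvmx M)); rewrite mulmxKp // mul0mx => /matrixP c0.
  by split; [have := c0 ord0 ord0|have := c0 ord0 ord_max]; rewrite !mxE.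
have v0 : 0 < dot v v.
  rewrite lt_neqAle dot_ge0 andbT eq_sym; apply/eqP => /dot_eq0 v0.
  have [_ /eqP] := free 0 1 ltac:(by rewrite v0 scale0r scaler0 addr0).
  by rewrite oner_eq0.
have : 0 < dot (dot v v *: u + (- dot u v) *: v) (dot v v *: u + (- dot u v) *: v).
  rewrite lt_neqAle dot_ge0 andbT eq_sym; apply/eqP => /dot_eq0 /free [/eqP].
  by rewrite gt_eqF.
rewrite [X in 0 < X](_ : _ = dot v v * (dot u u * dot v v - dot u v * dot u v)).
  by rewrite pmulr_rgt0.
by rewrite !(dotDl, dotDr, dotZl, dotZr) (dotC v u); ring.
Qed.
End Gram.

Section SecondVariation.
Context {R : realType} {n : nat}.
Notation A := (torus_fun R).
Variable F : 'rV[A]_n.+1.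
Notation f := (veval F).
Hypothesis imm : immersed_torus f.
Notation o0 := (ord0 : 'I_2).
Notation o1 := (ord_max : 'I_2).
Notation Fd i := (vderiv (Dt i) F).

Definition tmetric i j : A := vdot (Fd i) (Fd j).
Notation g := tmetric.
Lemma tmetricC i j : g i j = g j i. Proof. exact: vdotC. Qed.
Definition tgram : A := g o0 o0 * g o1 o1 - g o0 o1 * g o0 o1.

Lemma metricE p i j : metric f p i j = g i j p.
Proof. by rewrite mxE !partial_veval dot_veval. Qed.
Lemma tgram_gt0 p : 0 < tgram p.
Proof.
have [_ _ _ /(_ p)/gram_gt0] := imm.
by rewrite /= !rowK !partial_veval !dot_veval.
Qed.

Definition area : A := sval (cid (torus_sqrt tgram_gt0)).
Lemma areaP : (forall p, 0 < area p) /\ area * area = tgram.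
Proof. by rewrite /area; case: cid => k /= []. Qed.
Lemma det2 (T : comNzRingType) (M : 'M[T]_2) :
  \det M = M o0 o0 * M o1 o1 - M o0 o1 * M o1 o0.
Proof.
rewrite (expand_det_row _ o0) sum2 /cofactor !det_mx11 !mxE /=.
rewrite expr0 expr1 mul1r mulN1r mulrN.
by congr (_ * M _ _ - _ * M _ _); exact: val_inj.
Qed.

Lemma detE p : \det (metric f p) = tgram p.
Proof.
by rewrite det2 !metricE (tmetricC o1) /tgram torusB !torusM.
Qed.

Lemma area_densityE p : area_density f p = area p.
Proof.
have [a0 aa] := areaP; rewrite /area_density detE -aa torusM -expr2 sqrtr_sqr.
by rewrite gtr0_norm.
Qed.

Let tgram_neq0 p : tgram p != 0. Proof. by rewrite gt_eqF // tgram_gt0. Qed.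
Definition igram : A := sval (cid (torus_inv tgram_neq0)).
Lemma igramE p : igram p = (tgram p)^-1.
Proof. by rewrite /igram; case: cid => k /= []. Qed.

Definition tinv (i j : 'I_2) : A := locked (igram *
  (if i == j then g (rev_ord i) (rev_ord i) else - g o0 o1)).
Notation h := tinv.

Lemma tinv00 : h o0 o0 = igram * g o1 o1.
Proof. by rewrite /tinv -lock eqxx; congr (_ * g _ _); exact: val_inj. Qed.
Lemma tinv11 : h o1 o1 = igram * g o0 o0.
Proof. by rewrite /tinv -lock eqxx; congr (_ * g _ _); exact: val_inj. Qed.
Lemma tinv01 : h o0 o1 = - (igram * g o0 o1).
Proof. by rewrite /tinv -lock /= mulrN. Qed.
Lemma tinv10 : h o1 o0 = - (igram * g o0 o1).
Proof. by rewrite /tinv -lock /= mulrN. Qed.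
Lemma metric_unit p : metric f p \in unitmx.
Proof. by rewrite unitmxE detE unitfE. Qed.
Lemma inv_metricE p i j : inv_metric f p i j = h i j p.
Proof.
pose H : 'M[R]_2 := \matrix_(i, j) h i j p.
suff E : metric f p *m H = 1%:M.
  rewrite /inv_metric -[invmx _]mulmx1 -E mulmxA mulVmx ?metric_unit //.
  by rewrite mul1mx mxE.
apply/matrixP => a b; rewrite mxE sum2 !metricE [RHS]mxE.
have HE i' j' : H i' j' = h i' j' p by rewrite mxE.
 elim/ord2P: a; elim/ord2P: b; rewrite !HE.
all: rewrite ?tinv00 ?tinv01 ?tinv10 ?tinv11 ?(tmetricC o1 o0).
all: rewrite ?(torusN, torusM) igramE; have := tgram_neq0 p.
all: rewrite /tgram torusB !torusM.
all: move: (g _ _ p) (g _ _ p) (g _ _ p) => a b d E; rewrite /=; field; exact: E.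
Qed.

Let ff p : dot (f p) (f p) = 1. Proof. by have [_ _ + _] := imm; exact. Qed.
Lemma nproj_dot p x y : normal_at f p y -> dot (normal_proj f p x) y = dot x y.
Proof.
move=> [yf yd].
have E0 := yd o0. have E1 := yd o1. move: yf E0 E1 {yd}. rewrite /normal_proj.
rewrite sum22 dot_comb.
move: (partial o0 f p).
move: (partial o1 f p).
move: (f p) => a b c.
rewrite !(dotC y) => -> -> ->.
by rewrite !mulr0 !addr0 !subr0.
Qed.

Lemma nproj_dot2 p x y : dot (normal_proj f p x) y = dot x y
  - dot x (f p) * dot y (f p) - \sum_i \sum_j h i j p *
    (dot x (veval (Fd i) p) * dot y (veval (Fd j) p)).
Proof.
rewrite /normal_proj !sum22 dot_comb !inv_metricE !partial_veval.
move: (f p) (veval _ p) (veval _ p) => a b c.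
by rewrite !(dotC y) !mulrA.
Qed.

Definition nproj V : 'rV[A]_n.+1 := V - vdot V F *: F
  - \sum_i \sum_j (h i j * vdot V (Fd i)) *: Fd j.
Lemma nprojE V p : normal_proj f p (veval V p) = veval (nproj V) p.
Proof.
rewrite /nproj !vevalB vevalZ -dot_veval /normal_proj veval_sum; congr (_ - _).
apply: eq_bigr => i _; rewrite veval_sum; apply: eq_bigr => j _.
by rewrite vevalZ torusM -dot_veval inv_metricE !partial_veval.
Qed.

Variable V : 'rV[A]_n.+1.
Notation Vd i := (vderiv (Dt i) V).
Hypothesis nV : forall p, normal_at f p (veval V p).

Lemma tnormal : vdot V F = 0 /\ forall i, vdot V (Fd i) = 0.
Proof.
split=> [|i]; apply: torus_ext => p; rewrite -dot_veval; first by case: (nV p).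
by rewrite -partial_veval; case: (nV p).
Qed.

Lemma normal_connectionE i :
  normal_connection f i (veval V) = veval (nproj (Vd i)).
Proof. by apply/funext => p; rewrite /normal_connection partial_veval nprojE. Qed.

(** Coefficients of the second fundamental form in the direction [V]. *)
Definition shape i j : A := vdot (vderiv (Dt i) (Fd j)) V.

Lemma second_form_dot p i j :
  dot (second_form f i j p) (veval V p) = shape i j p.
Proof.
rewrite /second_form partial_veval partial_veval nproj_dot //.
by rewrite dot_veval.
Qed.

Lemma Vd_F i : vdot (Vd i) F = 0.
Proof.
have [VF Vt] := tnormal; have := deriv_vdot (Dt i) V F.
by rewrite VF raddf0 Vt addr0.
Qed.
Lemma Vd_Fd i j : vdot (Vd i) (Fd j) = - shape i j.
Proof.
have [VF Vt] := tnormal; have := deriv_vdot (Dt i) V (Fd j).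
rewrite Vt raddf0 [X in _ + X]vdotC -/(shape i j) => /esym/eqP.
by rewrite addr_eq0 => /eqP.
Qed.
Lemma shapeC i j : shape i j = shape j i.
Proof.
rewrite /shape; congr (vdot _ V); apply/matrixP => k a.
rewrite !vderiv_entry; exact: tdC.
Qed.

Lemma connection2_dot p i j :
  dot (normal_connection f i (normal_connection f j (veval V)) p) (veval V p)
  = (td i (vdot (Vd j) V) - vdot (Vd j) (Vd i)) p
    + \sum_k \sum_l h k l p * (shape j k p * shape i l p).
Proof.
rewrite normal_connectionE {1}/normal_connection partial_veval nproj_dot //.
rewrite dot_veval.
have E1 : vdot (nproj (Vd j)) V = vdot (Vd j) V.
  by apply: torus_ext => q; rewrite -!dot_veval -nprojE nproj_dot.
have -> : vdot (vderiv (Dt i) (nproj (Vd j))) V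
    = td i (vdot (Vd j) V) - vdot (nproj (Vd j)) (Vd i).
  by rewrite -E1 [td i _](deriv_vdot (Dt i) (nproj (Vd j)) V) addrK.
rewrite !torusB -[vdot (nproj _) _ p]dot_veval -nprojE nproj_dot2 !dot_veval.
rewrite !Vd_F torus0 mul0r subr0 opprB.
rewrite [X in _ + (X - _) = _](_ : _ =
  \sum_k \sum_l h k l p * (shape j k p * shape i l p)).
  by rewrite addrCA addrC.
apply: eq_bigr => k _; apply: eq_bigr => l _; rewrite !dot_veval !Vd_Fd !torusN.
by rewrite mulrNN.
Qed.

Lemma connection_dot p k :
  dot (normal_connection f k (veval V) p) (veval V p) = vdot (Vd k) V p.
Proof. by rewrite normal_connectionE -nprojE nproj_dot // dot_veval. Qed.
Lemma christoffelE p k i j : christoffel f k i j p = 2^-1 * \sum_l h k l p *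
  (td i (g j l) p + td j (g i l) p - td l (g i j) p).
Proof.
rewrite /christoffel; congr (_ * _); apply: eq_bigr => l _; rewrite inv_metricE.
have E a b : (fun q => metric f q a b) = g a b.
  by apply/funext => q; rewrite metricE.
by rewrite !E.
Qed.

Definition shape_mix i j : A := \sum_k h i k * shape k j.
Definition shape_sqr : A := \sum_i \sum_j shape_mix i j * shape_mix j i.

Lemma simonsE p : dot (simons_operator f p (veval V p)) (veval V p) = shape_sqr p.
Proof.
rewrite simons_operatorP /endo_dot /shape_operator.
set S := \matrix_(i, j) _.
have SE i j : S i j = shape i j p by rewrite mxE second_form_dot.
have hT : (inv_metric f p)^T = inv_metric f p.
  apply/matrixP => i j; rewrite mxE !inv_metricE.
  by elim/ord2P: i; elim/ord2P: j => //; rewrite tinv01 tinv10.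
have ST : S^T = S by apply/matrixP => i j; rewrite mxE !SE shapeC.
rewrite trmx_mul hT ST -!mulmxA mulVmx ?metric_unit // mulmx1 mulmxA.
have mixE i j : (inv_metric f p *m S) i j = shape_mix i j p.
  by rewrite mxE torus_sum; apply: eq_bigr => k _; rewrite inv_metricE SE.
rewrite -mulmxA mulmxA /mxtrace /shape_sqr torus_sum; apply: eq_bigr => i _.
rewrite mxE torus_sum; apply: eq_bigr => j _.
by rewrite !mixE.
Qed.

Definition grad_sqr : A := \sum_i \sum_j h i j * vdot (Vd i) (Vd j).

Let u i : A := vdot (Vd i) V.

Let flux i : A := area * (h i o0 * u o0 + h i o1 * u o1).

Fact td_flux i (c a b x y : A) p : td i (c * (a * x + b * y)) p
  = td i c p * (a p * x p + b p * y p) + c p * (td i a p * x p + a p * td i x p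
    + (td i b p * y p + b p * td i y p)).
Proof.
by rewrite tdM tdD !tdM !(torusD, torusM).
Qed.

Lemma igramK : tgram * igram = 1.
Proof. by apply: torus_ext => p; rewrite torusM igramE mulfV. Qed.

(** Divergence form of the Laplace-Beltrami operator. *)
Lemma laplace_beltrami p : area p * \sum_i \sum_j h i j p *
    (td i (u j) p - \sum_k christoffel f k i j p * u k p)
  = (td o0 (flux o0) + td o1 (flux o1)) p.
Proof.
have [a0 aa] := areaP.
have dW i : td i tgram p = td i (g o0 o0) p * g o1 o1 p
   + g o0 o0 p * td i (g o1 o1) p - 2 * g o0 o1 p * td i (g o0 o1) p.
  have -> : td i tgram = td i (g o0 o0) * g o1 o1 + g o0 o0 * td i (g o1 o1)
   - 2 * g o0 o1 * td i (g o0 o1) by rewrite /tgram raddfB /= !tdM; ring.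
  by rewrite torusB torusD !torusM.
have da i : td i area p = area p / (2 * tgram p) * td i tgram p.
  have := torus_eq (tdM i area area) p; rewrite aa torusD !torusM => ->.
  have := torus_eq aa p; rewrite torusM => <-.
  field; exact: lt0r_neq0.
have di i : td i igram p = - (td i tgram p / tgram p ^+ 2).
  have := congr1 (fun h : A => td i h p) igramK.
  rewrite tdM -(rmorph1 tcst) td_cst torusD !torusM igramE torus0 => /eqP.
  rewrite addrC addr_eq0 => /eqP E; apply: (mulfI (tgram_neq0 p)); rewrite E.
  by field; exact: tgram_neq0.
have hp x : (igram * x) p = x p / tgram p by rewrite torusM igramE mulrC.
have dM i (x : A) : td i (igram * x) p
    = - (td i tgram p / tgram p ^+ 2) * x p + td i x p / tgram p.
  by rewrite tdM torusD !torusM di igramE [_^-1 * _]mulrC.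
have dN i (x : A) : td i (- x) p = - td i x p by rewrite (raddfN (td i)).
have h00 : h o0 o0 p = g o1 o1 p / tgram p by rewrite tinv00 hp.
have h11 : h o1 o1 p = g o0 o0 p / tgram p by rewrite tinv11 hp.
have h01 : h o0 o1 p = - (g o0 o1 p / tgram p) by rewrite tinv01 torusN hp.
have h10 : h o1 o0 p = - (g o0 o1 p / tgram p) by rewrite tinv10 torusN hp.
rewrite /flux [RHS]torusD (td_flux o0 area) (td_flux o1 area).
rewrite !sum2 !christoffelE !sum2.
rewrite h00 h01 ?h10 h11 tinv00 tinv01 ?tinv10 tinv11 (tmetricC o1 o0).
rewrite (dN o0) (dN o1) (dM o0 (g o1 o1)) (dM o0 (g o0 o1)) (dM o1 (g o0 o1)).
rewrite (dM o1 (g o0 o0)) (da o0) (da o1) (dW o0) (dW o1).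
have -> : tgram p = g o0 o0 p * g o1 o1 p - g o0 o1 p * g o0 o1 p.
  by rewrite /tgram torusB !torusM.
have := tgram_neq0 p; rewrite /tgram torusB !torusM.
move: (td o0 (g o0 o0) p) (td o0 (g o0 o1) p) (td o0 (g o1 o1) p).
move: (td o1 (g o0 o0) p) (td o1 (g o0 o1) p) (td o1 (g o1 o1) p).
move: (g o0 o0 p) (g o0 o1 p) (g o1 o1 p) (area p).
move: (td o0 (u _) p) (td o0 (u _) p) (td o1 (u _) p) (td o1 (u _) p).
move: (u _ p) (u _ p) => *.
by field; rewrite ?pnatr_eq0 //.
Qed.

(** The second derivatives of the field form a divergence; what remains is
    quadratic in its first derivatives. *)
Lemma jacobi_dot p : dot (jacobi f (veval V) p) (veval V p) * area p =
  (td o0 (flux o0) + td o1 (flux o1)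
   - area * (grad_sqr - (vdot V V + vdot V V) - (shape_sqr + shape_sqr))) p.
Proof.
rewrite /jacobi !dotDl dotZl simonsE dot_veval.
have -> : dot (normal_laplacian f (veval V) p) (veval V p)
  = (\sum_i \sum_j h i j p *
    (td i (u j) p - \sum_k christoffel f k i j p * u k p))
    - grad_sqr p + shape_sqr p.
  rewrite /normal_laplacian dot_sum22.
  transitivity (\sum_i \sum_j (h i j p *
    (td i (u j) p - \sum_k christoffel f k i j p * u k p)
    + (- (h i j p * vdot (Vd i) (Vd j) p) + h i j p *
    \sum_k \sum_l h k l p * (shape j k p * shape i l p)))).
    apply: eq_bigr => i _; apply: eq_bigr => j _.
    rewrite inv_metricE.
    rewrite dotBl.
    rewrite connection2_dot.
    have -> : dot (\sum_k christoffel f k i j p *: normal_connection f k (veval V) p)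
    (veval V p) = \sum_k christoffel f k i j p * u k p.
    rewrite dot_suml.
    by apply: eq_bigr => k _; rewrite connection_dot.
    rewrite (vdotC (Vd j) (Vd i)) torusB.
    move: (\sum_k christoffel f k i j p * u k p) (\sum_k \sum_l _) (h i j p).
    move: (td i _ p) (vdot _ _ p) => *.
    ring.
  rewrite (eq_bigr _ (fun i _ => big_split _ _ _ _ _)) big_split /= -addrA.
  congr (_ + _).
  rewrite (eq_bigr _ (fun i _ => big_split _ _ _ _ _)) big_split /=; congr (_ + _).
    rewrite /grad_sqr torus_sum -sumrN; apply: eq_bigr => i _.
    by rewrite torus_sum sumrN.
  rewrite (@trace_sqr _ (fun i j => h i j p) (fun i j => shape i j p)).
  - rewrite /shape_sqr torus_sum; apply: eq_bigr => i _; rewrite torus_sum.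
    apply: eq_bigr => j _; rewrite torusM /shape_mix !torus_sum.
    by congr (_ * _); apply: eq_bigr => k _; rewrite torusM.
  - by rewrite tinv10 tinv01.
  - by rewrite (shapeC o1 o0).
rewrite torusB -laplace_beltrami torusM !torusB !torusD.
move: (area p) (grad_sqr p) (shape_sqr p) (vdot V V p) (\sum_i _) => *; ring.
Qed.

Lemma second_variationE : second_variation f (veval V) =
  tint (area * (grad_sqr - (vdot V V + vdot V V) - (shape_sqr + shape_sqr))).
Proof.
rewrite /second_variation.
transitivity (- tint (td o0 (flux o0) + td o1 (flux o1)
   - area * (grad_sqr - (vdot V V + vdot V V) - (shape_sqr + shape_sqr)))).
  congr (- _); rewrite /tint; congr square_integral; apply/funext => p.
  by rewrite area_densityE jacobi_dot.
have tD (x y z : A) : tint (td o0 x + td o1 y - z) = - tint z.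
  by rewrite raddfB raddfD /= !tint_td addr0 sub0r.
by rewrite tD opprK.
Qed.
End SecondVariation.
Transparent partial.

(** * The second variation in isothermal coordinates *)

Section ConformalLaplacian.
Variables (A : comNzRingType) (V : lmodType A) (F : frame V) (f : V) (E : A).
Notation "<< u , v >>" := (fdot F u v).
Notation Dx := (vfv (fX F)).
Notation Dy := (vfv (fY F)).
Hypotheses (ff : <<f, f>> = 1) (xx : <<Dx f, Dx f>> = E) (yy : <<Dy f, Dy f>> = E).
Hypothesis xy : <<Dx f, Dy f>> = 0.

(** For a conformal map to the sphere, [lap f + 2 E f] is [E] times the mean
    curvature vector. *)
Lemma conformal_lap_normal : normal F f (fvlap F f + (2 * E) *: f).
Proof.
have half := @f2reg _ _ F.
have fx : <<f, Dx f>> = 0.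
  by apply: half; have := fX_dot F f f; rewrite ff vf1 [<<Dx f, f>>]fdotC.
have fy : <<f, Dy f>> = 0.
  by apply: half; have := fY_dot F f f; rewrite ff vf1 [<<Dy f, f>>]fdotC.
have fxx : <<f, Dx (Dx f)>> = - E.
  have := fX_dot F f (Dx f); rewrite fx vf0 xx => /esym/eqP.
  by rewrite addrC addr_eq0 => /eqP.
have fyy : <<f, Dy (Dy f)>> = - E.
  have := fY_dot F f (Dy f); rewrite fy vf0 yy => /esym/eqP.
  by rewrite addrC addr_eq0 => /eqP.
have x1 : <<Dx (Dx f), Dx f>> + <<Dx (Dx f), Dx f>> = fX F E.
  by rewrite -xx fX_dot [<<Dx f, _>>]fdotC.
have x2 : <<Dx (Dy f), Dy f>> + <<Dx (Dy f), Dy f>> = fX F E.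
  by rewrite -yy fX_dot [<<Dy f, _>>]fdotC.
have y1 : <<Dx (Dy f), Dx f>> + <<Dx (Dy f), Dx f>> = fY F E.
  by rewrite -xx fY_dot -fXYv [<<Dx f, _>>]fdotC.
have y2 : <<Dy (Dy f), Dy f>> + <<Dy (Dy f), Dy f>> = fY F E.
  by rewrite -yy fY_dot [<<Dy f, _>>]fdotC.
have m1 : <<Dy (Dy f), Dx f>> = - <<Dx (Dy f), Dy f>>.
  have := fY_dot F (Dy f) (Dx f); rewrite [<<Dy f, Dx f>>]fdotC xy vf0 -fXYv.
  by rewrite [<<Dy f, _>>]fdotC => /esym/eqP; rewrite addr_eq0 => /eqP.
have m2 : <<Dx (Dx f), Dy f>> = - <<Dx (Dy f), Dx f>>.
  have := fX_dot F (Dx f) (Dy f); rewrite xy vf0 [<<Dx f, _>>]fdotC => /esym/eqP.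
  by rewrite addr_eq0 => /eqP.
have eqd h k g : h + h = g -> k + k = g -> h = k :> A.
  move=> hg kg; apply: subr0_eq; apply: half.
  by rewrite addrACA -opprD hg kg subrr.
split; rewrite fvlapE !fdotDl !fdotZl.
- by rewrite [<<Dx _, f>>]fdotC [<<Dy _, f>>]fdotC fxx fyy ff; ring.
- by rewrite fx m1 (eqd _ _ _ x1 x2); ring.
- by rewrite fy m2 (eqd _ _ _ y1 y2); ring.
Qed.
End ConformalLaplacian.

Section ChartFrame.
Context {R : realType} {n : nat}.
Notation A := (torus_fun R).
Variable c : chart R.

Definition derivation_vfield (D : derivation R) : vfield 'rV[A]_n :=
  VField (raddfD D) (derivM D) (vderivD D) (vderivZ D).

Fact torus_2reg (h : A) : h + h = 0 -> h = 0.
Proof.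
move=> E; apply: torus_ext => p; have := torus_eq E p.
by rewrite torusD torus0 => H; lra.
Qed.

Definition chart_frame : frame 'rV[A]_n :=
  @Frame _ _ vdot (derivation_vfield (Dx c)) (derivation_vfield (Dy c))
    (@vdotC _ _) (@vdotDl _ _) (@vdotZl _ _) (deriv_vdot (Dx c))
    (deriv_vdot (Dy c)) (DxyC c) (@vDxyC _ c n) torus_2reg.

End ChartFrame.

Section ConformalSecondVariation.
Context {R : realType} {n : nat}.
Notation A := (torus_fun R).
Variables (c : chart R) (F : 'rV[A]_n.+1) (e : A).
Notation f := (veval F).
Hypothesis imm : immersed_torus f.
Notation o0 := (ord0 : 'I_2).
Notation o1 := (ord_max : 'I_2).
Notation fr := (chart_frame c : frame 'rV[A]_n.+1).
Notation "<< u , v >>" := (vdot u v).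
Notation vx := (vderiv (Dx c)).
Notation vy := (vderiv (Dy c)).
Notation E := (e * e).
Hypotheses (e_gt0 : forall p, 0 < e p).
Hypotheses (xx : <<vx F, vx F>> = E) (yy : <<vy F, vy F>> = E).
Hypothesis xy : <<vx F, vy F>> = 0.

Definition cx (i : 'I_2) : A := if i == ord0 then cxs c else cxt c.
Definition cy (i : 'I_2) : A := if i == ord0 then cys c else cyt c.

Lemma td_chart i h : td i h = cx i * Dx c h + cy i * Dy c h.
Proof. by elim/ord2P: i; [exact: td0E|exact: td1E]. Qed.

(** Cramer's rule: the coordinate derivatives are the coefficients of the
    differential. *)
Lemma chart_coords h P Q : (forall i, td i h = cx i * P + cy i * Q) -> Dx c h = P /\ Dy c h = Q.
Proof.
move=> H; rewrite DxE DyE !H /cx /cy /=.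
have al (T : comNzRingType) (xs xt ys yt o x y : T) : (xs * yt - xt * ys) * o = 1 ->
    o * (yt * (xs * x + ys * y) - ys * (xt * x + yt * y)) = x /\
    o * (xs * (xt * x + yt * y) - xt * (xs * x + ys * y)) = y.
  move=> h1; split.
    by transitivity ((xs * yt - xt * ys) * o * x); [ring|rewrite h1 mul1r].
  by transitivity ((xs * yt - xt * ys) * o * y); [ring|rewrite h1 mul1r].
exact: al (jacV c).
Qed.

Lemma vderiv_chart i (V : 'rV[A]_n.+1) :
  vderiv (Dt i) V = cx i *: vx V + cy i *: vy V.
Proof.
apply/matrixP => k a; rewrite !(vderiv_entry, mxE) -td_chart.
by [].
Qed.

Lemma metric_chart i j : tmetric F i j = E * (cx i * cx j + cy i * cy j).
Proof.
rewrite /tmetric !vderiv_chart !vdotE xx yy (vdotC (vy F)) xy; ring.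
Qed.

Let cdet p : 0 < jac c p. Proof. exact: chart_det. Qed.
Lemma gram_chart : tgram F = (E * jac c) * (E * jac c).
Proof. by rewrite /tgram !metric_chart /cx /cy /= /jac; ring. Qed.
Lemma area_chart : area imm = E * jac c.
Proof.
have [a0 aa] := areaP imm; apply: torus_ext => p.
have h0 : 0 < (E * jac c) p by rewrite !torusM !mulr_gt0.
have /eqP := torus_eq aa p.
rewrite gram_chart torusM [RHS]torusM -!expr2 eqrXn2 ?ltW // => /eqP.
by [].
Qed.

Let rev2 : (rev_ord (ord0 : 'I_2) = ord_max) * (rev_ord (ord_max : 'I_2) = ord0).
Proof. by split; exact: val_inj. Qed.
Lemma tinv_chart i j p : tinv imm i j p = (if i == j then
  cx (rev_ord i) p ^+ 2 + cy (rev_ord i) p ^+ 2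
   else - (cx o0 p * cx o1 p + cy o0 p * cy o1 p)) / (E p * jac c p ^+ 2).
Proof.
have E0 : E p != 0 by rewrite torusM gt_eqF // mulr_gt0.
have d0 : jac c p != 0 by rewrite gt_eqF.
have gp : tgram F p = (E p * jac c p) ^+ 2 by rewrite gram_chart torusM expr2.
have ev (a b x y u v : A) : (a * (b * (x * u + y * v))) p
  = a p * (b p * (x p * u p + y p * v p)) by [].
have hp x y : (igram imm * (E * (x * x + y * y))) p
    = (x p ^+ 2 + y p ^+ 2) / (E p * jac c p ^+ 2).
  rewrite ev igramE gp; field; exact/andP.
have hm : (- (igram imm * tmetric F o0 o1)) p
    = - (cx o0 p * cx o1 p + cy o0 p * cy o1 p) / (E p * jac c p ^+ 2).
  rewrite metric_chart torusN ev igramE gp; field; exact/andP.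
elim/ord2P: i; elim/ord2P: j => /=.
- rewrite tinv00 metric_chart hp.
  by rewrite rev2.
- by rewrite tinv01 hm.
- by rewrite tinv10 hm.
- rewrite tinv11 metric_chart hp.
  by rewrite rev2.
Qed.

Lemma grad_chart V : area imm * grad_sqr imm V
  = jac c * (<<vx V, vx V>> + <<vy V, vy V>>).
Proof.
apply: torus_ext => p.
have E0 : E p != 0 by rewrite torusM gt_eqF // mulr_gt0.
have d0 : jac c p != 0 by rewrite gt_eqF.
have Vij i j : vdot (vderiv (Dt i) V) (vderiv (Dt j) V) p =
  cx i p * cx j p * <<vx V, vx V>> p + (cx i p * cy j p + cy i p * cx j p) *
   <<vx V, vy V>> p + cy i p * cy j p * <<vy V, vy V>> p.
  rewrite !vderiv_chart !vdotE (vdotC (vy V) (vx V)).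
  move: (vdot _ _) (vdot _ _) (vdot _ _) (cx i) (cx j) (cy i) (cy j) => *.
  by rewrite !(torusD, torusM); ring.
have gE : grad_sqr imm V p = \sum_i \sum_j tinv imm i j p *
    vdot (vderiv (Dt i) V) (vderiv (Dt j) V) p.
  rewrite /grad_sqr torus_sum; apply: eq_bigr => i _; rewrite torus_sum.
  by apply: eq_bigr => j _; rewrite torusM.
rewrite area_chart [LHS]torusM (torusM E (jac c)) [RHS]torusM torusD gE sum22.
rewrite !tinv_chart !Vij.
rewrite !rev2.
have : jac c p = cx o0 p * cy o1 p - cx o1 p * cy o0 p by [].
move: d0 E0; move: (jac c p) (E p) (<<_, _>> p) (<<_, _>> p) (<<_, _>> p).
move: (cx _ p) (cx _ p) (cy _ p) (cy _ p) => a b d g m k u v w m0 k0 mE /=.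
by rewrite mE; rewrite mE in m0; field; rewrite m0 k0.
Qed.

Section Normal.
Variable V : 'rV[A]_n.+1.
Hypothesis nV : normal fr F V.

Lemma normal_veval p : normal_at f p (veval V p).
Proof.
have [Vf Vx Vy] := nV; split=> [|i]; rewrite ?partial_veval dot_veval.
  by rewrite -[vdot V F]/(fdot fr V F) Vf.
rewrite vderiv_chart !vdotDr !vdotZr -[vdot V (vx F)]/(fdot fr V (vx F)).
by rewrite -[vdot V (vy F)]/(fdot fr V (vy F)) Vx Vy !mulr0 addr0.
Qed.

Notation a := <<vx (vx F), V>>.
Notation b := <<vx (vy F), V>>.
Notation d := <<vy (vy F), V>>.

Lemma shape_chart i j : shape F V i j
  = cx i * cx j * a + (cx i * cy j + cy i * cx j) * b + cy i * cy j * d.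
Proof.
have [_ Vx Vy] := nV.
have Vx' : <<vx F, V>> = 0 by rewrite vdotC.
have Vy' : <<vy F, V>> = 0 by rewrite vdotC.
have H : <<vy (vx F), V>> = b by rewrite vDxyC.
rewrite /shape (vderiv_chart j) vderivD !vderivZ !vdotDl !vdotZl Vx' Vy'.
rewrite !(vderiv_chart i) !vdotDl !vdotZl H.
move: (vdot _ _) (vdot _ _) (vdot _ _) (cx _) (cy _) (cx _) (cy _) => *.
ring.
Qed.

Lemma trace_chart p : \sum_i \sum_j tinv imm i j p * shape F V i j p
  = (a p + d p) / E p.
Proof.
have E0 : E p != 0 by rewrite torusM gt_eqF // mulr_gt0.
have d0 : jac c p != 0 by rewrite gt_eqF.
have Sij i j : shape F V i j p = cx i p * cx j p * a p + (cx i p * cy j p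
   + cy i p * cx j p) * b p + cy i p * cy j p * d p by rewrite shape_chart.
rewrite sum22 !tinv_chart !Sij.
rewrite !rev2.
have : jac c p = cx o0 p * cy o1 p - cx o1 p * cy o0 p by [].
move: d0 E0; move: (jac c p) (E p) (<<_, _>> p) (<<_, _>> p) (<<_, _>> p).
move: (cx _ p) (cx _ p) (cy _ p) (cy _ p) => ? ? ? ? m ? ? ? ? m0 k0 mE /=.
by rewrite mE; rewrite mE in m0; field; rewrite m0 k0.
Qed.

Lemma sqr_chart p : area imm p * shape_sqr imm V p
  = jac c p * ((a p ^+ 2 + 2 * b p ^+ 2 + d p ^+ 2) / E p).
Proof.
have E0 : E p != 0 by rewrite torusM gt_eqF // mulr_gt0.
have d0 : jac c p != 0 by rewrite gt_eqF.
have Sij i j : shape F V i j p = cx i p * cx j p * a p + (cx i p * cy j p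
   + cy i p * cx j p) * b p + cy i p * cy j p * d p by rewrite shape_chart.
rewrite area_chart (torusM E (jac c)).
have -> : shape_sqr imm V p = \sum_i \sum_j
   (\sum_k tinv imm i k p * shape F V k j p) * (\sum_k tinv imm j k p * shape F V k i p).
  rewrite /shape_sqr torus_sum; apply: eq_bigr => i _; rewrite torus_sum.
  apply: eq_bigr => j _; rewrite torusM /shape_mix !torus_sum.
  by congr (_ * _); apply: eq_bigr => k _; rewrite torusM.
rewrite sum22 !sum2 !tinv_chart !Sij.
rewrite !rev2.
have : jac c p = cx o0 p * cy o1 p - cx o1 p * cy o0 p by [].
move: d0 E0; move: (jac c p) (E p) (<<_, _>> p) (<<_, _>> p) (<<_, _>> p).
move: (cx _ p) (cx _ p) (cy _ p) (cy _ p) => ? ? ? ? m ? ? ? ? m0 k0 mE /=.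
by rewrite mE; rewrite mE in m0; field; rewrite m0 k0.
Qed.
End Normal.

Lemma normal_of_section V : normal_section f (veval V) -> normal fr F V.
Proof.
move=> [_ _ nV]; have [Vf Vt] := tnormal nV.
have Vi i : cx i * <<V, vx F>> + cy i * <<V, vy F>> = 0.
  by rewrite -(Vt i) vderiv_chart vdotDr !vdotZr.
split=> //=; rewrite -[vdot _ _]mul1r -(jacV c) mulrAC.
  have -> : jac c * <<V, vx F>> = cy o1 * (cx o0 * <<V, vx F>> + cy o0 * <<V, vy F>>)
    - cy o0 * (cx o1 * <<V, vx F>> + cy o1 * <<V, vy F>>).
    by rewrite /cx /cy /= /jac; ring.
  by rewrite !Vi !mulr0 subr0 mul0r.
have -> : jac c * <<V, vy F>> = cx o0 * (cx o1 * <<V, vx F>> + cy o1 * <<V, vy F>>)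
   - cx o1 * (cx o0 * <<V, vx F>> + cy o0 * <<V, vy F>>).
  by rewrite /cx /cy /= /jac; ring.
by rewrite !Vi !mulr0 subr0 mul0r.
Qed.

Lemma section_of_normal V : normal fr F V -> normal_section f (veval V).
Proof.
move=> nV; split; [exact: smooth_veval|exact: periodic_veval|].
exact: normal_veval.
Qed.

Let F_unit : <<F, F>> = 1.
Proof.
apply: torus_ext => p; rewrite -dot_veval torus1.
by have [_ _ + _] := imm; exact.
Qed.

(** [lap f + 2 E f] is normal by conformality, and its product with a normal
    field is [E] times that of the mean curvature. *)
Lemma minimal_conformal ie : e * ie = 1 -> minimal f ->
  conformal_minimal fr F e ie.
Proof.
move=> eie minf; split=> //.
pose V := fvlap fr F + (2 * E) *: F.
have nV : normal fr F V by apply: conformal_lap_normal.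
suff V0 : V = 0 by rewrite scaleNr; apply/eqP; rewrite -addr_eq0 -/V V0.
apply: vdot_eq0.
have aV : <<vx (vx F), V>> + <<vy (vy F), V>> = 0.
  apply: torus_ext => p; have := congr1 (fun z => dot z (veval V p)) (minf p).
  rewrite /mean_curvature dot0l dot_sum22.
  have -> : \sum_i \sum_j inv_metric f p i j * dot (second_form f i j p) (veval V p)
    = \sum_i \sum_j tinv imm i j p * shape F V i j p.
    apply: eq_bigr => i _; apply: eq_bigr => j _.
    by rewrite inv_metricE (second_form_dot (normal_veval nV)).
  rewrite trace_chart // => /eqP; rewrite mulf_eq0 invr_eq0 => /orP[/eqP//|].
  by rewrite torusM mulf_eq0 orbb gt_eqF.
have [VF _ _] := nV.
rewrite {1}/V vdotDl vdotZl -[vdot F V]vdotC -[vdot V F]/(fdot fr V F) VF mulr0.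
by rewrite addr0 fvlapE vdotDl.
Qed.

Lemma second_variation_conformal ie V : conformal_minimal fr F e ie ->
  normal fr F V -> second_variation f (veval V) =
  cint c (vdens fr F e ie V V - 2 * E * <<V, V>>).
Proof.
move=> cm nV.
have nVe := normal_veval nV.
rewrite (second_variationE imm nVe) /cint; congr tint.
rewrite mulrBr mulrBr grad_chart area_chart.
have -> : E * jac c * (shape_sqr imm V + shape_sqr imm V) = jac c *
   (4 * (ie * ie * (fdot fr (hopf1 fr F e ie) V * fdot fr (hopf1 fr F e ie) V
    + fdot fr (hopf2 fr F e ie) V * fdot fr (hopf2 fr F e ie) V))).
  have -> : fdot fr (hopf1 fr F e ie) V = <<vx (vx F), V>>.
    by rewrite -(fxx_normal e ie nV).
  have -> : fdot fr (hopf2 fr F e ie) V = <<vx (vy F), V>>.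
    by rewrite -(fxy_normal e ie nV).
  have dE : <<vy (vy F), V>> = - <<vx (vx F), V>>.
    have := fyy_normal cm nV; rewrite -(fxx_normal e ie nV).
    by move=> H; exact: H.
  apply: torus_ext => p; have := sqr_chart nV p; rewrite area_chart.
  have iE : (ie * ie) p = (E p)^-1.
    have := torus_eq (cm_inv cm) p; rewrite torusM torus1.
    have := e_gt0 p; rewrite !torusM; move: (e p) (ie p) => x y x0 xy1.
    have -> : y = x^-1 by rewrite -[RHS]mulr1 -xy1 mulKf // gt_eqF.
    by rewrite invfM.
  rewrite dE torusN; move: (vdot _ _) (vdot _ _) => u v H.
  rewrite torusM torusD mulrDr H [RHS]torusM [in RHS]torusM (torusM (ie * ie)).
  rewrite iE torusD !torusM (_ : (4 : A) p = 4) //.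
  rewrite (_ : (v * v + u * u) p = v p * v p + u p * u p) //.
  move: ((_ * _)^-1) => k; ring.
rewrite /vdens -[vdot (vx V) _]/(fdot fr (vfv (fX fr) V) (vfv (fX fr) V)).
rewrite -[vdot (vy V) _]/(fdot fr (vfv (fY fr) V) (vfv (fY fr) V)).
move: (fdot fr _ _) (fdot fr _ _) (fdot fr _ _) (fdot fr _ _) (vdot V V) (jac c).
by move=> *; ring.
Qed.
End ConformalSecondVariation.

(** * Spaces of negative fields *)

Section HopfForms.
Variables (A : comNzRingType) (V : lmodType A) (F : frame V) (f : V) (e ie : A).
Notation vdens := (vdens F f e ie).
Notation perp := (perp F f ie).

Lemma vdensZ_const h U W :
  fX F h = 0 -> fY F h = 0 -> vdens (h *: U) W = h * vdens U W.
Proof. by move=> hx hy; rewrite /vdens !vfvZ hx hy !scale0r !add0r !fdotE; ring. Qed.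
Lemma perp_linear h a b : perp (h *: a + b) = h *: perp a + perp b.
Proof.
have cmb (t x y z : V) (t' x' y' z' : V) : h *: t + t' - (h *: x + x') - (h *: y + y')
   - (h *: z + z') = h *: (t - x - y - z) + (t' - x' - y' - z').
  rewrite !scalerBr.
  by rewrite [RHS]addrACA -opprD [in RHS]addrACA -opprD [h *: t - _ + _]addrACA -opprD.
rewrite !perpE -cmb /height /slope1 /slope2 !fdotDl !fdotZl !scalerA -!scalerDl.
by rewrite !mulrDr ![h * (ie * _ * _)]mulrCA.
Qed.
End HopfForms.

Section NegativeFamilies.
Variables (R : realType) (A : comNzRingType) (V : lmodType A) (F : frame V).
Variables (f : V) (e ie : A) (kap : {rmorphism R -> A}) (I : A -> R).
Hypothesis cm : conformal_minimal F f e ie.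
Hypotheses (kx : forall d, fX F (kap d) = 0) (ky : forall d, fY F (kap d) = 0).
Hypotheses (ID : forall h k, I (h + k) = I h + I k) (IZ : forall d h, I (kap d * h) = d * I h).
Hypotheses (Ix : forall h, I (fX F h) = 0) (Iy : forall h, I (fY F h) = 0).
Notation "<< u , v >>" := (fdot F u v).
Notation P := (hopf1 F f e ie).
Notation N := (hopf2 F f e ie).
Notation E := (e * e).
Notation iE := (ie * ie).
Notation normal := (normal F f).
Notation vdens := (vdens F f e ie).

Variables (cst : 'rV[R]_5 -> V).
Hypotheses (cstD : forall a b, cst (a + b) = cst a + cst b).
Hypotheses (cstZ : forall d a, cst (d *: a) = kap d *: cst a).
Hypotheses (cx : forall a, vfv (fX F) (cst a) = 0) (cy : forall a, vfv (fY F) (cst a) = 0).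
Notation perp a := (perp F f ie (cst a)).
Hypothesis I_E : forall W, W <> 0 -> 0 < I (E * <<W, W>>).
Hypothesis I_iE : forall W, W <> 0 -> 0 < I (iE * <<W, W>>).

Lemma I0 : I 0 = 0. Proof. by have := ID 0 0; rewrite addr0 => H; lra. Qed.
Lemma IN h : I (- h) = - I h.
Proof. by apply/eqP; rewrite -addr_eq0 -ID addNr I0. Qed.
Lemma IB h k : I (h - k) = I h - I k. Proof. by rewrite ID IN. Qed.
Lemma I2 h : I (2 * h) = 2 * I h. Proof. by rewrite !mulr2n mulrDl mul1r ID; ring. Qed.

(** The second variation is [hform V V - 2 I (E |V|^2)], where the subtracted
    term is positive: [hform] decides. *)
Definition hform U W := I (vdens U W).
Definition qform U W := hform U W - 2 * I (E * <<U, W>>).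

Lemma hformC U W : hform U W = hform W U.
Proof. by rewrite /hform vdensC. Qed.
Lemma hformDl U U' W : hform (U + U') W = hform U W + hform U' W.
Proof. by rewrite /hform vdensDl ID. Qed.
Lemma hformZl d U W : hform (kap d *: U) W = d * hform U W.
Proof. by rewrite /hform vdensZ_const. Qed.
Lemma hform0l W : hform 0 W = 0.
Proof. by have := hformZl 0 0 W; rewrite scaler0 mul0r. Qed.
Lemma hformDr U U' W : hform W (U + U') = hform W U + hform W U'.
Proof. by rewrite ![hform W _]hformC hformDl. Qed.
Lemma hformZr d U W : hform W (kap d *: U) = d * hform W U.
Proof. by rewrite ![hform W _]hformC hformZl. Qed.
Lemma qform_lt0 U : hform U U <= 0 -> U <> 0 -> qform U U < 0.
Proof. by move=> h0 /I_E U0; rewrite /qform; lra. Qed.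
Lemma qformDZ d U W : qform (U + kap d *: W) (U + kap d *: W)
  = qform U U + 2 * d * qform U W + d ^+ 2 * qform W W.
Proof.
rewrite /qform !hformDl !hformDr !hformZl !hformZr [hform W _]hformC.
have -> : E * <<U + kap d *: W, U + kap d *: W>>
   = E * <<U, U>> + kap d * (2 * (E * <<U, W>>)) + kap d * (kap d * (E * <<W, W>>)).
  rewrite !fdotDl !fdotDr !fdotZl !fdotZr [<<W, U>>]fdotC; ring.
by rewrite !ID !IZ I2; ring.
Qed.

Definition linear_family n (L : 'rV[R]_n -> V) :=
  [/\ forall u v, L (u + v) = L u + L v, forall d v, L (d *: v) = kap d *: L v &
    forall v, normal (L v)].

Definition extend n (L : 'rV[R]_n -> V) X (v : 'rV[R]_(n + 1)) : V :=
  L (lsubmx v) + kap (rsubmx v ord0 ord0) *: X.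

Lemma extend_family n (L : 'rV[R]_n -> V) X :
  linear_family L -> normal X -> linear_family (extend L X).
Proof.
move=> [LD LZ nL] nX; split=> [u v|d v|v].
- by rewrite /extend !linearD /= LD mxE raddfD scalerDl addrACA.
- by rewrite /extend !linearZ /= LZ mxE rmorphM scalerDr scalerA.
- by apply: normalD; [|exact: normalZ].
Qed.

Lemma row1_eq0 n (v : 'rV[R]_(n + 1)) :
  lsubmx v = 0 -> rsubmx v ord0 ord0 = 0 -> v = 0.
Proof.
move=> l0 r0; rewrite -[v]hsubmxK l0.
have -> : rsubmx v = 0 by apply/matrixP => i j; rewrite !ord1 r0 mxE.
exact: row_mx0.
Qed.

Lemma family0 n (L : 'rV[R]_n -> V) : linear_family L -> L 0 = 0.
Proof. by move=> [_ LZ _]; rewrite -(scale0r (0 : 'rV[R]_n)) LZ raddf0 scale0r. Qed.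

Definition negative_family n := exists2 L : 'rV[R]_n -> V, linear_family L &
  forall v, v <> 0 -> qform (L v) (L v) < 0.

Lemma normal_perpc a : normal (perp a). Proof. exact: (normal_perp cm). Qed.
Lemma perp_family : linear_family (fun a => perp a).
Proof.
split=> [a b|d a|a]; last exact: normal_perpc.
  by have := perp_linear F f ie 1 (cst a) (cst b); rewrite !scale1r cstD.
have P0 : perp 0 = 0.
  have c0 : cst 0 = 0 by rewrite -(scale0r (0 : 'rV[R]_5)) cstZ raddf0 scale0r.
  have := perp_linear F f ie 1 0 0; rewrite !scale1r addr0 c0 => /esym/eqP.
  by rewrite -subr_eq0 addrK => /eqP.
have c0 : cst 0 = 0 by rewrite -(scale0r (0 : 'rV[R]_5)) cstZ raddf0 scale0r.
by have := perp_linear F f ie (kap d) (cst a) 0; rewrite -c0 P0 c0 !addr0 cstZ.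
Qed.

Lemma hform_perp a W : normal W -> hform (perp a) W = 0.
Proof. by move=> nW; rewrite /hform (vdens_perp cm (cx _) (cy _) nW) ID Ix Iy addr0. Qed.

Variable k : R.
Hypotheses (k_ge0 : 0 <= k) (PN : <<P, N>> = 0) (PPNN : <<P, P>> - <<N, N>> = kap k).
Hypotheses (P_neq0 : P <> 0) (perp_inj : forall a, perp a = 0 -> a = 0).

Let nP : normal P. Proof. exact: normal_hopf1. Qed.
Let nN : normal N. Proof. exact: normal_hopf2. Qed.
Lemma hform_hopf W : normal W -> hform P W = - (2 * k) * I (iE * <<P, W>>) /\
  hform N W = 2 * k * I (iE * <<N, W>>).
Proof.
move=> nW; have [h1 h2] := vdens_hopf cm nW.
rewrite /hform h1 h2 PPNN PN !mulr0 !mul0r addr0 subr0.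
by rewrite IB !ID !Ix !Iy !I2 !(mulrCA iE) !IZ; split; ring.
Qed.

Definition family6 := extend (fun a => perp a) P.
Lemma linear_family6 : linear_family family6.
Proof. exact: extend_family perp_family nP. Qed.
Let nF6 v : normal (family6 v). Proof. by have [_ _] := linear_family6. Qed.
Lemma hform_family6 v W : normal W -> hform (family6 v) W
  = rsubmx v ord0 ord0 * hform P W.
Proof. by move=> nW; rewrite hformDl (hform_perp _ nW) add0r hformZl. Qed.

Let hPP : hform P P = - (2 * k) * I (iE * <<P, P>>).
Proof. by have [-> _] := hform_hopf nP. Qed.
Lemma hform_family6_le0 v : hform (family6 v) (family6 v) <= 0.
Proof.
rewrite (hform_family6 _ (nF6 v)) hformC (hform_family6 _ nP) mulrA -expr2 hPP.
have := sqr_ge0 (rsubmx v ord0 ord0); move: (_ ^+ 2) (I_iE P_neq0) => x y0 x0.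
by rewrite mulNr mulrN oppr_le0 mulr_ge0 // mulr_ge0 ?mulr_ge0 // ltW.
Qed.

Lemma hform_P_eq0 v : 0 < k -> hform (family6 v) P = 0 -> rsubmx v ord0 ord0 = 0.
Proof.
move=> k0; rewrite (hform_family6 _ nP) hPP => /eqP.
rewrite mulf_eq0 => /orP[/eqP //|].
by rewrite mulf_eq0 oppr_eq0 mulf_eq0 pnatr_eq0 /= !gt_eqF // I_iE.
Qed.

Lemma family6_eq0 v : 0 < k -> family6 v = 0 -> v = 0.
Proof.
move=> k0 v0; have r0 : rsubmx v ord0 ord0 = 0.
  by apply: (hform_P_eq0 k0); rewrite v0 hform0l.
apply: row1_eq0 => //; apply: perp_inj; move: v0.
by rewrite /family6 /extend r0 raddf0 scale0r addr0.
Qed.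

Lemma family6_neg v : 0 < k -> v <> 0 -> qform (family6 v) (family6 v) < 0.
Proof.
move=> k0 v0; apply: qform_lt0; first exact: hform_family6_le0.
by move/(family6_eq0 k0).
Qed.

Lemma negative6 : 0 < k -> negative_family 6.
Proof. by move=> k0; exists family6 => [|v]; [exact: linear_family6|exact: family6_neg]. Qed.

(** An orthogonal sum of negative definite spaces is negative definite. *)
Lemma negative7_of X : 0 < k -> normal X -> (forall v, qform (family6 v) X = 0) ->
  qform X X < 0 -> negative_family 7.
Proof.
move=> k0 nX orth X0; suff H (v : 'rV[R]_(5 + 1 + 1)) : v <> 0 ->
    qform (extend family6 X v) (extend family6 X v) < 0.
  by exists (extend family6 X) => //; exact: extend_family linear_family6 nX.
have qE u d : qform (family6 u + kap d *: X) (family6 u + kap d *: X)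
    = qform (family6 u) (family6 u) + d ^+ 2 * qform X X.
  by rewrite qformDZ orth mulr0 addr0.
move=> v0; rewrite /extend qE.
have [r0|r0] := eqVneq (rsubmx v ord0 ord0) 0.
  rewrite r0 expr0n mul0r addr0; apply: (family6_neg k0) => l0; apply: v0.
  exact: row1_eq0 r0.
have r1 : 0 < rsubmx v ord0 ord0 ^+ 2 by rewrite lt_def sqrf_eq0 r0 sqr_ge0.
have r2 : rsubmx v ord0 ord0 ^+ 2 * qform X X < 0 by rewrite pmulr_rlt0.
have [->|l0] := pselect (lsubmx v = 0); last by have := family6_neg k0 l0; lra.
rewrite (family0 linear_family6) {1}/qform hform0l fdot0l mulr0 I0 mulr0 subr0.
by rewrite add0r.
Qed.

(** A field [K] in the kernel of [hform] is negative for [qform] together with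
    the family. The dimension can only fail to grow because of a linear
    relation, in which the coefficient of [P] vanishes since [hform P P < 0].
    *)
Lemma negative7_kernel K : 0 < k -> normal K -> (forall W, normal W -> hform K W = 0) ->
  negative_family 7 \/ exists a, K = perp a.
Proof.
move=> k0 nK Kker; have lin := extend_family linear_family6 nK.
have [_ _ nL] := lin; have nL' := nL : forall v : 'rV_(6 + 1), normal (extend family6 K v).
have hK v W : normal W -> hform (extend family6 K v) W = hform (family6 (lsubmx v)) W.
  by move=> nW; rewrite hformDl hformZl (Kker _ nW) mulr0 addr0.
have [inj|] := pselect (forall v, v <> 0 -> extend family6 K v <> 0).
  left; exists (extend family6 K) => // v v0; apply: qform_lt0; last exact: inj.
  by rewrite (hK _ _ (nL' v)) hformC (hK _ _ (nF6 _)); exact: hform_family6_le0.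
move=> /existsNP[v /not_implyP[v0 /contrapT L0]]; right.
have b0 : rsubmx (lsubmx v) ord0 ord0 = 0.
  by apply: (hform_P_eq0 k0); rewrite -(hK _ _ nP) L0 hform0l.
move: L0; rewrite {1}/extend; set r := rsubmx v ord0 ord0 => L0.
have r0 : r != 0.
  apply/eqP => r0; apply: v0; apply: row1_eq0 => //.
  by apply: (family6_eq0 k0); move: L0; rewrite r0 raddf0 scale0r addr0.
have [_ pZ _] := perp_family.
exists (- r^-1 *: lsubmx (lsubmx v)); rewrite pZ.
move: L0; rewrite /family6 /extend b0 raddf0 scale0r addr0 => /eqP.
rewrite addr_eq0 => /eqP ->; rewrite scalerN -scaleNr scalerA -rmorphN -rmorphM opprK.
by rewrite mulVf // rmorph1 scale1r.
Qed.

(** When [k = 0] both [P] and [N] are in the kernel of [hform]. They are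
    independent of the normal parts of constants, because [<<a, P>> / E] and
    [<<a, N>> / E] are divergences. *)
Lemma negative7_superminimal : k = 0 -> negative_family 7.
Proof.
move=> k0; have lin := extend_family linear_family6 nN; have [_ _ nL] := lin.
have NN : <<N, N>> = <<P, P>>.
  by apply/esym/eqP; rewrite -subr_eq0 PPNN k0 raddf0.
have hk W : normal W -> hform P W = 0 /\ hform N W = 0.
  by move=> /hform_hopf[-> ->]; rewrite k0 mulr0 oppr0 !mul0r.
suff H (v : 'rV[R]_(5 + 1 + 1)) : v <> 0 ->
    qform (extend family6 N v) (extend family6 N v) < 0 by exists (extend family6 N).
move=> v0; apply: qform_lt0.
  have [h1 h2] := hk _ (nL v).
  by rewrite {1}/extend hformDl hformZl (hform_family6 _ (nL v)) h1 h2 !mulr0 addr0.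
move=> L0; apply: v0; move: L0; rewrite /family6 /extend.
set a := lsubmx (lsubmx v); set b1 := rsubmx (lsubmx v) ord0 ord0.
set b2 := rsubmx v ord0 ord0 => L0.
have aE : perp a = - (kap b1 *: P + kap b2 *: N).
  by apply/eqP; rewrite -addr_eq0 addrA L0.
have [d1 d2] := hopf_div cm (cx a) (cy a).
have z1 : I (iE * <<cst a, P>>) = 0.
  have := congr1 I d1; rewrite IB Ix Iy subr0 I2 => /esym/eqP.
  by rewrite mulf_eq0 pnatr_eq0 => /eqP.
have z2 : I (iE * <<cst a, N>>) = 0.
  have := congr1 I d2; rewrite ID Ix Iy addr0 I2 => /esym/eqP.
  by rewrite mulf_eq0 pnatr_eq0 => /eqP.
have a0 : perp a = 0.
  apply: contrapT => /I_iE; rewrite {2}aE fdotNr fdotDr !fdotZr.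
  rewrite (perp_normal ie (cst a) nP) (perp_normal ie (cst a) nN).
  have -> : iE * - (kap b1 * <<cst a, P>> + kap b2 * <<cst a, N>>)
    = - (kap b1 * (iE * <<cst a, P>>)) - kap b2 * (iE * <<cst a, N>>) by ring.
  by rewrite IB IN !IZ z1 z2 !mulr0 subr0 oppr0 ltxx.
have bb : b1 ^+ 2 + b2 ^+ 2 = 0.
  have : <<perp a, perp a>> = kap (b1 ^+ 2 + b2 ^+ 2) * <<P, P>>.
    rewrite aE fdotNl fdotNr opprK !fdotDl !fdotDr !fdotZl !fdotZr [<<N, P>>]fdotC PN NN.
    by rewrite !expr2 (rmorphD kap) !(rmorphM kap); ring.
  rewrite a0 fdot0l => /(congr1 (fun h => I (iE * h))); rewrite mulr0 I0 mulrCA IZ.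
  by move=> /esym/eqP; rewrite mulf_eq0 => /orP[/eqP //|]; rewrite gt_eqF // I_iE.
move/eqP: bb; rewrite paddr_eq0 ?sqr_ge0 // !sqrf_eq0 => /andP[/eqP b10 /eqP b20].
by apply: row1_eq0 => //; apply: row1_eq0 => //; exact: perp_inj.
Qed.
End NegativeFamilies.

Section IndexBounds.
Context {R : realType}.
Notation A := (torus_fun R).

Lemma vcstD n (a b : 'rV[R]_n) : vcst (a + b) = vcst a + vcst b.
Proof. by apply/matrixP => i j; rewrite !mxE raddfD. Qed.
Lemma vcstZ n d (a : 'rV[R]_n) : vcst (d *: a) = tcst d *: vcst a.
Proof. by apply/matrixP => i j; rewrite !mxE rmorphM. Qed.
Lemma vcst0 n : vcst (0 : 'rV[R]_n) = 0.
Proof. by apply/matrixP => i j; rewrite !mxE raddf0. Qed.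
Lemma vcst_inj n (a b : 'rV[R]_n) : vcst a = vcst b -> a = b.
Proof.
move/matrixP => E; apply/matrixP => i j; have := torus_eq (E i j) (0, 0).
by rewrite !mxE !tcstE.
Qed.

Variables (c : chart R) (F : 'rV[A]_5) (e ie : A).
(* A variable, so that unification does not unfold the frame. *)
Variable fr : frame 'rV[A]_5.
Hypothesis frE : fr = chart_frame c.
Notation f := (veval F).
Hypothesis imm : immersed_torus f.
Hypothesis e_gt0 : forall p, 0 < e p.
Hypothesis cm : conformal_minimal fr F e ie.
Notation "<< u , v >>" := (fdot fr u v).
Notation P := (hopf1 fr F e ie).
Notation N := (hopf2 fr F e ie).
Notation E := (e * e).
Notation iE := (ie * ie).
Notation normal := (normal fr F).
Notation perp a := (perp fr F ie (vcst a)).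
Notation vdens := (vdens fr F e ie).

Lemma tcstM (x y : R) : tcst (x * y) = tcst x * tcst y :> A.
Proof. exact: rmorphM. Qed.
Lemma tcst1 : tcst 1 = 1 :> A.
Proof. exact: rmorph1. Qed.
Lemma natA n : (n%:R : A) = tcst n%:R. Proof. by rewrite rmorph_nat. Qed.
Lemma fr_cstx a : vfv (fX fr) (vcst a) = 0.
Proof. by rewrite frE; exact: vderiv_cst. Qed.
Lemma fr_csty a : vfv (fY fr) (vcst a) = 0.
Proof. by rewrite frE; exact: vderiv_cst. Qed.
Lemma fX_cst d : fX fr (tcst d) = 0. Proof. by rewrite frE; exact: deriv_cst. Qed.
Lemma fY_cst d : fY fr (tcst d) = 0. Proof. by rewrite frE; exact: deriv_cst. Qed.
Lemma fdot_ge0 (V : 'rV[A]_5) p : 0 <= <<V, V>> p.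
Proof. by rewrite frE; exact: vdot_ge0. Qed.
Lemma fdot_eq0 (V : 'rV[A]_5) : <<V, V>> = 0 -> V = 0.
Proof. by rewrite frE; exact: vdot_eq0. Qed.
Lemma cint_fX h : cint c (fX fr h) = 0. Proof. by rewrite frE; exact: cint_Dx. Qed.
Lemma cint_fY h : cint c (fY fr h) = 0. Proof. by rewrite frE; exact: cint_Dy. Qed.

Notation kap := (@tcst R : {rmorphism R -> A}).
Notation qform := (qform fr F e ie (cint c)).

Let E_reg h : E * h = 0 -> h = 0.
Proof. by move=> H; rewrite -[h](iEK cm) H mulr0. Qed.
Let iE_reg h : iE * h = 0 -> h = 0.
Proof. by move=> H; rewrite -[h](iEK cm) mulrCA H mulr0. Qed.
Lemma cint_Esqr_gt0 V : V <> 0 -> 0 < cint c (E * <<V, V>>).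
Proof.
move=> V0; apply: cint_gt0 => [p|H].
  by rewrite !torusM -expr2 mulr_ge0 ?sqr_ge0 // fdot_ge0.
by apply/V0/fdot_eq0/E_reg.
Qed.
Lemma cint_iEsqr_gt0 V : V <> 0 -> 0 < cint c (iE * <<V, V>>).
Proof.
move=> V0; apply: cint_gt0 => [p|H].
  by rewrite !torusM -expr2 mulr_ge0 ?sqr_ge0 // fdot_ge0.
by apply/V0/fdot_eq0/iE_reg.
Qed.

Lemma cintD h k : cint c (h + k) = cint c h + cint c k.
Proof. exact: raddfD. Qed.
Lemma second_variation_qform V : normal V -> second_variation f (veval V) = qform V V.
Proof.
rewrite /qform /hform; move: cm; rewrite frE => cm' nV.
rewrite (second_variation_conformal imm e_gt0 (cm_xx cm') (cm_yy cm') (cm_xy cm') cm' nV).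
by rewrite raddfB /= -mulrA natA cintZ.
Qed.

(** Definiteness makes the values of the family on a basis independent. *)
Lemma index_ge_family k : negative_family fr F e ie kap (cint c) k ->
  ((k%:R)%:E <= morse_index f)%E.
Proof.
move=> [L [LD LZ nL] Lneg]; have nv V : normal V -> normal_section f (veval V).
  by rewrite frE; exact: section_of_normal.
have L0 : L 0 = 0 by rewrite -(scale0r (0 : 'rV[R]_k)) LZ raddf0 scale0r.
have LE b : \sum_(i < k) b i *: veval (L (delta_mx ord0 i))
    = veval (L (\row_i b i)).
  have -> : L (\row_i b i) = \sum_i tcst (b i) *: L (delta_mx ord0 i).
    rewrite [\row_i b i]row_sum_delta.
    rewrite (big_morph L LD L0); apply: eq_bigr => i _; by rewrite LZ mxE.
  apply/funext => p; rewrite fct_sumE veval_sum; apply: eq_bigr => i _.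
  by rewrite vevalZ.
have Lr V : veval V = 0 -> V = 0.
  move=> V0; apply: veval_inj => p; rewrite V0.
  by apply/matrixP => i j; rewrite !mxE.
apply: ereal_sup_ubound; exists k => //; exists (fun i => veval (L (delta_mx ord0 i))).
split=> [i|b|b]; first exact/nv/nL.
- rewrite LE => /Lr b0 i; suff : (\row_i b i) = 0 by move/rowP/(_ i); rewrite !mxE.
  apply: contrapT => /Lneg; rewrite b0 /qform.
  have -> : hform fr F e ie (cint c) 0 0 = 0.
    by apply: hform0l; first [exact: fX_cst|exact: fY_cst|exact: cintD|exact: cintZ].
  by rewrite fdot0l mulr0 raddf0 mulr0 subr0 ltxx.
- rewrite LE => b0; rewrite second_variation_qform //; apply: Lneg => v0.
  by apply: b0; rewrite v0 L0; apply/funext => p; apply/matrixP => i j; rewrite !mxE.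
Qed.

Variable k : R.
Hypotheses (k_ge0 : 0 <= k) (PN : <<P, N>> = 0) (PPNN : <<P, P>> - <<N, N>> = tcst k).

Let nP : normal P. Proof. exact: normal_hopf1. Qed.
Let nN : normal N. Proof. exact: normal_hopf2. Qed.

(** Gauss-Bonnet: the integral of [(|P|^2 + |N|^2) / E] equals that of [E]. *)
Lemma hopf1_neq0 : P <> 0.
Proof.
move=> P0; have NN : <<N, N>> = - tcst k by rewrite -PPNN P0 fdot0l sub0r opprK.
have k0 : k = 0.
  apply/eqP; rewrite eq_le k_ge0 andbT -oppr_ge0.
  have := fdot_ge0 N (0, 0); rewrite NN torusN tcstE; exact.
have {}NN : <<N, N>> = 0 by rewrite NN k0 raddf0 oppr0.
have G := gauss' cm; rewrite P0 NN fdot0l addr0 mulr0 in G.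
have E0 : cint c E = 0.
  by have := congr1 (cint c) G; rewrite !raddfD /= cint_fX cint_fY !addr0 raddf0.
have E1 : E = 0 by apply: cint_eq0 E0 => p; rewrite torusM -expr2 sqr_ge0.
have := torus_eq E1 (0, 0); rewrite torusM torus0.
by move/eqP; rewrite mulf_eq0 orbb gt_eqF.
Qed.

(** At a point where the Hopf differential does not vanish, both slopes of [a]
    vanish to first order, hence so does its height, and the constant [a] is
    zero there. *)
Lemma perpc_eq0 a : perp a = 0 -> a = 0.
Proof.
move=> a0; have [pP qP aE] := perp_eq0 cm (fr_cstx _) (fr_csty _) a0 PN.
have [x1 x2 _ _] := slopes cm (fr_cstx a) (fr_csty a).
set p1 := slope1 _ _ _ _ in pP aE x1 x2; set q1 := slope2 _ _ _ _ in qP aE x1 x2.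
set al := height _ _ _ in aE x1 x2.
have X : fX fr p1 * (<<P, P>> * <<P, P>>) = 0.
  have := congr1 (fun h => fX fr h * <<P, P>>) pP; rewrite vfM vf0 mul0r mulrDl -mulrA.
  by rewrite mulrAC pP mul0r addr0.
have Y : fY fr q1 * (<<P, P>> * <<P, P>>) = 0.
  have := congr1 (fun h => fY fr h * <<P, P>>) qP; rewrite vfM vf0 mul0r mulrDl -mulrA.
  by rewrite mulrAC qP mul0r addr0.
have Al : al * (<<P, P>> * <<P, P>>) = 0.
  apply: torus_2reg.
  have -> : al * (<<P, P>> * <<P, P>>) + al * (<<P, P>> * <<P, P>>)
    = - (fX fr p1 * (<<P, P>> * <<P, P>>) + fY fr q1 * (<<P, P>> * <<P, P>>)
    + 2 * conf_s fr e ie * <<P, P>> * (p1 * <<P, P>>)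
    + 2 * conf_t fr e ie * <<P, P>> * (q1 * <<P, P>>)).
    by rewrite x1 x2; ring.
  by rewrite X Y pP qP !mulr0 !addr0 oppr0.
have [p0 P0] : exists p, <<P, P>> p <> 0.
  apply: contrapT => H; apply: hopf1_neq0; apply: fdot_eq0; apply: torus_ext => p.
  by rewrite torus0; apply: contrapT => Hp; apply: H; exists p.
have zero (h g : A) : h * g = 0 -> g p0 != 0 -> h p0 = 0.
  move=> /(congr1 (fun h : A => h p0)); rewrite torusM torus0 => /eqP.
  by rewrite mulf_eq0 => /orP[/eqP //|/eqP ->]; rewrite eqxx.
have P0' : <<P, P>> p0 != 0 by apply/eqP.
have PP0 : (<<P, P>> * <<P, P>>) p0 != 0 by rewrite torusM mulf_neq0.
have := congr1 (fun V => veval V p0) aE.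
rewrite !vevalD !vevalZ (zero _ _ Al PP0) (zero _ _ pP P0') (zero _ _ qP P0').
rewrite !scale0r !addr0 => H; apply/matrixP => i j.
by move/matrixP: H => /(_ i j); rewrite !mxE tcstE.
Qed.

End IndexBounds.

(** * Principal coordinates and vector products *)

Section Rotation.
Variables (A : comNzRingType) (n : nat).
Notation V := 'rV[A]_n.
Variables (F F' : frame V) (al be : A).
Notation "<< u , v >>" := (fdot F u v).
Hypothesis dotE : forall U W, fdot F' U W = <<U, W>>.
Hypotheses (xE : forall h, fX F' h = al * fX F h + be * fY F h).
Hypotheses (yE : forall h, fY F' h = - be * fX F h + al * fY F h).
Hypotheses (vxE : forall U, vfv (fX F') U = al *: vfv (fX F) U + be *: vfv (fY F) U).
Hypotheses (vyE : forall U, vfv (fY F') U = (- be) *: vfv (fX F) U + al *: vfv (fY F) U).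
Hypotheses (alx : fX F al = 0) (aly : fY F al = 0).
Hypotheses (bex : fX F be = 0) (bey : fY F be = 0).
Hypothesis ab1 : al * al + be * be = 1.
Variables (f : V) (e ie : A).
Hypothesis cm : conformal_minimal F f e ie.

Let comb3 (a1 b1 a2 b2 a3 b3 : A) (u v w : V) :
  a1 *: (a2 *: u + b2 *: v) + b1 *: (a3 *: v + b3 *: w)
  = (a1 * a2) *: u + (a1 * b2 + b1 * a3) *: v + (b1 * b3) *: w.
Proof. by rewrite !scalerDr !scalerA scalerDl !addrA. Qed.

Let xx' U : vfv (fX F') (vfv (fX F') U) = (al * al) *: vfv (fX F) (vfv (fX F) U)
  + (al * be + be * al) *: vfv (fX F) (vfv (fY F) U)
  + (be * be) *: vfv (fY F) (vfv (fY F) U).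
Proof.
rewrite !vxE !vfvD !vfvZ alx aly bex bey !scale0r !add0r -!fXYv.
exact: comb3.
Qed.
Let yy' U : vfv (fY F') (vfv (fY F') U) = (be * be) *: vfv (fX F) (vfv (fX F) U)
  + (- be * al + al * - be) *: vfv (fX F) (vfv (fY F) U)
  + (al * al) *: vfv (fY F) (vfv (fY F) U).
Proof.
rewrite !vyE !vfvD !vfvZ !vfN alx aly bex bey !oppr0 !scale0r !add0r -!fXYv.
by rewrite comb3 mulrNN.
Qed.
Let xy' U : vfv (fX F') (vfv (fY F') U) = (- (al * be)) *: vfv (fX F) (vfv (fX F) U)
  + (al * al - be * be) *: vfv (fX F) (vfv (fY F) U)
  + (be * al) *: vfv (fY F) (vfv (fY F) U).
Proof.
rewrite !vxE !vyE !vfvD !vfvZ !vfN alx aly bex bey !oppr0 !scale0r !add0r -!fXYv.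
by rewrite comb3 !mulrN.
Qed.

Lemma rotate_minimal : conformal_minimal F' f e ie.
Proof.
have [c1 c2 c3 c4 c5 c6] := cm.
have yx : <<vfv (fY F) f, vfv (fX F) f>> = 0 by rewrite fdotC.
split=> //; rewrite ?dotE //.
- rewrite !vxE !fdotDl !fdotDr !fdotZl !fdotZr c3 c4 c5 yx.
  by rewrite -[RHS]mul1r -ab1; ring.
- rewrite !vyE !fdotDl !fdotDr !fdotZl !fdotZr c3 c4 c5 yx.
  by rewrite -[RHS]mul1r -ab1; ring.
- by rewrite !vxE !vyE !fdotDl !fdotDr !fdotZl !fdotZr c3 c4 c5 yx; ring.
- rewrite -c6 !fvlapE xx' yy'.
  have -> : - be * al + al * - be = - (al * be + be * al) by ring.
  rewrite scaleNr; set X := vfv (fX F) _; set Y := vfv (fY F) _; set Z := _ *: _.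
  rewrite [X in X + _ = _]addrAC [X in _ + X = _]addrAC addrACA subrr addr0.
  by rewrite addrACA -!scalerDl [be * be + _]addrC ab1 !scale1r.
Qed.

(** The Hopf differential is multiplied by the square of the rotation. *)
Lemma rotate_hopf (p := al * al - be * be) (q := al * be + al * be) :
  hopf1 F' f e ie = p *: hopf1 F f e ie + q *: hopf2 F f e ie /\
  hopf2 F' f e ie = p *: hopf2 F f e ie - q *: hopf1 F f e ie.
Proof.
have [c1 c2 c3 c4 c5 c6] := cm; rewrite fvlapE in c6.
have yyE : vfv (fY F) (vfv (fY F) f) = - vfv (fX F) (vfv (fX F) f) - (2 * (e * e)) *: f.
  by rewrite -scaleNr -c6 addrA addNr add0r.
have sE : conf_s F' e ie = al * conf_s F e ie + be * conf_t F e ie.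
  by rewrite /conf_s /conf_t -!lock xE; ring.
have tE : conf_t F' e ie = - be * conf_s F e ie + al * conf_t F e ie.
  by rewrite /conf_s /conf_t -!lock yE; ring.
have EE : e * e = e * e * (al * al + be * be) by rewrite ab1 mulr1.
split.
  rewrite [LHS]hopf1E {1}EE hopf1E hopf2E xx' sE tE vxE vyE yyE /p /q.
  by apply/matrixP => i j; rewrite !mxE; ring.
rewrite [LHS]hopf2E hopf1E hopf2E xy' sE tE vxE vyE yyE /p /q.
by apply/matrixP => i j; rewrite !mxE; ring.
Qed.
End Rotation.

Section PrincipalChart.
Context {R : realType}.
Notation A := (torus_fun R).

Lemma half_angle (C S : R) : C ^+ 2 + S ^+ 2 = 1 ->
  exists a b, [/\ a ^+ 2 + b ^+ 2 = 1, a ^+ 2 - b ^+ 2 = C & 2 * a * b = S].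
Proof.
move=> CS1; have C1 : C ^+ 2 <= 1 by rewrite -CS1 lerDl sqr_ge0.
have C0 : 0 <= 1 + C by nra.
have [/eqP E|Cn] := eqVneq (1 + C) 0.
  exists 0, 1; have CE : C = -1 by move/eqP: E => E; lra.
  have S0 : S ^+ 2 = 0 by move: CS1; rewrite CE; lra.
  have {}S0 : S = 0 by apply/eqP; rewrite -sqrf_eq0 S0.
  by split; rewrite ?CE ?S0; ring.
have a0 : 0 < (1 + C) / 2 by rewrite divr_gt0 // lt_def Cn.
set a := Num.sqrt ((1 + C) / 2).
have aa : a ^+ 2 = (1 + C) / 2 by rewrite sqr_sqrtr // ltW.
have an : a != 0 by rewrite gt_eqF // sqrtr_gt0.
exists a, (S / (2 * a)).
have bb : (S / (2 * a)) ^+ 2 = (1 - C) / 2.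
  have -> : (S / (2 * a)) ^+ 2 = S ^+ 2 / (4 * a ^+ 2) by field.
  rewrite aa (_ : S ^+ 2 = (1 - C) * (1 + C)); last by lra.
  by field.
split; [by rewrite aa bb; field|by rewrite aa bb; field|by field].
Qed.

Lemma rotate_chart (c : chart R) a b : a ^+ 2 + b ^+ 2 = 1 -> exists c' : chart R,
  [/\ jac c' = jac c,
    forall h, Dx c' h = tcst a * Dx c h + tcst b * Dy c h &
    forall h, Dy c' h = - tcst b * Dx c h + tcst a * Dy c h].
Proof.
move=> ab; have AB : tcst a * tcst a + tcst b * tcst b = 1 :> A.
  by rewrite -!rmorphM -rmorphD -!expr2 ab rmorph1.
pose xs := tcst a * cxs c + tcst b * cys c; pose xt := tcst a * cxt c + tcst b * cyt c.
pose ys := - tcst b * cxs c + tcst a * cys c; pose yt := - tcst b * cxt c + tcst a * cyt c.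
have jE : xs * yt - xt * ys = jac c.
  rewrite -[RHS]mul1r -AB /xs /yt /xt /ys /jac.
  move: (tcst a) (tcst b) (cxs c) (cxt c) (cys c) (cyt c) => *; ring.
have clx : td ord_max xs = td ord0 xt.
  by rewrite /xs /xt !tdD !tdM !td_cst chart_closedx chart_closedy !mul0r.
have cly : td ord_max ys = td ord0 yt.
  by rewrite /ys /yt !tdD !tdM !tdN !td_cst !oppr0 !mul0r chart_closedx chart_closedy.
have dp p : 0 < (xs * yt - xt * ys) p by rewrite jE; exact: chart_det.
pose c' := Chart clx cly dp; have key h : Dx c' h = tcst a * Dx c h + tcst b * Dy c h /\
    Dy c' h = - tcst b * Dx c h + tcst a * Dy c h.
  apply: chart_coords => i; rewrite (td_chart c) -[LHS]mul1r -AB.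
  elim/ord2P: i; rewrite /cx /cy /= /xs /xt /ys /yt;
  by move: (Dx c h) (Dy c h) (tcst a) (tcst b) (cxs c) (cxt c) (cys c) (cyt c) => *; ring.
by exists c'; split=> [|h|h]; [exact: jE|have [] := key h|have [] := key h].
Qed.

(** Coordinates along the principal directions of the quartic differential. *)
Lemma principal_chart (c : chart R) n (F : 'rV[A]_n) e ie :
  conformal_minimal (chart_frame c) F e ie -> exists (c' : chart R) (k : R),
  let fr := chart_frame c' : frame 'rV[A]_n in
  let P := hopf1 fr F e ie in let N := hopf2 fr F e ie in
  [/\ conformal_minimal fr F e ie, 0 <= k, fdot fr P N = 0 &
    fdot fr P P - fdot fr N N = tcst k].
Proof.
move=> cm; have [q1 q2] := hopf_quartic cm.
have [[u uE] [v vE]] := @cauchy_riemann_const R c _ _ q1 q2.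
pose r := Num.sqrt (u ^+ 2 + v ^+ 2).
have r2 : r ^+ 2 = u ^+ 2 + v ^+ 2 by rewrite sqr_sqrtr // addr_ge0 ?sqr_ge0.
have [C [S [CS Cu Sv]]] : exists C S, [/\ C ^+ 2 + S ^+ 2 = 1, C * r = u & S * r = v].
  have [r0|r0] := eqVneq r 0.
    have : u ^+ 2 + v ^+ 2 = 0 by rewrite -r2 r0 expr0n.
    move=> /eqP; rewrite paddr_eq0 ?sqr_ge0 // !sqrf_eq0 => /andP[/eqP u0 /eqP v0].
    by exists 1, 0; rewrite r0 u0 v0; split; ring.
  exists (u / r), (v / r); split; [|by field|by field].
  have -> : (u / r) ^+ 2 + (v / r) ^+ 2 = (u ^+ 2 + v ^+ 2) / r ^+ 2 by field.
  by rewrite -r2 divff // expf_neq0.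
have [C' [S' [CS' CC SS]]] := half_angle CS.
have [a [b [ab aC bS]]] := half_angle CS'.
have [c' [jE xE yE]] := rotate_chart c ab.
have AB : tcst a * tcst a + tcst b * tcst b = 1 :> A.
  by rewrite -!rmorphM -rmorphD -!expr2 ab rmorph1.
have vx (U : 'rV[A]_n) : vderiv (Dx c') U = tcst a *: vderiv (Dx c) U + tcst b *: vderiv (Dy c) U.
  by apply/matrixP => i j; rewrite !(mxE, vderiv_entry) xE.
have vy (U : 'rV[A]_n) : vderiv (Dy c') U = (- tcst b) *: vderiv (Dx c) U + tcst a *: vderiv (Dy c) U.
  by apply/matrixP => i j; rewrite !(mxE, vderiv_entry) yE.
pose fr := chart_frame c : frame 'rV[A]_n; pose fr' := chart_frame c' : frame 'rV[A]_n.
have dE U W : fdot fr' U W = fdot fr U W by [].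
have cx := deriv_cst (Dx c); have cy := deriv_cst (Dy c).
have cm' := @rotate_minimal A n fr fr' (tcst a) (tcst b) dE vx vy (cx a) (cy a)
   (cx b) (cy b) AB F e ie cm.
have [P' N'] := @rotate_hopf A n fr fr' (tcst a) (tcst b) xE yE vx vy (cx a) (cy a)
   (cx b) (cy b) AB F e ie cm.
have pE : tcst a * tcst a - tcst b * tcst b = tcst C' :> A.
  by rewrite -!rmorphM -rmorphB -!expr2 aC.
have qE : tcst a * tcst b + tcst a * tcst b = tcst S' :> A.
  by rewrite -!rmorphM -rmorphD -bS; congr (tcst _); ring.
rewrite pE qE in P' N'.
exists c', r; cbv zeta; rewrite -/fr' P' N' !dE.
move: uE vE; rewrite -/fr; move: (hopf1 fr F e ie) (hopf2 fr F e ie) => P N uE vE.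
have NP : fdot fr N P = fdot fr P N by exact: fdotC.
have rr : r = (C' ^+ 2 - S' ^+ 2) * u + 2 * C' * S' * v.
  by rewrite CC SS -Cu -Sv -[LHS]mul1r -CS; ring.
have rv : (C' ^+ 2 - S' ^+ 2) * v - 2 * C' * S' * u = 0.
  by rewrite CC SS -Cu -Sv; ring.
have tE (x y z : A) : tcst u = x - y -> tcst v = z + z ->
    tcst ((C' ^+ 2 - S' ^+ 2) * v - 2 * C' * S' * u)
    = (tcst C' * tcst C' - tcst S' * tcst S') * (z + z)
    - 2 * tcst C' * tcst S' * (x - y) /\
    tcst ((C' ^+ 2 - S' ^+ 2) * u + 2 * C' * S' * v)
    = (tcst C' * tcst C' - tcst S' * tcst S') * (x - y)
    + 2 * tcst C' * tcst S' * (z + z).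
  move=> <- <-; rewrite !expr2 (rmorphB tcst) (rmorphD tcst) !(rmorphM tcst).
  by rewrite (rmorphB tcst) !(rmorphM tcst) rmorph_nat.
split=> //; first exact: sqrtr_ge0.
- rewrite !fdotDl !fdotBr !fdotZl !fdotZr NP.
  move: uE vE; move: (fdot fr P P) (fdot fr N N) (fdot fr P N) => x y z uE vE.
  have [h _] := tE _ _ _ (esym uE) (esym vE); rewrite rv raddf0 in h.
  apply: torus_2reg; rewrite [RHS]h.
  by move: (tcst C') (tcst S') => *; ring.
- rewrite rr !fdotDl !fdotDr !fdotNl !fdotNr !fdotZl !fdotZr NP.
  move: uE vE; move: (fdot fr P P) (fdot fr N N) (fdot fr P N) => x y z uE vE.
  have [_ ->] := tE _ _ _ (esym uE) (esym vE).
  by move: (tcst C') (tcst S') => *; ring.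
Qed.
End PrincipalChart.

Section CrossProduct.
Variables (T : comNzRingType) (n : nat).

(** The generalized vector product of the rows of an [n x (n+1)] matrix. *)
Definition cross (M : 'M[T]_(n, n + 1)) : 'rV[T]_(n + 1) :=
  \row_a cofactor (col_mx M 0 : 'M[T]_(n + 1)) (rshift n ord0) a.

Lemma cross_det (M : 'M[T]_(n, n + 1)) (v : 'rV[T]_(n + 1)) : \det (col_mx M v : 'M[T]_(n + 1)) = \sum_a v ord0 a * cross M ord0 a.
Proof.
rewrite (expand_det_row _ (rshift n ord0)); apply: eq_bigr => a _.
rewrite col_mxEd mxE; congr (_ * _); rewrite /cofactor; congr (_ * \det _).
apply/matrixP => i j; rewrite !mxE; case: splitP => k // kE.
have := neq_lift (rshift n ord0) i; move/eqP => []; apply: val_inj => /=.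
by move: kE => /= ->; rewrite ord1.
Qed.

Lemma cross_orth (M : 'M[T]_(n, n + 1)) i : \sum_a M i a * cross M ord0 a = 0.
Proof.
transitivity (\sum_a (row i M) ord0 a * cross M ord0 a).
  by apply: eq_bigr => a _; rewrite [row i M _ _]mxE.
rewrite -cross_det.
apply: (@determinant_alternate _ _ _ (lshift 1 i) (rshift n ord0)).
  by rewrite eq_lrshift.
by move=> a; rewrite col_mxEu col_mxEd mxE.
Qed.
End CrossProduct.

Lemma map_cross (T T' : comNzRingType) (phi : {rmorphism T -> T'}) n
  (M : 'M[T]_(n, n + 1)) : map_mx phi (cross M) = cross (map_mx phi M).
Proof.
apply/matrixP => i j; rewrite !mxE -cofactor_map_mx map_col_mx.
by rewrite map_mx0.
Qed.

Section OrthonormalFrame.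
Context {R : realType}.
Notation A := (torus_fun R).

Definition teval p (h : A) : R := h p.
Fact teval_additive p : zmod_morphism (teval p). Proof. by []. Qed.
Fact teval_monoid p : monoid_morphism (teval p). Proof. by []. Qed.
HB.instance Definition _ p := GRing.isZmodMorphism.Build A R (teval p) (teval_additive p).
HB.instance Definition _ p := GRing.isMonoidMorphism.Build A R (teval p) (teval_monoid p).

Variables (n : nat) (M : 'M[A]_(n, n + 1)).
Hypothesis MM : M *m M^T = 1%:M.
Let B := col_mx M (cross M) : 'M[A]_(n + 1).

Let BB (x : 'rV[A]_(n + 1)) : M *m x^T = 0 ->
  (col_mx M x : 'M[A]_(n + 1)) *m (col_mx M x)^T = block_mx 1%:M 0 0 (x *m x^T).
Proof.
move=> Mx; have xM : x *m M^T = 0 by rewrite -[LHS]trmxK trmx_mul trmxK Mx trmx0.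
by rewrite tr_col_mx mul_col_row MM Mx xM.
Qed.

Let Mc : M *m (cross M)^T = 0.
Proof.
apply/matrixP => i j; rewrite mxE [RHS]mxE -[RHS](cross_orth M i).
by apply: eq_bigr => a _; rewrite mxE ord1.
Qed.

Lemma cross_unit : cross M *m (cross M)^T = 1%:M.
Proof.
pose h := \sum_a cross M ord0 a * cross M ord0 a.
have hE : cross M *m (cross M)^T = h%:M.
  apply/matrixP => i j; rewrite !ord1 mxE [RHS]mxE eqxx mulr1n; apply: eq_bigr => a _.
  by rewrite [_^T _ _]mxE.
have Bh : \det B = h by rewrite cross_det.
have hh : h * h = h.
  rewrite -{1}Bh -{1}Bh -{2}[\det B]det_tr -det_mulmx (BB Mc) det_ublock det1 mul1r hE.
  by rewrite det_scalar expr1.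
suff h1 : h = 1 by rewrite hE h1.
apply: torus_ext => p; rewrite torus1.
have := torus_eq hh p; rewrite torusM => /eqP.
rewrite -subr_eq0 -{3}[h p]mulr1 -mulrBr mulf_eq0 => /orP[/eqP h0|]; last first.
  by rewrite subr_eq0 => /eqP.
exfalso; pose Mp := map_mx (teval p) M.
have cp a : cross Mp ord0 a = 0.
  have : (\sum_a cross Mp ord0 a ^+ 2 = 0).
    transitivity (h p); last exact: h0.
    rewrite /h torus_sum; apply: eq_bigr => b _.
    by rewrite -map_cross !mxE torusM expr2.
  move/eqP; rewrite psumr_eq0 => [/allP/(_ a)|b _]; last exact: sqr_ge0.
  by rewrite mem_index_enum sqrf_eq0 => /(_ isT)/eqP.
have MMp : Mp *m Mp^T = 1%:M by rewrite /Mp map_trmx -map_mxM MM map_mx1.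
have : kermx Mp^T != 0.
  rewrite kermx_eq0 /row_free neq_ltn; apply/orP; left.
  by rewrite (leq_ltn_trans (rank_leq_col _)) // addn1.
move=> /rowV0Pn[x /sub_kermxP xM x0].
have Mx : Mp *m x^T = 0 by rewrite -[LHS]trmxK trmx_mul trmxK xM trmx0.
have : \det (col_mx Mp x : 'M[R]_(n + 1)) = 0.
  by rewrite cross_det big1 // => a _; rewrite cp mulr0.
move=> D0; have : \det ((col_mx Mp x : 'M[R]_(n + 1)) *m (col_mx Mp x)^T) = 0.
  by rewrite det_mulmx D0 mul0r.
rewrite tr_col_mx mul_col_row MMp Mx xM det_ublock det1 mul1r det_mx11 mxE => /eqP.
rewrite psumr_eq0 => [/allP H|a _]; last by rewrite mxE -expr2 sqr_ge0.
move/eqP: x0; apply; apply/matrixP => i a; rewrite ord1 mxE.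
have := H a (mem_index_enum a); rewrite mxE mulf_eq0 orbb => /eqP.
by [].
Qed.

Lemma parseval_rows (U W : 'rV[A]_(n + 1)) : vdot U W =
  \sum_i vdot U (row i M) * vdot W (row i M) + vdot U (cross M) * vdot W (cross M).
Proof.
have BBt : B *m B^T = 1%:M.
  by rewrite (BB Mc) cross_unit -scalar_mx_block.
have BtB := mulmx1C BBt.
have vE (X Y : 'rV[A]_(n + 1)) : (X *m Y^T) ord0 ord0 = vdot X Y.
  by rewrite mxE vdot_sum; apply: eq_bigr => a _; rewrite mxE.
have -> : vdot U W = (U *m (B^T *m B) *m W^T) ord0 ord0 by rewrite BtB mulmx1 vE.
rewrite /B tr_col_mx mul_row_col mulmxDr mulmxDl mxE; congr (_ + _).
  rewrite mulmxA -mulmxA mxE; apply: eq_bigr => i _.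
  by congr (_ * _); rewrite mxE vdot_sum; apply: eq_bigr => a _; rewrite !mxE // mulrC.
rewrite mulmxA -mulmxA mxE big_ord1 vE; congr (_ * _).
by rewrite mxE vdot_sum; apply: eq_bigr => a _; rewrite [_^T _ _]mxE mulrC.
Qed.

Lemma cross_vdot : vdot (cross M) (cross M) = 1 /\ forall i, vdot (row i M) (cross M) = 0.
Proof.
split=> [|i].
  have := congr1 (fun X : 'M[A]_1 => X ord0 ord0) cross_unit.
  rewrite mxE [RHS]mxE eqxx mulr1n => <-; rewrite vdot_sum.
  by apply: eq_bigr => a _; rewrite [_^T _ _]mxE.
rewrite vdot_sum -[RHS](cross_orth M i); apply: eq_bigr => a _.
by rewrite [row i M _ _]mxE.
Qed.
End OrthonormalFrame.

(** * Surfaces of small index lie in a great sphere *)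

Section SmallIndex.
Context {R : realType}.
Notation A := (torus_fun R).
Variables (c : chart R) (F : 'rV[A]_5) (e ie : A).
Variable fr : frame 'rV[A]_5.
Hypothesis frE : fr = chart_frame c.
Notation f := (veval F).
Hypothesis imm : immersed_torus f.
Hypothesis e_gt0 : forall p, 0 < e p.
Hypothesis cm : conformal_minimal fr F e ie.
Notation "<< u , v >>" := (fdot fr u v).
Notation P := (hopf1 fr F e ie).
Notation N := (hopf2 fr F e ie).
Notation E := (e * e).
Notation iE := (ie * ie).
Notation normal := (normal fr F).
Notation perp a := (perp fr F ie (vcst a)).
Notation vdens := (vdens fr F e ie).

Notation kap := (@tcst R : {rmorphism R -> A}).
Notation negfam := (negative_family fr F e ie kap (cint c)).

Variable k : R.
Hypotheses (k_gt0 : 0 < k) (PN : <<P, N>> = 0) (PPNN : <<P, P>> - <<N, N>> = tcst k).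
Notation fx := (vfv (fX fr) F).
Notation fy := (vfv (fY fr) F).

Let dotE U W : fdot fr U W = vdot U W. Proof. by rewrite frE. Qed.
Let ff : <<F, F>> = 1 := cm_unit cm.
Let half h : h + h = 0 -> h = 0 :> A := @f2reg _ _ fr h.
Let f_fx : <<F, fx>> = 0.
Proof. by apply: half; have := fX_dot fr F F; rewrite ff vf1 [<<fx, F>>]fdotC. Qed.
Let f_fy : <<F, fy>> = 0.
Proof. by apply: half; have := fY_dot fr F F; rewrite ff vf1 [<<fy, F>>]fdotC. Qed.

Definition adapted_frame n1 n2 rho irho sg := [/\ normal n1 /\ normal n2,
  [/\ <<n1, n1>> = 1, <<n2, n2>> = 1 & <<n1, n2>> = 0],
  P = rho *: n1 /\ N = sg *: n2, rho * irho = 1 &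
  forall U W, <<U, W>> = <<U, F>> * <<W, F>>
  + iE * (<<U, fx>> * <<W, fx>>) + iE * (<<U, fy>> * <<W, fy>>)
  + <<U, n1>> * <<W, n1>> + <<U, n2>> * <<W, n2>>].

(** The first normal is [P / |P|], the second one the vector product of [f],
    [f_x], [f_y] and the first; [N] is a multiple of it because [<<P, N>> = 0].
    *)
Lemma adapted_frame_exists : exists n1 n2 rho irho sg, adapted_frame n1 n2 rho irho sg.
Proof.
have Ppos p : 0 < <<P, P>> p.
  have -> : <<P, P>> = <<N, N>> + tcst k by rewrite -PPNN addrC subrK.
  by rewrite torusD tcstE ltr_wpDl // (fdot_ge0 frE).
have [rho [rr rho0]] := torus_sqrt Ppos.
have rhon p : rho p != 0 by rewrite gt_eqF.
have [irho [ri _]] := torus_inv rhon.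
have nP : normal P := normal_hopf1 cm; have nN : normal N := normal_hopf2 cm.
have [n1 [nn1 hP n11 Nn1]] : exists n1,
    [/\ normal n1, P = rho *: n1, <<n1, n1>> = 1 & <<N, n1>> = 0].
  exists (irho *: P); split.
  - exact: normalZ.
  - by rewrite scalerA ri scale1r.
  - rewrite fdotZl fdotZr -rr.
    have -> : irho * (irho * (rho * rho)) = (rho * irho) * (rho * irho) by ring.
    by rewrite ri mulr1.
  - by rewrite fdotZr fdotC PN mulr0.
have [n1f n1x n1y] := nn1.
pose r : 'I_4 -> 'rV[A]_5 := fun i => nth 0 [:: F; ie *: fx; ie *: fy; n1] i.
pose M : 'M[A]_(4, 4 + 1) := \matrix_(i < 4) r i.
have rM i : row i M = r i by rewrite rowK.
have iE1 : ie * (ie * E) = 1 by rewrite mulrA -[LHS]mulr1 -mulrA (iEK cm).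
have rr' i j : fdot fr (r i) (r j) = (i == j)%:R.
  have fxx := cm_xx cm; have fyy := cm_yy cm; have fxy := cm_xy cm.
  have fyx : <<fy, fx>> = 0 by rewrite fdotC.
  have xf : <<fx, F>> = 0 by rewrite fdotC. have yf : <<fy, F>> = 0 by rewrite fdotC.
  have xn : <<fx, n1>> = 0 by rewrite fdotC. have yn : <<fy, n1>> = 0 by rewrite fdotC.
  have fn : <<F, n1>> = 0 by rewrite fdotC.
  case: i => [[|[|[|[|//]]]] Hi]; case: j => [[|[|[|[|//]]]] Hj];
    rewrite /r /= ?fdotZl ?fdotZr ?ff ?f_fx ?f_fy ?fxx ?fyy ?fxy ?fyx ?xf ?yf ?xn ?yn
    ?fn ?n1f ?n1x ?n1y ?n11 ?mulr0 ?iE1 //.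
have MM : M *m M^T = 1%:M.
  apply/matrixP => i j; rewrite mxE [RHS]mxE -rr' dotE vdot_sum.
  by apply: eq_bigr => a _; rewrite -!rM !mxE.
have [n22 n2r] := cross_vdot MM; pose n2 : 'rV[A]_5 := cross M.
have pars U W : <<U, W>> = <<U, F>> * <<W, F>>
  + iE * (<<U, fx>> * <<W, fx>>) + iE * (<<U, fy>> * <<W, fy>>)
  + <<U, n1>> * <<W, n1>> + <<U, n2>> * <<W, n2>>.
  rewrite [LHS]dotE (parseval_rows MM U W) !big_ord_recl big_ord0 !rM /r /= -!dotE.
  have sq X : <<U, ie *: X>> * <<W, ie *: X>> = iE * (<<U, X>> * <<W, X>>).
    by rewrite !fdotZr; move: (fdot _ _ _) (fdot _ _ _) => *; ring.
  by rewrite !sq addr0 !addrA.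
have n2f : <<n2, F>> = 0.
  by have := n2r ord0; rewrite rM /r /= -dotE fdotC.
have iEy h : ie * h = 0 -> h = 0.
  by move=> H; rewrite -[h]mul1r -(cm_inv cm) -mulrA H mulr0.
have n2x : <<n2, fx>> = 0.
  have := n2r (Ordinal (isT : (1 < 4)%N)); rewrite rM /r /= -dotE fdotZl => /iEy.
  by rewrite fdotC.
have n2y : <<n2, fy>> = 0.
  have := n2r (Ordinal (isT : (2 < 4)%N)); rewrite rM /r /= -dotE fdotZl => /iEy.
  by rewrite fdotC.
have n12 : <<n1, n2>> = 0.
  by have := n2r (Ordinal (isT : (3 < 4)%N)); rewrite rM /r /= -dotE.
have n22' : <<n2, n2>> = 1 by rewrite dotE.
pose sg := <<N, n2>>; pose X := N - sg *: n2.
have [Nf Nx Ny] := nN.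
have X0 : X = 0.
  apply: (fdot_eq0 frE); rewrite pars /X !fdotBl !fdotZl Nf Nx Ny n2f n2x n2y n22'.
  rewrite [<<n2, n1>>]fdotC n12.
  by rewrite Nn1 -/sg !mulr0 !subr0 !mulr0 !mulr1 subrr mul0r !addr0.
exists n1, n2, rho, irho, sg; split=> //.
by split=> //; apply/eqP; rewrite -subr_eq0 -/X X0.
Qed.

Notation kx := (fX_cst frE). Local Notation ky := (fY_cst frE).

(** The rotated Hopf differential lies in the kernel of [hform]. Either it
    enlarges the family, or it consists of normal parts of constants and
    [rotated_hopf_const] applies. *)
Lemma great_sphere_or_negative7 : negfam 7 \/ exists (u : 'rV[R]_5) (r : R),
  [/\ 0 < r, normal (vcst u) /\ N = 0, <<P, P>> = tcst (r ^+ 2),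
   <<vcst u, vcst u>> = 1 /\ <<vcst u, P>> = 0 &
  forall U W, <<U, W>> = <<U, F>> * <<W, F>>
  + iE * (<<U, fx>> * <<W, fx>>) + iE * (<<U, fy>> * <<W, fy>>)
  + tcst (r ^- 2) * (<<U, P>> * <<W, P>>) + <<U, vcst u>> * <<W, vcst u>>].
Proof.
have [n1 [n2 [rho [irho [sg [[nn1 nn2] [n11 n22 n12] [hP hN] rr pars]]]]]] :=
  adapted_frame_exists.
have rot := vdens_rotated_hopf cm nn1 nn2 n11 n22 n12 hP hN rr pars.
have kern (U : 'rV[A]_5) : (forall W, normal W -> vdens U W = fX fr <<vfv (fX fr) U, W>>
    + fY fr <<vfv (fY fr) U, W>>) -> forall W, normal W -> hform fr F e ie (cint c) U W = 0.
  by move=> H W nW; rewrite /hform (H _ nW) raddfD /= (cint_fX frE) (cint_fY frE) addr0.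
have dich := negative7_kernel cm (fX_cst frE) (fY_cst frE) (cintD c) (cintZ c)
  (cint_fX frE) (cint_fY frE) (@vcstD R 5) (@vcstZ R 5) (fr_cstx frE) (fr_csty frE)
  (cint_Esqr_gt0 frE cm) (cint_iEsqr_gt0 frE cm) (ltW k_gt0) PN PPNN
  (hopf1_neq0 frE e_gt0 cm (ltW k_gt0) PPNN) (perpc_eq0 frE e_gt0 cm (ltW k_gt0) PN PPNN).
have [|[a Ka]] := dich _ k_gt0 (normalZ rho nn2) (kern _ (fun W nW => (rot W nW).1)).
  by left.
have [|[b Kb]] := dich _ k_gt0 (normalZ sg nn1) (kern _ (fun W nW => (rot W nW).2)).
  by left.
right; have [aE _ rx ry sg0] := rotated_hopf_const cm nn1 nn2 n11 n22 n12 hP hN rr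
  (fr_cstx frE a) (fr_csty frE a) (fr_cstx frE b) (fr_csty frE b) Ka Kb.
have [d dE] : exists d, rho = tcst d.
  by apply: (@chart_const R c); [move: rx|move: ry]; rewrite frE; exact.
have d0 : d != 0.
  apply/eqP => d0; have := torus_eq rr (0, 0).
  rewrite dE d0 torusM tcstE mul0r torus1 => /esym/eqP; by rewrite oner_eq0.
have uE : vcst (d^-1 *: a) = n2.
  by rewrite vcstZ aE dE scalerA -rmorphM mulVf // rmorph1 scale1r.
have r2 : `|d| ^+ 2 = d ^+ 2 by rewrite real_normK // num_real.
exists (d^-1 *: a), `|d|; rewrite uE; split.
- by rewrite normr_gt0.
- split; [exact: nn2|by rewrite hN sg0 scale0r].
- by rewrite r2 hP fdotZl fdotZr n11 mulr1 dE -rmorphM expr2.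
- split; [exact: n22|by rewrite hP fdotZr fdotC n12 mulr0].
- move=> U W; rewrite {1}(pars U W); congr (_ + _ + _).
  rewrite hP !fdotZr dE r2 -[LHS]mul1r -tcst1.
  have -> : 1 = d ^- 2 * (d * d) :> R by rewrite -expr2 mulVf // expf_neq0.
  by rewrite !tcstM; move: (tcst _) (tcst d) (fdot _ _ _) (fdot _ _ _) => *; ring.
Qed.

(** * Surfaces of small index are flat *)
Variable u : 'rV[R]_5.
Hypotheses (nu : normal (vcst u)) (N0 : N = 0) (uu : <<vcst u, vcst u>> = 1).
Hypotheses (uP : <<vcst u, P>> = 0) (index7 : ~ negfam 7).

Let cX := cint_fX frE. Let cY := cint_fY frE.
Let c2 h : cint c (2 * h) = 2 * cint c h. Proof. by rewrite natA cintZ. Qed.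

Definition eform h g := cint c (fX fr h * fX fr g + fY fr h * fY fr g - 2 * E * (h * g)).

Lemma eformDZ h g t : eform (h + tcst t * g) (h + tcst t * g)
  = eform h h + 2 * t * eform h g + t ^+ 2 * eform g g.
Proof.
rewrite /eform !vfD !vfM (fX_cst frE) (fY_cst frE) !mul0r !add0r.
have -> : 2 * t * cint c (fX fr h * fX fr g + fY fr h * fY fr g - 2 * E * (h * g))
  = cint c (2 * (tcst t * (fX fr h * fX fr g + fY fr h * fY fr g - 2 * E * (h * g)))).
  by rewrite c2 cintZ -mulrA.
rewrite expr2 -mulrA -!cintZ -!cintD; congr (cint c _).
by rewrite tcstM; move: (tcst t) (fX fr h) (fX fr g) (fY fr h) (fY fr g) => *; ring.
Qed.

(** Along a constant normal field, the second variation is the energy form; a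
    negative direction orthogonal to [E] would enlarge the index. *)
Lemma eform_ge0 h : cint c (E * h) = 0 -> 0 <= eform h h.
Proof.
move=> Eh; rewrite leNgt; apply/negP => h0; apply: index7.
pose X := h *: vcst u; have nX : normal X by exact: normalZ.
have XP : <<P, X>> = 0 by rewrite /X fdotZr fdotC uP mulr0.
have nP : normal P := normal_hopf1 cm.
apply: (negative7_of cm (fX_cst frE) (fY_cst frE) (cintD c) (cintZ c)
  (cint_fX frE) (cint_fY frE) (@vcstD R 5) (@vcstZ R 5) (fr_cstx frE) (fr_csty frE)
  (cint_Esqr_gt0 frE cm) (cint_iEsqr_gt0 frE cm) (ltW k_gt0) PN PPNN
  (hopf1_neq0 frE e_gt0 cm (ltW k_gt0) PPNN) (perpc_eq0 frE e_gt0 cm (ltW k_gt0) PN PPNN)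
  k_gt0 nX).
  move=> v; rewrite /qform (hform_family6 cm (fX_cst frE) (fY_cst frE) (cintD c) (cintZ c)
    cX cY (fr_cstx frE) (fr_csty frE) v nX).
  have [-> _] := hform_hopf cm (cintD c) (cintZ c) cX cY PN PPNN nX.
  rewrite XP mulr0 raddf0 !mulr0 sub0r /family6 /extend fdotDl fdotZl XP mulr0 addr0.
  rewrite (perp_normal ie _ nX) /X fdotZr dotE vdot_vcst.
  have -> : E * (h * tcst (dot (lsubmx v) u)) = tcst (dot (lsubmx v) u) * (E * h) by ring.
  by rewrite cintZ Eh !mulr0 oppr0.
have -> : qform fr F e ie (cint c) X X = eform h h; last exact: h0.
rewrite /qform /hform /eform -c2 -raddfB /=; congr (cint c _).
rewrite /vdens XP N0 fdot0l !mulr0 addr0 mulr0 mulr0 subr0 /X !vfvZ (fr_cstx frE) (fr_csty frE).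
by rewrite !scaler0 !addr0 !fdotZl !fdotZr uu; move: (fX fr h) (fY fr h) => *; ring.
Qed.

(** A nonnegative quadratic polynomial without constant term has no linear
    term. *)
Lemma eform_null h g : cint c (E * h) = 0 -> cint c (E * g) = 0 -> eform h h = 0 ->
  eform h g = 0.
Proof.
move=> Eh Eg h0; have pos t : 0 <= 2 * t * eform h g + t ^+ 2 * eform g g.
  have := @eform_ge0 (h + tcst t * g); rewrite eformDZ h0 add0r; apply.
  by rewrite mulrDr mulrCA cintD cintZ Eh Eg mulr0 addr0.
have g0 := eform_ge0 Eg; move: pos g0; move: (eform h g) (eform g g) => b a pos a0.
have [//|b0] := eqVneq b 0; exfalso.
have := pos (- b / (a + 1)).
have -> : 2 * (- b / (a + 1)) * b + (- b / (a + 1)) ^+ 2 * a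
  = - (b ^+ 2 * (a + 2) / (a + 1) ^+ 2) by field; rewrite gt_eqF // ltr_wpDl.
rewrite oppr_ge0 leNgt => /negP; apply.
have b2 : 0 < b ^+ 2 by rewrite lt_def sqrf_eq0 b0 sqr_ge0.
by apply: divr_gt0; [apply: mulr_gt0; [exact: b2|lra]|apply: exprn_gt0; lra].
Qed.

Lemma E_reg h : E * h = 0 -> h = 0.
Proof. by move=> H; rewrite -[h](iEK cm) H mulr0. Qed.

Let not_const a : F <> vcst a.
Proof.
move=> Fa; have := cm_xx cm; rewrite Fa (fr_cstx frE) fdot0l => /esym H.
have : (1 : A) = 0 by apply: E_reg; rewrite mulr1.
by move=> /(congr1 (fun h : A => h (0, 0))) /eqP; rewrite torus1 torus0 oner_eq0.
Qed.

Let al a := height fr F (vcst a).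
Let tang (a : 'rV[R]_5) : 'rV[A]_5 := vcst a - al a *: F.
Let entry (V : 'rV[A]_5) b : A := V ord0 b.
Let dots (V W : 'rV[A]_5) : <<V, W>> = \sum_b entry V b * entry W b.
Proof. by rewrite dotE vdot_sum. Qed.
Let entryx V b : entry (vfv (fX fr) V) b = fX fr (entry V b).
Proof. by rewrite frE /entry [LHS]vderiv_entry. Qed.
Let entryy V b : entry (vfv (fY fr) V) b = fY fr (entry V b).
Proof. by rewrite frE /entry [LHS]vderiv_entry. Qed.
Let cint_sum (G : 'I_5 -> A) : cint c (\sum_b G b) = \sum_b cint c (G b).
Proof. exact: raddf_sum. Qed.

(** The center of mass of [tang a] depends injectively on [a], because [tang a
    = 0] with [a] nonzero would make the surface constant. *)
Lemma balance (g : 'rV[A]_5) : exists a, forall b, cint c (E * entry (g + tang a) b) = 0.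
Proof.
pose T : 'M[R]_5 := \matrix_(a, b) (cint c E * (a == b)%:R
  - cint c (E * (entry F a * entry F b))).
have TE (a : 'rV[R]_5) b : (a *m T) ord0 b = cint c (E * entry (tang a) b).
  have -> : entry (tang a) b = tcst (a ord0 b) - al a * entry F b.
    by rewrite /entry /tang !mxE.
  rewrite mxE mulrBr raddfB /= /al /height.
  under eq_bigr do rewrite [T _ _]mxE mulrBr.
  rewrite sumrB; congr (_ - _).
    rewrite (bigD1 b) //= big1 => [|i /negPf ib]; last by rewrite ib !mulr0.
    by rewrite eqxx mulr1 addr0 [E * _]mulrC cintZ.
  rewrite dots big_distrl /= big_distrr /= cint_sum; apply: eq_bigr => i _.
  rewrite -cintZ /entry mxE; congr (cint c _).
  by move: (tcst _) (F _ _) (F _ _) => *; ring.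
have Tfree : row_free T.
  rewrite -kermx_eq0; apply/rowV0P => a /sub_kermxP aT.
  have E0 : cint c (E * <<tang a, tang a>>) = 0.
    have -> : E * <<tang a, tang a>> = \sum_b tcst (a ord0 b) * (E * entry (tang a) b).
    have -> : <<tang a, tang a>> = <<vcst a, tang a>>.
    have Ft : <<F, tang a>> = 0.
    by rewrite /tang fdotBr fdotZr ff mulr1 /al /height [<<F, _>>]fdotC subrr.
    have := fdotBl fr (vcst a) (al a *: F) (tang a); rewrite -/(tang a) => ->.
    by rewrite fdotZl Ft mulr0 subr0.
    rewrite dots big_distrr; apply: eq_bigr => b _ /=.
    by rewrite mulrCA /entry mxE.
    rewrite cint_sum big1 // => b _; rewrite cintZ -TE aT.
    by rewrite mxE mulr0.
  have t0 : tang a = 0.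
    by apply: contrapT => /(cint_Esqr_gt0 frE cm); rewrite E0 ltxx.
  have aF : vcst a = al a *: F by apply/eqP; rewrite -subr_eq0 -/(tang a) t0.
  have ax : fX fr (al a) = 0.
    rewrite /al (height_x cm (fr_cstx frE a)) /slope1 aF fdotZl f_fx.
    by rewrite !mulr0.
  have ay : fY fr (al a) = 0.
    rewrite /al (height_y cm (fr_csty frE a)) /slope2 aF fdotZl f_fy.
    by rewrite !mulr0.
  have [d dE] : exists d, al a = tcst d.
    by apply: (@chart_const R c); [move: ax|move: ay]; rewrite frE; exact.
  have [d0|d0] := eqVneq d 0.
    apply: vcst_inj; rewrite vcst0 aF dE d0 raddf0 scale0r.
    by [].
  exfalso; apply: (@not_const (d^-1 *: a)); rewrite vcstZ aF dE scalerA -rmorphM mulVf //.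
  by rewrite rmorph1 scale1r.
pose t : 'rV[R]_5 := \row_b cint c (E * entry g b).
exists (- (t *m invmx T)) => b.
have := TE (- (t *m invmx T)) b; rewrite mulNmx mulmxKV; last by rewrite -row_free_unit.
rewrite /entry [(g + _) _ _]mxE mulrDr cintD => <-; rewrite mxE [t _ _]mxE /entry.
by rewrite subrr.
Qed.

(** The components of [g], balanced by a conformal motion, are admissible in
    [eform_ge0], while the Hessian is [- 2 E |perp a|^2]. Hence [a = 0] and
    these components are null for the form; its polar form then shows that [G f
    / E] is constant, which is impossible unless [G = 0]. *)
Lemma translation_invariance (g : 'rV[A]_5) (G : A) :
  fvlap fr g = - G *: F - (2 * E) *: g -> <<F, g>> = 0 ->
  (forall W, normal W -> <<W, g>> = 0) -> G = 0.
Proof.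
move=> lapg Fg gt; have [a bal] := balance g.
have := energy_hessian cm lapg Fg gt (fr_cstx frE a) (fr_csty frE a); cbv zeta.
rewrite -/(al a) -/(tang a); set Y := g + tang a => hess.
have eY : cint c (edens fr e Y Y) = \sum_b eform (entry Y b) (entry Y b).
  rewrite -cint_sum; congr (cint c _).
  rewrite /edens !dots big_distrr /= -big_split -sumrB; apply: eq_bigr => b _ /=.
  by rewrite !entryx !entryy.
have Eneg : cint c (edens fr e Y Y) = - (2 * cint c (E * <<perp a, perp a>>)).
  rewrite hess raddfB raddfD /= cX cY addr0 sub0r; congr (- _).
  by rewrite -mulrA c2.
have pos b : 0 <= eform (entry Y b) (entry Y b) by apply: eform_ge0.
have sum_ge0 : 0 <= \sum_b eform (entry Y b) (entry Y b) by apply: sumr_ge0.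
have pa : perp a = 0.
  apply: contrapT => /(cint_Esqr_gt0 frE cm) H.
  by move: sum_ge0; rewrite -eY Eneg; lra.
have a0 := perpc_eq0 frE e_gt0 cm (ltW k_gt0) PN PPNN pa.
have Yg : Y = g.
  rewrite /Y /tang /al /height a0 vcst0 fdot0l scale0r subr0.
  by rewrite addr0.
have bal' b : cint c (E * entry g b) = 0 by rewrite -Yg.
have null b : eform (entry g b) (entry g b) = 0.
  have := eY; rewrite Eneg pa fdot0l mulr0 raddf0 mulr0 oppr0 Yg => /esym/eqP.
  rewrite psumr_eq0 => [/allP H|b' _]; last by rewrite -Yg.
  by apply/eqP/H; rewrite mem_index_enum.
have cross0 b h : cint c (E * h) = 0 -> cint c (G * (entry F b * h)) = 0.
  move=> Eh; have := eform_null (bal' b) Eh (null b) => <-; rewrite /eform.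
  have lapb : fX fr (fX fr (entry g b)) + fY fr (fY fr (entry g b))
    = - (G * entry F b) - 2 * E * entry g b.
    rewrite -!entryx -!entryy; have := congr1 (fun V => entry V b) lapg.
    by rewrite fvlapE /entry !mxE mulNr.
  have -> : fX fr (entry g b) * fX fr h + fY fr (entry g b) * fY fr h - 2 * E * (entry g b * h)
    = fX fr (fX fr (entry g b) * h) + fY fr (fY fr (entry g b) * h)
    - (fX fr (fX fr (entry g b)) + fY fr (fY fr (entry g b))) * h - 2 * E * entry g b * h.
    by rewrite !vfM; ring.
  rewrite lapb; have -> : fX fr (fX fr (entry g b) * h) + fY fr (fY fr (entry g b) * h)
    - (- (G * entry F b) - 2 * E * entry g b) * h - 2 * E * entry g b * h
    = fX fr (fX fr (entry g b) * h) + fY fr (fY fr (entry g b) * h) + G * (entry F b * h) by ring.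
  by rewrite !cintD cX cY !add0r.
have iE0 : 0 < cint c E.
  have F0 : F <> 0 by move=> F0; apply: (@not_const 0); rewrite vcst0.
  by have := cint_Esqr_gt0 frE cm F0; rewrite ff mulr1.
pose q := iE * G.
have qF b : exists mu, q * entry F b = tcst mu.
  pose w := q * entry F b; pose mu := cint c (E * w) / cint c E; exists mu.
  pose h := w - tcst mu.
  have Eh : cint c (E * h) = 0.
    rewrite /h mulrBr raddfB /= [E * tcst mu]mulrC cintZ /mu divfK ?subrr //.
    by rewrite gt_eqF.
  apply: subr0_eq.
  have Ehh : cint c (E * (h * h)) = 0.
    have -> : E * (h * h) = E * w * h - tcst mu * (E * h) by rewrite {1}/h; ring.
    rewrite raddfB /= cintZ Eh mulr0 subr0.
    have -> : E * w * h = G * (entry F b * h).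
    rewrite /w /q; have -> : E * (iE * G * entry F b) * h = iE * (E * (G * (entry F b * h))) by ring.
    exact: (iEK cm).
    exact: cross0.
  have H : E * (h * h) = 0.
    by apply: cint_eq0 Ehh => p; rewrite !torusM -!expr2 mulr_ge0 // sqr_ge0.
  have hh := E_reg H; apply: torus_ext => p; have := torus_eq hh p.
  by rewrite torusM torus0 => /eqP; rewrite mulf_eq0 orbb => /eqP.
have qx b : fX fr q * entry F b + q * entry fx b = 0.
  by have [mu muE] := qF b; rewrite entryx -vfM muE (fX_cst frE).
have pair (W : 'rV[A]_5) : fX fr q * <<F, W>> + q * <<fx, W>> = 0.
  rewrite !dots !big_distrr -big_split big1 // => b _ /=.
  by rewrite !mulrA -mulrDl qx mul0r.
have q0 : fX fr q = 0 by have := pair F; rewrite ff [<<fx, F>>]fdotC f_fx mulr1 mulr0 addr0.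
have := pair fx; rewrite q0 mul0r add0r (cm_xx cm) mulrC => H.
by rewrite -(iEK cm G) mulrCA.
Qed.

Lemma conformal_factor_const : exists e0, e = tcst e0.
Proof.
have e2 D : (2 : A) * (D : A) = 0 -> D = 0.
  by move=> H; apply: half; rewrite -mulr2n -mulr_natl H.
have ereg h : e * h = 0 -> h = 0.
  by move=> H; rewrite -[h]mul1r -(cm_inv cm) mulrAC H mul0r.
have key (D : vfield 'rV[A]_5) : 2 * D E = 0 -> D e = 0.
  move=> H; apply: ereg; apply: half; have := e2 _ H; rewrite vfM => <-; congr (_ + _).
  exact: mulrC.
have ex0 : fX fr e = 0.
  apply: key; apply: (translation_invariance (g := fx)) => //.
    rewrite fvlap_X (cm_lap cm) vfvZ vfN vfM (vfnat _ 2) mul0r add0r.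
    by rewrite [(- (2 * E)) *: _]scaleNr.
  by move=> W [_ W2 _].
have ey0 : fY fr e = 0.
  apply: key; apply: (translation_invariance (g := fy)) => //.
    rewrite fvlap_Y (cm_lap cm) vfvZ vfN vfM (vfnat _ 2) mul0r add0r.
    by rewrite [(- (2 * E)) *: _]scaleNr.
  by move=> W [_ _ W3].
by apply: (@chart_const R c); [move: ex0|move: ey0]; rewrite frE; exact.
Qed.
Variables r e0 : R.
Hypotheses (r_gt0 : 0 < r) (PPr : <<P, P>> = tcst (r ^+ 2)) (eE : e = tcst e0).
Hypothesis pars : forall U W, <<U, W>> = <<U, F>> * <<W, F>>
  + iE * (<<U, fx>> * <<W, fx>>) + iE * (<<U, fy>> * <<W, fy>>)
  + tcst (r ^- 2) * (<<U, P>> * <<W, P>>) + <<U, vcst u>> * <<W, vcst u>>.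

Let e0_gt0 : 0 < e0. Proof. by have := e_gt0 (0, 0); rewrite eE tcstE. Qed.
Let EE : E = tcst (e0 ^+ 2). Proof. by rewrite eE expr2 -tcstM. Qed.
Let ieE : ie = tcst e0^-1.
Proof.
have H := cm_inv cm; rewrite eE in H.
have H' : tcst e0 * tcst e0^-1 = 1 :> A by rewrite -tcstM mulfV ?rmorph1 // gt_eqF.
by rewrite -[LHS]mul1r -H' mulrAC H mul1r.
Qed.
Let iEE : iE = tcst (e0 ^- 2).
Proof. by rewrite ieE -tcstM -expr2 exprVn. Qed.
Let s0 : conf_s fr e ie = 0.
Proof. by rewrite /conf_s -lock eE (fX_cst frE) mulr0. Qed.
Let t0 : conf_t fr e ie = 0.
Proof. by rewrite /conf_t -lock eE (fY_cst frE) mulr0. Qed.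
Lemma flat_gauss : r = e0 ^+ 2.
Proof.
have := gauss' cm; rewrite s0 t0 !vf0 !addr0 N0 fdot0l addr0 PPr iEE EE -tcstM.
move=> /(congr1 (fun h : A => h (0, 0))); rewrite !tcstE => H.
have {}H : r ^+ 2 = (e0 ^+ 2) ^+ 2.
  by rewrite [RHS]expr2 {1}H mulrAC mulVf ?mul1r // expf_neq0 // gt_eqF.
by apply/eqP; rewrite -(eqrXn2 (n := 2)) ?H // ?sqr_ge0 // ltW.
Qed.

Let fxxE : vfv (fX fr) fx = P - E *: F.
Proof. by rewrite hopf1E s0 t0 !scale0r subr0 addr0 addrK. Qed.
Let fxyE : vfv (fX fr) fy = 0.
Proof. by have := hopf2E fr F e ie; rewrite s0 t0 !scale0r !subr0 N0. Qed.
Let fyyE : vfv (fY fr) fy = - P - E *: F.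
Proof.
have := cm_lap cm; rewrite fvlapE fxxE => H.
have -> : vfv (fY fr) fy = (P - E *: F + vfv (fY fr) fy) - (P - E *: F) by rewrite addrC addKr.
rewrite H; apply/matrixP => i j; rewrite !mxE; move: (P i j) (F i j) => x y; ring.
Qed.
Let nP : normal P. Proof. exact: normal_hopf1. Qed.

Let vec0 (U : 'rV[A]_5) : <<U, F>> = 0 -> <<U, fx>> = 0 -> <<U, fy>> = 0 ->
  <<U, P>> = 0 -> <<U, vcst u>> = 0 -> U = 0.
Proof.
move=> h1 h2 h3 h4 h5; apply: (fdot_eq0 frE).
by rewrite pars h1 h2 h3 h4 h5 !(mulr0, mul0r, addr0).
Qed.

Let PE4 : <<P, P>> = E * E.
Proof. by rewrite PPr flat_gauss EE -tcstM. Qed.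
Lemma hopf_x : vfv (fX fr) P = - E *: fx.
Proof.
have [Pf Px Py] := nP; have [uf ux uy] := nu.
apply/eqP; rewrite -subr_eq0 scaleNr opprK; apply/eqP.
have dP : <<vfv (fX fr) P, P>> = 0.
  by apply: half; have := fX_dot fr P P; rewrite PPr (fX_cst frE) [<<P, _>>]fdotC.
apply: vec0; rewrite fdotDl fdotZl.
- by rewrite (nWx_f nP) [<<fx, F>>]fdotC f_fx mulr0 addr0.
- by rewrite (nWx_fx e ie nP) (cm_xx cm) PE4 addNr.
- by rewrite (nWx_fy e ie nP) N0 fdot0l oppr0 (cm_xy cm) mulr0 addr0.
- by rewrite dP [<<fx, P>>]fdotC Px mulr0 addr0.
- have := fX_dot fr P (vcst u); rewrite [<<P, _>>]fdotC uP vf0 (fr_cstx frE).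
  rewrite [<<P, 0>>]fdotC fdot0l addr0 => <-.
  by rewrite [<<fx, _>>]fdotC ux mulr0 addr0.
Qed.

Lemma hopf_y : vfv (fY fr) P = E *: fy.
Proof.
have [Pf Px Py] := nP; have [uf ux uy] := nu.
apply: subr0_eq.
have dP : <<vfv (fY fr) P, P>> = 0.
  by apply: half; have := fY_dot fr P P; rewrite PPr (fY_cst frE) [<<P, _>>]fdotC.
apply: vec0; rewrite fdotBl fdotZl.
- by rewrite (nWy_f nP) [<<fy, F>>]fdotC f_fy mulr0 subr0.
- by rewrite (nWy_fx e ie nP) N0 fdot0l oppr0 [<<fy, fx>>]fdotC (cm_xy cm) mulr0 subr0.
- by rewrite (nWy_fy cm nP) (cm_yy cm) PE4 subrr.
- by rewrite dP [<<fy, P>>]fdotC Py mulr0 subr0.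
- have := fY_dot fr P (vcst u); rewrite [<<P, _>>]fdotC uP vf0 (fr_csty frE).
  rewrite [<<P, 0>>]fdotC fdot0l addr0 => <-.
  by rewrite [<<fy, _>>]fdotC uy mulr0 subr0.
Qed.

Let xi : 'rV[A]_5 := F - iE *: P.
Let eta : 'rV[A]_5 := F + iE *: P.
Let lam : R := Num.sqrt (2 * e0 ^+ 2).
Let lam2 : lam ^+ 2 = 2 * e0 ^+ 2.
Proof. by rewrite sqr_sqrtr // mulr_ge0 // sqr_ge0. Qed.
Let lam_gt0 : 0 < lam. Proof. by rewrite sqrtr_gt0 mulr_gt0 // exprn_gt0. Qed.
Let zx : 'rV[A]_5 := tcst (2 / lam) *: fx.
Let zy : 'rV[A]_5 := tcst (2 / lam) *: fy.

Let iEc : fX fr iE = 0 /\ fY fr iE = 0.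
Proof. by rewrite iEE (fX_cst frE) (fY_cst frE). Qed.
Let iEKv (U : 'rV[A]_5) : iE *: (E *: U) = U.
Proof. by rewrite scalerA -[iE * E]mulr1 -mulrA (iEK cm) scale1r. Qed.
Let lamK (U : 'rV[A]_5) : tcst lam *: (tcst (2 / lam) *: U) = U + U.
Proof.
rewrite scalerA -tcstM mulrCA mulfV ?gt_eqF // mulr1 -natA.
by rewrite scaler_nat mulr2n.
Qed.
Let lamK' (U : 'rV[A]_5) : tcst (2 / lam) *: (P - E *: F) = - tcst lam *: xi /\
  tcst (2 / lam) *: (- P - E *: F) = - tcst lam *: eta.
Proof.
have H (W : 'rV[A]_5) : tcst (2 / lam) *: (E *: W) = tcst lam *: W.
  rewrite scalerA EE -tcstM; congr (tcst _ *: _).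
  by apply: (mulIf (lt0r_neq0 lam_gt0)); rewrite -[RHS]expr2 lam2 mulrAC divfK ?gt_eqF.
have EK : E *: (iE *: P) = P by rewrite scalerA mulrC -scalerA iEKv.
split.
  by rewrite [RHS]scaleNr -H -[RHS]scalerN; congr (_ *: _); rewrite /xi scalerBr EK opprB.
by rewrite [RHS]scaleNr -H -[RHS]scalerN; congr (_ *: _); rewrite /eta scalerDr EK opprD addrC.
Qed.

Let osc : [/\ vfv (fX fr) xi = tcst lam *: zx, vfv (fY fr) xi = 0,
   vfv (fX fr) zx = - tcst lam *: xi & vfv (fY fr) zx = 0] /\
  [/\ vfv (fX fr) eta = 0, vfv (fY fr) eta = tcst lam *: zy,
   vfv (fX fr) zy = 0 & vfv (fY fr) zy = - tcst lam *: eta].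
Proof.
have [ix iy] := iEc; have [k1 k2] := lamK' F.
split; split; rewrite /xi /eta /zx /zy ?lamK ?(vfvD, vfvB, vfvN, vfvZ) ?ix ?iy
  ?(fX_cst frE) ?(fY_cst frE) ?scale0r ?add0r ?hopf_x ?hopf_y.
- by rewrite scaleNr scalerN iEKv opprK.
- by rewrite iEKv subrr.
- by rewrite fxxE k1.
- by rewrite -fXYv fxyE scaler0.
- by rewrite scaleNr scalerN iEKv subrr.
- by rewrite iEKv.
- by rewrite fxyE scaler0.
- by rewrite fyyE k2.
Qed.

Let zz : tcst (2 / lam) * (tcst (2 / lam) * E) = 2 :> A.
Proof.
rewrite natA EE -!tcstM; congr tcst.
have -> : 2 / lam * (2 / lam * e0 ^+ 2) = 2 * (2 * e0 ^+ 2) / lam ^+ 2.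
  by field; exact: lt0r_neq0.
by rewrite -lam2 mulfK // expf_neq0 // gt_eqF.
Qed.

(** Four fields, two for each circle, whose frame rotates at constant speed in
    the flat coordinates. *)
Lemma rotating_pairs : exists V Z V' Z' : 'rV[A]_5,
  [/\ forall i, vderiv (Dt i) V = (tcst lam * cx c i) *: Z /\
    vderiv (Dt i) Z = - (tcst lam * cx c i) *: V,
    forall i, vderiv (Dt i) V' = (tcst lam * cy c i) *: Z' /\
    vderiv (Dt i) Z' = - (tcst lam * cy c i) *: V',
    [/\ <<V, V>> = 2, <<V, Z>> = 0, <<Z, Z>> = 2 & <<V', V'>> = 2] /\
    [/\ <<V', Z'>> = 0, <<Z', Z'>> = 2 & <<V, V'>> = 0],
    [/\ <<V, Z'>> = 0, <<Z, V'>> = 0 & <<Z, Z'>> = 0] & V + V' = F + F].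
Proof.
have [[x1 x2 x3 x4] [y1 y2 y3 y4]] := osc.
have vch i (V : 'rV[A]_5) : vderiv (Dt i) V = cx c i *: vfv (fX fr) V + cy c i *: vfv (fY fr) V.
  by rewrite frE; exact: vderiv_chart.
have combx (m a b : A) (U : 'rV[A]_5) : a *: (m *: U) + b *: 0 = (m * a) *: U.
  by rewrite scaler0 addr0 scalerA mulrC.
have comby (m a b : A) (U : 'rV[A]_5) : b *: 0 + a *: (m *: U) = (m * a) *: U.
  by rewrite scaler0 add0r scalerA mulrC.
have [Pf Px Py] := nP.
have fP : <<F, P>> = 0 by rewrite fdotC.
have xf : <<fx, F>> = 0 by rewrite fdotC. have yf : <<fy, F>> = 0 by rewrite fdotC.
have xP : <<fx, P>> = 0 by rewrite fdotC. have yP : <<fy, P>> = 0 by rewrite fdotC.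
have yx : <<fy, fx>> = 0 by rewrite fdotC (cm_xy cm).
have iP : iE * (iE * <<P, P>>) = 1 by rewrite PE4 (iEK cm) -[iE * E]mulr1 -mulrA (iEK cm).
have table := (ff, f_fx, f_fy, xf, yf, fP, Pf, xP, yP, Px, Py, yx, cm_xx cm, cm_yy cm, cm_xy cm).
exists xi, zx, eta, zy; split.
- by move=> i; rewrite !vch x1 x2 x3 x4; split; rewrite -?mulNr; exact: combx.
- by move=> i; rewrite !vch y1 y2 y3 y4; split; rewrite -?mulNr; exact: comby.
- by split; split; rewrite /xi /zx /eta /zy !(fdotBl, fdotBr, fdotDl, fdotDr, fdotZl, fdotZr);
    rewrite !table ?zz ?iP; ring.
- by split; rewrite /xi /zx /eta /zy !(fdotBl, fdotDr, fdotZl, fdotZr) !table; ring.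
- by rewrite /xi /eta addrACA addNr addr0.
Qed.
End SmallIndex.

(** * Developing maps of the plane *)

Section PlaneMaps.
Context {R : realType}.
Notation A := (torus_fun R).
Implicit Types (p q a b : R * R) (h : A).

(** Distance adapted to moving along one coordinate at a time. *)
Definition d1 p q : R := `|p.1 - q.1| + `|p.2 - q.2|.

Lemma d1_ge0 p q : 0 <= d1 p q. Proof. by rewrite addr_ge0. Qed.
Lemma d1C p q : d1 p q = d1 q p. Proof. by congr (_ + _); exact: distrC. Qed.
Lemma d1_tri q p r : d1 p r <= d1 p q + d1 q r.
Proof.
rewrite /d1 addrACA lerD //.
  by rewrite (le_trans _ (ler_normD _ _)) // addrA subrK.
by rewrite (le_trans _ (ler_normD _ _)) // addrA subrK.
Qed.
Lemma d1_eq0 p q : d1 p q <= 0 -> p = q.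
Proof.
move=> H; have : d1 p q = 0 by apply/eqP; rewrite eq_le H d1_ge0.
move=> /eqP; rewrite /d1 paddr_eq0 // !normr_eq0 !subr_eq0 => /andP[/eqP + /eqP].
by case: p q {H} => [p1 p2] [q1 q2] /= -> ->.
Qed.

Lemma zero_partials_const (h : R * R -> R) : has_partials h ->
  (forall i p, partial i h p = 0) -> forall p q, h p = h q.
Proof.
move=> dh h0 [p1 p2] [q1 q2].
have [c0 _ e0] := mvt0 q1 p1 p2 dh; have [c1 _ e1] := mvt1 q1 q2 p2 dh.
rewrite h0 mul0r in e0; rewrite h0 mul0r in e1.
by rewrite (subr0_eq e0) (subr0_eq e1).
Qed.

Lemma bounded_partials_lipschitz (h : R * R -> R) M : has_partials h ->
  (forall i p, `|partial i h p| <= M) -> forall p q, `|h p - h q| <= M * d1 p q.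
Proof.
move=> dh hM [p1 p2] [q1 q2].
have [c0 _ e0] := mvt0 q1 p1 p2 dh; have [c1 _ e1] := mvt1 q1 q2 p2 dh.
have -> : h (p1, p2) - h (q1, q2) = partial ord0 h (c0, p2) * (p1 - q1)
  + partial ord_max h (q1, c1) * (p2 - q2) by rewrite -e0 -e1; ring.
rewrite (le_trans (ler_normD _ _)) // !normrM /d1 /= mulrDr.
by apply: lerD; rewrite ler_wpM2r.
Qed.

Lemma torus_partials_lipschitz (H : R * R -> R) (h0 h1 : A) (phi : R * R -> R * R) :
  has_partials H -> partial ord0 H = h0 \o phi -> partial ord_max H = h1 \o phi ->
  exists2 M, 0 < M & forall p q, `|H p - H q| <= M * d1 p q.
Proof.
move=> dH e0 e1; have [M0 M00 H0] := torus_bounded h0; have [M1 M10 H1] := torus_bounded h1.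
exists (M0 + M1); first exact: addr_gt0.
apply: (bounded_partials_lipschitz dH) => i p; elim/ord2P: i; rewrite ?e0 ?e1 /=.
  by rewrite (le_trans (H0 _)) // lerDl ltW.
by rewrite (le_trans (H1 _)) // lerDr ltW.
Qed.

Lemma torus_lipschitz h : exists2 M, 0 < M & forall p q, `|h p - h q| <= M * d1 p q.
Proof.
exact: (@torus_partials_lipschitz h (td ord0 h) (td ord_max h) id (@torus_partials R h)).
Qed.

Lemma interior_min (g dg : R -> R) (a r s : R) : (forall x : R, is_derive x 1 g (dg x)) ->
  `|s - a| < r -> (forall x, `|x - a| <= r -> g s <= g x) -> dg s = 0.
Proof.
move=> dgP sr mn; have [_ <-] := dgP s.
suff [_ ->] : is_derive s 1 g 0 by [].
apply: (@derive1_at_min R _ (a - r) (a + r)) => [||| x].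
- by have := le_lt_trans (normr_ge0 _) sr; lra.
- by move=> x _; have [] := dgP x.
- by rewrite in_itv /= -ltr_distl.
- by rewrite in_itv /= => /andP[x1 x2]; apply: mn; rewrite ler_distl !ltW.
Qed.

Lemma cramer0 (i j k l x y : R) : i * l - j * k != 0 -> 2 * (x * i + y * k) = 0 ->
  2 * (x * j + y * l) = 0 -> x = 0 /\ y = 0.
Proof.
move=> D u v; split; apply: (mulfI D); rewrite mulr0.
  transitivity (2^-1 * (l * (2 * (x * i + y * k)) - k * (2 * (x * j + y * l)))); first by field.
  by rewrite u v !mulr0 subr0 mulr0.
transitivity (2^-1 * (i * (2 * (x * j + y * l)) - j * (2 * (x * i + y * k)))); first by field.
by rewrite u v !mulr0 subr0 mulr0.
Qed.

(** A map of the plane whose differential descends to the torus. *)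
Variables (c : chart R) (X Y : R * R -> R).
Hypotheses (sX : smooth X) (sY : smooth Y).
Hypotheses (X0 : partial ord0 X = cxs c) (X1 : partial ord_max X = cxt c).
Hypotheses (Y0 : partial ord0 Y = cys c) (Y1 : partial ord_max Y = cyt c).
Definition dev p : R * R := (X p, Y p).

Lemma increment (H : R * R -> R) (h0 h1 : A) M0 M1 : smooth H ->
  partial ord0 H = h0 -> partial ord_max H = h1 ->
  (forall p q, `|h0 p - h0 q| <= M0 * d1 p q) ->
  (forall p q, `|h1 p - h1 q| <= M1 * d1 p q) -> 0 <= M0 -> 0 <= M1 -> forall a b,
  `|H b - H a - (h0 a * (b.1 - a.1) + h1 a * (b.2 - a.2))|
    <= (M0 + M1) * d1 a b * d1 a b.
Proof.
move=> sH H0 H1 L0 L1 M00 M10 [a1 a2] [b1 b2] /=.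
have [c0 c0b e0] := mvt0 a1 b1 a2 (smooth_partials sH).
have [c1 c1b e1] := mvt1 b1 a2 b2 (smooth_partials sH).
have -> : H (b1, b2) - H (a1, a2) - (h0 (a1, a2) * (b1 - a1) + h1 (a1, a2) * (b2 - a2))
  = (h0 (c0, a2) - h0 (a1, a2)) * (b1 - a1) + (h1 (b1, c1) - h1 (a1, a2)) * (b2 - a2).
  rewrite H0 in e0; rewrite H1 in e1.
  have -> : H (b1, b2) - H (a1, a2) = h1 (b1, c1) * (b2 - a2) + h0 (c0, a2) * (b1 - a1).
    by rewrite -e0 -e1; ring.
  by ring.
rewrite (le_trans (ler_normD _ _)) // !normrM.
have d01 : d1 (c0, a2) (a1, a2) <= d1 (a1, a2) (b1, b2).
  rewrite /d1 /= subrr normr0 addr0 (le_trans c0b) // distrC lerDl //.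
have d11 : d1 (b1, c1) (a1, a2) <= d1 (a1, a2) (b1, b2).
  by rewrite /d1 /= [`|a1 - _|]distrC [`|a2 - _|]distrC lerD2l.
have u0 : `|h0 (c0, a2) - h0 (a1, a2)| <= M0 * d1 (a1, a2) (b1, b2).
  by rewrite (le_trans (L0 _ _)) // ler_wpM2l.
have u1 : `|h1 (b1, c1) - h1 (a1, a2)| <= M1 * d1 (a1, a2) (b1, b2).
  by rewrite (le_trans (L1 _ _)) // ler_wpM2l.
have v0 : `|b1 - a1| <= d1 (a1, a2) (b1, b2) by rewrite /d1 /= distrC lerDl.
have v1 : `|b2 - a2| <= d1 (a1, a2) (b1, b2) by rewrite /d1 /= [`|a2 - _|]distrC lerDr.
rewrite [X in _ <= X](_ : _ = M0 * d1 (a1, a2) (b1, b2) * d1 (a1, a2) (b1, b2)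
  + M1 * d1 (a1, a2) (b1, b2) * d1 (a1, a2) (b1, b2)); last by ring.
by apply: lerD; apply: ler_pM.
Qed.

(** The differential is invertible with bounds that are uniform because it
    descends to the compact torus, and Lipschitz continuous. *)
Lemma dev_expands : exists2 C, 0 < C & exists2 d, 0 < d &
  forall a b, d1 a b <= d -> d1 a b <= C * d1 (dev a) (dev b).
Proof.
have [Ma Ma0 La] := torus_lipschitz (cxs c); have [Mb Mb0 Lb] := torus_lipschitz (cxt c).
have [Mc Mc0 Lc] := torus_lipschitz (cys c); have [Md Md0 Ld] := torus_lipschitz (cyt c).
have [Ba Ba0 Ha] := torus_bounded (cxs c); have [Bb Bb0 Hb] := torus_bounded (cxt c).
have [Bc Bc0 Hc] := torus_bounded (cys c); have [Bd Bd0 Hd] := torus_bounded (cyt c).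
have [q0 Hq] := torus_min (jac c); have m0 : 0 < jac c q0 by exact: chart_det.
set m := jac c q0 in Hq m0.
pose B := Ba + Bb + Bc + Bd; have B0 : 0 < B by rewrite /B; lra.
pose L := Ma + Mb + Mc + Md; have L0 : 0 < L by rewrite /L; lra.
exists (4 * B / m); first by rewrite divr_gt0 // mulr_gt0.
exists (m / (8 * B * L)); first by rewrite divr_gt0 // !mulr_gt0.
move=> a b ab.
have eX := increment sX X0 X1 La Lb (ltW Ma0) (ltW Mb0) a b.
have eY := increment sY Y0 Y1 Lc Ld (ltW Mc0) (ltW Md0) a b.
set D := d1 a b in ab eX eY *; have D0 : 0 <= D by exact: d1_ge0.
set u := b.1 - a.1 in eX eY; set v := b.2 - a.2 in eX eY.
have DE : D = `|u| + `|v| by rewrite /D /u /v /d1 distrC [`|a.2 - _|]distrC.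
set rX := X b - X a - _ in eX; set rY := Y b - Y a - _ in eY.
have jE : jac c a = cxs c a * cyt c a - cxt c a * cys c a by [].
have mj := Hq a.
have uE : jac c a * u = cyt c a * (X b - X a) - cxt c a * (Y b - Y a)
   - (cyt c a * rX - cxt c a * rY) by rewrite jE /rX /rY; ring.
have vE : jac c a * v = cxs c a * (Y b - Y a) - cys c a * (X b - X a)
   - (cxs c a * rY - cys c a * rX) by rewrite jE /rX /rY; ring.
have lin (s t x y z w S T : R) : `|s| <= S -> `|t| <= T ->
   `|s * x - t * y - (s * z - t * w)| <= S * (`|x| + `|z|) + T * (`|y| + `|w|).
  move=> sS tT; have -> : s * x - t * y - (s * z - t * w) = s * (x - z) - t * (y - w) by ring.
  rewrite (le_trans (ler_normB _ _)) // !normrM.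
  by apply: lerD; apply: ler_pM => //; exact: ler_normB.
have mw w : m * `|w| <= `|jac c a * w|.
  by rewrite normrM ler_wpM2r // ger0_norm // (le_trans (ltW m0)).
have Ba' : `|cxs c a| <= B by rewrite (le_trans (Ha a)) // /B; lra.
have Bb' : `|cxt c a| <= B by rewrite (le_trans (Hb a)) // /B; lra.
have Bc' : `|cys c a| <= B by rewrite (le_trans (Hc a)) // /B; lra.
have Bd' : `|cyt c a| <= B by rewrite (le_trans (Hd a)) // /B; lra.
have l1 := lin _ _ (X b - X a) (Y b - Y a) rX rY _ _ Bd' Bb'.
have l2 := lin _ _ (Y b - Y a) (X b - X a) rY rX _ _ Ba' Bc'.
rewrite -uE in l1; rewrite -vE in l2.
have DpE : d1 (dev a) (dev b) = `|X b - X a| + `|Y b - Y a|.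
  by rewrite /d1 /= distrC [`|Y a - _|]distrC.
set DX := `|X b - X a| in l1 l2 DpE; set DY := `|Y b - Y a| in l1 l2 DpE.
have DX0 : 0 <= DX by rewrite /DX. have DY0 : 0 <= DY by rewrite /DY.
have LD : L * D <= m / (8 * B).
  have := ler_wpM2l (ltW L0) ab.
  have -> : L * (m / (8 * B * L)) = m / (8 * B) by field; rewrite !gt_eqF.
  by [].
have rXb : `|rX| <= m / (8 * B) * D.
  rewrite (le_trans eX) // ler_wpM2r // (le_trans _ LD) // ler_wpM2r // /L; lra.
have rYb : `|rY| <= m / (8 * B) * D.
  rewrite (le_trans eY) // ler_wpM2r // (le_trans _ LD) // ler_wpM2r // /L; lra.
set eps := m / (8 * B) * D in rXb rYb.
have Beps : B * eps = m * D / 8 by rewrite /eps; field; rewrite gt_eqF.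
have {}l1 : `|jac c a * u| <= B * (DX + eps) + B * (DY + eps).
  by rewrite (le_trans l1) // lerD // ler_wpM2l ?lerD2l // ltW.
have {}l2 : `|jac c a * v| <= B * (DY + eps) + B * (DX + eps).
  by rewrite (le_trans l2) // lerD // ler_wpM2l ?lerD2l // ltW.
have H3 : m * D <= 2 * (B * (DX + DY)) + 4 * (B * eps).
  rewrite DE mulrDr (le_trans (lerD (le_trans (mw u) l1) (le_trans (mw v) l2))) //.
  by rewrite le_eqVlt; apply/orP; left; apply/eqP; ring.
rewrite Beps in H3.
rewrite DpE mulrAC ler_pdivlMr // mulrC.
by rewrite -[4 * B * _]mulrA; move: H3; move: (m * D) (B * _) => x y; lra.
Qed.

(** The squared distance to [y] attains its minimum over a box inside the box,
    since it is larger on the boundary by the expansion property. A critical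
    point of it is a zero, since the differential is invertible. *)
Lemma dev_onto (C d : R) : 0 < C -> 0 < d ->
  (forall a b, d1 a b <= d -> d1 a b <= C * d1 (dev a) (dev b)) ->
  forall p y, d1 y (dev p) <= d / (8 * C) ->
  exists2 q, d1 q p <= d & dev q = y.
Proof.
move=> C0 d0 ex [p1 p2] [y1 y2] yp; pose r := d / 2.
have r0 : 0 < r by rewrite divr_gt0.
pose K : set (R * R) := `[p1 - r, p1 + r] `*` `[p2 - r, p2 + r].
have cK : compact K by apply: compact_setX; exact: segment_compact.
have KE q : K q <-> `|q.1 - p1| <= r /\ `|q.2 - p2| <= r.
  by rewrite /K /= !in_itv /= -!ler_distl.
have Kp : K (p1, p2) by apply/KE; rewrite /= !subrr normr0 !ltW.
pose g q := (X q - y1) * (X q - y1) + (Y q - y2) * (Y q - y2).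
have sg : smooth g.
  by apply: smoothD; apply: smoothM; apply: smoothD => //; exact: smooth_cst.
have [|||q0 Kq0 qmin] := @compact_EVT_min _ R g K.
- by exists (p1, p2).
- exact: cK.
- by apply: continuous_subspaceT; exact: smooth_continuous.
move: q0 Kq0 qmin => [s t] Kst qmin.
have Kd q : K q -> d1 q (p1, p2) <= d.
  by move=> /KE[]; rewrite /d1 /= /r; lra.
move: Kst; rewrite inE => Kst; exists (s, t); first exact: Kd.
have bd q : K q -> r <= d1 q (p1, p2) -> g (s, t) < g q.
  move=> Kq rq; apply: (@le_lt_trans _ _ (g (p1, p2))).
    by apply: qmin; rewrite inE.
  have := ex _ _ (Kd _ Kq); rewrite /d1 /g /= in rq yp *.
  set x1 := X q - X (p1, p2); set x2 := Y q - Y (p1, p2) => H.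
  have rC : r <= C * (`|x1| + `|x2|) by exact: le_trans H.
  have -> : X q - y1 = x1 - (y1 - X (p1, p2)) by rewrite /x1; ring.
  have -> : Y q - y2 = x2 - (y2 - Y (p1, p2)) by rewrite /x2; ring.
  have -> : X (p1, p2) - y1 = - (y1 - X (p1, p2)) by ring.
  have -> : Y (p1, p2) - y2 = - (y2 - Y (p1, p2)) by ring.
  move: yp; set z1 := y1 - _; set z2 := y2 - _ => yp.
  set eta := d / (8 * C) in yp; have eta0 : 0 < eta by rewrite divr_gt0 // mulr_gt0.
  have re : 4 * eta <= `|x1| + `|x2|.
    rewrite -(ler_pM2l C0) (le_trans _ rC) // /eta /r.
    have -> : C * (4 * (d / (8 * C))) = d / 2 by field; rewrite gt_eqF.
    by [].
  have n1 : `|x1| - `|z1| <= `|x1 - z1| by exact: lerB_dist.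
  have n2 : `|x2| - `|z2| <= `|x2 - z2| by exact: lerB_dist.
  rewrite !mulrNN -!expr2 -(real_normK (num_real z1)) -(real_normK (num_real z2)).
  rewrite -(real_normK (num_real (x1 - z1))) -(real_normK (num_real (x2 - z2))).
  have := normr_ge0 z1; have := normr_ge0 z2.
  move: (`|x1|) (`|x2|) (`|z1|) (`|z2|) (`|x1 - z1|) (`|x2 - z2|) yp re n1 n2.
  move=> a1 a2 b1 b2 w1 w2 yp re n1 n2 b10 b20.
  have w12 : 3 * eta <= w1 + w2 by lra.
  have h1 : b1 ^+ 2 + b2 ^+ 2 <= eta ^+ 2 by nra.
  have h2 : (w1 + w2) ^+ 2 <= 2 * (w1 ^+ 2 + w2 ^+ 2).
    by have := sqr_ge0 (w1 - w2); rewrite sqrrB sqrrD; lra.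
  have h3 : 9 * eta ^+ 2 <= (w1 + w2) ^+ 2.
    have -> : 9 * eta ^+ 2 = (3 * eta) ^+ 2 by ring.
    by rewrite lerXn2r ?nnegrE //; lra.
  by have := exprn_gt0 2 eta0; lra.
have bdf : r <= d1 (s, t) (p1, p2) -> False by move=> /(bd _ Kst); rewrite ltxx.
have /KE[/= k1 k2] := Kst.
have inner1 : `|s - p1| < r.
  by rewrite lt_neqAle k1 andbT; apply/eqP => H; apply: bdf; rewrite /d1 /= H lerDl.
have inner2 : `|t - p2| < r.
  by rewrite lt_neqAle k2 andbT; apply/eqP => H; apply: bdf; rewrite /d1 /= H lerDr.
have dX := smooth_partials sX; have dY := smooth_partials sY.
have g0 : 2 * ((X (s, t) - y1) * cxs c (s, t) + (Y (s, t) - y2) * cys c (s, t)) = 0.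
  have dg (x : R) : is_derive x 1 (fun x => g (x, t))
    (2 * ((X (x, t) - y1) * cxs c (x, t) + (Y (x, t) - y2) * cys c (x, t))).
    have hx := is_derive_slice0 x t dX; have hy := is_derive_slice0 x t dY.
    rewrite X0 in hx; rewrite Y0 in hy; rewrite /g; apply: is_derive_eq.
    by rewrite !subr0 /GRing.scale /=; ring.
  by apply: (interior_min dg inner1) => x xr; apply: qmin; rewrite inE; apply/KE.
have g1 : 2 * ((X (s, t) - y1) * cxt c (s, t) + (Y (s, t) - y2) * cyt c (s, t)) = 0.
  have dg (x : R) : is_derive x 1 (fun x => g (s, x))
    (2 * ((X (s, x) - y1) * cxt c (s, x) + (Y (s, x) - y2) * cyt c (s, x))).
    have hx := is_derive_slice1 s x dX; have hy := is_derive_slice1 s x dY.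
    rewrite X1 in hx; rewrite Y1 in hy; rewrite /g; apply: is_derive_eq.
    by rewrite !subr0 /GRing.scale /=; ring.
  by apply: (interior_min dg inner2) => x xr; apply: qmin; rewrite inE; apply/KE.
have D0 : cxs c (s, t) * cyt c (s, t) - cxt c (s, t) * cys c (s, t) != 0.
  by rewrite gt_eqF //; exact: (chart_det c (s, t)).
have [e1 e2] := cramer0 D0 g0 g1.
by rewrite /dev; congr (_, _); apply/eqP; rewrite -subr_eq0 ?e1 ?e2.
Qed.
End PlaneMaps.

(** * Primitives of closed forms *)

Section Potentials.
Context {R : realType}.
Notation A := (torus_fun R).

(** A quadratic error bound is the form in which derivatives of limits,
    primitives and inverse maps are found below. *)
Lemma is_derive_quadratic (G : R -> R) (t d K eta : R) : 0 < eta ->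
  (forall h, `|h| <= eta -> `|G (t + h) - G t - d * h| <= K * h ^+ 2) -> is_derive t (1 : R) G d.
Proof.
move=> eta0 H.
have cv : h^-1 *: ((G \o shift t) (h *: (1 : R)) - G t) @[h --> (0 : R)^'] --> d.
  apply/cvgrPdist_le => eps eps0; near=> h.
  have h0 : h != 0 by near: h; exact: nbhs_dnbhs_neq.
  have hs : `|h| <= eps / (`|K| + 1).
    by near: h; apply: dnbhs0_le; rewrite divr_gt0 // ltr_wpDl.
  have he : `|h| <= eta by near: h; exact: dnbhs0_le.
  have -> : d - h^-1 *: ((G \o shift t) (h *: 1) - G t)
    = - (h^-1 * (G (t + h) - G t - d * h)).
    have -> : (G \o shift t) (h *: 1) = G (t + h) by rewrite /= /GRing.scale /= mulr1 addrC.
    by rewrite /GRing.scale /=; field.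
  rewrite normrN normrM normfV mulrC ler_pdivrMr ?normr_gt0 //.
  apply: (le_trans (H h he)); rewrite -[h ^+ 2]real_normK ?num_real // expr2 mulrA.
  rewrite ler_wpM2r //.
  have K1 : 0 < `|K| + 1 by rewrite ltr_wpDl.
  apply: (@le_trans _ _ ((`|K| + 1) * `|h|)).
    by rewrite ler_wpM2r // (le_trans (ler_norm K)) // lerDl.
  by rewrite mulrC -ler_pdivlMr.
apply: DeriveDef; first by apply: (cvgP d); exact: cv.
by apply: cvg_lim; [exact: Rhausdorff|exact: cv].
Unshelve. all: by end_near.
Qed.

Lemma lipschitz_continuous (h : R * R -> R) M :
  (forall p q, `|h p - h q| <= M * d1 p q) -> continuous h.
Proof.
move=> H p; apply/cvgrPdist_le => eps eps0.
have M1 : 0 < `|M| + 1 by rewrite ltr_wpDl.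
have e2 : 0 < eps / (`|M| + 1) / 2 by rewrite !divr_gt0.
have c1 : \forall q \near p, `|p.1 - q.1| <= eps / (`|M| + 1) / 2.
  have Hc : (fun q : R * R => q.1) @ p --> p.1 by exact: cvg_fst.
  apply: (Hc [set x | `|p.1 - x| <= eps / (`|M| + 1) / 2]).
  by apply/nbhs_ballP; exists (eps / (`|M| + 1) / 2) => //= x; exact: ltW.
have c2 : \forall q \near p, `|p.2 - q.2| <= eps / (`|M| + 1) / 2.
  have Hc : (fun q : R * R => q.2) @ p --> p.2 by exact: cvg_snd.
  apply: (Hc [set x | `|p.2 - x| <= eps / (`|M| + 1) / 2]).
  by apply/nbhs_ballP; exists (eps / (`|M| + 1) / 2) => //= x; exact: ltW.
near=> q; have b1 : `|p.1 - q.1| <= eps / (`|M| + 1) / 2 by near: q; exact: c1.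
have b2 : `|p.2 - q.2| <= eps / (`|M| + 1) / 2 by near: q; exact: c2.
have d : d1 p q <= eps / (`|M| + 1) by rewrite /d1; move: b1 b2; lra.
apply: (le_trans (H p q)); apply: (@le_trans _ _ ((`|M| + 1) * d1 p q)).
  by rewrite ler_wpM2r ?d1_ge0 // (le_trans (ler_norm M)) // lerDl.
by rewrite mulrC -ler_pdivlMr.
Unshelve. all: by end_near.
Qed.

Lemma torus_partials_continuous (H : R * R -> R) (h0 h1 : A) (phi : R * R -> R * R) :
  has_partials H -> partial ord0 H = h0 \o phi -> partial ord_max H = h1 \o phi -> continuous H.
Proof. by move=> dH e0 e1; have [M _] := torus_partials_lipschitz dH e0 e1; exact: lipschitz_continuous. Qed.

(** Integrate in the first variable; closedness bounds the increments of the
    result in the second one. *)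
Lemma closed_potential (p q : A) : td ord_max p = td ord0 q ->
  exists X : R * R -> R, [/\ smooth X, partial ord0 X = p & partial ord_max X = q].
Proof.
move=> cl.
have sl h := continuous_slices (@torus_continuous R h).
have prim (f : R -> R) : continuous f ->
    exists F : R -> R, (forall x : R, is_derive x (1 : R) F (f x)) /\ F 0 = 0.
  move=> /antiderivative[F dF]; exists (fun x => F x - F 0); split; last by rewrite subrr.
  move=> x; have dFx := dF x.
  by rewrite -[f x]subr0; apply: is_deriveB.
have PE t := cid (prim _ ((sl p).1 t)); pose P0 t := sval (PE t).
have dP t s : is_derive s (1 : R) (P0 t) (p (s, t)) by rewrite /P0; case: (PE t) => F [].
have P00 t : P0 t 0 = 0 by rewrite /P0; case: (PE t) => F [].
have [Q [dQ Q0]] := prim _ ((sl q).2 0).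
pose X (z : R * R) := P0 z.2 z.1 + Q z.2.
have [M M0 LM] := torus_lipschitz (td ord0 q).
(* The increment of the primitive in the second variable, by the mean value
   theorem applied twice. *)
have quad s t h : `|X (s, t + h) - X (s, t) - q (s, t) * h - (Q (t + h) - Q t - q (0, t) * h)|
    <= M * `|s| * h ^+ 2.
  pose g x := P0 (t + h) x - P0 t x - q (x, t) * h.
  pose dg x := p (x, t + h) - p (x, t) - td ord0 q (x, t) * h.
  have dgP (x : R) : is_derive x (1 : R) g (dg x).
    have d1' := dP (t + h) x; have d2' := dP t x.
    have d3' := is_derive_slice0 x t (@torus_partials R q).
    rewrite /g; apply: is_derive_eq; rewrite /dg !scaler0 ?addr0 ?add0r.
    by rewrite [_ *: _]mulrC.
  have [x _ gx] := mvt_real 0 s dgP.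
  have -> : X (s, t + h) - X (s, t) - q (s, t) * h - (Q (t + h) - Q t - q (0, t) * h)
    = g s - g 0 by rewrite /X /g /= !P00; ring.
  rewrite gx subr0 normrM.
  have [y yb py] := mvt1 x t (t + h) (@torus_partials R p).
  have -> : dg x = (td ord0 q (x, y) - td ord0 q (x, t)) * h.
    rewrite /dg py [t + h]addrC addrK.
    have -> : partial ord_max p (x, y) = td ord0 q (x, y) by rewrite -cl.
    by ring.
  have yt : d1 (x, y) (x, t) <= `|h|.
    by rewrite /d1 /= subrr normr0 add0r (le_trans yb) // [t + h]addrC addrK.
  rewrite normrM -[h ^+ 2]real_normK ?num_real //.
  have := LM (x, y) (x, t); move: yt; move: (d1 _ _) (`|_ - _|) => d w dh wd.
  have : w * `|h| <= M * `|h| * `|h|.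
    by rewrite ler_wpM2r // (le_trans wd) // ler_wpM2l // ltW.
  have := normr_ge0 s; move: (`|s|) (`|h|) => a b a0 H.
  have -> : M * a * b ^+ 2 = M * b * b * a by ring.
  by rewrite ler_wpM2r.
have dX0 (s t : R) : is_derive s (1 : R) (fun x => X (x, t)) (p (s, t)).
  have := dP t s => dPs; rewrite /X /= -[p _]addr0.
  exact: is_deriveD.
have dX1 (s t : R) : is_derive t (1 : R) (fun x => X (s, x)) (q (s, t)).
  have H : is_derive t (1 : R) (fun x => X (s, x) - Q x) (q (s, t) - q (0, t)).
    apply: (@is_derive_quadratic _ _ _ (M * `|s|) 1) => // h _.
    rewrite (le_trans _ (quad s t h)) //.
    by rewrite le_eqVlt; apply/orP; left; apply/eqP; congr (`|_|); ring.
  have -> : (fun x => X (s, x)) = (fun x => X (s, x) - Q x) \+ Q.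
    by apply/funext => x /=; rewrite subrK.
  rewrite -[q (s, t)](subrK (q (0, t))).
  exact: is_deriveD.
have [dX E0 E1] := partials_of_slices dX0 dX1.
exists X; split=> //; apply/smoothE; split=> //.
  exact: (@torus_partials_continuous X p q id).
by move=> i; elim/ord2P: i; rewrite ?E0 ?E1; exact: torus_smooth.
Qed.
End Potentials.

(** * Flat surfaces are products of circles *)

Section Oscillator.
Context {R : realType} {n : nat}.
Notation A := (torus_fun R).
Variables (V Z : 'rV[A]_n) (w : 'I_2 -> A) (X : R * R -> R).
Hypotheses (sX : smooth X) (Xw : forall i, partial i X = w i).
Hypotheses (dV : forall i, vderiv (Dt i) V = w i *: Z).
Hypotheses (dZ : forall i, vderiv (Dt i) Z = - w i *: V).

Lemma cos_partial i : partial i (cos \o X) = fun p => - sin (X p) * w i p.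
Proof.
have [_ ->] := @partial_comp R cos (fun x => - sin x) setT X i (fun x _ => is_derive_cos x)
  (fun _ => I) (smooth_partials sX).
by apply/funext => p; rewrite Xw.
Qed.
Lemma sin_partial i : partial i (sin \o X) = fun p => cos (X p) * w i p.
Proof.
have [_ ->] := @partial_comp R sin cos setT X i (fun x _ => is_derive_sin x)
  (fun _ => I) (smooth_partials sX).
by apply/funext => p; rewrite Xw.
Qed.

(** The vectors obtained by rotating back by the angle [X] have zero
    derivative. *)
Lemma oscillator : exists a b : 'rV[R]_n, forall p,
  [/\ veval V p = cos (X p) *: a + sin (X p) *: b,
    a = cos (X p) *: veval V p - sin (X p) *: veval Z p &
    b = sin (X p) *: veval V p + cos (X p) *: veval Z p].
Proof.
have [ss sc] := smooth_sincos sX.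
have dc := smooth_partials sc; have ds := smooth_partials ss.
have cst (h k : A) (C S : R * R -> R) (dC dS : 'I_2 -> R * R -> R) :
    has_partials C -> has_partials S -> (forall i, partial i C = dC i) ->
    (forall i, partial i S = dS i) ->
    (forall i p, dC i p * h p + C p * td i h p + (dS i p * k p + S p * td i k p) = 0) ->
    forall p q, C p * h p + S p * k p = C q * h q + S q * k q.
  move=> hC hS eC eS H p q.
  have hh := @torus_partials R h; have hk := @torus_partials R k.
  apply: (@zero_partials_const R (fun p => C p * h p + S p * k p)).
    move=> i z; apply: derivableD; apply: derivableM.
    - exact: hC.
    - exact: hh.
    - exact: hS.
    - exact: hk.
  move=> i z; rewrite (partialD i (h := fun p => C p * h p) (k := fun p => S p * k p)).
  - by rewrite (partialM i hC hh) (partialM i hS hk) eC eS; exact: H.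
  - by move=> j y; apply: derivableM; [exact: hC|exact: hh].
  - by move=> j y; apply: derivableM; [exact: hS|exact: hk].
have Vb i b : td i (V ord0 b) = w i * Z ord0 b.
  have H := congr1 (fun U : 'rV[A]_n => U ord0 b) (dV i).
  by rewrite vderiv_entry mxE in H; exact: H.
have Zb i b : td i (Z ord0 b) = - (w i * V ord0 b).
  have H := congr1 (fun U : 'rV[A]_n => U ord0 b) (dZ i).
  by rewrite vderiv_entry mxE mulNr in H; exact: H.
pose a p : 'rV[R]_n := cos (X p) *: veval V p - sin (X p) *: veval Z p.
pose b p : 'rV[R]_n := sin (X p) *: veval V p + cos (X p) *: veval Z p.
have aC p q : a p = a q.
  apply/matrixP => i j; rewrite ord1 !mxE -!mulNr.
  have hS : has_partials (fun p => - (sin \o X) p).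
    by move=> l z; apply: derivableN; exact: ds.
  apply: (cst (V ord0 j) (Z ord0 j) (cos \o X) (fun p => - (sin \o X) p)
    (fun i p => - sin (X p) * w i p) (fun i p => - (cos (X p) * w i p)) dc hS) => l.
  - exact: cos_partial.
  - by rewrite (partialN l ds) sin_partial.
  - by move=> z; rewrite Vb Zb torusN !torusM /=; ring.
have bC p q : b p = b q.
  apply/matrixP => i j; rewrite ord1 !mxE.
  apply: (cst (V ord0 j) (Z ord0 j) (sin \o X) (cos \o X)
    (fun i p => cos (X p) * w i p) (fun i p => - sin (X p) * w i p) ds dc) => l.
  - exact: sin_partial.
  - exact: cos_partial.
  - by move=> z; rewrite Vb Zb torusN !torusM /=; ring.
exists (a (0, 0)), (b (0, 0)) => p; rewrite (aC _ p) (bC _ p); split=> //.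
apply/matrixP => i j; rewrite /a /b !mxE.
have := cos2Dsin2 (X p); move: (cos (X p)) (sin (X p)) => C S CS.
by rewrite -[LHS]mul1r -CS; ring.
Qed.
End Oscillator.

Definition clifford_angles {R : realType} (x y : R) : 'rV[R]_4 :=
  (Num.sqrt 2)^-1 *: \row_(a < 4) [:: cos x; sin x; cos y; sin y]`_a.

Section FlatForm.
Context {R : realType}.
Notation A := (torus_fun R).
Variables (F V Z V' Z' : 'rV[A]_5) (w w' : 'I_2 -> A) (X Y : R * R -> R).
Hypotheses (sX : smooth X) (sY : smooth Y).
Hypotheses (Xw : forall i, partial i X = w i) (Yw : forall i, partial i Y = w' i).
Hypothesis dV : forall i, vderiv (Dt i) V = w i *: Z /\ vderiv (Dt i) Z = - w i *: V.
Hypothesis dV' : forall i, vderiv (Dt i) V' = w' i *: Z' /\ vderiv (Dt i) Z' = - w' i *: V'.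
Hypotheses (VV : vdot V V = 2) (VZ : vdot V Z = 0) (ZZ : vdot Z Z = 2).
Hypotheses (VV' : vdot V' V' = 2) (VZ' : vdot V' Z' = 0) (ZZ' : vdot Z' Z' = 2).
Hypotheses (c1 : vdot V V' = 0) (c2 : vdot V Z' = 0) (c3 : vdot Z V' = 0) (c4 : vdot Z Z' = 0).
Hypothesis FF : V + V' = F + F.

Lemma flat_form : exists M : 'M[R]_(4, 5), M *m M^T = 1%:M /\
    forall p, veval F p = clifford_angles (X p) (Y p) *m M.
Proof.
have [a [b Hab]] := oscillator sX Xw (fun i => (dV i).1) (fun i => (dV i).2).
have [a' [b' Hab']] := oscillator sY Yw (fun i => (dV' i).1) (fun i => (dV' i).2).
pose p0 : R * R := (0, 0); have [_ aE bE] := Hab p0; have [_ aE' bE'] := Hab' p0.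
have D2 (U W : 'rV[A]_5) : vdot U W = 2 -> dot (veval U p0) (veval W p0) = 2.
  by move=> E; rewrite dot_veval E.
have D0 (U W : 'rV[A]_5) : vdot U W = 0 -> dot (veval U p0) (veval W p0) = 0.
  by move=> E; rewrite dot_veval E.
move: aE bE aE' bE' (D2 _ _ VV) (D0 _ _ VZ) (D2 _ _ ZZ) (D2 _ _ VV') (D0 _ _ VZ') (D2 _ _ ZZ')
  (D0 _ _ c1) (D0 _ _ c2) (D0 _ _ c3) (D0 _ _ c4).
move: (veval V p0) (veval Z p0) (veval V' p0) (veval Z' p0) => v1 v2 v3 v4.
have k1 := cos2Dsin2 (X p0); have k2 := cos2Dsin2 (Y p0).
move: k1 k2; move: (cos (X p0)) (sin (X p0)) (cos (Y p0)) (sin (Y p0)) => C S C' S' k1 k2.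
move=> aE bE aE' bE' d1 d2 d3 d4 d5 d6 d7 d8 d9 d10.
pose rows (i : 'I_4) := nth 0 [:: a; b; a'; b'] i.
have rowsE i j : dot (rows i) (rows j) = 2 * (i == j)%:R.
  have sum1 : forall k k' : R, k ^+ 2 + k' ^+ 2 = 1 -> k * (k * 2) + k' * (k' * 2) = 2.
    by move=> k k' H; rewrite -[RHS]mulr1 -H; ring.
  have aa : dot a a = 2.
    by rewrite aE !dotBl !dotBr !dotZl !dotZr (dotC v2 v1) d1 d2 d3 -[RHS](sum1 _ _ k1); ring.
  have bb : dot b b = 2.
    by rewrite bE !dotDl !dotDr !dotZl !dotZr (dotC v2 v1) d1 d2 d3 -[RHS](sum1 _ _ k1); ring.
  have ab : dot a b = 0.
    by rewrite aE bE !dotBl !dotDr !dotZl !dotZr (dotC v2 v1) d1 d2 d3; ring.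
  have aa' : dot a' a' = 2.
    by rewrite aE' !dotBl !dotBr !dotZl !dotZr (dotC v4 v3) d4 d5 d6 -[RHS](sum1 _ _ k2); ring.
  have bb' : dot b' b' = 2.
    by rewrite bE' !dotDl !dotDr !dotZl !dotZr (dotC v4 v3) d4 d5 d6 -[RHS](sum1 _ _ k2); ring.
  have ab' : dot a' b' = 0.
    by rewrite aE' bE' !dotBl !dotDr !dotZl !dotZr (dotC v4 v3) d4 d5 d6; ring.
  have m1 : dot a a' = 0 by rewrite aE aE' !dotBl !dotBr !dotZl !dotZr d7 d8 d9 d10; ring.
  have m2 : dot a b' = 0 by rewrite aE bE' !dotBl !dotDr !dotZl !dotZr d7 d8 d9 d10; ring.
  have m3 : dot b a' = 0 by rewrite bE aE' !dotDl !dotBr !dotZl !dotZr d7 d8 d9 d10; ring.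
  have m4 : dot b b' = 0 by rewrite bE bE' !dotDl !dotDr !dotZl !dotZr d7 d8 d9 d10; ring.
  case: i => [[|[|[|[|//]]]] Hi]; case: j => [[|[|[|[|//]]]] Hj];
    rewrite /rows /= ?(dotC b a) ?(dotC a' a) ?(dotC a' b) ?(dotC b' a) ?(dotC b' b)
    ?(dotC b' a') ?aa ?bb ?ab ?aa' ?bb' ?ab' ?m1 ?m2 ?m3 ?m4 ?mulr0 ?mulr1 //.
pose s : R := (Num.sqrt 2)^-1.
have ss : s * s = 2^-1 by rewrite -invfM -expr2 sqr_sqrtr.
exists (\matrix_i (s *: rows i)); split.
  apply/matrixP => i j; rewrite mxE [RHS]mxE.
  transitivity (dot (s *: rows i) (s *: rows j)).
    by apply: eq_bigr => k _; rewrite !mxE.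
  by rewrite dotZl dotZr rowsE !mulrA ss mulVf ?mul1r.
move=> p; have [Vp _ _] := Hab p; have [Wp _ _] := Hab' p.
have FE : veval F p = 2^-1 *: (veval V p + veval V' p).
  rewrite -vevalD FF vevalD; move: (veval F p) => v.
  by apply/matrixP => i j; rewrite !mxE; field.
rewrite FE Vp Wp /clifford_angles -scalemxAl mulmx_sum_row !big_ord_recl big_ord0 !rowK.
rewrite /rows !mxE /= -/s; apply/matrixP => i j; rewrite !mxE -ss.
by move: (a i j) (b i j) (a' i j) (b' i j) => *; ring.
Qed.
End FlatForm.

(** * The inverse of a developing map *)

Section GlobalInverse.
Context {R : realType}.
Notation A := (torus_fun R).
Variables (c : chart R) (X Y : R * R -> R).
Hypotheses (sX : smooth X) (sY : smooth Y).
Hypotheses (X0 : partial ord0 X = cxs c) (X1 : partial ord_max X = cxt c).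
Hypotheses (Y0 : partial ord0 Y = cys c) (Y1 : partial ord_max Y = cyt c).
Notation dev := (dev X Y).
Implicit Types (p q a b y z : R * R).

Lemma dev_lipschitz : exists2 L, 0 < L & forall a b, d1 (dev a) (dev b) <= L * d1 a b.
Proof.
have [K K0 hX] := @torus_partials_lipschitz _ X (cxs c) (cxt c) id (smooth_partials sX) X0 X1.
have [L L0 hY] := @torus_partials_lipschitz _ Y (cys c) (cyt c) id (smooth_partials sY) Y0 Y1.
exists (K + L) => [|a b]; first exact: addr_gt0.
by rewrite mulrDl; apply: lerD; [exact: hX|exact: hY].
Qed.

Definition lerp (t : R) y z : R * R := (y.1 + t * (z.1 - y.1), y.2 + t * (z.2 - y.2)).

Lemma lerp0 y z : lerp 0 y z = y.
Proof. by case: y => y1 y2; rewrite /lerp !mul0r !addr0. Qed.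
Lemma lerp1 y z : lerp 1 y z = z.
Proof. by case: z => z1 z2; rewrite /lerp !mul1r; congr (_, _); rewrite addrC subrK. Qed.
Lemma lerp_same t y : lerp t y y = y.
Proof. by case: y => y1 y2; rewrite /lerp !subrr !mulr0 !addr0. Qed.
Lemma d1_lerp s t y z : d1 (lerp s y z) (lerp t y z) = `|s - t| * d1 y z.
Proof.
rewrite /d1 mulrDr; congr (_ + _).
  transitivity `|(s - t) * (y.1 - z.1)|; last exact: normrM.
  by rewrite -normrN; congr (`|_|); rewrite /lerp /=; ring.
transitivity `|(s - t) * (y.2 - z.2)|; last exact: normrM.
by rewrite -normrN; congr (`|_|); rewrite /lerp /=; ring.
Qed.
Lemma d1_lerpr t y z z' : d1 (lerp t y z) (lerp t y z') = `|t| * d1 z z'.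
Proof.
rewrite /d1 mulrDr; congr (_ + _).
  transitivity `|t * (z.1 - z'.1)|; last exact: normrM.
  by congr (`|_|); rewrite /lerp /=; ring.
transitivity `|t * (z.2 - z'.2)|; last exact: normrM.
by congr (`|_|); rewrite /lerp /=; ring.
Qed.

Section Lift.
Variables (C d eta : R).
Hypotheses (C0 : 0 < C) (d0 : 0 < d) (eta0 : 0 < eta).
Hypothesis ex : forall a b, d1 a b <= d -> d1 a b <= C * d1 (dev a) (dev b).
Hypothesis onto : forall p y, d1 y (dev p) <= eta -> exists2 q, d1 q p <= d / 4 & dev q = y.

Definition step p y := if pselect (exists2 q, d1 q p <= d / 4 & dev q = y) is left H
  then s2val (cid2 H) else p.

Lemma stepP p y : d1 y (dev p) <= eta -> d1 (step p y) p <= d / 4 /\ dev (step p y) = y.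
Proof.
by move=> /onto H; rewrite /step; case: pselect => // H'; split;
  [exact: (s2valP (cid2 H'))|exact: (s2valP' (cid2 H'))].
Qed.

Variable a : R * R.
(** Discrete lift, starting at [a], of the segment from [dev a] to [y]. *)
Fixpoint lift_seg (N k : nat) y : R * R := if k is k'.+1
  then step (lift_seg N k' y) (lerp (k%:R / N%:R) (dev a) y) else a.

Lemma lift_segP N y k : (0 < N)%N -> d1 (dev a) y <= N%:R * eta ->
  dev (lift_seg N k y) = lerp (k%:R / N%:R) (dev a) y /\
  d1 (lift_seg N k.+1 y) (lift_seg N k y) <= d / 4.
Proof using C0 d0 eta0 ex onto.
move=> N0 yN; have N0' : 0 < N%:R :> R by rewrite ltr0n.
have st j : d1 (lerp (j.+1%:R / N%:R) (dev a) y) (lerp (j%:R / N%:R) (dev a) y) <= eta.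
  rewrite d1_lerp -mulrBl -natrB // subSnn mul1r normfV ger0_norm ?(ltW N0') //.
  by rewrite ler_pdivrMl.
elim: k => [|k [IH _]].
  have := st 0%N; rewrite mul0r lerp0 => H.
  by split; [|exact: (stepP H).1].
have [s1 s2] := @stepP (lift_seg N k y) (lerp (k.+1%:R / N%:R) (dev a) y) ltac:(by rewrite IH; exact: st).
split; first exact: s2.
have H : d1 (lerp (k.+2%:R / N%:R) (dev a) y) (dev (lift_seg N k.+1 y)) <= eta.
  by have E : dev (lift_seg N k.+1 y) = _ := s2; rewrite E; exact: st.
exact: (stepP H).1.
Qed.

Lemma lift_seg_close N y z k : (0 < N)%N -> (k <= N)%N -> d1 (dev a) y <= N%:R * eta ->
  d1 (dev a) z <= N%:R * eta -> C * d1 y z <= d / 4 ->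
  d1 (lift_seg N k y) (lift_seg N k z) <= C * d1 y z.
Proof using C0 d0 eta0 ex onto.
move=> N0 + yN zN yz; have N0' : 0 < N%:R :> R by rewrite ltr0n.
elim: k => [|k IH] kN.
  by rewrite /= /d1 !subrr normr0 addr0 mulr_ge0 ?d1_ge0 // ltW.
have {}IH := IH (ltnW kN).
have [_ y1] := lift_segP k N0 yN; have [_ z1] := lift_segP k N0 zN.
have [y2 _] := lift_segP k.+1 N0 yN; have [z2 _] := lift_segP k.+1 N0 zN.
have near_ : d1 (lift_seg N k.+1 y) (lift_seg N k.+1 z) <= d.
  have t1 := d1_tri (lift_seg N k y) (lift_seg N k.+1 y) (lift_seg N k.+1 z).
  have t2 := d1_tri (lift_seg N k z) (lift_seg N k y) (lift_seg N k.+1 z).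
  have z1' : d1 (lift_seg N k z) (lift_seg N k.+1 z) <= d / 4 by rewrite d1C.
  by move: t1 t2 y1 z1' IH yz d0; lra.
apply: (le_trans (ex near_)); rewrite y2 z2 d1_lerpr ler_wpM2l ?(ltW C0) //.
rewrite ger0_norm ?divr_ge0 // -[X in _ <= X]mul1r ler_wpM2r ?d1_ge0 //.
by rewrite ler_pdivrMr // mul1r ler_nat.
Qed.

Lemma lift_seg_refl N k : (0 < N)%N -> lift_seg N k (dev a) = a.
Proof using C0 d0 eta0 ex onto.
move=> N0; have ya : d1 (dev a) (dev a) <= N%:R * eta.
  by rewrite /d1 !subrr normr0 addr0 mulr_ge0 // ltW.
elim: k => [//|k IH]; have [_ s1] := lift_segP k N0 ya; rewrite IH in s1.
have [s2 _] := lift_segP k.+1 N0 ya; apply: d1_eq0.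
have d4 : d / 4 <= d by move: d0; lra.
have := ex (le_trans s1 d4); rewrite s2 lerp_same => H; apply: (le_trans H).
by rewrite /d1 !subrr normr0 addr0 mulr0.
Qed.
End Lift.

Lemma archi (x e : R) : 0 < e -> exists N : nat, (0 < N)%N /\ x <= N%:R * e.
Proof.
move=> e0; exists (Num.truncn `|x / e|).+1; split=> //.
rewrite -ler_pdivrMr // ltW // (le_lt_trans (ler_norm _)) //.
exact: truncnS_gt.
Qed.

Lemma lift_constants : exists C d eta, [/\ 0 < C, 0 < d, 0 < eta,
  forall a b, d1 a b <= d -> d1 a b <= C * d1 (dev a) (dev b) &
  forall p y, d1 y (dev p) <= eta -> exists2 q, d1 q p <= d / 4 & dev q = y].
Proof.
have [C C0 [d d0 ex]] := dev_expands sX sY X0 X1 Y0 Y1.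
exists C, d, (d / 4 / (8 * C)); split=> //; first by rewrite !divr_gt0 // mulr_gt0.
move=> p y py; apply: (dev_onto sX sY X0 X1 Y0 Y1 C0 _ _ py); first by rewrite divr_gt0.
by move=> a b ab; apply: ex; lra.
Qed.

Lemma dev_surj y : exists p, dev p = y.
Proof.
have [C [d [eta [C0 d0 eta0 ex onto]]]] := lift_constants.
have [N [N0 yN]] := archi (d1 (dev (0, 0)) y) eta0.
have [H _] := lift_segP C0 d0 eta0 ex onto N N0 yN.
by exists (lift_seg d (0, 0) N N y); rewrite H divff ?lerp1 // pnatr_eq0 -lt0n.
Qed.

(** Paths in the image lift uniquely, and loops lift to loops because the plane
    is simply connected: segments to nearby points have nearby lifts. *)
Lemma dev_inj a b : dev a = dev b -> a = b.
Proof.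
move=> ab; have [C [d [eta [C0 d0 eta0 ex onto]]]] := lift_constants.
have [L L0 lip] := dev_lipschitz.
have [N [N0 yN]] := archi (L * d1 a b) eta0.
have [M1 [M10 h1]] := archi (d1 a b) (divr_gt0 d0 (ltr0Sn R 3)).
have [M2 [M20 h2]] := archi (C * (L * d1 a b)) (divr_gt0 d0 (ltr0Sn R 3)).
pose M := (M1 + M2)%N; have M0 : 0 < M%:R :> R by rewrite ltr0n addn_gt0 M10.
pose g (j : nat) := lerp (j%:R / M%:R) a b.
have gj j : d1 (g j) (g j.+1) = M%:R^-1 * d1 a b.
  rewrite d1_lerp -mulrBl -[j.+1]addn1 natrD opprD addrA subrr sub0r mulN1r normrN.
  by rewrite normfV ger0_norm // (ltW M0).
have gd j : d1 (g j) (g j.+1) <= d / 4.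
  rewrite gj ler_pdivrMl // (le_trans h1) // ler_wpM2r ?divr_ge0 ?(ltW d0) //.
  by rewrite /M natrD lerDl.
have gC j : C * d1 (dev (g j)) (dev (g j.+1)) <= d / 4.
  apply: (@le_trans _ _ (C * (L * d1 (g j) (g j.+1)))).
    by rewrite ler_wpM2l ?lip // (ltW C0).
  have -> : C * (L * d1 (g j) (g j.+1)) = M%:R^-1 * (C * (L * d1 a b)) by rewrite gj; ring.
  rewrite ler_pdivrMl // (le_trans h2) // ler_wpM2r ?divr_ge0 ?(ltW d0) //.
  by rewrite /M natrD lerDr.
have gN j : (j <= M)%N -> d1 (dev a) (dev (g j)) <= N%:R * eta.
  move=> jM; apply: (le_trans (lip _ _)); apply: le_trans yN; rewrite ler_wpM2l ?(ltW L0) //.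
  rewrite -[a in X in d1 X _](lerp0 a b) d1_lerp sub0r normrN ger0_norm ?divr_ge0 //.
  by rewrite -[X in _ <= X]mul1r ler_wpM2r ?d1_ge0 // ler_pdivrMr // mul1r ler_nat.
have key j : (j <= M)%N -> lift_seg d a N N (dev (g j)) = g j.
  elim: j => [_|j IH jM].
    have -> : g 0%N = a by rewrite /g mul0r lerp0.
    exact: (lift_seg_refl C0 d0 eta0 ex onto).
  have {}IH := IH (ltnW jM).
  have cl := lift_seg_close C0 d0 eta0 ex onto N0 (leqnn N) (gN _ (ltnW jM)) (gN _ jM) (gC j).
  rewrite IH in cl; have [H _] := lift_segP C0 d0 eta0 ex onto N N0 (gN _ jM).
  rewrite divff ?lerp1 ?pnatr_eq0 -?lt0n // in H; apply: d1_eq0.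
  have nr : d1 (lift_seg d a N N (dev (g j.+1))) (g j.+1) <= d.
    apply: (le_trans (d1_tri (g j) _ _)); rewrite (d1C _ (g j)).
    by move: cl (gC j) (gd j); lra.
  apply: (le_trans (ex _ _ nr)); rewrite H.
  by rewrite /d1 !subrr normr0 addr0 mulr0.
have := key M (leqnn M); rewrite /g divff ?gt_eqF // lerp1 -ab.
by rewrite (lift_seg_refl C0 d0 eta0 ex onto).
Qed.

Definition dev_inv y := sval (cid (dev_surj y)).
Lemma dev_invK y : dev (dev_inv y) = y. Proof. by rewrite /dev_inv; case: cid. Qed.
Lemma devK p : dev_inv (dev p) = p. Proof. by apply: dev_inj; rewrite dev_invK. Qed.

(** Taylor expansion of a function along the inverse images of a coordinate
    direction [(k, l)]. *)
Lemma inverse_increment (H : R * R -> R) (h0 h1 : A) y (k l : R) : smooth H ->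
  partial ord0 H = h0 -> partial ord_max H = h1 -> `|k| + `|l| = 1 ->
  exists K eta : R, 0 < eta /\ forall t : R, `|t| <= eta ->
  `|H (dev_inv (y.1 + t * k, y.2 + t * l)) - H (dev_inv y)
    - (k * (ijac c * (cyt c * h0 - cys c * h1)) (dev_inv y)
    + l * (ijac c * (cxs c * h1 - cxt c * h0)) (dev_inv y)) * t|
   <= K * t ^+ 2.
Proof.
move=> sH H0 H1 kl.
have [C [d [eta [C0 d0 eta0 ex onto]]]] := lift_constants.
set a := dev_inv y; have ay : dev a = y by exact: dev_invK.
have [Ma Ma0 La] := torus_lipschitz (cxs c); have [Mb Mb0 Lb] := torus_lipschitz (cxt c).
have [Mc Mc0 Lc] := torus_lipschitz (cys c); have [Md Md0 Ld] := torus_lipschitz (cyt c).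
have [Me Me0 Le] := torus_lipschitz h0; have [Mf Mf0 Lf] := torus_lipschitz h1.
pose MX := (Ma + Mb) * C * C; pose MY := (Mc + Md) * C * C; pose MH := (Me + Mf) * C * C.
have ji : jac c a * ijac c a = 1.
  by have := torus_eq (jacV c) a; rewrite torusM torus1.
have jE : jac c a = cxs c a * cyt c a - cxt c a * cys c a by [].
have iE (g g' h h' : A) : (ijac c * (g * h - g' * h')) a = ijac c a * (g a * h a - g' a * h' a) by [].
rewrite !iE.
pose K := MH + `|ijac c a| * (`|h0 a| * (`|cyt c a| * MX + `|cxt c a| * MY)
  + `|h1 a| * (`|cxs c a| * MY + `|cys c a| * MX)).
exists K, eta; split=> // t teta; set y' := (_, _); set b := dev_inv y'.
have by' : dev b = y' by exact: dev_invK.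
have yy' : d1 y' (dev a) = `|t|.
  rewrite ay /d1 /y' /= ![_ + _ * _ - _]addrAC !subrr !add0r.
  transitivity (`|t| * (`|k| + `|l|)); last by rewrite kl mulr1.
  by rewrite mulrDr; congr (_ + _); exact: normrM.
have ab : d1 a b <= C * `|t|.
  have [|q qa qy] := onto a y'; first by rewrite yy'.
  have qb : q = b by rewrite /b -qy devK.
  rewrite -yy' -by' -qb d1C (d1C (dev q)) [X in C * X]d1C; apply: ex.
  by move: qa d0; lra.
have tri (g : R * R -> R) (g0 g1 : A) m0 m1 : smooth g -> partial ord0 g = g0 ->
   partial ord_max g = g1 -> 0 < m0 -> 0 < m1 ->
   (forall p q, `|g0 p - g0 q| <= m0 * d1 p q) -> (forall p q, `|g1 p - g1 q| <= m1 * d1 p q) ->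
   `|g b - g a - (g0 a * (b.1 - a.1) + g1 a * (b.2 - a.2))| <= (m0 + m1) * C * C * t ^+ 2.
  move=> sg e0 e1 m00 m10 l0 l1.
  apply: (le_trans (increment sg e0 e1 l0 l1 (ltW m00) (ltW m10) a b)).
  rewrite -[t ^+ 2]real_normK ?num_real //.
  have -> : (m0 + m1) * C * C * `|t| ^+ 2 = (m0 + m1) * (C * `|t|) * (C * `|t|) by ring.
  have m2 : 0 <= m0 + m1 by rewrite addr_ge0 // ltW.
  by apply: ler_pM; rewrite ?mulr_ge0 ?d1_ge0 // ler_wpM2l.
have eX := tri _ _ _ _ _ sX X0 X1 Ma0 Mb0 La Lb.
have eY := tri _ _ _ _ _ sY Y0 Y1 Mc0 Md0 Lc Ld.
have eH := tri _ _ _ _ _ sH H0 H1 Me0 Mf0 Le Lf.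
have Xt : X b - X a = t * k.
  have e1 : X b = y.1 + t * k := congr1 fst by'.
  by have e2 : X a = y.1 := congr1 fst ay; rewrite e1 e2; ring.
have Yt : Y b - Y a = t * l.
  have e1 : Y b = y.2 + t * l := congr1 snd by'.
  by have e2 : Y a = y.2 := congr1 snd ay; rewrite e1 e2; ring.
rewrite Xt -/MX in eX; rewrite Yt -/MY in eY; rewrite -/MH in eH.
move: eX eY eH; set u := b.1 - a.1; set v := b.2 - a.2.
set rX := t * k - _; set rY := t * l - _; set rH := H b - H a - _ => eX eY eH.
have -> : H b - H a - (k * (ijac c a * (cyt c a * h0 a - cys c a * h1 a))
    + l * (ijac c a * (cxs c a * h1 a - cxt c a * h0 a))) * t
  = rH - ijac c a * (h0 a * (cyt c a * rX - cxt c a * rY) + h1 a * (cxs c a * rY - cys c a * rX)).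
  have -> : H b - H a = rH + (jac c a * ijac c a) * (h0 a * u + h1 a * v) by rewrite ji /rH; ring.
  by rewrite /rX /rY jE; ring.
rewrite (le_trans (ler_normB _ _)) // /K mulrDl; apply: lerD => //.
rewrite normrM -mulrA ler_wpM2l // mulrDl (le_trans (ler_normD _ _)) //.
have t2 (p q s s' m m' : R) : `|s| <= m * t ^+ 2 -> `|s'| <= m' * t ^+ 2 ->
    `|p * s - q * s'| <= (`|p| * m + `|q| * m') * t ^+ 2.
  move=> h h'; rewrite (le_trans (ler_normB _ _)) // !normrM mulrDl -!mulrA.
  by apply: lerD; rewrite ler_wpM2l.
by apply: lerD; rewrite normrM -mulrA ler_wpM2l // t2.
Qed.

Lemma inverse_partials (H : R * R -> R) (h0 h1 : A) : smooth H ->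
  partial ord0 H = h0 -> partial ord_max H = h1 ->
  let g0 : A := ijac c * (cyt c * h0 - cys c * h1) in
  let g1 : A := ijac c * (cxs c * h1 - cxt c * h0) in
  [/\ has_partials (H \o dev_inv), partial ord0 (H \o dev_inv) = g0 \o dev_inv &
    partial ord_max (H \o dev_inv) = g1 \o dev_inv].
Proof.
move=> sH H0 H1; cbv zeta; apply: partials_of_slices => s t.
  have [|K [eta [eta0 inc]]] := inverse_increment (s, t) sH H0 H1 (k := 1) (l := 0).
    by rewrite normr1 normr0 addr0.
  apply: (is_derive_quadratic eta0) => h heta; have := inc h heta.
  by rewrite /= mulr1 mulr0 addr0 mul1r mul0r addr0; exact.
have [|K [eta [eta0 inc]]] := inverse_increment (s, t) sH H0 H1 (k := 0) (l := 1).
  by rewrite normr1 normr0 add0r.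
apply: (is_derive_quadratic eta0) => h heta; have := inc h heta.
by rewrite /= mulr1 mulr0 addr0 mul1r mul0r add0r; exact.
Qed.

(** Functions of this form are closed under partial differentiation, which is
    the chain rule for the inverse map. *)
Lemma smooth_comp_inverse (h : A) : smooth (h \o dev_inv).
Proof.
apply: (@smooth_coind _ _ (fun g => exists k : A, g = k \o dev_inv)); last by exists h.
move=> _ [k ->]; have [hp p0 p1] := inverse_partials (torus_smooth k) (erefl (td ord0 k : R * R -> R))
  (erefl (td ord_max k : R * R -> R)).
split=> // [|i]; first exact: torus_partials_continuous hp p0 p1.
by elim/ord2P: i; rewrite ?p0 ?p1; eexists.
Qed.

Lemma smooth_primitive (G : R * R -> R) (g0 g1 : A) : has_partials G ->
  partial ord0 G = g0 \o dev_inv -> partial ord_max G = g1 \o dev_inv -> smooth G.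
Proof.
move=> hp p0 p1; apply/smoothE.
split=> // [|i]; first exact: torus_partials_continuous hp p0 p1.
by elim/ord2P: i; rewrite ?p0 ?p1; exact: smooth_comp_inverse.
Qed.

Lemma coordinates_smooth : [/\ smooth (fun p : R * R => p.1) /\ smooth (fun p : R * R => p.2),
  partial ord0 (fun p : R * R => p.1) = tcst 1 /\ partial ord_max (fun p : R * R => p.1) = tcst 0 &
  partial ord0 (fun p : R * R => p.2) = tcst 0 /\ partial ord_max (fun p : R * R => p.2) = tcst 1].
Proof.
have [a0 a1 a2] := @partials_of_slices R R^o (fun p : R * R => p.1) (tcst 1) (tcst 0)
  (fun s t => is_derive_id _ _) (fun s t => is_derive_cst _ _ _).
have [b0 b1 b2] := @partials_of_slices R R^o (fun p : R * R => p.2) (tcst 0) (tcst 1)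
  (fun s t => is_derive_cst _ _ _) (fun s t => is_derive_id _ _).
split=> //; split; apply/smoothE; split=> //.
- by move=> p; exact: cvg_fst.
- by move=> i; elim/ord2P: i; rewrite ?a1 ?a2; exact: smooth_cst.
- by move=> p; exact: cvg_snd.
- by move=> i; elim/ord2P: i; rewrite ?b1 ?b2; exact: smooth_cst.
Qed.

Lemma smooth_pair (g h : R * R -> R) : smooth g -> smooth h ->
  smooth (fun p => (g p, h p) : R * R).
Proof.
move=> sg sh; apply: (@smooth_coind _ _ (fun k => exists g h : R * R -> R,
  [/\ smooth g, smooth h & k = fun p => (g p, h p)])); last by exists g, h.
move=> _ [{sg sh}g [{}h [sg sh ->]]].
have [cg dg pg] := (smoothE g).1 sg; have [ch dh ph] := (smoothE h).1 sh.
have key i p : (t^-1 *: (((fun p => (g p, h p) : R * R) \o shift p) (t *: coord_vec R i)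
    - (g p, h p)) @[t --> (0 : R)^']) --> (partial i g p, partial i h p).
  exact: cvg_pair (dg i p) (dh i p).
have pE i : partial i (fun p => (g p, h p) : R * R) = fun p => (partial i g p, partial i h p).
  by apply/funext => p; apply: cvg_lim; [exact: norm_hausdorff|exact: key].
split=> [p|i p|i].
- exact: cvg_pair (cg p) (ch p).
- by apply: cvgP; exact: key.
- by exists (partial i g), (partial i h).
Qed.

Lemma smooth_dev_inv : smooth dev_inv.
Proof.
have [[s1 s2] [p10 p11] [p20 p21]] := coordinates_smooth.
have [h1 e1 e2] := inverse_partials s1 p10 p11; have [h2 e3 e4] := inverse_partials s2 p20 p21.
rewrite (_ : dev_inv = fun p => ((fst \o dev_inv) p, (snd \o dev_inv) p)).
  by apply: smooth_pair; [exact: smooth_primitive e1 e2|exact: smooth_primitive e3 e4].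
by apply/funext => p /=; case: (dev_inv p).
Qed.
End GlobalInverse.

(** * Fourier modes and Fejer kernels *)

Section FourierAlgebra.
Variable T : comNzRingType.
Implicit Types (w o a b x y e k C S : T).

Lemma shift_sum w o a a' b b' x x' y y' :
  w * (o * 2) * (a' * a + b' * b)
  + (w * o * ((a' * x' - 1 * (b' * y')) * (a * x - 1 * (b * y))
    + (b' * x' + 1 * (a' * y')) * (b * x + 1 * (a * y)))
  + w * o * ((a' * x' - - 1 * (b' * y')) * (a * x - - 1 * (b * y))
    + (b' * x' + - 1 * (a' * y')) * (b * x + - 1 * (a * y))))
  = o * 2 * (1 + (x' * x + y' * y)) * (w * (a' * a + b' * b)).
Proof. ring. Qed.
Lemma shift_cos e k C S x y : e * e = 1 ->
  - (k * S) * x + C * (- y) - (0 * (S * y) + e * (k * C * y + S * x))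
  = - ((k + e) * (S * x + e * (C * y))).
Proof.
move=> e2; transitivity (- ((k + e) * (S * x + e * (C * y))) + (e * e - 1) * (C * y)); first by ring.
by rewrite e2 subrr mul0r addr0.
Qed.

Lemma shift_sin e k C S x y : e * e = 1 ->
  k * C * x + S * (- y) + (0 * (C * y) + e * (- (k * S) * y + C * x))
  = (k + e) * (C * x - e * (S * y)).
Proof.
move=> e2; transitivity ((k + e) * (C * x - e * (S * y)) + (e * e - 1) * (S * y)); first by ring.
by rewrite e2 subrr mul0r addr0.
Qed.

Lemma shift_cos0 e l C S x y :
  - (l * S) * x + C * 0 - (0 * (S * y) + e * (l * C * y + S * 0))
  = - (l * (S * x + e * (C * y))).
Proof. ring. Qed.
Lemma shift_sin0 e l C S x y :
  l * C * x + S * 0 + (0 * (C * y) + e * (- (l * S) * y + C * 0))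
  = l * (C * x - e * (S * y)).
Proof. ring. Qed.
Lemma unit_rotation x x' y y' : x * x + y * y = 1 -> x' * x' + y' * y' = 1 ->
  (x' * x + y' * y) * (x' * x + y' * y) + (y' * x - x' * y) * (y' * x - x' * y) = 1.
Proof.
move=> h h'; transitivity ((x * x + y * y) * (x' * x' + y' * y')); first by ring.
by rewrite h h' mulr1.
Qed.

Lemma sin_square (k s : T) : k * k + s * s = 1 -> s * s = (2 - (1 + k)) * (1 + k).
Proof. by move=> ks; apply: (addrI (k * k)); rewrite ks; ring. Qed.
Lemma kernel_step (o a b v : T) :
  o * a * (o * b * v) = o * o * (a * b) * v.
Proof. ring. Qed.
Lemma power_step (n u s v : T) : s * s = (2 - u) * u ->
  (2 * n + 1 - (n + 1) * u) * v * u + s * v * s = (2 * (n + 1) + 1 - (n + 1 + 1) * u) * (u * v).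
Proof.
move=> h; transitivity ((2 * n + 1 - (n + 1) * u) * v * u + s * s * v); first by ring.
by rewrite h; ring.
Qed.
End FourierAlgebra.

Section Scalars.
Context {R : realType}.
Notation A := (torus_fun R).
Implicit Types (h g : A).
Lemma tcstD2 (a b : R) : tcst (a + b) = tcst a + tcst b :> torus_fun R. Proof. exact: raddfD. Qed.
Lemma tcstN12 : tcst (- 1) = - 1 :> torus_fun R. Proof. by apply: torus_ext. Qed.
Lemma derivD (D : derivation R) h g : D (h + g) = D h + D g. Proof. exact: raddfD. Qed.
Lemma derivB (D : derivation R) h g : D (h - g) = D h - D g. Proof. exact: raddfB. Qed.
Lemma deriv1 (D : derivation R) : D 1 = 0. Proof. by rewrite -tcst1 deriv_cst. Qed.
Lemma derivZ (D : derivation R) t g : D (tcst t * g) = tcst t * D g.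
Proof. by rewrite derivM deriv_cst mul0r add0r. Qed.
Lemma deriv_sum (D : derivation R) (J : Type) (r : seq J) (F : J -> A) :
  D (\sum_(i <- r) F i) = \sum_(i <- r) D (F i).
Proof. exact: raddf_sum. Qed.
Variable c : chart R.
Lemma cint_add g h : cint c (g + h) = cint c g + cint c h. Proof. exact: raddfD. Qed.
Lemma cint_sub g h : cint c (g - h) = cint c g - cint c h. Proof. exact: raddfB. Qed.
Lemma cint_opp g : cint c (- g) = - cint c g. Proof. exact: raddfN. Qed.
Lemma cint_sum (J : Type) (r : seq J) (F : J -> A) :
  cint c (\sum_(i <- r) F i) = \sum_(i <- r) cint c (F i).
Proof. exact: raddf_sum. Qed.
End Scalars.

(** A chart of the torus together with the functions [cos x], [sin x], [cos y],
    [sin y] of its coordinates, which separate the points of the torus. *)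
Record trig_chart (R : realType) := TrigChart {
  tchart :> chart R; cosx : torus_fun R; sinx : torus_fun R; cosy : torus_fun R; siny : torus_fun R;
  Dx_cosx : Dx tchart cosx = - sinx; Dx_sinx : Dx tchart sinx = cosx;
  Dy_cosx : Dy tchart cosx = 0; Dy_sinx : Dy tchart sinx = 0;
  Dy_cosy : Dy tchart cosy = - siny; Dy_siny : Dy tchart siny = cosy;
  Dx_cosy : Dx tchart cosy = 0; Dx_siny : Dx tchart siny = 0;
  cosx_sinx : cosx * cosx + sinx * sinx = 1; cosy_siny : cosy * cosy + siny * siny = 1;
  trig_separated : forall p q, cosx p = cosx q -> sinx p = sinx q -> cosy p = cosy q ->
    siny p = siny q -> lattice (p - q) }.

Section FourierModes.
Context {R : realType}.
Notation A := (torus_fun R).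
Variable c : trig_chart R.
Notation DX := (Dx c).
Notation DY := (Dy c).
Notation cX := (cosx c).
Notation sX := (sinx c).
Notation cY := (cosy c).
Notation sY := (siny c).
Let Xc := Dx_cosx c. Let Xs := Dx_sinx c. Let Yc0 := Dy_cosx c. Let Ys0 := Dy_sinx c.
Let Yc := Dy_cosy c. Let Ys := Dy_siny c. Let Xc0 := Dx_cosy c. Let Xs0 := Dx_siny c.
Implicit Types (h g : A) (p q : R * R).

(** The weighted Fourier mode [(w, C, S, k, l)] stands for [w] times the pair
    [cos (k x + l y), sin (k x + l y)]. *)
Record mode := Mode { wt : R; mc : A; ms : A; mk : int; ml : int;
  wt_ge0 : 0 <= wt;
  DX_mc : DX mc = - (tcst mk%:~R * ms); DX_ms : DX ms = tcst mk%:~R * mc;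
  DY_mc : DY mc = - (tcst ml%:~R * ms); DY_ms : DY ms = tcst ml%:~R * mc }.

Definition freq m : R := (mk m)%:~R ^+ 2 + (ml m)%:~R ^+ 2.

Definition kernel (s : seq mode) p : A := \sum_(m <- s)
  tcst (wt m) * (tcst (mc m p) * mc m + tcst (ms m p) * ms m).

Section Shift.
Variables (e : int) (e2 : e%:~R * e%:~R = 1 :> R) (m : mode).
Let e2A : tcst e%:~R * tcst e%:~R = 1 :> A. Proof. by rewrite -tcstM e2 tcst1. Qed.
Let kE k : tcst (k + e)%:~R = tcst k%:~R + tcst e%:~R :> A. Proof. by rewrite intrD tcstD2. Qed.
Let w4 : 0 <= wt m / 4. Proof. by rewrite divr_ge0 // wt_ge0. Qed.
Lemma shift_X1 : DX (mc m * cX - tcst e%:~R * (ms m * sX))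
  = - (tcst (mk m + e)%:~R * (ms m * cX + tcst e%:~R * (mc m * sX))).
Proof. by rewrite derivB !derivM deriv_cst DX_mc DX_ms Xc Xs kE; exact: shift_cos. Qed.
Lemma shift_X2 : DX (ms m * cX + tcst e%:~R * (mc m * sX))
  = tcst (mk m + e)%:~R * (mc m * cX - tcst e%:~R * (ms m * sX)).
Proof. by rewrite derivD !derivM deriv_cst DX_mc DX_ms Xc Xs kE; exact: shift_sin. Qed.
Lemma shift_X3 : DY (mc m * cX - tcst e%:~R * (ms m * sX))
  = - (tcst (ml m)%:~R * (ms m * cX + tcst e%:~R * (mc m * sX))).
Proof. by rewrite derivB !derivM deriv_cst DY_mc DY_ms Yc0 Ys0; exact: shift_cos0. Qed.
Lemma shift_X4 : DY (ms m * cX + tcst e%:~R * (mc m * sX))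
  = tcst (ml m)%:~R * (mc m * cX - tcst e%:~R * (ms m * sX)).
Proof. by rewrite derivD !derivM deriv_cst DY_mc DY_ms Yc0 Ys0; exact: shift_sin0. Qed.
Definition shiftX := Mode w4 shift_X1 shift_X2 shift_X3 shift_X4.

Lemma shift_Y1 : DX (mc m * cY - tcst e%:~R * (ms m * sY))
  = - (tcst (mk m)%:~R * (ms m * cY + tcst e%:~R * (mc m * sY))).
Proof. by rewrite derivB !derivM deriv_cst DX_mc DX_ms Xc0 Xs0; exact: shift_cos0. Qed.
Lemma shift_Y2 : DX (ms m * cY + tcst e%:~R * (mc m * sY))
  = tcst (mk m)%:~R * (mc m * cY - tcst e%:~R * (ms m * sY)).
Proof. by rewrite derivD !derivM deriv_cst DX_mc DX_ms Xc0 Xs0; exact: shift_sin0. Qed.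
Lemma shift_Y3 : DY (mc m * cY - tcst e%:~R * (ms m * sY))
  = - (tcst (ml m + e)%:~R * (ms m * cY + tcst e%:~R * (mc m * sY))).
Proof. by rewrite derivB !derivM deriv_cst DY_mc DY_ms Yc Ys kE; exact: shift_cos. Qed.
Lemma shift_Y4 : DY (ms m * cY + tcst e%:~R * (mc m * sY))
  = tcst (ml m + e)%:~R * (mc m * cY - tcst e%:~R * (ms m * sY)).
Proof. by rewrite derivD !derivM deriv_cst DY_mc DY_ms Yc Ys kE; exact: shift_sin. Qed.
Definition shiftY := Mode w4 shift_Y1 shift_Y2 shift_Y3 shift_Y4.
End Shift.

Lemma unit1 : 1%:~R * 1%:~R = 1 :> R. Proof. by rewrite mulr1. Qed.
Lemma unitN1 : (-1)%:~R * (-1)%:~R = 1 :> R. Proof. by rewrite mulrN1z mulrNN mulr1. Qed.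
Lemma half_ge0 m : 0 <= wt m / 2. Proof. by rewrite divr_ge0 // wt_ge0. Qed.
Definition half m := Mode (half_ge0 m) (DX_mc m) (DX_ms m) (DY_mc m) (DY_ms m).
Definition mulX s := flatten [seq [:: half m; shiftX unit1 m; shiftX unitN1 m] | m <- s].
Definition mulY s := flatten [seq [:: half m; shiftY unit1 m; shiftY unitN1 m] | m <- s].

Let one1 : DX 1 = - (tcst 0%:~R * 0).
Proof. by rewrite mulr0 oppr0 -tcst1; exact: deriv_cst. Qed.
Let one2 : DX 0 = tcst 0%:~R * 1.
Proof. by rewrite raddf0 (raddf0 (@tcst R)) mul0r. Qed.
Let one3 : DY 1 = - (tcst 0%:~R * 0).
Proof. by rewrite mulr0 oppr0 -tcst1; exact: deriv_cst. Qed.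
Let one4 : DY 0 = tcst 0%:~R * 1.
Proof. by rewrite raddf0 (raddf0 (@tcst R)) mul0r. Qed.
Definition mode1 := Mode ler01 one1 one2 one3 one4.
Definition modes N := iter N (mulX \o mulY) [:: mode1].

Definition kapX p : A := tcst (cX p) * cX + tcst (sX p) * sX.
Definition kapY p : A := tcst (cY p) * cY + tcst (sY p) * sY.

Let shift_eval (e : int) (C S a b : A) p : tcst ((C * a - tcst e%:~R * (S * b)) p)
  = tcst (C p) * tcst (a p) - tcst e%:~R * (tcst (S p) * tcst (b p)) :> A.
Proof. by apply: torus_ext. Qed.
Let shift_eval' (e : int) (C S a b : A) p : tcst ((S * a + tcst e%:~R * (C * b)) p)
  = tcst (S p) * tcst (a p) + tcst e%:~R * (tcst (C p) * tcst (b p)) :> A.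
Proof. by apply: torus_ext. Qed.
Let w2E (w : R) : tcst (w / 2) = tcst w * (tcst 4^-1 * 2) :> A.
Proof.
apply: torus_ext => q; rewrite mulr_natr torusM !tcstE.
by change (w / 2 = w * (4^-1 + 4^-1)); field.
Qed.
Let half4 : tcst 2^-1 = tcst 4^-1 * 2 :> A.
Proof.
apply: torus_ext => q; rewrite mulr_natr.
by change (2^-1 = 4^-1 + 4^-1 :> R); field.
Qed.

Let shiftX_term e e2 m p : let m' := @shiftX e e2 m in
  tcst (wt m') * (tcst (mc m' p) * mc m' + tcst (ms m' p) * ms m')
  = tcst (wt m) * tcst 4^-1 * ((tcst (mc m p) * tcst (cX p) - tcst e%:~R * (tcst (ms m p) * tcst (sX p)))
    * (mc m * cX - tcst e%:~R * (ms m * sX))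
    + (tcst (ms m p) * tcst (cX p) + tcst e%:~R * (tcst (mc m p) * tcst (sX p)))
    * (ms m * cX + tcst e%:~R * (mc m * sX))).
Proof.
by cbv zeta; congr (_ * (_ * _ + _ * _)); [exact: tcstM|exact: shift_eval|exact: shift_eval'].
Qed.
Let shiftY_term e e2 m p : let m' := @shiftY e e2 m in
  tcst (wt m') * (tcst (mc m' p) * mc m' + tcst (ms m' p) * ms m')
  = tcst (wt m) * tcst 4^-1 * ((tcst (mc m p) * tcst (cY p) - tcst e%:~R * (tcst (ms m p) * tcst (sY p)))
    * (mc m * cY - tcst e%:~R * (ms m * sY))
    + (tcst (ms m p) * tcst (cY p) + tcst e%:~R * (tcst (mc m p) * tcst (sY p)))
    * (ms m * cY + tcst e%:~R * (mc m * sY))).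
Proof.
by cbv zeta; congr (_ * (_ * _ + _ * _)); [exact: tcstM|exact: shift_eval|exact: shift_eval'].
Qed.
Let big3 (F : mode -> A) a b d : \sum_(m <- [:: a; b; d]) F m = F a + (F b + F d).
Proof. by rewrite 3!big_cons big_nil; congr (_ + (_ + _)); exact: addr0. Qed.
Lemma kernel_mulX s p : kernel (mulX s) p = tcst 2^-1 * (1 + kapX p) * kernel s p.
Proof.
rewrite /kernel /mulX big_flatten big_map mulr_sumr; apply: eq_bigr => m _.
etransitivity; first exact: big3.
cbv beta; rewrite !shiftX_term [wt (half m)]/(_ / 2) [mc (half m)]/(mc m) [ms (half m)]/(ms m) w2E half4.
rewrite mulr1z tcst1 mulrN1z tcstN12; exact: shift_sum.
Qed.

Lemma kernel_mulY s p : kernel (mulY s) p = tcst 2^-1 * (1 + kapY p) * kernel s p.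
Proof.
rewrite /kernel /mulY big_flatten big_map mulr_sumr; apply: eq_bigr => m _.
etransitivity; first exact: big3.
cbv beta; rewrite !shiftY_term [wt (half m)]/(_ / 2) [mc (half m)]/(mc m) [ms (half m)]/(ms m) w2E half4.
rewrite mulr1z tcst1 mulrN1z tcstN12; exact: shift_sum.
Qed.

Definition fejer p : A := tcst 4^-1 * ((1 + kapX p) * (1 + kapY p)).

Lemma kernel_modes N p : kernel (modes N) p = fejer p ^+ N.
Proof.
elim: N => [|N IH].
  transitivity (tcst 1 * (tcst 1 * 1 + tcst 0 * 0) : A); first exact: big_seq1.
  by rewrite tcst1 mulr0 addr0 !mul1r expr0.
rewrite /modes iterS -/(modes N) [(_ \o _) _]/(mulX (mulY _)) kernel_mulX kernel_mulY IH exprS /fejer.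
have <- : tcst 2^-1 * tcst 2^-1 = tcst 4^-1 :> A by rewrite -tcstM; congr tcst; field.
exact: kernel_step.
Qed.

End FourierModes.

Section Korovkin.
Context {R : realType}.
Notation A := (torus_fun R).
Variable c : trig_chart R.
Notation DX := (Dx c).
Notation DY := (Dy c).
Notation I := (cint c).
Notation cX := (cosx c).
Notation sX := (sinx c).
Notation cY := (cosy c).
Notation sY := (siny c).
Let Xc := Dx_cosx c. Let Xs := Dx_sinx c. Let Yc0 := Dy_cosx c. Let Ys0 := Dy_sinx c.
Let Yc := Dy_cosy c. Let Ys := Dy_siny c. Let Xc0 := Dx_cosy c. Let Xs0 := Dx_siny c.
Let X1 := cosx_sinx c. Let Y1 := cosy_siny c.
Implicit Types (h g : A) (p q : R * R).
Notation fejer := (fejer c).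
Notation modes := (modes c).
Notation kapX := (kapX c).
Notation kapY := (kapY c).

(** Integration by parts, together with [s^2 = (2 - (1 + k)) (1 + k)], gives a
    recursion for the integrals of the powers of [1 + k]. *)
Lemma mass_step (D : derivation R) (k s w : A) N : (forall g, I (D g) = 0) ->
  D k = s -> D s = - k -> k * k + s * s = 1 -> D w = 0 ->
  N.+1%:R * I ((1 + k) ^+ N.+1 * w) = (2 * N + 1)%:R * I ((1 + k) ^+ N * w).
Proof.
move=> D0 Dk Ds ks Dw; set u := 1 + k.
have Du : D u = s by rewrite /u derivD deriv1 add0r.
have ss : s * s = (2 - u) * u.
  exact: sin_square.
have key n : D (s * u ^+ n) = (2 * n%:R + 1 - (n%:R + 1) * u) * u ^+ n.
  elim: n => [|n IH].
    by rewrite expr0 !mulr1 Ds mulr0 !add0r mul1r /u opprD addrA subrr add0r.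
  by rewrite exprSr mulrA derivM IH Du power_step // -(natr1 n) [u * _]mulrC.
have := D0 (s * u ^+ N * w); rewrite derivM key Dw mulr0 addr0.
rewrite mulrBl mulrBl cint_sub => /subr0_eq.
have IM n g : I (n%:R * g) = n%:R * I g by rewrite mulr_natl raddfMn mulr_natl.
rewrite -!mulrA natr1 !IM.
have -> : (2 * N%:R + 1 : A) = (2 * N + 1)%:R by rewrite natrD natrM.
by rewrite IM mulrA -exprS => ->.
Qed.

Lemma derivX0 (D : derivation R) (g : A) N : D g = 0 -> D (g ^+ N) = 0.
Proof.
move=> g0; elim: N => [|N IH]; first by rewrite expr0 deriv1.
by rewrite exprS derivM g0 IH mulr0 mul0r addr0.
Qed.

Definition mass N : R := \prod_(i < N) ((2 * i + 1)%:R / (2 * i + 2)%:R) ^+ 2 * I 1.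

Lemma cint1_gt0 : 0 < I 1.
Proof.
apply: cint_gt0 => [p|]; first exact: ler01.
by move=> /(congr1 (fun h : A => h (0, 0))) /eqP; rewrite oner_eq0.
Qed.

Lemma mass_gt0 N : 0 < mass N.
Proof.
rewrite mulr_gt0 ?cint1_gt0 //; apply: prodr_gt0 => i _.
by rewrite exprn_gt0 // divr_gt0 // ltr0n addn1 || rewrite addn2.
Qed.

Lemma unit_at (x y : A) p : x * x + y * y = 1 ->
  tcst (x p) * tcst (x p) + tcst (y p) * tcst (y p) = 1 :> A.
Proof.
move=> /(congr1 (fun h : A => h p)) H; rewrite -!tcstM -tcstD2.
have -> : x p * x p + y p * y p = 1 by exact: H.
exact: tcst1.
Qed.

Lemma fejer_mass p N : I (fejer p ^+ N) = mass N.
Proof.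
pose sigX : A := tcst (sX p) * cX - tcst (cX p) * sX.
pose sigY : A := tcst (sY p) * cY - tcst (cY p) * sY.
have kX : DX (kapX p) = sigX.
  by rewrite derivD !derivZ Xc Xs mulrN addrC.
have kY : DY (kapY p) = sigY.
  by rewrite derivD !derivZ Yc Ys mulrN addrC.
have dX : DX sigX = - kapX p by rewrite derivB !derivZ Xc Xs mulrN /kapX opprD addrC.
have dY : DY sigY = - kapY p by rewrite derivB !derivZ Yc Ys mulrN /kapY opprD addrC.
have uX : kapX p * kapX p + sigX * sigX = 1.
  by apply: unit_rotation => //; exact: unit_at.
have uY : kapY p * kapY p + sigY * sigY = 1.
  by apply: unit_rotation => //; exact: unit_at.
have kXY : DY (1 + kapX p) = 0.
  by rewrite derivD deriv1 add0r derivD !derivZ Yc0 Ys0 !mulr0 addr0.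
have kYX : DX (1 + kapY p) = 0.
  by rewrite derivD deriv1 add0r derivD !derivZ Xc0 Xs0 !mulr0 addr0.
elim: N => [|N IH]; first by rewrite expr0 /mass big_ord0 mul1r.
have h1 := mass_step N (@cint_Dx _ c) kX dX uX (derivX0 N.+1 kYX).
have h2 := mass_step N (@cint_Dy _ c) kY dY uY (derivX0 N kXY).
have E n : fejer p ^+ n = tcst (4^-1 ^+ n) * ((1 + kapX p) ^+ n * (1 + kapY p) ^+ n).
  rewrite /fejer exprMn_comm; last exact: mulrC.
  rewrite exprMn; congr (_ * _); apply: torus_ext => q.
  by rewrite torusX !tcstE.
rewrite /mass big_ord_recr /= mulrAC -/(mass N) -IH !E !cintZ.
have n0 : N.+1%:R != 0 :> R by rewrite pnatr_eq0.
apply: (mulfI n0); apply: (mulfI n0); apply: (mulfI n0).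
rewrite [_ ^+ N.+1 * _]mulrC [_ ^+ N * _]mulrC in h2.
move: h1 h2; set a := I _; set b := I _; set d := I _ => h1 h2.
rewrite exprS [LHS](_ : _ = N.+1%:R * N.+1%:R / 4 * 4^-1 ^+ N * (N.+1%:R * a)); last by ring.
rewrite h1 [LHS](_ : _ = N.+1%:R / 4 * 4^-1 ^+ N * (2 * N + 1)%:R * (N.+1%:R * b)); last by ring.
rewrite h2 (_ : (2 * N + 1)%:R = 2 * N%:R + 1); last by rewrite natrD natrM.
rewrite (_ : (2 * N + 2)%:R = 2 * (N%:R + 1)); last by rewrite natrD natrM mulrDr mulr1.
rewrite -natr1; have : (N%:R + 1 : R) != 0 by rewrite natr1.
by move: (N%:R) (4^-1 ^+ N) => n z n1; field.
Qed.

Lemma massS N : mass N.+1 = mass N * ((2 * N + 1)%:R / (2 * N + 2)%:R) ^+ 2.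
Proof. by rewrite /mass big_ord_recr /= mulrAC. Qed.
Lemma mass_drop N : mass N - mass N.+1 <= mass N / N.+1%:R.
Proof.
rewrite massS -{1}[mass N]mulr1 -mulrBr ler_wpM2l ?(ltW (mass_gt0 N)) //.
have N1 : 0 < N.+1%:R :> R by rewrite ltr0n.
rewrite (_ : (2 * N + 1)%:R = 2 * N.+1%:R - 1); last by rewrite -natr1 natrD natrM; ring.
rewrite (_ : (2 * N + 2)%:R = 2 * N.+1%:R); last by rewrite -natr1 natrD natrM; ring.
move: N1; move: (N.+1%:R) => x x0.
rewrite -subr_ge0 (_ : _ - _ = (2 * x)^-1 ^+ 2); last by field; rewrite gt_eqF.
exact: sqr_ge0.
Qed.

Lemma kap_bound (x y : A) p q : x * x + y * y = 1 ->
  -1 <= x p * x q + y p * y q <= 1 /\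
  (x p * x q + y p * y q = 1 -> x p = x q /\ y p = y q).
Proof.
move=> H; have e z : x z * x z + y z * y z = 1 by exact: (torus_eq H z).
move: (e p) (e q); move: (x p) (x q) (y p) (y q) => a b d f h1 h2.
have E : (a - b) ^+ 2 + (d - f) ^+ 2 = 2 - 2 * (a * b + d * f).
  by transitivity ((a * a + d * d) + (b * b + f * f) - 2 * (a * b + d * f)); [ring|rewrite h1 h2].
have E' : (a + b) ^+ 2 + (d + f) ^+ 2 = 2 + 2 * (a * b + d * f).
  by transitivity ((a * a + d * d) + (b * b + f * f) + 2 * (a * b + d * f)); [ring|rewrite h1 h2].
have := sqr_ge0 (a - b); have := sqr_ge0 (d - f); have := sqr_ge0 (a + b); have := sqr_ge0 (d + f).
move=> g1 g2 g3 g4; split; first by apply/andP; split; lra.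
move=> k; rewrite k in E.
have /eqP : (a - b) ^+ 2 = 0 by lra.
have /eqP : (d - f) ^+ 2 = 0 by lra.
by rewrite !sqrf_eq0 !subr_eq0 => /eqP -> /eqP ->.
Qed.

Lemma fejer_bound p q : 0 <= fejer p q <= 1 /\ (fejer p q = 1 -> lattice (p - q)).
Proof.
have [/andP[a1 a2] a3] := kap_bound p q X1; have [/andP[b1 b2] b3] := kap_bound p q Y1.
have E : fejer p q = 4^-1 * ((1 + (cX p * cX q + sX p * sX q)) * (1 + (cY p * cY q + sY p * sY q))) by [].
rewrite E; move: a1 a2 a3 b1 b2 b3.
move: (cX p * cX q + _) (cY p * cY q + _) => k l a1 a2 a3 b1 b2 b3.
have : 0 <= (1 - k) * (1 + l) by rewrite mulr_ge0; lra.
have : 0 <= (1 + k) * (1 - l) by rewrite mulr_ge0; lra.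
have : 0 <= (1 + k) * (1 + l) by rewrite mulr_ge0; lra.
have : 0 <= (1 - k) * (1 - l) by rewrite mulr_ge0; lra.
rewrite !mulrDl !mul1r !mulrDr !mulr1 !mulrN !mulNr => g1 g2 g3 g4.
split=> [|H]; first by apply/andP; split; lra.
have k1 : k = 1 by lra.
have l1 : l = 1 by lra.
by have [? ?] := a3 k1; have [? ?] := b3 l1; exact: (@trig_separated _ c).
Qed.

(** By compactness the kernel is bounded away from its maximum where [h] varies
    by more than [e]. *)
Lemma kernel_modulus h e : 0 < e -> exists2 C : R, 0 <= C &
  forall p q, `|h q - h p| <= e + C * (1 - fejer p q).
Proof.
move=> e0; pose sq : set (R * R) := unit_square.
have c1 (g : A) : continuous (fun z : (R * R) * (R * R) => g z.1).
  by move=> z; apply: (@cvg_comp _ _ _ fst g _ (nbhs z.1)); [exact: cvg_fst|exact: torus_continuous].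
have c2 (g : A) : continuous (fun z : (R * R) * (R * R) => g z.2).
  by move=> z; apply: (@cvg_comp _ _ _ snd g _ (nbhs z.2)); [exact: cvg_snd|exact: torus_continuous].
pose f z : R := 1 - fejer z.1 z.2.
have fc : continuous (f : (R * R) * (R * R) -> R).
  move=> z; apply: cvgB; first exact: cvg_cst.
  apply: (@cvgM _ _ _ _ (fun _ => 4^-1)); first exact: cvg_cst.
  by apply: cvgM; (apply: cvgD; first exact: cvg_cst);
    apply: cvgD; apply: cvgM; (exact: c1 || exact: c2).
pose S : set ((R * R) * (R * R)) := (sq `*` sq) `&` [set z | e <= `|h z.2 - h z.1|].
have Sc : compact S.
  apply: compact_closedI; first by apply: compact_setX; exact: compact_square.
  have hc : continuous (fun z : (R * R) * (R * R) => `|h z.2 - h z.1|).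
    by move=> z; apply: cvg_norm; apply: cvgB; [exact: c2|exact: c1].
  have := @closed_comp _ _ (fun z : (R * R) * (R * R) => `|h z.2 - h z.1|) [set x | e <= x].
  by apply=> [z _|]; [exact: hc|exact: closed_ge].
have [B B0 hB] := torus_bounded h.
have [m m0 Sm] : exists2 m, 0 < m & forall z, S z -> m <= f z.
  have [S0|/set0P S1] := eqVneq S set0; first by exists 1 => // z; rewrite S0.
  have [|||z0 Sz0 H] := @compact_EVT_min _ R f S => //; first exact: continuous_subspaceT.
  exists (f z0) => [|z Sz]; last by apply: H; rewrite inE.
  move: Sz0; rewrite inE => -[_ /= hz]; rewrite /f subr_gt0.
  have [/andP[_ b] L] := fejer_bound z0.1 z0.2; rewrite lt_neqAle b andbT.
  apply/eqP => /L /(torus_periodic h) E.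
  by move: hz; rewrite E subrr normr0 leNgt e0.
exists (2 * B / m) => [|p q]; first by rewrite divr_ge0 ?mulr_ge0 // ltW.
have [p' Sp pp] := fundamental_domain p; have [q' Sq qq] := fundamental_domain q.
have -> : fejer p q = fejer p' q'.
  by rewrite (torus_periodic _ qq) /fejer /kapX /kapY !torusE !tcstE !(torus_periodic _ pp).
rewrite (torus_periodic h pp) (torus_periodic h qq).
have [/andP[_ b] _] := fejer_bound p' q'.
have [H|H] := leP e `|h q' - h p'|; last first.
  apply: (le_trans (ltW H)); rewrite lerDl mulr_ge0 ?subr_ge0 //.
  by rewrite divr_ge0 ?mulr_ge0 // ltW.
have := Sm (p', q') (conj (conj Sp Sq) H); rewrite /f /= => Hm.
have : `|h q' - h p'| <= 2 * B.
  by rewrite (le_trans (ler_normB _ _)) // mulr_natl mulr2n lerD.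
move=> H2; apply: (le_trans H2); apply: ler_wpDl; first exact: ltW.
by rewrite mulrAC ler_pdivlMr // ler_wpM2l // mulr_ge0 // ltW.
Qed.

Definition smoothing N h : A := \sum_(m <- modes N)
  tcst (wt m) * (tcst (I (h * mc m)) * mc m + tcst (I (h * ms m)) * ms m).

Lemma smoothingE N h p : smoothing N h p = I (h * fejer p ^+ N).
Proof.
rewrite -kernel_modes /kernel mulr_sumr cint_sum torus_sum; apply: eq_bigr => m _.
rewrite [in RHS]mulrCA [RHS]cintZ [in RHS]mulrDr cint_add [h * (_ * mc m)]mulrCA [h * (_ * ms m)]mulrCA !cintZ.
by rewrite !torusE !tcstE; congr (_ * (_ + _)); exact: mulrC.
Qed.

Lemma smoothing_close h e : 0 < e -> exists C : R, forall N p,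
  `|smoothing N h p - mass N * h p| <= mass N * (e + C / N.+1%:R).
Proof.
move=> e0; have [C C0 HC] := kernel_modulus h e0; exists C => N p.
have F0 q : 0 <= (fejer p ^+ N) q.
  by rewrite torusX exprn_ge0 //; have [/andP[]] := fejer_bound p q.
have up : I ((tcst e + tcst C * (1 - fejer p)) * fejer p ^+ N) <= mass N * (e + C / N.+1%:R).
  rewrite mulrDl cint_add cintZ fejer_mass -mulrA cintZ mulrBl mul1r -exprS cint_sub !fejer_mass.
  by rewrite [leRHS]mulrDr [e * _]mulrC lerD2l [leRHS]mulrCA ler_wpM2l // mass_drop.
have -> : smoothing N h p - mass N * h p = I ((h - tcst (h p)) * fejer p ^+ N).
  by rewrite smoothingE mulrBl cint_sub cintZ fejer_mass; congr (_ - _); exact: mulrC.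
rewrite ler_norml; apply/andP; split; last first.
  apply: le_trans up; apply: cint_le => q; rewrite !torusM ler_wpM2r //.
  by rewrite !torusE !tcstE (le_trans (ler_norm _)).
rewrite lerNl (le_trans _ up) // -cint_opp -mulNr; apply: cint_le => q.
rewrite !torusM ler_wpM2r // !torusE !tcstE opprB (le_trans (ler_norm _)) //.
by rewrite distrC.
Qed.

Definition approx N h : A := locked (tcst (mass N)^-1 * smoothing N h).
Lemma approxE N h : approx N h = tcst (mass N)^-1 * smoothing N h.
Proof. by rewrite /approx -lock. Qed.

(** As in Korovkin's theorem: the mean of [1 - fejer] against the powers of the
    kernel is of order [1 / N]. *)
Lemma approx_cvg h e : 0 < e -> exists N0, forall N, (N0 <= N)%N ->
  forall p, `|approx N h p - h p| <= e.
Proof.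
move=> e0; have e2 : 0 < e / 2 by rewrite divr_gt0.
have [C HC] := smoothing_close h e2.
exists (Num.truncn `|C / (e / 2)|) => N N0 p; have m0 := mass_gt0 N.
have -> : approx N h p - h p = (mass N)^-1 * (smoothing N h p - mass N * h p).
  by rewrite approxE torusM tcstE mulrBr mulrA mulVf ?gt_eqF // mul1r.
rewrite normrM normfV [`|mass N|]ger0_norm ?(ltW m0) // ler_pdivrMl //.
apply: (le_trans (HC N p)); rewrite ler_wpM2l ?(ltW m0) //.
suff H : C / N.+1%:R <= e / 2 by rewrite [leRHS]splitr lerD2l.
rewrite ler_pdivrMr ?ltr0n // mulrC -ler_pdivrMr // (le_trans (ler_norm _)) //.
by rewrite ltW // (lt_le_trans (truncnS_gt _)) // ler_nat ltnS.
Qed.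

End Korovkin.

(** * The Poincare inequality *)

Section ModeAlgebra.
Variable T : comNzRingType.
Implicit Types (a b d e f k l x y C S w : T).
Lemma mode_deriv a b k C S : a * - (k * S) + b * (k * C) = k * b * C + - (k * a) * S.
Proof. ring. Qed.
Lemma mode_lap_cos k l C : - (k * (k * C)) - l * (l * C) = - ((k * k + l * l) * C).
Proof. ring. Qed.
Lemma mode_lap_sin k l S : k * - (k * S) + l * - (l * S) = - ((k * k + l * l) * S).
Proof. ring. Qed.
Lemma mode_inverse a f w d e x y : a * f = -1 ->
  a * (w * (d * - (f * x) + e * - (f * y))) = w * (d * x + e * y).
Proof.
move=> af; transitivity (- (a * f) * (w * (d * x + e * y))); first by ring.
by rewrite af opprK mul1r.
Qed.
End ModeAlgebra.

Lemma perturbed_le (R : realFieldType) (lam a a' b b' d e : R) : 0 <= lam ->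
  `|a' - a| <= d -> `|b' - b| <= d -> lam * a' <= - b' ->
  d * (lam + 1) = e -> lam * a <= - b + e.
Proof.
move=> lam0; rewrite !ler_norml => /andP[h1 h2] /andP[h3 h4] h5 <-.
have h6 : lam * a <= lam * (a' + d) by rewrite ler_wpM2l //; lra.
apply: (le_trans h6); rewrite mulrDr [d * _]mulrDr mulr1 [d * lam]mulrC.
by move: h5 h3; move: (lam * a') (lam * d) => x y; lra.
Qed.

Section SpectralGap.
Context {R : realType}.
Notation A := (torus_fun R).
Variable c : trig_chart R.
Notation DX := (Dx c).
Notation DY := (Dy c).
Notation I := (cint c).
Implicit Types (h g : A) (p q : R * R).
Notation modes := (modes c).
Notation smoothing := (smoothing c).
Notation approx := (approx c).
Notation mass := (mass c).

Let tcstNM (a b : R) : tcst (- (a * b)) = - (tcst a * tcst b) :> A.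
Proof. by apply: torus_ext. Qed.
Lemma smoothing_DX N h : DX (smoothing N h) = smoothing N (DX h).
Proof.
rewrite deriv_sum; apply: eq_bigr => m _; rewrite derivZ derivD !derivZ DX_mc DX_ms.
rewrite !cint_parts_x DX_mc DX_ms [h * - _]mulrN cint_opp opprK [h * (_ * ms m)]mulrCA.
rewrite [h * (_ * mc m)]mulrCA !cintZ tcstNM tcstM; congr (_ * _).
exact: mode_deriv.
Qed.

Lemma smoothing_DY N h : DY (smoothing N h) = smoothing N (DY h).
Proof.
rewrite deriv_sum; apply: eq_bigr => m _; rewrite derivZ derivD !derivZ DY_mc DY_ms.
rewrite !cint_parts_y DY_mc DY_ms [h * - _]mulrN cint_opp opprK [h * (_ * ms m)]mulrCA.
rewrite [h * (_ * mc m)]mulrCA !cintZ tcstNM tcstM; congr (_ * _).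
exact: mode_deriv.
Qed.

Lemma approx_DX N h : DX (approx N h) = approx N (DX h).
Proof. by rewrite !approxE derivZ smoothing_DX. Qed.
Lemma approx_DY N h : DY (approx N h) = approx N (DY h).
Proof. by rewrite !approxE derivZ smoothing_DY. Qed.
Lemma lap_mode (m : mode c) : lap c (mc m) = - (tcst (freq m) * mc m) /\ lap c (ms m) = - (tcst (freq m) * ms m).
Proof.
have dN (D : derivation R) g : D (- g) = - D g by exact: raddfN.
rewrite /lap DX_mc DX_ms DY_mc DY_ms !dN !derivZ DX_mc DX_ms DY_mc DY_ms.
rewrite /freq tcstD2 !expr2 !tcstM.
by split; [exact: mode_lap_cos|exact: mode_lap_sin].
Qed.

Lemma lap_sym g h : I (lap c g * h) = I (g * lap c h).
Proof.
rewrite /lap mulrDl mulrDr !cint_add !cint_parts_x !cint_parts_y.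
by rewrite !opprK.
Qed.

Lemma smoothing_pair N g h : I (g * smoothing N h) = \sum_(m <- modes N)
  wt m * (I (h * mc m) * I (g * mc m) + I (h * ms m) * I (g * ms m)).
Proof.
rewrite /smoothing mulr_sumr cint_sum; apply: eq_bigr => m _.
rewrite mulrCA cintZ mulrDr cint_add [g * (_ * mc m)]mulrCA [g * (_ * ms m)]mulrCA !cintZ.
by [].
Qed.

Lemma approx_pair g h e : 0 < e -> exists N0, forall N, (N0 <= N)%N ->
  `|I (g * approx N h) - I (g * h)| <= e.
Proof.
move=> e0; have [B B0 hB] := torus_bounded g.
have I1 := cint1_gt0 c; pose d := e / (B * I 1).
have d0 : 0 < d by rewrite divr_gt0 // mulr_gt0.
have [N0 HN] := approx_cvg c h d0; exists N0 => N /HN {}HN.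
have E : I (tcst (B * d)) = e.
  by rewrite -[tcst _]mulr1 cintZ /d; field; rewrite !gt_eqF.
have bd p : `|(g * approx N h - g * h) p| <= B * d.
  by rewrite -mulrBr torusM normrM; apply: ler_pM => //; exact: HN.
rewrite -cint_sub -E ler_norml -cint_opp; apply/andP; split; apply: cint_le => p.
  by rewrite torusN tcstE; have := bd p; rewrite ler_norml => /andP[].
by rewrite tcstE; have := bd p; rewrite ler_norml => /andP[].
Qed.

Lemma dirichlet h : I (DX h * DX h + DY h * DY h) = - I (h * lap c h).
Proof.
rewrite /lap mulrDr !cint_add opprD -cint_parts_x -cint_parts_y; congr (_ + _).
Qed.

(** A function orthogonal to all the modes of frequency below [lam] satisfies the
    Poincare inequality with constant [lam]: both sides are limits of sums over
    the modes, because Fejer means commute with the Laplacian. *)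
Lemma spectral_gap h lam : 0 <= lam -> (forall m : mode c, freq m < lam ->
    I (h * mc m) = 0 /\ I (h * ms m) = 0) ->
  lam * I (h * h) <= I (DX h * DX h + DY h * DY h).
Proof.
move=> lam0 orth; rewrite dirichlet; apply/ler_addgt0Pr => e e0.
have k0 : 0 < lam + 1 by rewrite ltr_wpDl.
have d0 : 0 < e / (lam + 1) by rewrite divr_gt0.
have [N1 H1] := approx_pair h h d0; have [N2 H2] := approx_pair h (lap c h) d0.
pose N := maxn N1 N2.
have {}H1 := H1 N (leq_maxl _ _); have {}H2 := H2 N (leq_maxr _ _).
have key : lam * I (h * approx N h) <= - I (h * approx N (lap c h)).
  have ap g : I (h * approx N g) = (mass N)^-1 * I (h * smoothing N g).
    by rewrite approxE mulrCA cintZ.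
  have m0 : 0 <= (mass N)^-1 by rewrite invr_ge0 ltW // mass_gt0.
  have alg (a x y u v : R) : 0 <= a -> u = a * x -> v = a * y -> lam * x <= - y -> lam * u <= - v.
    by move=> a0 -> -> xy; rewrite mulrCA -mulrN ler_wpM2l.
  apply: (alg _ _ _ _ _ m0 (ap h) (ap (lap c h))).
  have alg_sum (J : Type) (r : seq J) (F G : J -> R) u v : u = \sum_(j <- r) F j ->
    v = \sum_(j <- r) G j -> (forall j, lam * F j <= - G j) -> lam * u <= - v.
    by move=> -> -> FG; rewrite mulr_sumr -sumrN; apply: ler_sum => j _; exact: FG.
  apply: (alg_sum _ _ _ _ _ _ (smoothing_pair N h h) (smoothing_pair N h (lap c h))) => m.
  have [l1 l2] := lap_mode m.
  have -> : I (lap c h * mc m) = - (freq m * I (h * mc m)).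
    by rewrite lap_sym l1 mulrN cint_opp mulrCA cintZ.
  have -> : I (lap c h * ms m) = - (freq m * I (h * ms m)).
    by rewrite lap_sym l2 mulrN cint_opp mulrCA cintZ.
  have [small|big_] := ltP (freq m) lam.
    have [-> ->] := orth m small.
    by rewrite !mulr0 addr0 !mulr0 oppr0.
  have w0 := wt_ge0 m.
  rewrite [leLHS](_ : _ = wt m * (lam * (I (h * mc m) ^+ 2 + I (h * ms m) ^+ 2))); last by ring.
  rewrite [leRHS](_ : _ = wt m * (freq m * (I (h * mc m) ^+ 2 + I (h * ms m) ^+ 2))); last by ring.
  by rewrite ler_wpM2l // ler_wpM2r // addr_ge0 ?sqr_ge0.
apply: (perturbed_le lam0 H1 H2 key).
by rewrite divfK // gt_eqF.
Qed.

Lemma int_sqr_lt1 (k : int) : (k%:~R ^+ 2 : R) < 1 -> k = 0.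
Proof.
rewrite -rmorphXn /= -[1]/(1%:~R) ltr_int => H; apply/eqP; apply: contraTT H => k0.
by rewrite -leNgt -[k ^+ 2]real_normK ?num_real // exprn_ege1 // -gtz0_ge1 normr_gt0.
Qed.

Lemma freq0 (m : mode c) : freq m < 1 -> freq m = 0 /\
  exists a b, mc m = tcst a /\ ms m = tcst b.
Proof.
rewrite /freq => H.
have k0 : mk m = 0 by apply: int_sqr_lt1; apply: le_lt_trans H; rewrite lerDl sqr_ge0.
have l0 : ml m = 0 by apply: int_sqr_lt1; apply: le_lt_trans H; rewrite lerDr sqr_ge0.
have t0 : tcst 0 = 0 :> A by apply: torus_ext.
split; first by rewrite k0 l0 expr2 mulr0 addr0.
have [||a ->] := @chart_const _ c (mc m).
- by rewrite DX_mc k0 t0 mul0r oppr0.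
- by rewrite DY_mc l0 t0 mul0r oppr0.
have [||b ->] := @chart_const _ c (ms m).
- by rewrite DX_ms k0 t0 mul0r.
- by rewrite DY_ms l0 t0 mul0r.
by exists a, b.
Qed.

Lemma mean0_const h a : I h = 0 -> I (h * tcst a) = 0.
Proof. by move=> h0; rewrite mulrC cintZ h0 mulr0. Qed.
Lemma poincare h : I h = 0 -> I (h * h) <= I (DX h * DX h + DY h * DY h).
Proof.
move=> h0; rewrite -[leLHS]mul1r; apply: spectral_gap => // m /freq0[_ [a [b [-> ->]]]].
by split; exact: mean0_const.
Qed.

(** On a mode the Laplacian is multiplication by minus the frequency, and mean
    zero removes the constant modes. *)
Lemma poisson_approx N h : I h = 0 -> exists u, I u = 0 /\ lap c u = approx N h.
Proof.
move=> h0; have dN (D : derivation R) g : D (- g) = - D g by exact: raddfN.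
have lapZ a g : lap c (tcst a * g) = tcst a * lap c g by rewrite /lap !derivZ mulrDr.
have lapD g g' : lap c (g + g') = lap c g + lap c g'.
  by rewrite /lap !derivD addrACA.
have lap0 : lap c 0 = 0 by rewrite /lap !raddf0 addr0.
pose v : A := \sum_(m <- modes N) tcst (- (freq m)^-1) * (tcst (wt m) *
  (tcst (I (h * mc m)) * mc m + tcst (I (h * ms m)) * ms m)).
have lv : lap c v = smoothing N h.
  rewrite /v /smoothing (big_morph (lap c) lapD lap0); apply: eq_bigr => m _.
  rewrite !lapZ lapD !lapZ; have [-> ->] := lap_mode m.
  have [f0|f0] := eqVneq (freq m) 0.
    have [_ [a [b [-> ->]]]] := @freq0 m ltac:(by rewrite f0).
    rewrite !(mean0_const _ h0) f0; have -> : tcst 0 = 0 :> A by apply: torus_ext.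
    by rewrite !mul0r addr0 !mulr0.
  have E : tcst (- (freq m)^-1) * tcst (freq m) = -1 :> A.
    by rewrite -tcstM mulNr mulVf // tcstN12.
  exact: mode_inverse.
pose u := tcst (mass N)^-1 * v; pose a := I u / I 1.
exists (u - tcst a); split.
  rewrite cint_sub -[tcst a]mulr1 cintZ /a divfK ?subrr // gt_eqF //; exact: cint1_gt0.
rewrite lapD /u lapZ lv approxE; rewrite [X in _ + X](_ : _ = 0) ?addr0 //.
have d0 (D : derivation R) : D 0 = 0 by exact: raddf0.
have -> : - tcst a = tcst (- a) :> A by apply: torus_ext.
by rewrite /lap !deriv_cst !d0 addr0.
Qed.
End SpectralGap.

(** * Rapidly convergent series *)

Section RapidSequences.
Context {R : realType}.
Notation A := (torus_fun R).
Implicit Types (g : nat -> A) (h : A) (p : R * R).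

Definition decay g := exists C r : R, [/\ 0 <= C, 0 < r, r < 1 &
  forall n, tint (g n * g n) <= C * r ^+ n].

Lemma decay_le2 g1 g2 g K : 0 <= K -> decay g1 -> decay g2 ->
  (forall n, tint (g n * g n) <= K * (tint (g1 n * g1 n) + tint (g2 n * g2 n))) -> decay g.
Proof.
move=> K0 [C1 [r1 [C10 r10 r11 h1]]] [C2 [r2 [C20 r20 r21 h2]]] H.
pose r := Num.max r1 r2.
exists (K * (C1 + C2)), r; split; rewrite ?mulr_ge0 ?addr_ge0 //.
- by rewrite lt_max r10.
- by rewrite gt_max r11.
move=> n; apply: (le_trans (H n)); rewrite -mulrA ler_wpM2l // mulrDl; apply: lerD.
  apply: (le_trans (h1 n)); rewrite ler_wpM2l // lerXn2r ?nnegrE ?(ltW r10) //.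
    by rewrite le_max (ltW r10).
  by rewrite le_max lexx.
apply: (le_trans (h2 n)); rewrite ler_wpM2l // lerXn2r ?nnegrE ?(ltW r20) //.
  by rewrite le_max (ltW r10).
by rewrite le_max lexx orbT.
Qed.

Lemma decayD g1 g2 : decay g1 -> decay g2 -> decay (fun n => g1 n + g2 n).
Proof.
move=> d1 d2; apply: (decay_le2 (K := 2) _ d1 d2) => // n.
rewrite -tintD -tintZ; apply: tint_le => p; rewrite !torusE !tcstE.
move: (g1 n p) (g2 n p) => a b; have := sqr_ge0 (a - b); nra.
Qed.

Lemma decay_le g g' K : 0 <= K -> decay g -> (forall n p, `|g' n p| <= K * `|g n p|) -> decay g'.
Proof.
move=> K0 d H; apply: (decay_le2 (K := K ^+ 2) _ d d) => [|n]; first exact: sqr_ge0.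
rewrite -tintD -tintZ; apply: tint_le => p; rewrite !torusE !tcstE.
have k2 : `|g' n p| * `|g' n p| <= (K * `|g n p|) * (K * `|g n p|) by rewrite ler_pM.
have e (x : R) : `|x| * `|x| = x * x by rewrite -expr2 real_normK ?num_real // expr2.
rewrite e mulrACA e in k2; apply: (le_trans k2); rewrite expr2 mulrDr lerDl.
by rewrite mulr_ge0 // -expr2 sqr_ge0.
Qed.

Lemma decayM m g : decay g -> decay (fun n => m * g n).
Proof.
move=> d; have [B B0 hB] := torus_bounded m.
by apply: (decay_le (ltW B0) d) => n p; rewrite torusM normrM ler_wpM2r.
Qed.

Fixpoint decays k g := decay g /\
  if k is k'.+1 then forall i, decays k' (fun n => td i (g n)) else True.
Definition rapid g := forall k, decays k g.

Lemma decays0 k g : decays k g -> decay g. Proof. by case: k => [|k] []. Qed.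
Lemma decaysW k g : decays k.+1 g -> decays k g.
Proof.
elim: k g => [|k IH] g [d H]; first by split.
by split=> // i; apply: IH; exact: H.
Qed.

Lemma decaysD k g1 g2 : decays k g1 -> decays k g2 -> decays k (fun n => g1 n + g2 n).
Proof.
elim: k g1 g2 => [|k IH] g1 g2 [d1 H1] [d2 H2]; split; rewrite ?decayD //; try exact: decayD.
move=> i; have -> : (fun n => td i (g1 n + g2 n)) = (fun n => td i (g1 n) + td i (g2 n)).
  by apply/funext => n; exact: raddfD.
by apply: IH; [exact: H1|exact: H2].
Qed.

Lemma decaysM k m g : decays k g -> decays k (fun n => m * g n).
Proof.
elim: k m g => [|k IH] m g H; first by split=> //; apply: decayM; exact: decays0 H.
split=> [|i]; first by apply: decayM; exact: decays0 H.
have -> : (fun n => td i (m * g n)) = (fun n => td i m * g n + m * td i (g n)).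
  by apply/funext => n; exact: tdM.
by apply: decaysD; apply: IH; [exact: decaysW|exact: H.2].
Qed.

Lemma rapidD g1 g2 : rapid g1 -> rapid g2 -> rapid (fun n => g1 n + g2 n).
Proof. by move=> h1 h2 k; apply: decaysD. Qed.
Lemma rapidM m g : rapid g -> rapid (fun n => m * g n).
Proof. by move=> h k; apply: decaysM. Qed.
Lemma rapid_td i g : rapid g -> rapid (fun n => td i (g n)).
Proof. by move=> h k; have [_] := h k.+1; exact. Qed.

(** Sobolev's inequality turns decay in mean square of the derivatives into
    uniform decay. *)
Lemma rapid_sup g : rapid g -> exists C r : R, [/\ 0 <= C, 0 < r, r < 1 &
  forall n p, `|g n p| <= C * r ^+ n].
Proof.
move=> rg; have d0 := decays0 (rg 0%N).
have d1 i := decays0 (rapid_td i rg 0%N).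
have d2 := decays0 (rapid_td ord0 (rapid_td ord_max rg) 0%N).
have Z a g' : decay g' -> decay (fun n => tcst a * g' n) by exact: decayM.
have [C0 [r0 [C00 r00 r01 h0]]] := d0.
have [C1 [r1 [C10 r10 r11 h1]]] := d1 ord0.
have [C2 [r2 [C20 r20 r21 h2]]] := d1 ord_max.
have [C3 [r3 [C30 r30 r31 h3]]] := d2.
pose r := Num.max (Num.max r0 r1) (Num.max r2 r3).
pose C := 4 * C0 + 2 * C1 + 2 * C2 + C3.
have rp : 0 < r by rewrite !lt_max r00.
exists (Num.sqrt C), (Num.sqrt r); split; rewrite ?sqrtr_ge0 ?sqrtr_gt0 //.
  by rewrite -[X in _ < X]sqrtr1 ltr_sqrt // !gt_max r01 r11 r21.
move=> n p; rewrite -(@ler_pXn2r _ 2) ?nnegrE ?mulr_ge0 ?exprn_ge0 ?sqrtr_ge0 //.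
have C_ge0 : 0 <= C by rewrite /C !addr_ge0 ?mulr_ge0.
rewrite real_normK ?num_real // exprMn -exprM mulnC exprM !sqr_sqrtr ?(ltW rp) //.
apply: (le_trans (torus_sobolev (g n) p)); rewrite !tintD !tintZ.
have le_r (C' r' : R) x : 0 <= C' -> 0 < r' -> r' <= r -> x <= C' * r' ^+ n -> x <= C' * r ^+ n.
  move=> c0 r'0 r'r H; apply: (le_trans H); rewrite ler_wpM2l // lerXn2r ?nnegrE ?(ltW r'0) //.
  exact: ltW.
have {}h0 := le_r _ _ _ C00 r00 ltac:(by rewrite !le_max lexx) (h0 n).
have {}h1 := le_r _ _ _ C10 r10 ltac:(by rewrite !le_max lexx !orbT) (h1 n).
have {}h2 := le_r _ _ _ C20 r20 ltac:(by rewrite !le_max lexx !orbT) (h2 n).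
have {}h3 := le_r _ _ _ C30 r30 ltac:(by rewrite !le_max lexx !orbT) (h3 n).
move: h0 h1 h2 h3; rewrite /C; move: (tint _) (tint _) (tint _) (tint _) (r ^+ n) => a b d e x.
by rewrite !mulrDl -!mulrA; lra.
Qed.

Lemma geometric_series (x : nat -> R) (C r : R) : 0 <= C -> 0 < r -> r < 1 ->
  (forall n, `|x n| <= C * r ^+ n) ->
  cvgn (series x) /\ `|limn (series x)| <= C / (1 - r).
Proof.
move=> C0 r0 r1 H; have rr : `|r| < 1 by rewrite ger0_norm // ltW.
have G := cvg_geometric_series (a := C) rr.
have Gc : cvgn (series (geometric C r)) by apply: cvgP G.
have Nc : cvgn [normed series x].
  apply: (series_le_cvg _ _ _ Gc) => n /=; first exact: normr_ge0; last exact: H.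
  by rewrite mulr_ge0 // exprn_ge0 // ltW.
split; first exact: normed_cvg.
apply: (le_trans (lim_series_norm Nc)); rewrite -(cvg_lim _ G) //.
by apply: lim_series_le.
Qed.

Definition total g p : R := limn (series (fun n => g n p)).

Lemma rapid_cvg g p : rapid g -> cvgn (series (fun n => g n p)).
Proof.
move=> /rapid_sup[C [r [C0 r0 r1 H]]].
by have [] := geometric_series C0 r0 r1 (fun n => H n p).
Qed.

Lemma totalD g1 g2 p : rapid g1 -> rapid g2 ->
  total (fun n => g1 n + g2 n) p = total g1 p + total g2 p.
Proof.
move=> r1 r2; rewrite /total -lim_seriesD; try exact: rapid_cvg.
by congr (limn (series _)).
Qed.

Lemma totalM m g p : rapid g -> total (fun n => m * g n) p = m p * total g p.
Proof.
move=> rg; rewrite /total; apply/cvg_lim => //.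
have -> : series (fun n => (m * g n) p) = (fun n => m p * series (fun n => g n p) n).
  by apply/funext => n; rewrite /series /= mulr_sumr.
by apply: cvgMr; exact: rapid_cvg.
Qed.

Lemma totalS g p : rapid g -> total (fun n => g n.+1) p = total g p - g 0%N p.
Proof.
move=> rg; rewrite /total; apply/cvg_lim => //.
have -> : series (fun n => g n.+1 p) = (fun n => series (fun n => g n p) n.+1 - g 0%N p).
  by apply/funext => n; rewrite /series /= big_nat_recl // addrC addKr.
apply: cvgB; last exact: cvg_cst.
by rewrite cvg_shiftS; exact: rapid_cvg.
Qed.

(** Taylor expansion term by term: the second derivatives are bounded by a
    geometric series. *)
Lemma total_derive g (i : 'I_2) (p : R * R) : rapid g -> exists2 K : R, 0 <= K & forall x : R,
  `|total g (p.1 + x * (i == ord0)%:R, p.2 + x * (i != ord0)%:R) - total g p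
    - total (fun n => td i (g n)) p * x| <= K * x ^+ 2.
Proof.
move=> rg; have r1 := rapid_td i rg; have [C [r [C0 r0 r1' H]]] := rapid_sup (rapid_td i r1).
exists (C / (1 - r)) => [|x]; first by rewrite divr_ge0 // subr_ge0 ltW.
set q := (_, _).
have quad n : `|g n q - g n p - td i (g n) p * x| <= C * x ^+ 2 * r ^+ n.
  have -> : C * x ^+ 2 * r ^+ n = C * r ^+ n * x ^+ 2 by ring.
  rewrite -[x ^+ 2]real_normK ?num_real //.
  suff [z z' E1] : exists2 z : R * R, exists2 z' : R * R,
    (`|td i (g n) z - td i (g n) p| <= `|td i (td i (g n)) z'| * `|x|) & True &
    g n q - g n p = td i (g n) z * x.
    case: z' => w Hw _; rewrite E1 -mulrBl normrM expr2 mulrA ler_wpM2r //.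
    by apply: (le_trans Hw); rewrite ler_wpM2r.
  have pp k := @torus_partials R k.
  rewrite {}/q; elim/ord2P: i r1 H {rg} => r1 H; case: p => s t /=; rewrite ?mulr1 ?mulr0 ?addr0.
    have [c0 b0 e0] := mvt0 s (s + x) t (pp (g n)).
    have [c1 b1 e1] := mvt0 s c0 t (pp (td ord0 (g n))).
    exists (c0, t); last by rewrite e0 [s + x]addrC addrK.
    exists (c1, t) => //; rewrite e1 normrM ler_wpM2l // (le_trans b0) //.
    by rewrite [s + x]addrC addrK.
  have [c0 b0 e0] := mvt1 s t (t + x) (pp (g n)).
  have [c1 b1 e1] := mvt1 s t c0 (pp (td ord_max (g n))).
  exists (s, c0); last by rewrite e0 [t + x]addrC addrK.
  exists (s, c1) => //; rewrite e1 normrM ler_wpM2l // (le_trans b0) //.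
  by rewrite [t + x]addrC addrK.
have Cx : 0 <= C * x ^+ 2 by rewrite mulr_ge0 // sqr_ge0.
have [_ L] := geometric_series Cx r0 r1' quad.
have E : limn (series (fun n => g n q - g n p - td i (g n) p * x))
   = total g q - total g p - total (fun n => td i (g n)) p * x.
  apply/cvg_lim => //.
  have -> : series (fun n => g n q - g n p - td i (g n) p * x)
    = (fun N => series (fun n => g n q) N - series (fun n => g n p) N
    - series (fun n => td i (g n) p) N * x).
    by apply/funext => N; rewrite /series /= mulr_suml -!sumrB.
  apply: cvgB; first by apply: cvgB; exact: rapid_cvg.
  by apply: cvgMl; exact: rapid_cvg.
by rewrite -E (le_trans L) // mulrAC.
Qed.

Lemma total_periodic g : Defs.periodic (total g).
Proof.
move=> p q pq; rewrite /total; congr (limn (series _)).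
by apply/funext => n; exact: torus_periodic.
Qed.

Lemma total_partials g : rapid g -> has_partials (total g) /\
  forall i, partial i (total g) = total (fun n => td i (g n)).
Proof.
move=> rg.
have [||dp e0 e1] := @partials_of_slices R R^o (total g) (total (fun n => td ord0 (g n)))
  (total (fun n => td ord_max (g n))).
- move=> s t; have [K K0 H] := total_derive ord0 (s, t) rg.
  apply: (@is_derive_quadratic _ _ _ _ K 1) => // x _.
  by have := H x; rewrite /= mulr1 mulr0 addr0.
- move=> s t; have [K K0 H] := total_derive ord_max (s, t) rg.
  apply: (@is_derive_quadratic _ _ _ _ K 1) => // x _.
  by have := H x; rewrite /= mulr1 mulr0 addr0.
by split; [exact: dp|elim/ord2P; [exact: e0|exact: e1]].
Qed.

(** The sequences of derivatives are again rapid, so that smoothness follows by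
    coinduction. *)
Lemma rapid_sum g : rapid g -> exists v : A, (forall p, v p = total g p) /\
  forall i p, td i v p = total (fun n => td i (g n)) p.
Proof.
move=> rg.
have sm : smooth (total g).
  apply: (@smooth_coind R R^o (fun f => exists g, rapid g /\ f = total g)); last by exists g.
  move=> _ [k [rk ->]]; have [dp pE] := total_partials rk; split=> // [|i]; last first.
    by exists (fun n => td i (k n)); split; [exact: rapid_td|exact: pE].
  have bd i : exists M : R, forall p, `|partial i (total k) p| <= M.
    have [C [r [C0 r0 r1 H]]] := rapid_sup (rapid_td i rk).
    exists (C / (1 - r)) => p; rewrite pE.
    by have [_] := geometric_series C0 r0 r1 (fun n => H n p).
  have [M0 b0] := bd ord0; have [M1 b1] := bd ord_max.
  apply: (@lipschitz_continuous _ _ (Num.max M0 M1)).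
  apply: bounded_partials_lipschitz => // i p; elim/ord2P: i.
    by rewrite le_max b0.
  by rewrite le_max b1 orbT.
have [dp pE] := total_partials rg.
exists (mk_torus (conj sm (@total_periodic g))); split=> // i p.
by rewrite -pE.
Qed.
End RapidSequences.

(** * Angle functions *)

Section Angles.
Context {R : realType}.
Implicit Types (x y : R) (k : int).

Lemma cos_sin_2pi_nat (n : nat) : cos (2 * pi * n%:R) = 1 :> R /\ sin (2 * pi * n%:R) = 0 :> R.
Proof.
elim: n => [|n [c s]]; first by rewrite mulr0 cos0 sin0.
have e2 : 2 * pi = pi *+ 2 :> R by rewrite mulr_natl.
by rewrite -(natr1 n) mulrDr mulr1 cosD sinD c s e2 cos2pi sin2pi !mulr0 !mul1r mul0r subr0 addr0.
Qed.

Lemma cos_sin_2pi k : cos (2 * pi * k%:~R) = 1 :> R /\ sin (2 * pi * k%:~R) = 0 :> R.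
Proof.
case: k => n; first exact: cos_sin_2pi_nat.
have [c s] := cos_sin_2pi_nat n.+1.
by rewrite NegzE mulrNz mulrN cosN sinN c s oppr0.
Qed.

Lemma angle_periodic x k : cos (x + 2 * pi * k%:~R) = cos x /\ sin (x + 2 * pi * k%:~R) = sin x.
Proof. by have [c s] := cos_sin_2pi k; rewrite cosD sinD c s !mulr0 !mulr1 subr0 addr0. Qed.

(** Reduce the difference of the angles to the interval between [0] and [2 pi]
    and use that the sine of its half is positive inside. *)
Lemma angle_inj x y : cos x = cos y -> sin x = sin y -> exists k, x - y = 2 * pi * k%:~R.
Proof.
move=> cxy sxy; have tp : 0 < 2 * pi :> R by rewrite mulr_gt0 ?pi_gt0.
pose k := Num.floor ((x - y) / (2 * pi)); exists k; apply: subr0_eq.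
pose r : R := x - y + 2 * pi * (- k)%:~R.
have -> : x - y - 2 * pi * k%:~R = r by rewrite /r mulrNz mulrN.
have r0 : 0 <= r.
  by rewrite /r mulrNz mulrN subr_ge0 -ler_pdivlMl // mulrC real_floor_le ?num_real.
have r1 : r < 2 * pi.
  have := real_floorD1_gt (num_real ((x - y) / (2 * pi))).
  rewrite -/k intrD ltr_pdivrMr // mulrDl mul1r => H.
  by rewrite /r mulrNz mulrN ltrBlDl [2 * pi * k%:~R]mulrC.
have cr : cos r = 1.
  by rewrite /r; have [-> _] := angle_periodic (x - y) (- k); rewrite cosB cxy sxy -!expr2 cos2Dsin2.
apply/eqP; rewrite -[_ == _]negbK; apply/negP => rn.
have rp : 0 < r by rewrite lt_neqAle eq_sym rn.
have := @sin_gt0_pi R (r / 2); rewrite divr_gt0 //= ltr_pdivrMr // mulrC.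
move=> /(_ r1) s0.
have : cos (r / 2 *+ 2) = 1 by rewrite -[_ *+ 2]mulr_natr divfK.
rewrite cos_mulr2n => /eqP; rewrite subr_eq -[1 + 1]/(1 *+ 2) eqrMn2r //= => /eqP c2.
have := cos2Dsin2 (r / 2); rewrite c2 => /eqP; rewrite -subr_eq0 addrC addKr sqrf_eq0.
by rewrite gt_eqF.
Qed.
End Angles.

Section AngleChart.
Context {R : realType}.
Notation A := (torus_fun R).

Lemma angle_functions (th : R * R -> R) (w : 'I_2 -> A) : smooth th ->
  (forall i, partial i th = w i) ->
  (forall p q, lattice (p - q) -> exists k : int, th p = th q + 2 * pi * k%:~R) ->
  exists C S : A, [/\ forall p, C p = cos (th p) /\ S p = sin (th p), C * C + S * S = 1,
    forall i, td i C = - S * w i & forall i, td i S = C * w i].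
Proof.
move=> sth thw per; have [ss sc] := smooth_sincos sth.
have pc : Defs.periodic (cos \o th).
  by move=> p q /per[k E] /=; rewrite E; have [] := angle_periodic (th q) k.
have ps : Defs.periodic (sin \o th).
  by move=> p q /per[k E] /=; rewrite E; have [] := angle_periodic (th q) k.
exists (mk_torus (conj sc pc)), (mk_torus (conj ss ps)); split=> // [|i|i].
- by apply: torus_ext => p; have := cos2Dsin2 (th p); rewrite !expr2.
- by apply: torus_ext => p; exact: (congr1 (fun f => f p) (cos_partial sth thw i)).
- by apply: torus_ext => p; exact: (congr1 (fun f => f p) (sin_partial sth thw i)).
Qed.

Lemma angle_forms_chart (c1 s1 c2 s2 : A) (x y : 'I_2 -> A)
  (clx : td ord_max (x ord0) = td ord0 (x ord_max)) (cly : td ord_max (y ord0) = td ord0 (y ord_max))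
  (det : forall p, 0 < (x ord0 * y ord_max - x ord_max * y ord0) p) :
  c1 * c1 + s1 * s1 = 1 -> c2 * c2 + s2 * s2 = 1 ->
  (forall i, td i c1 = - s1 * x i) -> (forall i, td i s1 = c1 * x i) ->
  (forall i, td i c2 = - s2 * y i) -> (forall i, td i s2 = c2 * y i) ->
  (forall p q, c1 p = c1 q -> s1 p = s1 q -> c2 p = c2 q -> s2 p = s2 q -> lattice (p - q)) ->
  exists T : trig_chart R, tchart T = Chart clx cly det /\
    [/\ cosx T = c1, sinx T = s1, cosy T = c2 & siny T = s2].
Proof.
move=> cs1 cs2 dc1 ds1 dc2 ds2 sep; pose c := Chart clx cly det.
have along h g : (forall i, td i h = g * x i) -> Dx c h = g /\ Dy c h = 0.
  by move=> H; apply: chart_coords => i; rewrite H mulr0 addr0 mulrC; elim/ord2P: i.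
have across h g : (forall i, td i h = g * y i) -> Dx c h = 0 /\ Dy c h = g.
  by move=> H; apply: chart_coords => i; rewrite H mulr0 add0r mulrC; elim/ord2P: i.
have [h1 h3] := along _ _ dc1; have [h2 h4] := along _ _ ds1.
have [h7 h5] := across _ _ dc2; have [h8 h6] := across _ _ ds2.
by exists (TrigChart h1 h2 h3 h4 h5 h6 h7 h8 cs1 cs2 sep).
Qed.
End AngleChart.

Lemma scaled_squares (T : comNzRingType) (k x y : T) :
  k * x * (k * x) + k * y * (k * y) = k * k * (x * x + y * y).
Proof. ring. Qed.

Section FlatTorus.
Context {R : realType}.
Notation A := (torus_fun R).
Implicit Types (h u : A).
Notation a := (2 * pi : R).

Let a0 : 0 < a. Proof. by rewrite mulr_gt0 ?pi_gt0. Qed.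
Lemma unit_trig_chart : exists T : trig_chart R,
  [/\ forall h, td ord0 h = tcst a * Dx T h, forall h, td ord_max h = tcst a * Dy T h
    & forall h, cint T h = a ^+ 2 * tint h].
Proof.
have [[s1 s2] [p10 p11] [p20 p21]] := @coordinates_smooth R.
have an : a != 0 by rewrite gt_eqF.
have ang (f : R * R -> R) (b : 'I_2 -> R) : smooth f -> (forall i, partial i f = tcst (b i)) ->
    (forall p q, lattice (p - q) -> f p - f q \is a Num.int) ->
    exists C S : A, [/\ forall p, C p = cos (a * f p) /\ S p = sin (a * f p), C * C + S * S = 1,
    forall i, td i C = - S * tcst (a * b i) & forall i, td i S = C * tcst (a * b i)].
  move=> sf fb fint; apply: angle_functions.
  - by apply: smoothM => //; exact: smooth_cst.
  - move=> i; have d := smooth_partials sf; have dc := smooth_partials (@smooth_cst R R^o a).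
    by apply/funext => p; rewrite (partialM _ dc d) partial_cst mul0r add0r fb.
  - by move=> p q /fint/intrP[k kE]; exists k; rewrite -kE; ring.
have [||C1 [S1 [E1 cs1 dc1 ds1]]] := ang fst (fun i => (i == ord0)%:R) s1.
- by move=> i; elim/ord2P: i; [exact: p10|exact: p11].
- by move=> p q [].
have [||C2 [S2 [E2 cs2 dc2 ds2]]] := ang snd (fun i => (i != ord0)%:R) s2.
- by move=> i; elim/ord2P: i; [exact: p20|exact: p21].
- by move=> p q [].
have sep p q : C1 p = C1 q -> S1 p = S1 q -> C2 p = C2 q -> S2 p = S2 q -> lattice (p - q).
  have [-> ->] := E1 p; have [-> ->] := E1 q; have [-> ->] := E2 p; have [-> ->] := E2 q.
  move=> a1 a2 a3 a4; have [k] := angle_inj a1 a2; have [l] := angle_inj a3 a4.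
  rewrite -!mulrBr => /(mulfI an) lE /(mulfI an) kE.
  by split; apply/intrP; [exists k|exists l].
pose x (i : 'I_2) : A := tcst (a * (i == ord0)%:R); pose y (i : 'I_2) : A := tcst (a * (i != ord0)%:R).
have z0 : td ord_max (x ord0) = td ord0 (x ord_max) by rewrite !td_cst.
have z1 : td ord_max (y ord0) = td ord0 (y ord_max) by rewrite !td_cst.
have det p : 0 < (x ord0 * y ord_max - x ord_max * y ord0) p.
  by rewrite torusB !torusM !tcstE /= !mulr1 mulr0 mul0r subr0 mulr_gt0.
pose c := Chart z0 z1 det.
have [T [TE _]] := angle_forms_chart z0 z1 det cs1 cs2 dc1 ds1 dc2 ds2 sep.
have t1 : tcst (a * 1) = tcst a :> A by rewrite mulr1.
exists T; have J : jac c = tcst (a ^+ 2).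
  by apply: torus_ext => p; rewrite /jac torusB !torusM !tcstE /= !mulr1 mulr0 mul0r subr0 expr2.
have ZZ (h : A) : tcst (a * 0) * h = 0 by apply: torus_ext => p; rewrite torusM tcstE mulr0 mul0r.
rewrite TE; split=> [h|h|h].
- by rewrite (td0E c) [cys c * _]ZZ addr0 [cxs c]t1.
- by rewrite (td1E c) [cxt c * _]ZZ add0r [cyt c]t1.
- by rewrite /cint J tintZ.
Qed.

Definition flat_lap h : A := td ord0 (td ord0 h) + td ord_max (td ord_max h).

(** What elliptic theory on the flat torus needs from Fourier analysis. *)
Lemma fourier_approximation : exists ap : nat -> A -> A,
  [/\ forall h e, 0 < e -> exists N0, forall N, (N0 <= N)%N -> forall p, `|ap N h p - h p| <= e,
    forall N i h, td i (ap N h) = ap N (td i h) &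
    forall N h, tint h = 0 -> exists u, tint u = 0 /\ flat_lap u = ap N h].
Proof.
have [T [t0 t1 tI]] := unit_trig_chart; exists (approx T); split.
- by move=> h e e0; exact: approx_cvg.
- have apZ N k h : approx T N (tcst k * h) = tcst k * approx T N h.
    rewrite !approxE mulrCA; congr (_ * _); rewrite /smoothing mulr_sumr; apply: eq_bigr => m _.
    rewrite -!mulrA !cintZ !tcstM; move: (tcst k) (tcst (wt m)) (tcst _) (tcst _) (mc m) (ms m).
    by move=> k' w x y u v; rewrite [RHS]mulrCA [in RHS]mulrDr !mulrA.
  by move=> N i h; elim/ord2P: i; rewrite ?t0 ?t1 ?approx_DX ?approx_DY apZ.
move=> N h h0; have [|u [u0 lu]] := @poisson_approx _ T N h; first by rewrite tI h0 mulr0.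
exists (tcst (a ^- 2) * u); split; first by rewrite tintZ; move/eqP: u0; rewrite tI mulf_eq0
  expf_eq0 (gt_eqF a0) /= => /eqP ->; rewrite mulr0.
have E (x : A) : tcst a * (tcst a * (tcst (a ^- 2) * x)) = x.
  by rewrite !mulrA -!tcstM -expr2 divff ?expf_neq0 ?gt_eqF // tcst1 mul1r.
by rewrite -lu /flat_lap /lap !t0 !t1 !derivZ !E.
Qed.

Lemma flat_poincare h : tint h = 0 ->
  tint (h * h) <= tint (td ord0 h * td ord0 h + td ord_max h * td ord_max h).
Proof.
move=> h0; have [T [t0 t1 tI]] := unit_trig_chart.
have := @poincare _ T h; rewrite !tI h0 mulr0 ler_pM2l ?exprn_gt0 // => /(_ erefl) H.
have a1 : 1 <= a ^+ 2.
  by rewrite expr_ge1 ?(ltW a0) //; have := pi_ge2 R; lra.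
have E : td ord0 h * td ord0 h + td ord_max h * td ord_max h
   = tcst (a ^+ 2) * (Dx T h * Dx T h + Dy T h * Dy T h).
  rewrite t0 t1 expr2 (tcstM a a); move: (tcst a) (Dx T h) (Dy T h) => k x y.
  exact: scaled_squares.
rewrite E tintZ; apply: (le_trans H); rewrite -[leLHS]mul1r ler_wpM2r //.
by apply: tint_ge0 => p; rewrite !torusE -!expr2 addr_ge0 ?sqr_ge0.
Qed.
End FlatTorus.

(** * Poisson's equation *)

Lemma geometric_recursion (R : realType) (E : nat -> R) (k C r : R) :
  0 <= k -> k < 1 -> 0 <= C -> 0 < r -> r < 1 -> (forall n, 0 <= E n) ->
  (forall n, E n.+1 <= k * E n + C * r ^+ n) ->
  exists C' s : R, [/\ 0 <= C', 0 < s, s < 1 & forall n, E n <= C' * s ^+ n].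
Proof.
move=> k0 k1 C0 r0 r1 E0 H; pose m := Num.max k r.
have km : k <= m by rewrite le_max lexx.
have rm : r <= m by rewrite le_max lexx orbT.
have m1 : m < 1 by rewrite gt_max k1.
pose s := (1 + m) / 2.
have s1 : s < 1 by rewrite /s; lra.
have ms : m < s by rewrite /s; lra.
have sk : 0 < s - k by lra.
have s0 : 0 < s by lra.
pose D := E 0%N + C / (s - k).
have D0 : 0 <= D by rewrite addr_ge0 // divr_ge0 // ltW.
exists D, s; split=> //; elim=> [|n IH].
  by rewrite expr0 mulr1 /D lerDl divr_ge0 // ltW.
apply: (le_trans (H n)); have sn : 0 <= s ^+ n by rewrite exprn_ge0 // ltW.
have rs : r ^+ n <= s ^+ n by rewrite lerXn2r ?nnegrE ?(ltW r0) ?(ltW s0) // (le_trans rm) // ltW.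
have h1 : k * E n <= k * (D * s ^+ n) by rewrite ler_wpM2l.
have h2 : C * r ^+ n <= C * s ^+ n by rewrite ler_wpM2l.
have h3 : C <= (s - k) * D.
  by rewrite /D mulrDr mulrCA divff ?gt_eqF // mulr1 lerDr mulr_ge0 // ltW.
have h4 : C * s ^+ n <= (s - k) * D * s ^+ n by rewrite ler_wpM2r.
apply: (le_trans (lerD h1 h2)); apply: (le_trans (lerD (lexx _) h4)).
by rewrite exprS le_eqVlt; apply/orP; left; apply/eqP; ring.
Qed.

Section SquareEstimates.
Variable K : realFieldType.
Implicit Types (x y z w e : K).
Lemma neg_prod_le x y : - (x * y) <= 2^-1 * (x * x + y * y).
Proof. by have := sqr_ge0 (x + y); rewrite expr2 mulrDl !mulrDr (mulrC y x); lra. Qed.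
Lemma inner_prod_le x y z w : x * z + y * w <= 2^-1 * (x * x + y * y + (z * z + w * w)).
Proof.
have := sqr_ge0 (x - z); have := sqr_ge0 (y - w).
by rewrite !expr2 !mulrBl !mulrBr (mulrC z x) (mulrC w y); lra.
Qed.
Lemma half_absorb x y : x <= 2^-1 * (x + y) -> x <= y. Proof. by lra. Qed.
Lemma energy_close x e z y : x <= e -> e = z -> z <= 2^-1 * (x + y) -> 0 <= y -> x <= y + y.
Proof. by move=> h1 h0 h2 h3; lra. Qed.
End SquareEstimates.

Section Elliptic.
Context {R : realType}.
Notation A := (torus_fun R).
Notation dS := (td ord0).
Notation dT := (td ord_max).
Implicit Types (h u v : A) (p : R * R).

Lemma decay_shift (g : nat -> A) : decay (fun n => g n.+1) -> decay g.
Proof.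
move=> [C [r [C0 r0 r1 H]]].
exists (tint (g 0%N * g 0%N) + C / r), r; split=> //.
  rewrite addr_ge0 ?divr_ge0 ?(ltW r0) //.
  by apply: tint_ge0 => p; rewrite torusM -expr2 sqr_ge0.
have t0 : 0 <= tint (g 0%N * g 0%N) by apply: tint_ge0 => p; rewrite torusM -expr2 sqr_ge0.
case=> [|n]; first by rewrite expr0 mulr1 lerDl divr_ge0 // ltW.
apply: (le_trans (H n)); rewrite exprS mulrA ler_wpM2r ?exprn_ge0 ?(ltW r0) //.
by rewrite mulrDl divfK ?gt_eqF // lerDr mulr_ge0 // ltW.
Qed.

Fixpoint close k (e : R) (f h : A) := (forall p, `|f p - h p| <= e) /\
  if k is k'.+1 then forall i, close k' e (td i f) (td i h) else True.

Lemma close_decay (f : nat -> A) h n0 :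
  (forall n, (n0 <= n)%N -> forall p, `|f n p - h p| <= 2^-1 ^+ n) -> decay (fun n => f n.+1 - f n).
Proof.
move=> H; suff : decay (fun n => f (n0 + n).+1 - f (n0 + n)%N).
  elim: n0 {H} => [//|m IHm] Hm; apply: IHm; apply: decay_shift.
  suff -> : (fun n => f (m + n.+1).+1 - f (m + n.+1)%N)
    = (fun n => f (m.+1 + n).+1 - f (m.+1 + n)%N) by [].
  by apply/funext => n; rewrite addnS.
pose r : R := 2^-1 * 2^-1.
have i0 : 0 < 2^-1 :> R by rewrite invr_gt0.
exists 4, r; split=> //; first by rewrite mulr_gt0.
  by rewrite /r; lra.
move=> n; have b p : `|(f (n0 + n).+1 - f (n0 + n)%N) p| <= 2 * 2^-1 ^+ n.
  have le1 m : (n <= m)%N -> (2^-1 ^+ m : R) <= 2^-1 ^+ n.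
    by move=> nm; apply: (ler_wiXn2l (ltW i0) _ nm); rewrite invf_le1 // ler1n.
  have h1 := H (n0 + n).+1 (leqW (leq_addr _ _)) p.
  have h2 := H (n0 + n)%N (leq_addr _ _) p.
  rewrite torusB (_ : _ - _ = (f (n0 + n).+1 p - h p) - (f (n0 + n)%N p - h p)); last by ring.
  rewrite (le_trans (ler_normB _ _)) // mulr_natl mulr2n; apply: lerD.
    by apply: (le_trans h1); apply: le1; rewrite leqW // leq_addl.
  by apply: (le_trans h2); apply: le1; rewrite leq_addl.
have -> : 4 * r ^+ n = (2 * 2^-1 ^+ n) * (2 * 2^-1 ^+ n) by rewrite /r exprMn; ring.
rewrite -[X in _ <= X]tint_cst; apply: tint_le => p; rewrite torusM tcstE.
by rewrite (le_trans (ler_norm _)) // normrM ler_pM.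
Qed.

Lemma close_decays k (f : nat -> A) h n0 :
  (forall n, (n0 <= n)%N -> close k (2^-1 ^+ n) (f n) h) -> decays k (fun n => f n.+1 - f n).
Proof.
elim: k f h => [|k IH] f h H; first by split=> //; apply: (@close_decay f h n0) => n /H [].
split; first by apply: (@close_decay f h n0) => n /H [].
move=> i; have -> : (fun n => td i (f n.+1 - f n)) = (fun n => td i (f n.+1) - td i (f n)).
  by apply/funext => n; exact: tdB.
by apply: (IH (fun n => td i (f n)) (td i h)) => n nn; have [_] := H n nn; exact.
Qed.

Lemma dirichlet_energy u : tint (dS u * dS u + dT u * dT u) = - tint (u * flat_lap u).
Proof.
have e1 := tint_parts ord0 u (dS u); have e2 := tint_parts ord_max u (dT u).
by rewrite tintD e1 e2 /flat_lap mulrDr tintD opprD.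
Qed.

Lemma poisson_decays k (w d : nat -> A) : (forall n, tint (w n) = 0) ->
  (forall n, flat_lap (w n) = d n) -> decays k d -> decays k w.
Proof.
elim: k w d => [|k IH] w d w0 E D.
  split=> //; have dd := decays0 D.
  apply: (decay_le2 (K := 1) _ dd dd) => // n; rewrite mul1r.
  have h1 := flat_poincare (w0 n).
  have h2 : tint (dS (w n) * dS (w n) + dT (w n) * dT (w n)) = - tint (w n * d n).
    by rewrite -E; exact: dirichlet_energy.
  have h3 : - tint (w n * d n) <= tint (tcst 2^-1 * (w n * w n + d n * d n)).
    rewrite -tintN; apply: tint_le => p; rewrite !torusE tcstE.
    exact: neg_prod_le.
  have h4 : 0 <= tint (d n * d n) by apply: tint_ge0 => p; rewrite torusM -expr2 sqr_ge0.
  rewrite tintZ tintD in h3; exact: energy_close h1 h2 h3 h4.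
split; first exact: (decays0 (IH w d w0 E (decaysW D))).
move=> i; apply: (IH _ (fun n => td i (d n))) => [n|n|]; first exact: tint_td.
  by rewrite -E /flat_lap tdD (tdC i ord0) (tdC i ord0) (tdC i ord_max) (tdC i ord_max).
by case: D => _; exact.
Qed.

(** The equation is solved explicitly for the Fejer means of [h]. A subsequence
    of means converges geometrically with all derivatives, so that the
    corresponding solutions form a telescoping rapid series. *)
Lemma poisson h : tint h = 0 -> exists u, tint u = 0 /\ flat_lap u = h.
Proof.
move=> h0; have [ap [apc apd apu]] := @fourier_approximation R.
have cl k e g : 0 < e -> exists N0, forall N, (N0 <= N)%N -> close k e (ap N g) g.
  move=> e0; elim: k g => [|k IH] g; have [N0 H0] := apc g e e0; first by exists N0 => N /H0.
  have [N1 H1] := IH (dS g); have [N2 H2] := IH (dT g).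
  exists (maxn N0 (maxn N1 N2)) => N; rewrite !geq_max => /and3P[n0 n1 n2]; split; first exact: H0.
  by move=> i; rewrite apd; elim/ord2P: i; [exact: H1|exact: H2].
have half_gt0 k : 0 < 2^-1 ^+ k :> R by rewrite exprn_gt0 // invr_gt0.
pose NN k := sval (cid (cl k _ h (half_gt0 k))).
have NP k : close k (2^-1 ^+ k) (ap (NN k) h) h by rewrite /NN; case: cid => N0 /=; exact.
pose f k := ap (NN k) h.
have closeW k e g g' j : (j <= k)%N -> close k e g g' -> close j e g g'.
  by elim: k j g g' => [|k IH] [|j] g g' //= jk [a b]; split=> // i; exact: IH.
have fr : rapid (fun n => f n.+1 - f n).
  by move=> k; apply: (@close_decays k f h k) => n kn; apply: closeW (NP n).
have ue k := apu (NN k) h h0; pose u k := sval (cid (ue k)).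
have uP k : tint (u k) = 0 /\ flat_lap (u k) = f k by rewrite /u; case: cid.
pose w k := u k.+1 - u k.
have lapB (x y : A) : flat_lap (x - y) = flat_lap x - flat_lap y.
  by rewrite /flat_lap !tdB opprD addrACA.
have wr : rapid w.
  move=> k; apply: (poisson_decays _ _ (fr k)) => n.
    have [a1 _] := uP n; have [a2 _] := uP n.+1.
    by rewrite /w tintD tintN a1 a2 subrr.
  by have [_ a1] := uP n; have [_ a2] := uP n.+1; rewrite /w lapB a1 a2.
have [v [vE vD]] := rapid_sum wr.
have two i j : forall p, td i (td j v) p = total (fun n => td i (td j (w n))) p.
  have [v' [vE' vD']] := rapid_sum (rapid_td j wr).
  have -> : td j v = v' by apply: torus_ext => p; rewrite vD vE'.
  exact: vD'.
have Lv p : flat_lap v p = h p - f 0%N p.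
  rewrite /flat_lap torusD !two -totalD; try (by do 2 apply: rapid_td).
  have -> : (fun n => dS (dS (w n)) + dT (dT (w n))) = (fun n => f n.+1 - f n).
    apply/funext => n; have [_ a1] := uP n; have [_ a2] := uP n.+1.
    by rewrite -[LHS]/(flat_lap (w n)) /w lapB a1 a2.
  rewrite /total; apply/cvg_lim => //.
  have -> : series (fun n => (f n.+1 - f n) p) = (fun n => f n p - f 0%N p).
    by apply/funext => n; rewrite /series /= telescope_sumr.
  apply: cvgB; last exact: cvg_cst.
  have c0 : (2^-1 ^+ n : R) @[n --> \oo] --> 0.
    by apply: cvg_expr; rewrite ger0_norm ?invr_ge0 // invf_lt1 // ltr1n.
  apply/cvgrPdist_le => e e0; have /cvgrPdist_le /(_ e e0) := c0.
  apply: filterS => n; rewrite sub0r normrN ger0_norm ?(ltW (half_gt0 n)) // => H.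
  have cl0 : close 0 (2^-1 ^+ n) (f n) h by exact: closeW (leq0n n) (NP n).
  by have [a _] := cl0; rewrite distrC (le_trans (a p)).
pose z := u 0%N + v; exists (z - tcst (tint z)); split.
  by rewrite tintD tintN tint_cst subrr.
rewrite lapB [X in _ - X](_ : _ = 0) ?subr0.
  have lapD (x y : A) : flat_lap (x + y) = flat_lap x + flat_lap y.
    by rewrite /flat_lap !tdD addrACA.
  have [_ l0] := uP 0%N.
  by apply: torus_ext => p; rewrite /z lapD l0 torusD Lv addrC subrK.
by rewrite /flat_lap !td_cst !raddf0 addr0.
Qed.
End Elliptic.

(** * Elliptic equations in divergence form *)

Section Contraction.
Variable K : realFieldType.
Implicit Types (a b c t x y d g h : K).

(** Multiplication by [1 - t A] contracts when [A] is positive of determinant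
    one, because [A ^ 2 = (tr A) A - 1]. *)
Lemma matrix_contraction a b c t x y : 0 < a -> a * c - b * b = 1 -> 0 < t -> t * (a + c) <= 1 ->
  ((1 - t * a) * x + - (t * b) * y) ^+ 2 + (- (t * b) * x + (1 - t * c) * y) ^+ 2
  <= (1 - t ^+ 2) * (x ^+ 2 + y ^+ 2).
Proof.
move=> a0 det t0 tr; pose q := a * x ^+ 2 + 2 * b * x * y + c * y ^+ 2.
have q0 : 0 <= q.
  rewrite -(pmulr_rge0 _ a0).
  have -> : a * q = (a * x + b * y) ^+ 2 + (a * c - b * b) * y ^+ 2 by rewrite /q; ring.
  by rewrite det mul1r addr_ge0 ?sqr_ge0.
rewrite -subr_ge0.
have -> : (1 - t ^+ 2) * (x ^+ 2 + y ^+ 2) - (((1 - t * a) * x + - (t * b) * y) ^+ 2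
    + (- (t * b) * x + (1 - t * c) * y) ^+ 2)
  = t * (2 - t * (a + c)) * q + t ^+ 2 * (a * c - b * b - 1) * (x ^+ 2 + y ^+ 2).
  by rewrite /q; ring.
rewrite det subrr mulr0 mul0r addr0 !mulr_ge0 //; first exact: ltW.
by rewrite subr_ge0 (le_trans tr) // ler1n.
Qed.

Lemma young d g h : 0 < d -> (h + g) ^+ 2 <= (1 + d) * h ^+ 2 + (1 + d^-1) * g ^+ 2.
Proof.
move=> d0; rewrite -subr_ge0.
have -> : (1 + d) * h ^+ 2 + (1 + d^-1) * g ^+ 2 - (h + g) ^+ 2 = d^-1 * (d * h - g) ^+ 2.
  by field; rewrite gt_eqF.
by rewrite mulr_ge0 ?sqr_ge0 // invr_ge0 ltW.
Qed.

Lemma perturbed_contraction k d x y u v g h : 0 < d -> 0 <= k ->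
  u ^+ 2 + v ^+ 2 <= k * (x ^+ 2 + y ^+ 2) ->
  (u + g) ^+ 2 + (v + h) ^+ 2 <= (1 + d) * k * (x ^+ 2 + y ^+ 2) + (1 + d^-1) * (g ^+ 2 + h ^+ 2).
Proof.
move=> d0 k0 H; have y1 := young g u d0; have y2 := young h v d0.
apply: (le_trans (lerD y1 y2)).
have h1 : (1 + d) * (u ^+ 2 + v ^+ 2) <= (1 + d) * (k * (x ^+ 2 + y ^+ 2)).
  by rewrite ler_wpM2l // addr_ge0 // ltW.
have -> : (1 + d) * u ^+ 2 + (1 + d^-1) * g ^+ 2 + ((1 + d) * v ^+ 2 + (1 + d^-1) * h ^+ 2)
  = (1 + d) * (u ^+ 2 + v ^+ 2) + (1 + d^-1) * (g ^+ 2 + h ^+ 2) by ring.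
by rewrite lerD2r -mulrA.
Qed.
End Contraction.

Lemma regroup (V : zmodType) (a b c d e : V) : a + b + (c + d) + e = b + d + (a + c + e).
Proof. by rewrite addrACA [a + c + (b + d)]addrC -addrA. Qed.

Section EllipticEquation.
Context {R : realType}.
Notation A := (torus_fun R).
Notation dS := (td ord0).
Notation dT := (td ord_max).
Implicit Types (h u v : A) (p : R * R).
Variables (a b c F G : A).
Hypotheses (a0 : forall p, 0 < a p) (det1 : a * c - b * b = 1).

Let bound := sval (cid2 (torus_bounded (a + c))).
Let bound_gt0 : 0 < bound. Proof. exact: s2valP (cid2 (torus_bounded (a + c))). Qed.
Let boundP p : `|(a + c) p| <= bound. Proof. exact: s2valP' (cid2 (torus_bounded (a + c))) p. Qed.
Let t : R := (bound + 1)^-1.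
Let t0 : 0 < t. Proof. by rewrite invr_gt0 addr_gt0. Qed.
Let t1 : t < 1. Proof. by rewrite invf_lt1 ?ltrDr ?addr_gt0. Qed.
Let tr p : t * (a p + c p) <= 1.
Proof.
rewrite mulrC ler_pdivrMr ?addr_gt0 // mul1r.
by rewrite (le_trans (ler_norm _)) // (le_trans (boundP p)) // lerDl.
Qed.

Let m00 := 1 - tcst t * a.
Let m01 := - (tcst t * b).
Let m11 := 1 - tcst t * c.
Let M0 u : A := m00 * dS u + m01 * dT u.
Let M1 u : A := m01 * dS u + m11 * dT u.
Definition grad2 u : A := dS u * dS u + dT u * dT u.

Let contract (x y g h : A) p : let d := t ^+ 2 in
  ((m00 * x + m01 * y + g) * (m00 * x + m01 * y + g)
   + (m01 * x + m11 * y + h) * (m01 * x + m11 * y + h)) p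
  <= (tcst ((1 + d) * (1 - d)) * (x * x + y * y) + tcst (1 + d^-1) * (g * g + h * h)) p.
Proof.
cbv zeta; rewrite !torusE !tcstE -!expr2.
have det : a p * c p - b p * b p = 1 by exact: (torus_eq det1 p).
apply: perturbed_contraction; first by rewrite exprn_gt0.
  by rewrite subr_ge0 expr_le1 ?ltW.
exact: matrix_contraction (a0 p) det t0 (tr p).
Qed.

Lemma energy_step u (X Y : A) : flat_lap u = dS X + dT Y -> tint (grad2 u) <= tint (X * X + Y * Y).
Proof.
move=> E.
have e1 : tint (grad2 u) = tint (dS u * X + dT u * Y).
  rewrite /grad2 dirichlet_energy E mulrDr !tintD opprD.
  by have := tint_parts ord0 u X; have := tint_parts ord_max u Y => -> ->.
have e2 : tint (dS u * X + dT u * Y) <= tint (tcst 2^-1 * (grad2 u + (X * X + Y * Y))).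
  apply: tint_le => p; rewrite /grad2 !torusE tcstE.
  exact: inner_prod_le.
rewrite -e1 tintZ tintD in e2; exact: half_absorb e2.
Qed.

Definition iteration (u G0 G1 : nat -> A) := forall n,
  flat_lap (u n.+1) = dS (M0 (u n) + G0 n) + dT (M1 (u n) + G1 n).

Lemma tint_sqr_ge0 h : 0 <= tint (h * h).
Proof. by apply: tint_ge0 => p; rewrite torusM -expr2 sqr_ge0. Qed.

(** The contraction factor [1 - t^2] leaves room for the factor [1 + t^2] that
    Young's inequality needs to absorb the source terms. *)
Lemma gradient_decay (u G0 G1 : nat -> A) : iteration u G0 G1 -> decay G0 -> decay G1 ->
  forall i, decay (fun n => td i (u n)).
Proof.
move=> it d0 d1; pose d := t ^+ 2; pose k := (1 + d) * (1 - d).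
have d_gt0 : 0 < d by rewrite exprn_gt0.
have d_lt1 : d < 1 by rewrite expr_lt1 ?(ltW t0).
have [C0 [r0 [C00 r00 r01 h0]]] := d0; have [C1 [r1 [C10 r10 r11 h1]]] := d1.
pose r := Num.max r0 r1.
have rp : 0 < r by rewrite lt_max r00.
have le_r (C' r' x : R) n : 0 <= C' -> 0 < r' -> r' <= r -> x <= C' * r' ^+ n -> x <= C' * r ^+ n.
  move=> c0 r'0 r'r H; apply: (le_trans H); rewrite ler_wpM2l // lerXn2r ?nnegrE ?(ltW r'0) //.
  exact: ltW.
have dV : 0 < d^-1 by rewrite invr_gt0.
have [||||||C [s [C_ge0 s0 s1 H]]] := @geometric_recursion R (fun n => tint (grad2 (u n))) k
    ((1 + d^-1) * (C0 + C1)) r _ _ _ rp _ _ _.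
- by rewrite /k mulr_ge0 ?subr_ge0 ?(ltW d_lt1) // addr_ge0 // ltW.
- have -> : k = 1 - d ^+ 2 by rewrite /k; ring.
  by rewrite ltrBlDr ltrDl exprn_gt0.
- by rewrite !mulr_ge0 // addr_ge0 // ltW.
- by rewrite gt_max r01.
- by move=> n; rewrite /grad2 tintD addr_ge0 ?tint_sqr_ge0.
- move=> n; apply: (le_trans (energy_step (it n))).
  apply: (le_trans (tint_le (contract (dS (u n)) (dT (u n)) (G0 n) (G1 n)))).
  rewrite tintD !tintZ; apply: lerD => //; rewrite -mulrA ler_wpM2l //.
    by rewrite addr_ge0 // ltW.
  rewrite tintD mulrDl; apply: lerD.
    by apply: (le_r _ r0) (h0 n) => //; rewrite le_max lexx.
  by apply: (le_r _ r1) (h1 n) => //; rewrite le_max lexx orbT.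
move=> i; exists C, s; split=> // n; apply: le_trans (H n).
by rewrite /grad2 tintD; elim/ord2P: i; [rewrite lerDl|rewrite lerDr]; exact: tint_sqr_ge0.
Qed.

Let commutator l (x y g : A) u : td l (x * dS u + y * dT u + g)
  = x * dS (td l u) + y * dT (td l u) + (td l x * dS u + td l y * dT u + td l g).
Proof.
rewrite !tdD !tdM (tdC l ord0) (tdC l ord_max).
exact: regroup.
Qed.

(** The differentiated iteration is the same iteration, with source terms that
    involve derivatives of lower order. *)
Lemma gradient_decays j (u G0 G1 : nat -> A) : iteration u G0 G1 -> decays j G0 -> decays j G1 ->
  forall i, decays j (fun n => td i (u n)).
Proof.
elim: j u G0 G1 => [|j IH] u G0 G1 it d0 d1 i.
  by split=> //; apply: (gradient_decay it); [exact: decays0 d0|exact: decays0 d1].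
split; first by apply: (gradient_decay it); [exact: decays0 d0|exact: decays0 d1].
move=> l; have gd := IH u G0 G1 it (decaysW d0) (decaysW d1).
(* The commutator of the operator with a derivative involves only first
   derivatives of the solution, which are already under control. *)
pose H0 n : A := td l m00 * dS (u n) + td l m01 * dT (u n) + td l (G0 n).
pose H1 n : A := td l m01 * dS (u n) + td l m11 * dT (u n) + td l (G1 n).
have it' : iteration (fun n => td l (u n)) H0 H1.
  move=> n; have -> : flat_lap (td l (u n.+1)) = td l (flat_lap (u n.+1)).
    by rewrite /flat_lap tdD (tdC l ord0) (tdC l ord0 (u _)) (tdC l ord_max) (tdC l ord_max (u _)).
  rewrite (it n) tdD (tdC l ord0) (tdC l ord_max) /M0 /M1 /H0 /H1.
  by rewrite !commutator.
have dj i' : decays j (fun n => td i' (u n)) by exact: gd.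
have -> : (fun n => td l (td i (u n))) = (fun n => td i (td l (u n))).
  by apply/funext => n; exact: tdC.
apply: (IH _ H0 H1 it').
- apply: decaysD; first by apply: decaysD; exact: decaysM.
  by case: d0 => _; exact.
- apply: decaysD; first by apply: decaysD; exact: decaysM.
  by case: d1 => _; exact.
Qed.

Let tint_div (X Y : A) : tint (dS X + dT Y) = 0.
Proof. by rewrite tintD !tint_td addr0. Qed.

Let start := cid (poisson (tint_div (- (tcst t * F)) (- (tcst t * G)))).
Let next u := cid (poisson (tint_div (M0 u) (M1 u))).
Fixpoint iterate n : A := if n is n'.+1 then sval (next (iterate n')) else sval start.

Lemma iterate0 : tint (iterate 0) = 0 /\ flat_lap (iterate 0) = dS (- (tcst t * F)) + dT (- (tcst t * G)).
Proof. by rewrite /=; case: start. Qed.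
Lemma iterateS n : tint (iterate n.+1) = 0 /\
  flat_lap (iterate n.+1) = dS (M0 (iterate n)) + dT (M1 (iterate n)).
Proof. by rewrite /=; case: (next _). Qed.
Lemma iterate_rapid : rapid iterate.
Proof.
have it : iteration iterate (fun=> 0) (fun=> 0).
  by move=> n; rewrite !addr0; have [_] := iterateS n.
have z j : decays j (fun=> 0 : A).
  have dz : decay (fun=> 0 : A).
    exists 0, 2^-1; split; [by []|by rewrite invr_gt0|by rewrite invf_lt1 ?ltr1n|].
    by move=> n; rewrite !mul0r; have -> : tint (0 : A) = 0 by exact: raddf0.
  elim: j => [|j IH]; split=> // i.
  by rewrite (_ : (fun=> _) = (fun=> 0 : A)) //; apply/funext => n; exact: raddf0.
have gd j := gradient_decays it (z j) (z j).
have du : decay iterate.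
  apply: (decay_le2 (K := 1) _ (decays0 (gd 0%N ord0)) (decays0 (gd 0%N ord_max))) => // n.
  rewrite mul1r -tintD; apply: flat_poincare.
  by case: n => [|n]; [have [] := iterate0|have [] := iterateS n].
by case=> [|j]; split=> // i; exact: gd.
Qed.

(** The relaxed iteration [lap v' = div ((1 - t A) grad v - t F)] converges
    with all derivatives. *)
Theorem elliptic_solution : exists v, dS (a * dS v + b * dT v + F) + dT (b * dS v + c * dT v + G) = 0.
Proof.
have [v [vE vD]] := rapid_sum iterate_rapid; exists v.
have rd i := rapid_td i iterate_rapid.
have two i j : forall p, td i (td j v) p = total (fun n => td i (td j (iterate n))) p.
  have [v' [vE' vD']] := rapid_sum (rd j).
  have -> : td j v = v' by apply: torus_ext => p; rewrite vD vE'.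
  exact: vD'.
have lapE p : flat_lap v p = total (fun n => flat_lap (iterate n)) p.
  by rewrite /flat_lap torusD !two -totalD //; do 2 apply: rapid_td; exact: iterate_rapid.
(* The divergence of the relaxed flux, summed over the iteration. *)
have divE (x y : A) i p : td i (x * dS v + y * dT v) p
    = total (fun n => td i (x * dS (iterate n) + y * dT (iterate n))) p.
  have e (f : A) j n : td i (f * td j n) = td i f * td j n + f * td i (td j n) by exact: tdM.
  have A1 := rapidM (td i x) (rd ord0); have A2 := rapidM x (rapid_td i (rd ord0)).
  have A3 := rapidM (td i y) (rd ord_max); have A4 := rapidM y (rapid_td i (rd ord_max)).
  transitivity (total (fun n => td i x * dS (iterate n) + x * td i (dS (iterate n))
    + (td i y * dT (iterate n) + y * td i (dT (iterate n)))) p); last first.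
    by congr (total _ p); apply/funext => n; rewrite tdD !e.
  rewrite (totalD p (rapidD A1 A2) (rapidD A3 A4)) (totalD p A1 A2) (totalD p A3 A4).
  rewrite (totalM _ p (rd ord0)) (totalM _ p (rd ord_max)).
  rewrite (totalM _ p (rapid_td i (rd ord0))) (totalM _ p (rapid_td i (rd ord_max))).
  by rewrite -!vD -!two tdD !tdM.
have rl : rapid (fun n => flat_lap (iterate n)).
  by apply: rapidD; do 2 apply: rapid_td; exact: iterate_rapid.
have key : flat_lap v - (dS (- (tcst t * F)) + dT (- (tcst t * G))) = dS (M0 v) + dT (M1 v).
  apply: torus_ext => p; have [_ <-] := iterate0.
  rewrite torusB lapE -(totalS p rl) torusD !divE -totalD.
  - by congr (total _ p); apply/funext => n; have [_ ->] := iterateS n.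
  - by apply: rapid_td; apply: rapidD; apply: rapidM; exact: rd.
  - by apply: rapid_td; apply: rapidD; apply: rapidM; exact: rd.
have tdZ i (x : A) : td i (tcst t * x) = tcst t * td i x by rewrite tdM td_cst mul0r add0r.
have M0E : M0 v = dS v - tcst t * (a * dS v + b * dT v).
  by rewrite /M0 /m00 /m01; move: (tcst t) (dS v) (dT v) => k x y; ring.
have M1E : M1 v = dT v - tcst t * (b * dS v + c * dT v).
  by rewrite /M1 /m11 /m01; move: (tcst t) (dS v) (dT v) => k x y; ring.
have tn : tcst t != 0 :> A.
  by apply/eqP => /(congr1 (fun h : A => h (0, 0))) /eqP; rewrite tcstE torus0 gt_eqF.
move: key; rewrite M0E M1E /flat_lap !(tdD _ (td _ _)) !tdN !tdZ => key.
have {}key : tcst t * (dS (a * dS v + b * dT v) + dT (b * dS v + c * dT v) + (dS F + dT G)) = 0.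
  move: key; move: (dS (dS v)) (dT (dT v)) (dS (_ + _)) (dT (_ + _)) (dS F) (dT G) (tcst t).
  move=> x y z w f g k E.
  have -> : k * (z + w + (f + g)) = (x + y - (- (k * f) + - (k * g))) - (x - k * z + (y - k * w)) by ring.
  by rewrite E subrr.
have tV : tcst t^-1 * tcst t = 1 :> A by rewrite -tcstM mulVf ?tcst1 // gt_eqF.
rewrite !(tdD _ (_ + _)) addrACA -[LHS]mul1r -tV -mulrA key mulr0 //.
Qed.
End EllipticEquation.

(** * Isothermal coordinates *)

Section IsothermalAlgebra.
Variable T : comNzRingType.
Implicit Types (E F G D iE iD P S f g x w : T).

Lemma coframe_coefs E F G D iE iD P S : E * iE = 1 -> D * iD = 1 -> D * D = E * G - F * F ->
  let f := iE * P in let g := iD * (f * F - S) in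
  [/\ f * E = P, f * F - g * D = S,
    g * E = - (- (F * iD) * P + E * iD * S) & f * D + g * F = G * iD * P + - (F * iD) * S].
Proof.
move=> eE eD DD; cbv zeta; have fE : iE * P * E = P by transitivity (E * iE * P); [ring|rewrite eE mul1r].
split=> //.
- transitivity (iE * P * F * (1 - D * iD) + D * iD * S); first by ring.
  by rewrite eD subrr mulr0 add0r mul1r.
- transitivity (iD * (iE * P * E * F - E * S)); first by ring.
  by rewrite fE; ring.
- transitivity (iE * P * D * (1 - D * iD) + iD * iE * P * (D * D + F * F) - iD * S * F); first by ring.
  rewrite DD eD subrr mulr0 add0r subrK.
  transitivity (E * iE * (iD * P * G) - iD * S * F); first by ring.
  by rewrite eE mul1r; ring.
Qed.

(** Real and imaginary part of the covariant holomorphy of [f + i g]. *)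
Lemma covariant_closed E F D E_t F_s D_s v_s v_t p q f g f_s g_s (f_t : T) :
  v_s * F - v_t * E - p * D + F_s - E_t = 0 -> v_s * D + p * F - q * E + D_s = 0 ->
  f_s * F + f * F_s - (g_s * D + g * D_s) = f_t * E + f * E_t ->
  (f_s - f * v_s + g * p) * F - (g_s - g * v_s - f * p) * D = (f_t - f * v_t + g * q) * E.
Proof.
move=> h1 h2 h3.
have {}h1 : F_s = E_t - (v_s * F - v_t * E - p * D) by rewrite -[RHS]addr0 -h1; ring.
have {}h2 : D_s = - (v_s * D + p * F - q * E) by rewrite -[RHS]addr0 -h2; ring.
apply: subr0_eq; move/eqP: h3; rewrite -subr_eq0 => /eqP h3.
by rewrite -[RHS]h3 h1 h2; ring.
Qed.

Lemma covariant_closed' E F D E_t F_s D_s v_s v_t p q f g f_s g_s (g_t : T) :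
  v_s * F - v_t * E - p * D + F_s - E_t = 0 -> v_s * D + p * F - q * E + D_s = 0 ->
  f_s * D + f * D_s + (g_s * F + g * F_s) = g_t * E + g * E_t ->
  (f_s - f * v_s + g * p) * D + (g_s - g * v_s - f * p) * F = (g_t - g * v_t - f * q) * E.
Proof.
move=> h1 h2 h3.
have {}h1 : F_s = E_t - (v_s * F - v_t * E - p * D) by rewrite -[RHS]addr0 -h1; ring.
have {}h2 : D_s = - (v_s * D + p * F - q * E) by rewrite -[RHS]addr0 -h2; ring.
apply: subr0_eq; move/eqP: h3; rewrite -subr_eq0 => /eqP h3.
by rewrite -[RHS]h3 h1 h2; ring.
Qed.

Lemma bochner_identity w f g f_s f_t g_s g_t f_st g_st v_s v_t p q (p_t : T) :
  (-2 * v_s * w) * (f * g_t - g * f_t - (f * f + g * g) * q)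
  + w * (f_s * g_t + f * g_st - (g_s * f_t + g * f_st)
    - ((f_s * f + f * f_s + (g_s * g + g * g_s)) * q + (f * f + g * g) * p_t))
  - ((-2 * v_t * w) * (f * g_s - g * f_s - (f * f + g * g) * p)
  + w * (f_t * g_s + f * g_st - (g_t * f_s + g * f_st)
    - ((f_t * f + f * f_t + (g_t * g + g * g_t)) * p + (f * f + g * g) * p_t)))
  = 2 * w * ((f_s - f * v_s + g * p) * (g_t - g * v_t - f * q)
    - (f_t - f * v_t + g * q) * (g_s - g * v_s - f * p)).
Proof. ring. Qed.
Lemma norm_derivative w v_i f g f_i g_i t_i :
  -2 * v_i * w * (f * f + g * g) + w * (f_i * f + f * f_i + (g_i * g + g * g_i))
  = 2 * w * (f * (f_i - f * v_i + g * t_i) + g * (g_i - g * v_i - f * t_i)).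
Proof. ring. Qed.
Lemma wedge_square E iE F D a_s b_s a_t (b_t : T) : E * iE = 1 ->
  a_s * F - b_s * D = a_t * E -> a_s * D + b_s * F = b_t * E ->
  a_s * b_t - a_t * b_s = iE * D * (a_s * a_s + b_s * b_s).
Proof.
move=> e h1 h2; transitivity (E * iE * (a_s * b_t - a_t * b_s)); first by rewrite e mul1r.
transitivity (iE * (a_s * (b_t * E) - b_s * (a_t * E))); first by ring.
by rewrite -h1 -h2; ring.
Qed.

Lemma conformal_forms E F G D f g : D * D = E * G - F * F ->
  let J := f * E * (f * D + g * F) - (f * F - g * D) * (g * E) in
  [/\ J = E * D * (f * f + g * g),
   (f * D + g * F) * (f * D + g * F) * E - 2 * ((f * D + g * F) * (g * E)) * F + g * E * (g * E) * G = J * D,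
   f * E * (f * E) * G - 2 * (f * E * (f * F - g * D)) * F + (f * F - g * D) * (f * F - g * D) * E = J * D &
   (f * D + g * F) * (f * F - g * D) * E - (f * D + g * F) * (f * E) * F
    - g * E * (f * F - g * D) * F + g * E * (f * E) * G = 0].
Proof.
move=> DD; have EG : E * G = D * D + F * F by rewrite DD subrK.
cbv zeta; split; first by ring.
- transitivity (E * ((f * D + g * F) * (f * D + g * F) - 2 * (f * D + g * F) * g * F + g * g * (E * G))); first by ring.
  by rewrite EG; ring.
- transitivity (E * (f * f * (E * G) - 2 * f * (f * F - g * D) * F + (f * F - g * D) * (f * F - g * D))); first by ring.
  by rewrite EG; ring.
- transitivity (E * ((f * D + g * F) * (f * F - g * D) - (f * D + g * F) * f * F
    - g * (f * F - g * D) * F + g * f * (E * G))); first by ring.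
  by rewrite EG; ring.
Qed.

Lemma neg_double x w : - (x + x) * w = -2 * x * w. Proof. ring. Qed.
Lemma density_det E F G D iD : D * D = E * G - F * F ->
  G * iD * (E * iD) - - (F * iD) * - (F * iD) = D * iD * (D * iD).
Proof. by move=> DD; transitivity (iD * iD * (D * D)); [rewrite DD|]; ring. Qed.
Lemma connection_eq1 E F D iD v_s v_t r : D * iD = 1 ->
  v_s * F - v_t * E - (- (- (F * iD) * v_s + E * iD * v_t) + r * iD) * D + r = 0.
Proof.
move=> e; transitivity ((1 - D * iD) * (v_s * F - v_t * E + r)); first by ring.
by rewrite e subrr mul0r.
Qed.

Lemma connection_eq2 E F G D iE iD v_s v_t r d : E * iE = 1 -> D * iD = 1 -> D * D = E * G - F * F ->
  v_s * D + (- (- (F * iD) * v_s + E * iD * v_t) + r * iD) * F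
  - (G * iD * v_s + - (F * iD) * v_t + iE * (F * r * iD + d)) * E + d = 0.
Proof.
move=> eE eD DD.
transitivity (v_s * D * (1 - D * iD) + iD * v_s * (D * D - (E * G - F * F))
   + (1 - E * iE) * (F * r * iD + d)); first by ring.
by rewrite eE eD DD !subrr !mulr0 mul0r !addr0.
Qed.
End IsothermalAlgebra.

Section Isothermal.
Context {R : realType}.
Notation A := (torus_fun R).
Notation dS := (td ord0).
Notation dT := (td ord_max).
Variables (E F G : A).
Hypotheses (E0 : forall p, 0 < E p) (det0 : forall p, 0 < (E * G - F * F) p).

(** The Bochner argument: a harmonic one-form [f eta] on a torus whose metric is
    conformal to the flat metric [exp (2 v) |eta|^2] is parallel, hence without zeros. *)
Lemma harmonic_nonzero (D iE v p q f g : A) : (forall z, 0 < D z) -> E * iE = 1 ->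
  dS v * F - dT v * E - p * D + dS F - dT E = 0 ->
  dS v * D + p * F - q * E + dS D = 0 -> dT p = dS q ->
  dS (f * F - g * D) = dT (f * E) -> dS (f * D + g * F) = dT (g * E) ->
  exists n : R, 0 <= n /\ exists w : A, (forall z, 0 < w z) /\ w * (f * f + g * g) = tcst n.
Proof.
move=> D0 eE h1 h2 pq c1 c2.
have [w [w0 dw]] := torus_exp (- (v + v)).
have {}dw i : td i w = -2 * td i v * w.
  by rewrite dw tdN tdD; exact: neg_double.
rewrite !tdB !tdM in c1; rewrite !tdD !tdM in c2.
have a1 := covariant_closed h1 h2 c1; have a2 := covariant_closed' h1 h2 c2.
pose k i t : A := w * (f * td i g - g * td i f - (f * f + g * g) * t).
set as_ := dS f - f * dS v + g * p in a1 a2; set bs := dS g - g * dS v - f * p in a1 a2.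
set at_ := dT f - f * dT v + g * q in a1; set bt := dT g - g * dT v - f * q in a2.
have bo : dS (k ord_max q) - dT (k ord0 p) = 2 * w * (as_ * bt - at_ * bs).
  rewrite /k !tdM !tdB !tdM !tdD !tdM !dw (tdC ord_max ord0 f) (tdC ord_max ord0 g) -pq.
  exact: bochner_identity.
have iE0 z : 0 < iE z.
  have := torus_eq eE z; rewrite torusM torus1 => H.
  by rewrite -(pmulr_rgt0 _ (E0 z)) H.
have zero : tint (2 * w * (iE * D * (as_ * as_ + bs * bs))) = 0.
  have div0 (x y : A) : tint (dS x - dT y) = 0.
    have -> : tint (dS x - dT y) = tint (dS x) - tint (dT y) by exact: raddfB.
    by rewrite !tint_td subrr.
  by rewrite -(wedge_square eE a1 a2) -bo div0.
have nonneg z : 0 <= (2 * w * (iE * D * (as_ * as_ + bs * bs))) z.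
  rewrite !torusE -mulrA mulr_ge0 // ?mulr_ge0 ?addr_ge0 ?(ltW (w0 z)) ?(ltW (iE0 z)) ?(ltW (D0 z)) //.
  - by rewrite -expr2 sqr_ge0.
  - by rewrite -expr2 sqr_ge0.
have sq0 z : as_ z = 0 /\ bs z = 0.
  have H := torus_eq (tint_eq0 nonneg zero) z.
  have w2 : 0 < w z * (iE z * D z) by rewrite !mulr_gt0.
  have : 2 * (w z * (iE z * D z)) * (as_ z ^+ 2 + bs z ^+ 2) = 0.
    rewrite -[RHS]H.
    transitivity ((1 + 1) * w z * (iE z * D z * (as_ z * as_ z + bs z * bs z))); last by [].
    by move: (w z) (iE z) (D z) (as_ z) (bs z) => *; ring.
  move=> /eqP; rewrite mulf_eq0 (gt_eqF (mulr_gt0 (ltr0Sn R 1) w2)) /=.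
  by rewrite paddr_eq0 ?sqr_ge0 // !sqrf_eq0 => /andP[/eqP -> /eqP ->].
have as0 : as_ = 0 by apply: torus_ext => z; have [] := sq0 z.
have bs0 : bs = 0 by apply: torus_ext => z; have [] := sq0 z.
have cancelE (x : A) : 0 = x * E -> x = 0.
  by move=> H; rewrite -[x]mulr1 -eE mulrA -H mul0r.
have at0 : at_ = 0 by apply: cancelE; rewrite -a1 as0 bs0 !mul0r subrr.
have bt0 : bt = 0 by apply: cancelE; rewrite -a2 as0 bs0 !mul0r addr0.
pose N : A := w * (f * f + g * g).
have dN i t (a b : A) : td i f - f * td i v + g * t = a -> td i g - g * td i v - f * t = b ->
    a = 0 -> b = 0 -> td i N = 0.
  move=> <- <- a0 b0; rewrite /N tdM dw tdD !tdM (norm_derivative _ _ _ _ _ _ t) a0 b0.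
  by rewrite !mulr0 addr0 mulr0.
have [|n nE] := @torus_const R N.
  move=> i; elim/ord2P: i; first by apply: (dN _ p as_ bs).
  by apply: (dN _ q at_ bt).
exists n; split; last by exists w.
have := torus_eq nE (0, 0); rewrite tcstE => <-.
by rewrite /N torusM torusD !torusM mulr_ge0 ?(ltW (w0 _)) // addr_ge0 // -expr2 sqr_ge0.
Qed.

(** Every metric on the torus is conformally flat: the coordinates integrate a
    harmonic one-form and its conjugate. *)
Theorem isothermal : exists (c : chart R) (D : A), [/\ forall z, 0 < D z,
  cyt c * cyt c * E - 2 * (cyt c * cys c) * F + cys c * cys c * G = jac c * D,
  cxs c * cxs c * G - 2 * (cxs c * cxt c) * F + cxt c * cxt c * E = jac c * D &
  cyt c * cxt c * E - cyt c * cxs c * F - cys c * cxt c * F + cys c * cxs c * G = 0].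
Proof.
have [D [DD D0]] := torus_sqrt det0.
have [iE [eE _]] : exists k, E * k = 1 /\ forall p, k p = (E p)^-1.
  by apply: torus_inv => z; rewrite gt_eqF.
have [iD [eD iDE]] : exists k, D * k = 1 /\ forall p, k p = (D p)^-1.
  by apply: torus_inv => z; rewrite gt_eqF.
have iD0 z : 0 < iD z by rewrite iDE invr_gt0.
pose a := G * iD; pose b := - (F * iD); pose d := E * iD.
have det1 : a * d - b * b = 1.
  transitivity (D * iD * (D * iD)); last by rewrite eD mulr1.
  exact: density_det.
have a0 z : 0 < a z.
  have G0 : 0 < G z.
    have := det0 z; rewrite torusB !torusM subr_gt0 => H.
    by rewrite -(pmulr_rgt0 _ (E0 z)); apply: le_lt_trans H; rewrite -expr2 sqr_ge0.
  by rewrite /a torusM mulr_gt0.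
pose r := dS F - dT E; pose h := iE * (F * r * iD + dS D).
have [v vE] := elliptic_solution h (- (r * iD)) a0 det1.
have [u uE] := elliptic_solution a b a0 det1.
pose p := - (b * dS v + d * dT v) + r * iD; pose q := a * dS v + b * dT v + h.
have pq : dT p = dS q.
  apply/esym/eqP; rewrite -subr_eq0; apply/eqP; rewrite -[RHS]vE /p /q -tdN; congr (_ + td _ _).
  by rewrite opprD opprK.
have h1 : dS v * F - dT v * E - p * D + dS F - dT E = 0.
  by rewrite -addrA -/r /p /b /d; exact: connection_eq1.
have h2 : dS v * D + p * F - q * E + dS D = 0.
  by rewrite /p /q /h /a /b /d; exact: connection_eq2.
pose P := 1 + dS u; pose S := dT u; pose f := iE * P; pose g := iD * (f * F - S).
have [fE fS gE gY] := coframe_coefs P S eE eD DD; rewrite -/f -/g in fE fS gE gY.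
have c1 : dS (f * F - g * D) = dT (f * E).
  by rewrite fE fS /P /S tdD -tcst1 td_cst add0r; exact: tdC.
have c2 : dS (f * D + g * F) = dT (g * E).
  apply/eqP; rewrite gE gY -/a -/b -/d -subr_eq0 -tdN opprK; apply/eqP; rewrite -[RHS]uE /P /S.
  rewrite !mulrDr !mulr1; congr (td _ _ + td _ _).
    by rewrite -addrA addrC.
  by rewrite -addrA addrC.
have [n [n0 [w [w0 wn]]]] := harmonic_nonzero D0 eE h1 h2 pq c1 c2.
have n_gt0 : 0 < n.
  rewrite lt_neqAle n0 andbT eq_sym; apply/eqP => nz.
  have f0 z : f z = 0.
    have := torus_eq wn z; rewrite nz torusM torusD !torusM tcstE => /eqP.
    rewrite mulf_eq0 gt_eqF ?w0 //= -!expr2 paddr_eq0 ?sqr_ge0 //.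
    by rewrite !sqrf_eq0 => /andP[/eqP].
  have P0 : P = 0 by rewrite -fE (torus_ext (h := f) (k := 0) f0) mul0r.
  have : tint P = 1.
    have -> : tint P = tint 1 + tint (dS u) by exact: raddfD.
    by rewrite tint_td addr0 -tcst1 tint_cst.
  by rewrite P0 raddf0 => /eqP; rewrite eq_sym oner_eq0.
have nz z : 0 < (f * f + g * g) z.
  have := torus_eq wn z; rewrite torusM tcstE => H.
  by rewrite -(pmulr_rgt0 _ (w0 z)) H.
have [J1 J2 J3 J4] := conformal_forms f g DD.
have det z : 0 < (f * E * (f * D + g * F) - (f * F - g * D) * (g * E)) z.
  by rewrite J1 !torusM !mulr_gt0.
by exists (Chart (esym c1) (esym c2) det), D.
Qed.
End Isothermal.

(** * The period lattice *)

Section LatticePeriods.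
Context {R : realType}.
Notation A := (torus_fun R).
Variables (c : chart R) (X Y : R * R -> R).
Hypotheses (sX : smooth X) (sY : smooth Y).
Hypotheses (X0 : partial ord0 X = cxs c) (X1 : partial ord_max X = cxt c).
Hypotheses (Y0 : partial ord0 Y = cys c) (Y1 : partial ord_max Y = cyt c).
Hypothesis periods : forall p q, lattice (p - q) ->
  exists k l : int, X p - X q = k%:~R /\ Y p - Y q = l%:~R.
Hypothesis no_small_character : forall a b : R,
  (forall p q, lattice (p - q) -> exists k : int, a * (X p - X q) + b * (Y p - Y q) = k%:~R) ->
  a ^+ 2 + b ^+ 2 <= 2^-1 -> a = 0 /\ b = 0.

(** An integer valued function cannot change on steps shorter than the inverse
    of its Lipschitz constant. *)
Lemma integer_lipschitz_const (g : R * R -> R) L : 0 < L -> (forall p, exists k : int, g p = k%:~R) ->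
  (forall p q, `|g p - g q| <= L * d1 p q) -> forall p q, g p = g q.
Proof.
move=> L0 gZ gL p q; have [N [N0 H]] := archi (L * d1 p q) (divr_gt0 (ltr01 : 0 < 1 :> R) (ltr0Sn R 1)).
have N0' : 0 < N%:R :> R by rewrite ltr0n.
have st (x y : R * R) : L * d1 x y <= 1 / 2 -> g x = g y.
  have [k kE] := gZ x; have [l lE] := gZ y => xy.
  have : `|g x - g y| < 1 by rewrite (le_lt_trans (gL x y)) // (le_lt_trans xy) //; lra.
  rewrite kE lE -intrB -intr_norm -[1]/(1%:~R) ltr_int => kl.
  by congr (_ *~ _); apply/eqP; rewrite -subr_eq0 -normr_eq0 eq_le normr_ge0 andbT -ltzD1 add0r.
suff key j : g (lerp (j%:R / N%:R) p q) = g p.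
  by have := key N; rewrite divff ?gt_eqF // lerp1.
elim: j => [|j <-]; first by rewrite mul0r lerp0.
apply: st; rewrite d1_lerp.
have -> : j.+1%:R / N%:R - j%:R / N%:R = N%:R^-1 :> R.
  by rewrite -(natr1 j) mulrDl addrC addKr mul1r.
by rewrite ger0_norm ?invr_ge0 ?(ltW N0') // mulrCA ler_pdivrMl.
Qed.

Lemma additive_int (f : int -> R) : (forall i j, f (i + j) = f i + f j) ->
  forall i, f i = i%:~R * f 1.
Proof.
move=> fD; have f0 : f 0 = 0 by apply: (addrI (f 0)); rewrite -fD !addr0.
have fn (n : nat) : f n = n%:R * f 1.
  elim: n => [|n IH]; first by rewrite mul0r.
  by rewrite -addn1 PoszD fD IH natrD mulrDl mul1r.
case=> n; first exact: fn.
by apply: (addIr (f n.+1)); rewrite -fD NegzE addNr f0 fn mulrNz mulNr addNr.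
Qed.

Definition vec (i j : int) : R * R := (i%:~R, j%:~R).

(** The increment of a multivalued coordinate along a period is integer valued
    and continuous, hence independent of the base point, hence additive in the
    period. *)
Lemma shift_add (Z : R * R -> R) (wz : 'I_2 -> A) : smooth Z -> (forall i, partial i Z = wz i) ->
  (forall p q, lattice (p - q) -> exists k : int, Z p - Z q = k%:~R) ->
  exists z0 z1 : int, forall p i j, Z (p + vec i j) - Z p = i%:~R * z0%:~R + j%:~R * z1%:~R.
Proof.
move=> sZ Zw Zp.
have lat p i j : lattice (p + vec i j - p).
  by rewrite [p + _]addrC addrK; split; apply/intrP; [exists i|exists j].
have [L L0 LZ] := @torus_partials_lipschitz _ Z (wz ord0) (wz ord_max) id (smooth_partials sZ) (Zw _) (Zw _).
have cst i j p q : Z (p + vec i j) - Z p = Z (q + vec i j) - Z q.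
  apply: (@integer_lipschitz_const (fun p => Z (p + vec i j) - Z p) (L + L)).
  - by rewrite !addr_gt0.
  - by move=> x; exact: Zp.
  move=> x y; have -> : Z (x + vec i j) - Z x - (Z (y + vec i j) - Z y)
    = (Z (x + vec i j) - Z (y + vec i j)) - (Z x - Z y) by ring.
  rewrite (le_trans (ler_normB _ _)) // mulrDl; apply: lerD; last exact: LZ.
  apply: (le_trans (LZ _ _)); rewrite le_eqVlt; apply/orP; left; apply/eqP; congr (_ * _).
  by rewrite /d1; congr (_ + _); congr (`|_|); rewrite /=; ring.
pose D i j := Z (0 + vec i j) - Z 0.
have DD i j i' j' : D (i + i') (j + j') = D i j + D i' j'.
  rewrite /D -(cst i' j' (0 + vec i j)).
  have -> : 0 + vec (i + i') (j + j') = 0 + vec i j + vec i' j'.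
    by rewrite -addrA; congr (_ + _); rewrite /vec !intrD.
  by rewrite [RHS]addrC subrKA.
have [z0 E0] := Zp _ _ (lat 0 1 0); have [z1 E1] := Zp _ _ (lat 0 0 1).
exists z0, z1 => p i j; rewrite (cst i j p 0) -/(D i j).
have -> : D i j = D i 0 + D 0 j by rewrite -DD addr0 add0r.
have a0 : D i 0 = i%:~R * D 1 0.
  by apply: (@additive_int (fun i => D i 0)) => a b; rewrite -DD addr0.
have a1 : D 0 j = j%:~R * D 0 1.
  by apply: (@additive_int (fun j => D 0 j)) => a b; rewrite -DD addr0.
by rewrite a0 a1 /D E0 E1.
Qed.

Lemma round_int (x : R) : exists k : int, (x - k%:~R) ^+ 2 <= 2^-1 / 2.
Proof.
pose k := Num.floor (x + 2^-1); exists k.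
have h1 : k%:~R <= x + 2^-1 by exact: real_floor_le (num_real _).
have h2 : x + 2^-1 < k%:~R + 1 by have := real_floorD1_gt (num_real (x + 2^-1)); rewrite intrD.
have -> : 2^-1 / 2 = 2^-1 ^+ 2 :> R by rewrite expr2.
rewrite -[(x - _) ^+ 2]real_normK ?num_real // lerXn2r ?nnegrE ?invr_ge0 //.
by rewrite ler_norml; apply/andP; split; lra.
Qed.

(** Vectors dual to the period lattice are integral: reduced modulo the integers
    they would give a character of frequency at most one half. *)
Lemma dual_integral (a b : R) :
  (forall p q, lattice (p - q) -> exists k : int, a * (X p - X q) + b * (Y p - Y q) = k%:~R) ->
  exists i j : int, a = i%:~R /\ b = j%:~R.
Proof.
move=> H; have [i iE] := round_int a; have [j jE] := round_int b; exists i, j.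
have [||a0 b0] := @no_small_character (a - i%:~R) (b - j%:~R).
- move=> p q pq; have [k kE] := H p q pq; have [k1 [l1 [k1E l1E]]] := periods pq.
  exists (k - i * k1 - j * l1); rewrite !intrB !intrM -kE -k1E -l1E; ring.
- by rewrite [leRHS]splitr lerD.
by split; apply/eqP; rewrite -subr_eq0 ?a0 ?b0.
Qed.

(** If the matrix of periods were not invertible over the integers, Cramer's
    rule would give a vector dual to the lattice with a nonintegral coordinate.
    *)
Lemma periods_injective p q (k l : int) : X p - X q = k%:~R -> Y p - Y q = l%:~R -> lattice (p - q).
Proof.
move=> kE lE.
pose wX (i : 'I_2) : A := if i == ord0 then cxs c else cxt c.
pose wY (i : 'I_2) : A := if i == ord0 then cys c else cyt c.
have XE i : partial i X = wX i by elim/ord2P: i.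
have YE i : partial i Y = wY i by elim/ord2P: i.
have [|k0 [k1 kk]] := shift_add sX XE.
  by move=> x y /periods[a [b [ab _]]]; exists a.
have [|l0 [l1 ll]] := shift_add sY YE.
  by move=> x y /periods[a [b [_ ab]]]; exists b.
have dev_add z i j : dev X Y (z + vec i j)
    = (X z + (i%:~R * k0%:~R + j%:~R * k1%:~R), Y z + (i%:~R * l0%:~R + j%:~R * l1%:~R)).
  by rewrite /dev -(kk z i j) -(ll z i j); congr (_, _); rewrite [RHS]addrC subrK.
have inj x y : dev X Y x = dev X Y y -> x = y.
  exact: (dev_inj sX sY X0 X1 Y0 Y1).
have lattice_vec x y : lattice (x - y) -> exists i j, x = y + vec i j.
  move=> [/intrP[i iE] /intrP[j jE]]; exists i, j; rewrite [LHS](_ : x = y + (x - y)); last by rewrite addrC subrK.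
  by congr (_ + _); rewrite /vec -iE -jE; case: (x - y).
pose d : R := k0%:~R * l1%:~R - k1%:~R * l0%:~R.
have d0 : d != 0.
  apply/eqP => dz.
  have z0 (i j : int) : i%:~R * k0%:~R + j%:~R * k1%:~R = 0 :> R -> i%:~R * l0%:~R + j%:~R * l1%:~R = 0 :> R ->
    i = 0 /\ j = 0.
    move=> e1 e2; have := inj (0 + vec i j) 0; rewrite dev_add e1 e2 !addr0 => /(_ erefl).
    by rewrite add0r => -[/eqP + /eqP]; rewrite !intr_eq0 => /eqP -> /eqP ->.
  have [a1 a2] := z0 l1 (- l0) ltac:(by rewrite -[RHS]dz mulrNz /d; ring) ltac:(by rewrite mulrNz; ring).
  have [a3 a4] := z0 k1 (- k0) ltac:(by rewrite mulrNz; ring) ltac:(by rewrite -[RHS]oppr0 -dz mulrNz /d; ring).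
  have k00 : k0 = 0 by apply/eqP; rewrite -oppr_eq0 a4.
  have l00 : l0 = 0 by apply/eqP; rewrite -oppr_eq0 a2.
  by have [] := z0 1 0 ltac:(by rewrite k00 mulr0 mul0r addr0) ltac:(by rewrite l00 mulr0 mul0r addr0).
have [a1 [b1 [a1E b1E]]] := @dual_integral (l1%:~R / d) (- k1%:~R / d) ltac:(
  move=> x y /lattice_vec[i [j ->]]; exists i; rewrite kk ll; move: d0; rewrite /d => d0; field; exact: d0).
have [a2 [b2 [a2E b2E]]] := @dual_integral (- l0%:~R / d) (k0%:~R / d) ltac:(
  move=> x y /lattice_vec[i [j ->]]; exists j; rewrite kk ll; move: d0; rewrite /d => d0; field; exact: d0).
pose m0 := a1 * k + b1 * l; pose m1 := a2 * k + b2 * l.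
have -> : p = q + vec m0 m1.
  apply: inj; rewrite dev_add /dev /m0 /m1 !intrD !intrM -a1E -a2E -b1E -b2E.
  have -> : X p = X q + k%:~R by rewrite -kE addrC subrK.
  have -> : Y p = Y q + l%:~R by rewrite -lE addrC subrK.
  by congr (_, _); congr (_ + _); move: d0; rewrite /d => d0; field; exact: d0.
by rewrite [q + _]addrC addrK; split; apply/intrP; eexists; reflexivity.
Qed.
End LatticePeriods.

Section SmallCharacter.
Context {R : realType}.
Notation A := (torus_fun R).
Variables (c : chart R) (h s : A) (a b E0 : R).
Notation DX := (Dx c).
Notation DY := (Dy c).
Hypotheses (hx : DX h = - (tcst a * s)) (sx : DX s = tcst a * h).
Hypotheses (hy : DY h = - (tcst b * s)) (sy : DY s = tcst b * h).
Hypothesis hs : h * h + s * s = 1.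

(** On a character the energy form is a multiple [a^2 + b^2 - 2 E0] of the
    square integral. *)
Lemma character_energy : 0 < E0 -> a ^+ 2 + b ^+ 2 < 2 * E0 ->
  (cint c (tcst E0 * h) = 0 -> 0 <= cint c (DX h * DX h + DY h * DY h - 2 * tcst E0 * (h * h))) ->
  a = 0 /\ b = 0.
Proof.
move=> E00 small H; have dN (D : derivation R) g : D (- g) = - D g by exact: raddfN.
have cD (u v : A) : cint c (u + v) = cint c u + cint c v by exact: raddfD.
have cB (u v : A) : cint c (u - v) = cint c u - cint c v by exact: raddfB.
have lapE : lap c h = - (tcst (a ^+ 2 + b ^+ 2) * h).
  rewrite /lap hx hy !dN !derivZ sx sy tcstD2 !expr2 !tcstM.
  by move: (tcst a) (tcst b) h => x y z; ring.
have en : cint c (DX h * DX h + DY h * DY h) = (a ^+ 2 + b ^+ 2) * cint c (h * h).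
  rewrite cD !cint_parts_x cint_parts_y -opprD -cD -mulrDr -/(lap c h) lapE mulrN.
  have -> : cint c (- (h * (tcst (a ^+ 2 + b ^+ 2) * h)))
    = - cint c (h * (tcst (a ^+ 2 + b ^+ 2) * h)) by exact: raddfN.
  by rewrite opprK [h * _]mulrCA cintZ.
have [z|nz] := eqVneq (a ^+ 2 + b ^+ 2) 0.
  by move/eqP: z; rewrite paddr_eq0 ?sqr_ge0 // !sqrf_eq0 => /andP[/eqP -> /eqP ->].
have mean0 : cint c h = 0.
  have : cint c (lap c h) = 0 by rewrite /lap cD cint_Dx cint_Dy addr0.
  rewrite lapE; have -> : cint c (- (tcst (a ^+ 2 + b ^+ 2) * h)) = - cint c (tcst (a ^+ 2 + b ^+ 2) * h) by exact: raddfN.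
  by rewrite cintZ => /eqP; rewrite oppr_eq0 mulf_eq0 (negPf nz) /= => /eqP.
have {}H := H ltac:(by rewrite cintZ mean0 mulr0).
rewrite cB en -mulrA (_ : 2 * (tcst E0 * (h * h)) = tcst (2 * E0) * (h * h)) in H; last first.
  by rewrite tcstM mulrA; congr (_ * _ * _); apply: torus_ext => p.
rewrite cintZ -mulrBl in H.
have h0 : cint c (h * h) = 0.
  apply/eqP; rewrite eq_le; apply/andP; split; last first.
    by apply: cint_ge0 => p; rewrite torusM -expr2 sqr_ge0.
  by rewrite -(nmulr_rge0 _ (_ : a ^+ 2 + b ^+ 2 - 2 * E0 < 0)) // subr_lt0.
have hz := cint_sqr_eq0 h0.
have s1 : s * s = 1 by rewrite -[RHS]hs hz mul0r add0r.
have tz (t : R) : tcst t * s = 0 -> t = 0.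
  move=> ts; have : tcst t * s * s = 0 by rewrite ts mul0r.
  by rewrite -mulrA s1 mulr1 => /(congr1 (fun g : A => g (0, 0))); rewrite tcstE.
split; apply: tz; apply: oppr_inj; rewrite oppr0; [rewrite -hx|rewrite -hy]; rewrite hz; exact: raddf0.
Qed.
End SmallCharacter.

(** * From index six to the Clifford torus *)

Section LinearImage.
Context {R : realType}.
Variable M : 'M[R]_(4, 5).
Hypothesis MM : M *m M^T = 1%:M.

Lemma dot_mulmx m (x y : 'rV[R]_m) : x *m y^T = (dot x y)%:M.
Proof.
apply/matrixP => i j; rewrite !ord1 !mxE mulr1n; apply: eq_bigr => k _.
by rewrite mxE.
Qed.

Lemma dot_image (x y : 'rV[R]_4) : dot (x *m M) (y *m M) = dot x y.
Proof.
have := dot_mulmx (x *m M) (y *m M); rewrite trmx_mul mulmxA -(mulmxA x) MM mulmx1 dot_mulmx.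
by move=> /(congr1 (fun A : 'M[R]_1 => A ord0 ord0)); rewrite !mxE !mulr1n.
Qed.

Definition imageW : {vspace 'rV[R]_5} := limg (linfun (mulmxr M)).

Lemma imageWP y : (y \in imageW) <-> exists x : 'rV[R]_4, y = x *m M.
Proof.
split=> [/memv_imgP[x _ ->]|[x ->]]; first by exists x; rewrite lfunE.
have -> : x *m M = linfun (mulmxr M) x by rewrite lfunE.
by apply: memv_img; exact: memvf.
Qed.

Lemma image_inj : injective (mulmx^~ M : 'rV[R]_4 -> 'rV[R]_5).
Proof. by move=> x y /(congr1 (mulmx^~ M^T)); rewrite -!mulmxA MM !mulmx1. Qed.

Definition image_sphere : set 'rV[R]_5 := sphere R 4 `&` [set x | x \in imageW].

Lemma great_image_sphere : great_sphere 3 image_sphere.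
Proof.
exists imageW; split=> //; rewrite /imageW limg_dim_eq ?dimvf ?/dim //=.
apply/eqP; rewrite -subv0; apply/subvP => x; rewrite memv_cap memvf memv_ker lfunE /= memv0.
by move=> /eqP xM; apply/eqP; apply: image_inj; rewrite /= xM mul0mx.
Qed.

Lemma isometry_image : isometry_onto (sphere R 3) image_sphere (mulmx^~ M).
Proof.
split=> [|x y _ _]; last by rewrite /sphere_dist dot_image.
split.
- by move=> x sx; split; [rewrite /sphere /= dot_image|apply/imageWP; exists x].
- by move=> x y _ _; exact: image_inj.
- move=> y [sy /imageWP[x yE]]; exists x => //; move: sy; rewrite yE /sphere /= dot_image.
  by [].
Qed.
End LinearImage.

Section FlatCase.
Context {R : realType}.
Notation A := (torus_fun R).
Variables (c : chart R) (F : 'rV[A]_5) (e ie : A).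
Variable fr : frame 'rV[A]_5.
Hypothesis frE : fr = chart_frame c.
Hypothesis imm : immersed_torus (veval F).
Hypothesis e_gt0 : forall p, 0 < e p.
Hypothesis cm : conformal_minimal fr F e ie.
Notation "<< u , v >>" := (fdot fr u v).
Notation P := (hopf1 fr F e ie).
Notation N := (hopf2 fr F e ie).
Variables (k : R).
Hypotheses (k_gt0 : 0 < k) (PN : <<P, N>> = 0) (PPNN : <<P, P>> - <<N, N>> = tcst k).
Hypothesis index7 : ~ negative_family fr F e ie (@tcst R : {rmorphism R -> A}) (cint c) 7.

(** The angles of the two circles are globally defined linear coordinates.
    Stability against the characters of small frequency shows that their period
    lattice is the standard one, so that they are a diffeomorphism of tori. *)
Lemma clifford_of_index : exists (S : set 'rV[R]_5) (iota : 'rV[R]_4 -> 'rV[R]_5),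
  [/\ great_sphere 3 S, isometry_onto (sphere R 3) S iota &
    congruent (veval F) (fun p => iota (clifford_torus p))].
Proof.
have [//|[u [r [r0 [nu N0] PPr [uu uP] pars]]]] := great_sphere_or_negative7 frE e_gt0 cm k_gt0 PN PPNN.
have [e0 eE] := conformal_factor_const frE e_gt0 cm k_gt0 PN PPNN nu N0 uu uP index7.
have e00 : 0 < e0 by have := e_gt0 (0, 0); rewrite eE tcstE.
have [V [Z [V' [Z' [dV dV' [[VV VZ ZZ VV'] [VZ' ZZ' c1]] [c2 c3 c4] FF]]]]] :=
  rotating_pairs frE e_gt0 cm nu N0 uP r0 PPr eE pars.
set lam : R := Num.sqrt _ in dV dV'.
have lam0 : 0 < lam by rewrite sqrtr_gt0 mulr_gt0 // exprn_gt0.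
have lam2 : lam ^+ 2 = 2 * e0 ^+ 2 by rewrite sqr_sqrtr // mulr_ge0 // sqr_ge0.
have tp : 0 < 2 * pi :> R by rewrite mulr_gt0 ?pi_gt0.
pose mu := lam / (2 * pi); have mu0 : 0 < mu by rewrite divr_gt0.
have muE : 2 * pi * mu = lam by rewrite /mu mulrCA divff ?mulr1 // gt_eqF.
have tdZ i (t : R) (g : A) : td i (tcst t * g) = tcst t * td i g.
  by rewrite tdM td_cst mul0r add0r.
have cl1 : td ord_max (tcst mu * cxs c) = td ord0 (tcst mu * cxt c) by rewrite !tdZ chart_closedx.
have cl2 : td ord_max (tcst mu * cys c) = td ord0 (tcst mu * cyt c) by rewrite !tdZ chart_closedy.
have det p : 0 < (tcst mu * cxs c * (tcst mu * cyt c) - tcst mu * cxt c * (tcst mu * cys c)) p.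
  have := chart_det c p; rewrite !torusE tcstE; move: (cxs c p) (cxt c p) (cys c p) (cyt c p).
  move=> x y z w H; have -> : mu * x * (mu * w) - mu * y * (mu * z) = mu ^+ 2 * (x * w - y * z) by ring.
  by rewrite mulr_gt0 // exprn_gt0.
pose c' := Chart cl1 cl2 det.
have [X [sX X0 X1]] := closed_potential cl1; have [Y [sY Y0 Y1]] := closed_potential cl2.
pose X' p : R := 2 * pi * X p; pose Y' p : R := 2 * pi * Y p.
have scaled (f : R * R -> R) (w : 'I_2 -> A) : smooth f -> (forall i, partial i f = tcst mu * w i) ->
    smooth (fun p => 2 * pi * f p) /\ forall i, partial i (fun p => 2 * pi * f p) = tcst lam * w i.
  move=> sf fw; have dc := smooth_partials (@smooth_cst R R^o (2 * pi)).
  split; first by apply: smoothM => //; exact: smooth_cst.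
  move=> i; apply/funext => p; rewrite (partialM _ dc (smooth_partials sf)) partial_cst mul0r add0r fw.
  by rewrite !torusM !tcstE mulrA muE.
have [sX' Xw] : smooth X' /\ forall i, partial i X' = tcst lam * cx c i.
  by apply: scaled => // i; elim/ord2P: i.
have [sY' Yw] : smooth Y' /\ forall i, partial i Y' = tcst lam * cy c i.
  by apply: scaled => // i; elim/ord2P: i.
have dE (U W : 'rV[A]_5) : fdot fr U W = vdot U W by rewrite frE.
rewrite !dE in VV VZ ZZ VV' VZ' ZZ' c1 c2 c3 c4.
have [M [MM FM]] := flat_form sX' sY' Xw Yw dV dV' VV VZ ZZ VV' VZ' ZZ' c1 c2 c3 c4 FF.
have s2 : Num.sqrt 2 != 0 :> R by rewrite gt_eqF // sqrtr_gt0.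
have [_ Fper _ _] := imm.
have angles p q : lattice (p - q) -> [/\ cos (X' p) = cos (X' q), sin (X' p) = sin (X' q),
    cos (Y' p) = cos (Y' q) & sin (Y' p) = sin (Y' q)].
  move=> /Fper; rewrite !FM => /(image_inj MM) /rowP H.
  have g a := congr1 ( *%R (Num.sqrt 2)) (H a).
  have := g ord0; have := g (lift ord0 ord0); have := g (lift ord0 (lift ord0 ord0)).
  have := g (lift ord0 (lift ord0 (lift ord0 ord0))).
  by rewrite !mxE /= !mulVKf // => -> -> -> ->.
have periods p q : lattice (p - q) -> exists i j : int, X p - X q = i%:~R /\ Y p - Y q = j%:~R.
  move=> /angles[a1 a2 a3 a4]; have [i iE] := angle_inj a1 a2; have [j jE] := angle_inj a3 a4.
  by exists i, j; split; apply: (mulfI (x := 2 * pi)); rewrite ?gt_eqF // mulrBr.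
(* Characters of small frequency contradict the stability inequality. *)
have small a b : (forall p q, lattice (p - q) -> exists j : int, a * (X p - X q) + b * (Y p - Y q) = j%:~R) ->
    a ^+ 2 + b ^+ 2 <= 2^-1 -> a = 0 /\ b = 0.
  move=> H ab; pose th p : R := a * X' p + b * Y' p.
  have sth : smooth th.
    by apply: smoothD; apply: smoothM => //; exact: smooth_cst.
  have thw i : partial i th = (tcst lam * (tcst a * cx c i + tcst b * cy c i) : A).
    have da := smooth_partials (@smooth_cst R R^o a); have db := smooth_partials (@smooth_cst R R^o b).
    have dX := smooth_partials sX'; have dY := smooth_partials sY'.
    have dM (t : R) (g : R * R -> R) : smooth g -> has_partials (fun p => t * g p).
    by move=> sg; apply: smooth_partials; apply: smoothM => //; exact: smooth_cst.
    apply/funext => p; rewrite (partialD _ (dM a _ sX') (dM b _ sY')) (partialM _ da dX) (partialM _ db dY).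
    by rewrite !partial_cst !mul0r !add0r Xw Yw !torusM torusD !torusM !tcstE; ring.
  have thper p q : lattice (p - q) -> exists j : int, th p = th q + 2 * pi * j%:~R.
    by move=> /H[j jE]; exists j; rewrite -jE /th /X' /Y'; ring.
  have [h [s [_ hs dh ds]]] := angle_functions sth thw thper.
  have [hx hy] : Dx c h = - (tcst (lam * a) * s) /\ Dy c h = - (tcst (lam * b) * s).
    apply: chart_coords => i; rewrite dh !tcstM; move: (tcst _) (tcst a) (tcst b) (cx c i) (cy c i) => *.
    ring.
  have [sx sy] : Dx c s = tcst (lam * a) * h /\ Dy c s = tcst (lam * b) * h.
    apply: chart_coords => i; rewrite ds !tcstM; move: (tcst _) (tcst a) (tcst b) (cx c i) (cy c i) => *.
    ring.
  have e20 : 0 < e0 ^+ 2 by rewrite exprn_gt0.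
  have EE : e * e = tcst (e0 ^+ 2) by rewrite eE expr2 tcstM.
  have [||/eqP + /eqP] := character_energy hx sx hy sy hs e20.
  - rewrite !exprMn -mulrDr lam2 -mulrA ltr_pM2l // gtr_pMr //.
    by rewrite (le_lt_trans ab) // invf_lt1 // ltr1n.
  - move=> z; have := eform_ge0 frE e_gt0 cm k_gt0 PN PPNN nu N0 uu uP index7 (h := h).
    by rewrite /eform EE frE => /(_ z).
  by rewrite !mulf_eq0 !(gt_eqF lam0) /= => /eqP -> /eqP ->.
have inj p q i j : X p - X q = i%:~R -> Y p - Y q = j%:~R -> lattice (p - q).
  exact: (periods_injective (c := c') sX sY X0 X1 Y0 Y1 periods small).
pose phi := @dev_inv R c' X Y sX sY X0 X1 Y0 Y1.
have phiK y : dev X Y (phi y) = y by exact: dev_invK.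
have latE p q : lattice (dev X Y p - dev X Y q) -> lattice (p - q).
  by move=> [/intrP[i iE] /intrP[j jE]]; apply: (inj p q i j).
have devL p q : lattice (p - q) -> lattice (dev X Y p - dev X Y q).
  by move=> /periods[i [j [iE jE]]]; split; apply/intrP; [exists i|exists j].
have lat0 (p : R * R) : lattice (p - p) by rewrite subrr; split; apply/intrP; exists 0.
exists (image_sphere M), (mulmx^~ M); split; [exact: great_image_sphere|exact: isometry_image|].
exists id, phi; split.
- split; last by move=> x y _ _.
  by split; [|move=> x y _ _|move=> y sy; exists y].
- split.
    split; first exact: smooth_dev_inv.
    by move=> p q pq; apply: latE; rewrite !phiK.
  exists (dev X Y); split.
  + by split; [exact: smooth_pair|exact: devL].
  + by move=> p; rewrite phiK; exact: lat0.
  + by move=> p; apply: latE; rewrite phiK; exact: lat0.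
move=> p; rewrite FM; congr (_ *m M); rewrite /clifford_torus /clifford_angles.
by rewrite /X' /Y' -[X (phi p)]/((dev X Y (phi p)).1) -[Y (phi p)]/((dev X Y (phi p)).2) phiK.
Qed.
End FlatCase.

(** * The index of the Clifford torus *)

Lemma vderiv_pair (R : realType) n (D : derivation R) (k : R) (r s : 'rV[R]_n)
  (a b a' b' : torus_fun R) : D a = a' -> D b = b' ->
  vderiv D (tcst k *: (a *: vcst r + b *: vcst s)) = tcst k *: (a' *: vcst r + b' *: vcst s).
Proof.
move=> <- <-.
by rewrite vderivZ deriv_cst scale0r add0r vderivD !vderivZ !vderiv_cst !scaler0 !addr0.
Qed.

Lemma vderiv_quad (R : realType) n (D : derivation R) (k : R) (r0 r1 r2 r3 : 'rV[R]_n)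
  (a b c d a' b' c' d' : torus_fun R) : D a = a' -> D b = b' -> D c = c' -> D d = d' ->
  vderiv D (tcst k *: (a *: vcst r0 + b *: vcst r1 + (c *: vcst r2 + d *: vcst r3)))
  = tcst k *: (a' *: vcst r0 + b' *: vcst r1 + (c' *: vcst r2 + d' *: vcst r3)).
Proof.
move=> ea eb ec ed; rewrite scalerDr vderivD (vderiv_pair k r0 r1 ea eb).
by rewrite (vderiv_pair k r2 r3 ec ed) -scalerDr.
Qed.

Section LowModes.
Context {R : realType}.
Notation A := (torus_fun R).
Variable T : trig_chart R.
Notation I := (cint T).
Notation cX := (cosx T).
Notation sX := (sinx T).
Notation cY := (cosy T).
Notation sY := (siny T).

Lemma int_sqr_eq1 (k : int) : k != 0 -> (k%:~R ^+ 2 : R) < 2 -> k%:~R * k%:~R = 1 :> R.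
Proof.
move=> k0; rewrite -expr2 -rmorphXn /= -[2]/(2%:~R) ltr_int => H.
suff -> : k ^+ 2 = 1 by [].
apply/eqP; rewrite eq_le -ltzD1 H /= -[k ^+ 2]real_normK ?num_real // exprn_ege1 //.
by rewrite -gtz0_ge1 normr_gt0.
Qed.

(** Rotating the mode back by the angle of that coordinate gives functions with
    zero derivative. *)
Lemma unit_mode (D1 D2 : derivation R) (C S c s : A) (k : R) : k * k = 1 ->
  (forall g, D1 g = 0 -> D2 g = 0 -> exists t, g = tcst t) ->
  D1 C = - (tcst k * S) -> D1 S = tcst k * C -> D2 C = 0 -> D2 S = 0 ->
  D1 c = - s -> D1 s = c -> D2 c = 0 -> D2 s = 0 -> c * c + s * s = 1 ->
  exists u v u' v' : R, C = tcst u * c + tcst v * s /\ S = tcst u' * c + tcst v' * s.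
Proof.
move=> kk cst DC DS D2C D2S Dc Ds D2c D2s cs.
have kkA : tcst k * tcst k = 1 :> A by rewrite -tcstM kk tcst1.
have [||u uE] := cst (C * c + tcst k * (S * s)).
- rewrite derivD derivZ !derivM DC DS Dc Ds; move: kkA; move: (tcst k) => z zz.
  transitivity ((z * z - 1) * (C * s)); first by ring.
  by rewrite zz subrr mul0r.
- by rewrite derivD derivZ !derivM D2C D2S D2c D2s !(mul0r, mulr0, addr0).
have [||v vE] := cst (C * s - tcst k * (S * c)).
- rewrite derivB derivZ !derivM DC DS Dc Ds; move: kkA; move: (tcst k) => z zz.
  transitivity ((1 - z * z) * (C * c)); first by ring.
  by rewrite zz subrr mul0r.
- by rewrite derivB derivZ !derivM D2C D2S D2c D2s !(mul0r, mulr0, addr0) subrr.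
exists u, v, (- (k * v)), (k * u); split.
  rewrite -uE -vE; move: (tcst k) => z.
  by transitivity (C * (c * c + s * s)); [rewrite cs mulr1|ring].
have -> : tcst (- (k * v)) = - (tcst k * tcst v) :> A by apply: torus_ext.
rewrite tcstM -uE -vE; move: kkA; move: (tcst k) => z zz.
by transitivity (z * z * (S * (c * c + s * s))); [rewrite zz cs mul1r mulr1|ring].
Qed.

(** A mode of frequency less than two involves only one of the coordinates,
    with coefficient [0], [1] or [-1]. *)
Lemma low_modes (a : A) (m : mode T) : freq m < 2 ->
  I a = 0 -> I (a * cX) = 0 -> I (a * sX) = 0 -> I (a * cY) = 0 -> I (a * sY) = 0 ->
  I (a * mc m) = 0 /\ I (a * ms m) = 0.
Proof.
move=> f2 a0 a1 a2 a3 a4.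
have comb (g h : A) u v : I (a * g) = 0 -> I (a * h) = 0 -> I (a * (tcst u * g + tcst v * h)) = 0.
  by move=> g0 h0; rewrite mulrDr cint_add [a * (_ * g)]mulrCA [a * (_ * h)]mulrCA !cintZ g0 h0 !mulr0 addr0.
have [f1|f1] := ltP (freq m) 1.
  by have [_ [x [y [-> ->]]]] := freq0 f1; split; exact: mean0_const.
have t0 : tcst 0 = 0 :> A by apply: torus_ext.
have cstX (g : A) : Dx T g = 0 -> Dy T g = 0 -> exists t, g = tcst t.
  by move=> g1 g2; exact: chart_const g1 g2.
have cstY (g : A) : Dy T g = 0 -> Dx T g = 0 -> exists t, g = tcst t.
  by move=> g2 g1; exact: chart_const g1 g2.
have h1 := DX_mc m; have h2 := DX_ms m; have h3 := DY_mc m; have h4 := DY_ms m.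
have big (k : int) : k != 0 -> 1 <= k%:~R ^+ 2 :> R.
  by move=> k0; rewrite leNgt; apply: contra k0 => /int_sqr_lt1 ->.
have [l0|l0] := eqVneq (ml m) 0.
  have k0 : mk m != 0.
    by apply: contraTneq f1 => k0; rewrite -ltNge /freq k0 l0 expr2 mulr0 addr0 ltr01.
  rewrite l0 t0 !mul0r ?oppr0 in h3 h4.
  have kk := int_sqr_eq1 k0; move: f2; rewrite /freq l0 [0 ^+ 2]expr2 mulr0 addr0 => /kk{}kk.
  have [u [v [u' [v' [-> ->]]]]] := unit_mode kk cstX h1 h2 h3 h4 (Dx_cosx T) (Dx_sinx T)
    (Dy_cosx T) (Dy_sinx T) (cosx_sinx T).
  by split; exact: comb.
have [k0|k0] := eqVneq (mk m) 0; last first.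
  by move: f2; rewrite ltNge -[2]/(1 + 1) lerD ?big.
rewrite k0 t0 !mul0r ?oppr0 in h1 h2.
have kk := int_sqr_eq1 l0; move: f2; rewrite /freq k0 [0 ^+ 2]expr2 mulr0 add0r => /kk{}kk.
have [u [v [u' [v' [-> ->]]]]] := unit_mode kk cstY h3 h4 h1 h2 (Dy_cosy T) (Dy_siny T)
  (Dx_cosy T) (Dx_siny T) (cosy_siny T).
by split; exact: comb.
Qed.
End LowModes.

Section CliffordAlgebra.
Variable K : comNzRingType.
Implicit Types (x y z w c s d t a b : K).

Lemma normal_coefs c s d t x y z w : c * c + s * s = 1 -> d * d + t * t = 1 ->
  c * x + s * y + (d * z + t * w) = 0 -> - s * x + c * y = 0 -> - t * z + d * w = 0 ->
  let a := c * x + s * y in [/\ x = c * a, y = s * a, z = - (d * a) & w = - (t * a)].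
Proof.
move=> cs dt h1 h2 h3; cbv zeta.
have h1' : d * z + t * w = - (c * x + s * y) by apply/eqP; rewrite -addr_eq0 addrC h1.
split.
- transitivity ((c * c + s * s) * x + s * (- s * x + c * y)); first by rewrite cs h2 mul1r mulr0 addr0.
  by ring.
- transitivity ((c * c + s * s) * y - c * (- s * x + c * y)); first by rewrite cs h2 mul1r mulr0 subr0.
  by ring.
- rewrite -mulrN -h1'; transitivity ((d * d + t * t) * z + t * (- t * z + d * w)); last by ring.
  by rewrite dt h3 mul1r mulr0 addr0.
- rewrite -mulrN -h1'; transitivity ((d * d + t * t) * w - d * (- t * z + d * w)); last by ring.
  by rewrite dt h3 mul1r mulr0 subr0.
Qed.

Lemma rotated_norm c s d t a ax : c * c + s * s = 1 -> d * d + t * t = 1 ->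
  (- s * a + c * ax) * (- s * a + c * ax) + (c * a + s * ax) * (c * a + s * ax)
  + - (0 * a + d * ax) * - (0 * a + d * ax) + - (0 * a + t * ax) * - (0 * a + t * ax)
  = a * a + ax * ax + ax * ax.
Proof.
move=> cs dt; transitivity ((c * c + s * s) * (a * a + ax * ax) + (d * d + t * t) * (ax * ax)).
  by ring.
by rewrite cs dt !mul1r.
Qed.

Lemma jacobi_density a ax ay b bx bY q r : r * q = 1 -> r = 2 ->
  a * a + ax * ax + ax * ax + bx * bx + (a * a + ay * ay + ay * ay + bY * bY)
  - 4 * (r * (q * (a * a) + 0 * 0)) - 2 * q * (a * a + a * a + b * b)
  = 2 * (ax * ax + ay * ay) - 2 * (2 * (a * a)) + (bx * bx + bY * bY - b * b).
Proof.
move=> rq r2; have q2 : 2 * q = 1 by rewrite -r2.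
transitivity (a * a + ax * ax + ax * ax + bx * bx + (a * a + ay * ay + ay * ay + bY * bY)
  - 4 * (r * q) * (a * a) - (2 * q) * (a * a + a * a + b * b)); first by ring.
by rewrite rq q2; ring.
Qed.
End CliffordAlgebra.

Lemma hopf_dot (A : comNzRingType) (V : lmodType A) (F : frame V) (f : V) (e ie : A) W :
  normal F f W -> fdot F (hopf1 F f e ie) W = fdot F (vfv (fX F) (vfv (fX F) f)) W /\
    fdot F (hopf2 F f e ie) W = fdot F (vfv (fX F) (vfv (fY F) f)) W.
Proof.
move=> [Wf Wx Wy]; rewrite hopf1E hopf2E !(fdotBl, fdotDl, fdotNl, fdotZl).
rewrite !(fdotC F _ W) Wf Wx Wy; by rewrite !(mulr0, addr0, subr0, oppr0).
Qed.

Lemma vdot_comb (R : realType) n (x a b y c d : torus_fun R) (U W U' W' : 'rV[torus_fun R]_n) :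
  vdot (x *: (a *: U + b *: W)) (y *: (c *: U' + d *: W'))
  = x * y * (a * c * vdot U U' + a * d * vdot U W' + (b * c * vdot W U' + b * d * vdot W W')).
Proof.
rewrite vdotZl vdotZr vdotDl !vdotDr !vdotZl !vdotZr.
move: (vdot U U') (vdot U W') (vdot W U') (vdot W W') => p q r s.
by rewrite !mulrA -!mulrA; congr (_ * (_ * _)); rewrite !mulrA.
Qed.

Lemma vdensE (A : comNzRingType) (V : lmodType A) (F : frame V) (f : V) (e ie : A) U W :
  vdens F f e ie U W = fdot F (vfv (fX F) U) (vfv (fX F) W) + fdot F (vfv (fY F) U) (vfv (fY F) W)
  - 4 * (ie * ie * (fdot F (hopf1 F f e ie) U * fdot F (hopf1 F f e ie) W
    + fdot F (hopf2 F f e ie) U * fdot F (hopf2 F f e ie) W)).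
Proof. by []. Qed.

Section RotationAlgebra.
Variable K : comNzRingType.
Implicit Types (c s d t x y a b q r : K).
Lemma frame_norm x s c : c * c + s * s = 1 ->
  x * x * (- s * - s * 1 + - s * c * 0 + (c * - s * 0 + c * c * 1)) = x * x.
Proof. by move=> h; transitivity (x * x * (c * c + s * s)); [ring|rewrite h mulr1]. Qed.
Lemma product_norm c s d t x y : c * c + s * s = 1 -> d * d + t * t = 1 ->
  c * x * (c * x) + s * x * (s * x) + - (d * x) * - (d * x) + - (t * x) * - (t * x) + y * y
  = x * x + x * x + y * y.
Proof.
move=> h h'; transitivity ((c * c + s * s) * (x * x) + (d * d + t * t) * (x * x) + y * y); first by ring.
by rewrite h h' !mul1r.
Qed.
Lemma rotated_norm' c s d t x y : c * c + s * s = 1 -> d * d + t * t = 1 ->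
  (0 * x + c * y) * (0 * x + c * y) + (0 * x + s * y) * (0 * x + s * y)
  + - (- t * x + d * y) * - (- t * x + d * y) + - (d * x + t * y) * - (d * x + t * y)
  = x * x + y * y + y * y.
Proof.
move=> h h'; transitivity ((c * c + s * s) * (y * y) + (d * d + t * t) * (x * x + y * y)); first by ring.
by rewrite h h' !mul1r; ring.
Qed.
End RotationAlgebra.

Section CliffordIndex.
Context {R : realType}.
Notation A := (torus_fun R).
Variable T : trig_chart R.
Notation I := (cint T).
Notation cX := (cosx T).
Notation sX := (sinx T).
Notation cY := (cosy T).
Notation sY := (siny T).
Notation DX := (Dx T).
Notation DY := (Dy T).
Variables (F : 'rV[A]_5) (r0 r1 r2 r3 r4 : 'rV[R]_5).
Let rt : A := tcst (Num.sqrt 2)^-1.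
Let irt : A := tcst (Num.sqrt 2).
Hypothesis FE : F = rt *: (cX *: vcst r0 + sX *: vcst r1 + (cY *: vcst r2 + sY *: vcst r3)).
Hypotheses (o00 : dot r0 r0 = 1) (o11 : dot r1 r1 = 1) (o22 : dot r2 r2 = 1) (o33 : dot r3 r3 = 1).
Hypotheses (o01 : dot r0 r1 = 0) (o02 : dot r0 r2 = 0) (o03 : dot r0 r3 = 0).
Hypotheses (o12 : dot r1 r2 = 0) (o13 : dot r1 r3 = 0) (o23 : dot r2 r3 = 0).
Hypothesis pars : forall U W : 'rV[A]_5, vdot U W = vdot U (vcst r0) * vdot W (vcst r0)
  + vdot U (vcst r1) * vdot W (vcst r1) + vdot U (vcst r2) * vdot W (vcst r2)
  + vdot U (vcst r3) * vdot W (vcst r3) + vdot U (vcst r4) * vdot W (vcst r4).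
Hypothesis imm : immersed_torus (veval F).
Hypothesis fmin : minimal (veval F).

Let s2 : 0 < Num.sqrt 2 :> R. Proof. by rewrite sqrtr_gt0. Qed.
Let rtirt : rt * irt = 1. Proof. by rewrite -tcstM mulVf ?tcst1 // gt_eqF. Qed.
Let rt_gt0 p : 0 < rt p. Proof. by rewrite tcstE invr_gt0. Qed.
Let irt2 : irt * irt = 2.
Proof.
rewrite -tcstM -expr2 sqr_sqrtr //; apply: torus_ext => p.
by rewrite tcstE -[2 in RHS]/(1 + 1) torusD torus1.
Qed.
Let irtrt2 : irt * irt * (rt * rt) = 1.
Proof. by rewrite mulrACA [irt * rt]mulrC rtirt mulr1. Qed.
Let Fx : vderiv DX F = rt *: (- sX *: vcst r0 + cX *: vcst r1).
Proof.
by rewrite FE (vderiv_quad _ _ _ _ _ (Dx_cosx T) (Dx_sinx T) (Dx_cosy T) (Dx_siny T)) !scale0r !addr0.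
Qed.
Let Fy : vderiv DY F = rt *: (- sY *: vcst r2 + cY *: vcst r3).
Proof.
by rewrite FE (vderiv_quad _ _ _ _ _ (Dy_cosx T) (Dy_sinx T) (Dy_cosy T) (Dy_siny T)) !scale0r !add0r.
Qed.
Let Fxx : vderiv DX (vderiv DX F) = rt *: (- cX *: vcst r0 + - sX *: vcst r1).
Proof.
rewrite Fx; apply: vderiv_pair (Dx_cosx T).
by transitivity (- DX sX); [exact: raddfN|congr (- _); exact: Dx_sinx].
Qed.
Let Fxy : vderiv DX (vderiv DY F) = 0.
Proof.
have z : DX (- sY) = 0.
  by transitivity (- DX sY); [exact: raddfN|rewrite [DX sY](Dx_siny T) oppr0].
by rewrite Fy (vderiv_pair _ _ _ z (Dx_cosy T)) !scale0r addr0 scaler0.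
Qed.

Let t1E : tcst (1 : R) = 1 :> A. Proof. exact: tcst1. Qed.
Let t0E : tcst (0 : R) = 0 :> A. Proof. by apply: torus_ext. Qed.

Let conf : [/\ vdot (vderiv DX F) (vderiv DX F) = rt * rt,
  vdot (vderiv DY F) (vderiv DY F) = rt * rt & vdot (vderiv DX F) (vderiv DY F) = 0].
Proof.
split.
- rewrite Fx vdot_comb !vdot_vcst (dotC r1 r0) o00 o01 o11 t0E t1E.
  exact: frame_norm (cosx_sinx T).
- rewrite Fy vdot_comb !vdot_vcst (dotC r3 r2) o22 o23 o33 t0E t1E.
  exact: frame_norm (cosy_siny T).
- by rewrite Fx Fy vdot_comb !vdot_vcst o02 o03 o12 o13 t0E !mulr0 !addr0 mulr0.
Qed.

Let cm : conformal_minimal (chart_frame T) F rt irt.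
Proof. by have [xx yy xy] := conf; exact: (minimal_conformal imm rt_gt0 xx yy xy rtirt fmin). Qed.

(** The two components of a normal field: along the normal of the torus in the
    great sphere, up to a factor, and along the normal of the great sphere. *)
Definition comp_nu (V : 'rV[A]_5) : A := cX * vdot V (vcst r0) + sX * vdot V (vcst r1).
Definition comp_e (V : 'rV[A]_5) : A := vdot V (vcst r4).

(** In the orthonormal frame along the torus the two components decouple: the
    part along the normal of the torus inside the great sphere contributes
    twice the form of [lap + 2], the other part the form of [lap + 1]. *)
Lemma clifford_second_variation V : normal (chart_frame T) F V ->
  let a := comp_nu V in let b := comp_e V in
  second_variation (veval F) (veval V)
  = I (2 * (DX a * DX a + DY a * DY a) - 2 * (2 * (a * a)) + (DX b * DX b + DY b * DY b - b * b)).
Proof.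
move=> nV a b; have [xx yy xy] := conf.
rewrite (second_variation_conformal imm rt_gt0 xx yy xy cm nV); congr (cint _ _).
have [Vf_ Vx_ Vy_] := nV.
have Vf : vdot V F = 0 := Vf_.
have Vx : vdot V (vderiv DX F) = 0 := Vx_.
have Vy : vdot V (vderiv DY F) = 0 := Vy_.
have unitK g : rt * g = 0 -> g = 0.
  by move=> H; rewrite -[g]mul1r -rtirt mulrAC H mul0r.
pose v0 := vdot V (vcst r0); pose v1 := vdot V (vcst r1); pose v2 := vdot V (vcst r2).
pose v3 := vdot V (vcst r3).
have e1 : cX * v0 + sX * v1 + (cY * v2 + sY * v3) = 0.
  by apply: unitK; rewrite -Vf FE vdotZr vdotDr !vdotDr !vdotZr.
have e2 : - sX * v0 + cX * v1 = 0 by apply: unitK; rewrite -Vx Fx vdotZr vdotDr !vdotZr.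
have e3 : - sY * v2 + cY * v3 = 0 by apply: unitK; rewrite -Vy Fy vdotZr vdotDr !vdotZr.
have [v0E v1E v2E v3E] := normal_coefs (cosx_sinx T) (cosy_siny T) e1 e2 e3.
rewrite -[cX * v0 + sX * v1]/a in v0E v1E v2E v3E.
have dD (D : derivation R) r : vdot (vderiv D V) (vcst r) = D (vdot V (vcst r)).
  by rewrite deriv_vdot vderiv_cst [vdot V 0]vdotC vdot0l addr0.
have dN (D : derivation R) g : D (- g) = - D g by exact: raddfN.
have VV : vdot V V = a * a + a * a + b * b.
  rewrite pars -/v0 -/v1 -/v2 -/v3 -[vdot V (vcst r4)]/b v0E v1E v2E v3E.
  exact: product_norm (cosx_sinx T) (cosy_siny T).
have Vxx : vdot (vderiv DX V) (vderiv DX V) = a * a + DX a * DX a + DX a * DX a + DX b * DX b.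
  rewrite pars !dD -/v0 -/v1 -/v2 -/v3 -[vdot V (vcst r4)]/b v0E v1E v2E v3E !dN !derivM.
  rewrite Dx_cosx Dx_sinx Dx_cosy Dx_siny; congr (_ + _).
  exact: rotated_norm (cosx_sinx T) (cosy_siny T).
have Vyy : vdot (vderiv DY V) (vderiv DY V) = a * a + DY a * DY a + DY a * DY a + DY b * DY b.
  rewrite pars !dD -/v0 -/v1 -/v2 -/v3 -[vdot V (vcst r4)]/b v0E v1E v2E v3E !dN !derivM.
  rewrite Dy_cosx Dy_sinx Dy_cosy Dy_siny; congr (_ + _).
  exact: rotated_norm' (cosx_sinx T) (cosy_siny T).
have [P_ N_] := @hopf_dot _ _ (chart_frame T) F rt irt V nV.
have PV : fdot (chart_frame T) (hopf1 (chart_frame T) F rt irt) V = - (rt * a).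
  rewrite P_; suff H : vdot (vderiv DX (vderiv DX F)) V = - (rt * a) by exact: H.
  by rewrite Fxx vdotC vdotZr vdotDr !vdotZr !mulNr -opprD mulrN.
have NV : fdot (chart_frame T) (hopf2 (chart_frame T) F rt irt) V = 0.
  rewrite N_; suff H : vdot (vderiv DX (vderiv DY F)) V = 0 by exact: H.
  by rewrite Fxy vdot0l.
rewrite vdensE PV NV mulrNN (mulrACA rt a rt a).
have -> : fdot (chart_frame T) (vfv (fX (chart_frame T)) V) (vfv (fX (chart_frame T)) V)
  = a * a + DX a * DX a + DX a * DX a + DX b * DX b := Vxx.
have -> : fdot (chart_frame T) (vfv (fY (chart_frame T)) V) (vfv (fY (chart_frame T)) V)
  = a * a + DY a * DY a + DY a * DY a + DY b * DY b := Vyy.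
by rewrite VV; exact: jacobi_density irtrt2 irt2.
Qed.

(** The spectral gap beyond the low modes has the constants two and one for the
    two components. *)
Lemma clifford_nonneg V : normal (chart_frame T) F V ->
  let a := comp_nu V in I a = 0 -> I (a * cX) = 0 -> I (a * sX) = 0 -> I (a * cY) = 0 ->
  I (a * sY) = 0 -> I (comp_e V) = 0 -> 0 <= second_variation (veval F) (veval V).
Proof.
move=> nV a a0 a1 a2 a3 a4 b0; rewrite (clifford_second_variation nV) -/a; set b := comp_e V.
have g1 := @spectral_gap _ T a 2 (ler0n _ _) (fun m f2 => low_modes f2 a0 a1 a2 a3 a4).
have g2 := poincare b0; rewrite -/b in g2.
have two g : I (2 * g) = 2 * I g.
  by rewrite !mulr_natl !mulr2n cint_add.
rewrite cint_add 2!cint_sub !two.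
by move: g1 g2; move: (I _) (I _) (I _) (I _) => x y z w; lra.
Qed.

(** Among more than six fields some combination is orthogonal to all low modes,
    and the second variation is nonnegative on it. *)
Lemma clifford_index k (B : 'I_k -> R * R -> 'rV[R]_5) :
  negative_definite_family (veval F) B -> (k <= 6)%N.
Proof.
move=> [nB free neg]; rewrite leqNgt; apply/negP => k6.
have WE i : exists W : 'rV[A]_5, B i = veval W.
  by have [sB pB _] := nB i; exact: veval_surj.
pose W i := sval (cid (WE i)); have BE i : B i = veval (W i) by rewrite /W; case: cid.
pose l (j : 'I_6) (V : 'rV[A]_5) : R := [:: I (comp_nu V); I (comp_nu V * cX); I (comp_nu V * sX);
  I (comp_nu V * cY); I (comp_nu V * sY); I (comp_e V)]`_j.
pose L : 'M[R]_(k, 6) := \matrix_(i, j) l j (W i).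
have : kermx L != 0.
  by rewrite -mxrank_eq0 mxrank_ker -lt0n subn_gt0 (leq_ltn_trans (rank_leq_col L)).
move=> /rowV0Pn[v /sub_kermxP vL v0].
pose V : 'rV[A]_5 := \sum_i tcst (v ord0 i) *: W i.
have VE : veval V = \sum_i v ord0 i *: B i.
  apply/funext => p; rewrite veval_sum fct_sumE; apply: eq_bigr => i _.
  by rewrite vevalZ tcstE BE.
have nuV : comp_nu V = \sum_i tcst (v ord0 i) * comp_nu (W i).
  have sumd r : vdot V (vcst r) = \sum_i tcst (v ord0 i) * vdot (W i) (vcst r).
    rewrite /V; elim/big_rec2: _ => [|i x y _ <-]; first exact: vdot0l.
    by rewrite vdotDl vdotZl.
  rewrite /comp_nu !sumd !mulr_sumr -big_split; apply: eq_bigr => i _ /=.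
  by rewrite mulrDr ![_ * (tcst _ * _)]mulrCA.
have eV : comp_e V = \sum_i tcst (v ord0 i) * comp_e (W i).
  rewrite /comp_e /V; elim/big_rec2: _ => [|i x y _ <-]; first exact: vdot0l.
  by rewrite vdotDl vdotZl.
have lin (g : A) (h : 'I_k -> A) : I ((\sum_i tcst (v ord0 i) * h i) * g) = \sum_i v ord0 i * I (h i * g).
  by rewrite mulr_suml cint_sum; apply: eq_bigr => i _; rewrite -mulrA cintZ.
have lin1 (h : 'I_k -> A) : I (\sum_i tcst (v ord0 i) * h i) = \sum_i v ord0 i * I (h i).
  by rewrite cint_sum; apply: eq_bigr => i _; rewrite cintZ.
have col j : \sum_i v ord0 i * l j (W i) = 0.
  have H : \sum_i v ord0 i * L i j = 0.
    by have := congr1 (fun M : 'M[R]_(1, 6) => M ord0 j) vL; rewrite !mxE.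
  by rewrite -[RHS]H; apply: eq_bigr => i _; rewrite mxE.
have sVn : normal_section (veval F) (veval V).
  split; [exact: smooth_veval|exact: periodic_veval|] => p.
  have nBp i : normal_at (veval F) p (veval (W i) p) by have [_ _] := nB i; rewrite BE.
  rewrite VE fct_sumE; split=> [|j].
    by rewrite dot_suml big1 // => i _; rewrite BE; have [-> _] := nBp i; rewrite mulr0.
  by rewrite dot_suml big1 // => i _; rewrite BE; have [_ ->] := nBp i; rewrite mulr0.
have nV : normal (chart_frame T) F V by exact: normal_of_section sVn.
have nn := clifford_nonneg nV.
pose nu i := comp_nu (W i).
have l0 : I (comp_nu V) = \sum_i v ord0 i * I (nu i) by rewrite nuV; exact: lin1.
have lg g : I (comp_nu V * g) = \sum_i v ord0 i * I (nu i * g) by rewrite nuV; exact: lin.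
have l5 : I (comp_e V) = \sum_i v ord0 i * I (comp_e (W i)) by rewrite eV; exact: lin1.
have j0 (n : nat) (Hn : (n < 6)%N) := col (Ordinal Hn).
have := nn (etrans l0 (j0 0%N isT)) (etrans (lg _) (j0 1%N isT)) (etrans (lg _) (j0 2%N isT))
  (etrans (lg _) (j0 3%N isT)) (etrans (lg _) (j0 4%N isT)) (etrans l5 (j0 5%N isT)).
rewrite VE leNgt => /negP; apply; apply: neg => /free vz.
by move/eqP: v0; apply; apply/rowP => i; rewrite vz mxE.
Qed.
End CliffordIndex.

(** * Congruence to the Clifford torus *)

Section GramReconstruction.
Context {R : realType}.
Implicit Types (p q : R * R).

Lemma lattice_sub p q : lattice p -> lattice q -> lattice (p - q).
Proof. by move=> [p1 p2] [q1 q2]; split; rewrite /= rpredB. Qed.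
Lemma cos_sphere_dist m (x y : 'rV[R]_m) : dot x x = 1 -> dot y y = 1 ->
  cos (sphere_dist x y) = dot x y.
Proof.
move=> xx yy; apply: acosK; rewrite in_itv /=.
have := dot_ge0 (x - y); have := dot_ge0 (x + y).
rewrite !(dotBl, dotBr, dotDl, dotDr) xx yy (dotC y x) => h1 h2.
by apply/andP; split; lra.
Qed.

Lemma clifford_unit p : dot (clifford_torus p) (clifford_torus p) = 1.
Proof.
rewrite /clifford_torus dotZl dotZr /dot !big_ord_recl big_ord0 !mxE /= addr0 mulrA -invfM -expr2 sqr_sqrtr //.
rewrite -!expr2 addrA !cos2Dsin2.
by field.
Qed.

Lemma quarter_angles : [/\ cos (2 * pi * 0) = 1 :> R /\ sin (2 * pi * 0) = 0 :> R,
  cos (2 * pi * (1 / 2)) = -1 :> R /\ sin (2 * pi * (1 / 2)) = 0 :> R,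
  cos (2 * pi * (1 / 4)) = 0 :> R /\ sin (2 * pi * (1 / 4)) = 1 :> R &
  cos (2 * pi * (3 / 4)) = 0 :> R /\ sin (2 * pi * (3 / 4)) = -1 :> R].
Proof.
have -> : 2 * pi * (1 / 2) = pi :> R by field.
have -> : 2 * pi * (1 / 4) = pi / 2 :> R by field.
have -> : 2 * pi * (3 / 4) = pi / 2 + pi :> R by field.
by rewrite mulr0 cos0 sin0 cospi sinpi cosDpi sinDpi cos_pihalf sin_pihalf oppr0.
Qed.

Definition chord1 (k : 'I_4) : R * R := [:: (0, 0); (1 / 4, 0); (0, 0); (0, 1 / 4)]`_k.
Definition chord2 (k : 'I_4) : R * R := [:: (1 / 2, 0); (3 / 4, 0); (0, 1 / 2); (0, 3 / 4)]`_k.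

(** Four chords of the Clifford torus form an orthogonal basis, so that inner
    products with points of the torus determine a vector. *)
Lemma clifford_chords k :
  clifford_torus (chord1 k) - clifford_torus (chord2 k) = Num.sqrt 2 *: delta_mx ord0 k.
Proof.
have [[c0 s0] [c2 s2] [c1 s1] [c3 s3]] := quarter_angles.
have r : (Num.sqrt 2)^-1 * 2 = Num.sqrt 2 :> R.
  have s0' : Num.sqrt 2 != 0 :> R by rewrite gt_eqF // sqrtr_gt0.
  by apply: (mulfI s0'); rewrite mulrA divff // mul1r -expr2 sqr_sqrtr.
apply/rowP => j; rewrite /clifford_torus -scalerBr !mxE.
case: k => [[|[|[|[|//]]]] Hk]; case: j => [[|[|[|[|//]]]] Hj]; rewrite /chord1 /chord2 /=
  ?c0 ?s0 ?c1 ?s1 ?c2 ?s2 ?c3 ?s3 ?subrr ?mulr0 //= ?opprK ?mulr1 //.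
Qed.

Variable f : R * R -> 'rV[R]_5.
Hypothesis per : Defs.periodic f.

(** A distance preserving map between spheres preserves inner products, and
    these determine it on the torus as a linear map. *)
Lemma linear_clifford (S : set 'rV[R]_5) (iota : 'rV[R]_4 -> 'rV[R]_5) :
  great_sphere 3 S -> isometry_onto (sphere R 3) S iota ->
  congruent f (fun p => iota (clifford_torus p)) ->
  exists (M : 'M[R]_(4, 5)) (psi : R * R -> R * R), [/\ M *m M^T = 1%:M,
    forall p, f p = clifford_torus (psi p) *m M &
    forall p q, lattice (psi p - psi q) -> lattice (p - q)].
Proof.
move=> [W [_ SE]] [[iS _ _] id_] [s [phi [[[sS _ _] sd] [[_ lphi] [psi [_ psiphi phipsi]]] fphi]]].
pose u := @clifford_torus R; pose g p := f (phi p).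
have uS p : sphere R 3 (u p) by exact: clifford_unit.
have SS x : S x -> sphere R 4 x by rewrite SE => -[].
have gg p q : dot (g p) (g q) = dot (u p) (u q).
  rewrite /g !fphi -[RHS]cos_sphere_dist ?clifford_unit // -id_ // -sd; try by apply: SS; exact: iS.
  by rewrite cos_sphere_dist //; apply: sS; apply: SS; exact: iS.
have s0 : Num.sqrt 2 != 0 :> R by rewrite gt_eqF // sqrtr_gt0.
pose w k := (Num.sqrt 2)^-1 *: (g (chord1 k) - g (chord2 k)).
have gw p k : dot (g p) (w k) = u p ord0 k.
  rewrite /w dotZr dotBr !gg -dotBr clifford_chords dotZr mulrA mulVf // mul1r.
  rewrite /dot (bigD1 k) //= big1 ?addr0; first by rewrite [delta_mx _ _ _ _]mxE !eqxx mulr1.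
  by move=> i /negPf ik; rewrite [delta_mx _ _ _ _]mxE ik andbF mulr0.
pose M := \matrix_k w k.
have MM : M *m M^T = 1%:M.
  apply/matrixP => k l; rewrite mxE [RHS]mxE.
  transitivity (dot (w k) (w l)); first by apply: eq_bigr => i _; rewrite !mxE.
  rewrite {1}/w dotZl dotBl !gw -[_ - _](_ : (u (chord1 k) - u (chord2 k)) ord0 l = _); last by rewrite !mxE.
  by rewrite clifford_chords !mxE mulrA mulVf // mul1r eqxx /= eq_sym.
have gM p : g p = u p *m M.
  apply: subr0_eq; apply: dot_eq0.
  have x1 : dot (g p) (u p *m M) = 1.
    rewrite mulmx_sum_row dotC dot_suml -[RHS](clifford_unit p).
    by apply: eq_bigr => k _; rewrite rowK dotC gw.
  by rewrite dotBl !dotBr (dotC (u p *m M) (g p)) x1 (dot_image MM) gg !clifford_unit !subrr.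
exists M, psi; split=> // [p|p q pq].
  by rewrite -[clifford_torus _]/(u _) -gM /g; apply: per; rewrite -opprB -sub0r;
    apply: lattice_sub => //; rewrite -(subrr (phi (psi p) - p)); exact: lattice_sub.
have -> : p - q = (phi (psi p) - phi (psi q) - (phi (psi p) - p)) - (0 - (phi (psi q) - q)).
  by rewrite sub0r opprK !opprB; case: p q pq => [a b] [c d] _; congr (_, _); rewrite /=; ring.
apply: lattice_sub; first by apply: lattice_sub => //; exact: lphi.
by apply: (lattice_sub _ (phipsi q)); rewrite -(subrr (phi (psi q) - q)); exact: lattice_sub.
Qed.
End GramReconstruction.

Section CliffordChart.
Context {R : realType}.
Notation A := (torus_fun R).

(** The form [c ds - s dc] is the differential of the angle. *)
Lemma angle_form (c s : A) : c * c + s * s = 1 -> exists x : 'I_2 -> A,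
  [/\ forall i, td i c = - s * x i, forall i, td i s = c * x i &
    td ord_max (x ord0) = td ord0 (x ord_max)].
Proof.
move=> cs; exists (fun i => c * td i s - s * td i c).
have two0 (h : A) : h + h = 0 -> h = 0.
  move=> H; apply: torus_ext => p; have := torus_eq H p; rewrite torusD torus0.
  by move=> /eqP; rewrite -mulr2n mulrn_eq0 /= => /eqP.
have orth i : c * td i c + s * td i s = 0.
  apply: two0; have := congr1 (td i) cs; rewrite -tcst1 td_cst.
  have -> : td i (c * c + s * s) = td i (c * c) + td i (s * s) by exact: raddfD.
  rewrite !tdM => <-; move: (td i c) (td i s) => x y; ring.
have dc i : td i c = - s * (c * td i s - s * td i c).
  have al (K : comNzRingType) (a b x y : K) : a * a + b * b = 1 -> a * x + b * y = 0 ->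
    x = - b * (a * y - b * x).
    move=> h1 h2; transitivity ((a * a + b * b) * x - a * (a * x + b * y)); last by ring.
    by rewrite h1 h2 mulr0 subr0 mul1r.
  exact: al.
have ds i : td i s = c * (c * td i s - s * td i c).
  have al (K : comNzRingType) (a b x y : K) : a * a + b * b = 1 -> a * x + b * y = 0 ->
    y = a * (a * y - b * x).
    move=> h1 h2; transitivity ((a * a + b * b) * y - b * (a * x + b * y)); last by ring.
    by rewrite h1 h2 mulr0 subr0 mul1r.
  exact: al.
split=> //.
rewrite !tdB !tdM (tdC ord_max ord0 s) (tdC ord_max ord0 c).
have al (K : comNzRingType) (a b x y x' y' z w p q : K) : x = - b * p -> y = a * p ->
   x' = - b * q -> y' = a * q ->
   x' * y + a * z - (y' * x + b * w) = x * y' + a * z - (y * x' + b * w).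
  by move=> -> -> -> ->; ring.
exact: al (dc ord0) (ds ord0) (dc ord_max) (ds ord_max).
Qed.

(** The quotient of [h] by its absolute value has square one, hence zero
    derivative. *)
Lemma constant_sign (h : A) : (forall p, h p != 0) -> (forall p, 0 < h p) \/ (forall p, 0 < (- h) p).
Proof.
move=> h0; have hh p : 0 < (h * h) p by rewrite torusM -expr2 lt_def sqrf_eq0 h0 sqr_ge0.
have [k [kk k0]] := torus_sqrt hh.
have [ik [kik _]] := torus_inv (fun p => negbT (gt_eqF (k0 p))).
pose t := h * ik; have tt : t * t = 1.
  by rewrite /t mulrACA -kk mulrACA kik mulr1.
have dt i : td i t = 0.
  have two0 (g : A) : g + g = 0 -> g = 0.
    move=> H; apply: torus_ext => p; have := torus_eq H p; rewrite torusD torus0.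
    by move=> /eqP; rewrite -mulr2n mulrn_eq0 /= => /eqP.
  have H : t * td i t = 0.
    by apply: two0; have := congr1 (td i) tt; rewrite tdM -tcst1 td_cst => <-; rewrite [td i t * t]mulrC.
  by rewrite -[LHS]mul1r -tt -mulrA H mulr0.
have [d dE] := torus_const dt.
have hE p : h p = d * k p.
  have -> : h = t * k by rewrite /t mulrAC -mulrA kik mulr1.
  by rewrite dE torusM tcstE.
have [d0|d0] := ltP 0 d; [left|right] => p; first by rewrite hE mulr_gt0.
rewrite torusN hE -mulNr mulr_gt0 // oppr_gt0 lt_neqAle d0 andbT.
by apply: contra (h0 (0, 0)) => /eqP z; rewrite hE z mul0r.
Qed.

Variables (F : 'rV[A]_5) (M : 'M[R]_(4, 5)) (psi : R * R -> R * R).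
Hypotheses (imm : immersed_torus (veval F)) (fmin : minimal (veval F)).
Hypotheses (MM : M *m M^T = 1%:M) (FM : forall p, veval F p = clifford_torus (psi p) *m M).
Hypothesis psi_lattice : forall p q, lattice (psi p - psi q) -> lattice (p - q).

Lemma row_dots k l : dot (row k M) (row l M) = (k == l)%:R.
Proof.
have := congr1 (fun N : 'M[R]_4 => N k l) MM; rewrite mxE [RHS]mxE => <-.
by apply: eq_bigr => j _; rewrite !mxE.
Qed.

Lemma dot_row (u : 'rV[R]_4) k : dot (u *m M) (row k M) = u ord0 k.
Proof.
transitivity ((u *m M *m M^T) ord0 k); last by rewrite -mulmxA MM mulmx1.
by rewrite [RHS]mxE; apply: eq_bigr => j _; rewrite [row k M _ _]mxE [M^T _ _]mxE.
Qed.

Notation o0 := (ord0 : 'I_4).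
Notation o1 := (lift ord0 ord0 : 'I_4).
Notation o2 := (lift ord0 (lift ord0 ord0) : 'I_4).
Notation o3 := (lift ord0 (lift ord0 (lift ord0 ord0)) : 'I_4).
Notation r0 := (row o0 M).
Notation r1 := (row o1 M).
Notation r2 := (row o2 M).
Notation r3 := (row o3 M).

Lemma trig_components : exists c1 s1 c2 s2 : A,
  [/\ forall p, c1 p = cos (2 * pi * (psi p).1) /\ s1 p = sin (2 * pi * (psi p).1),
    forall p, c2 p = cos (2 * pi * (psi p).2) /\ s2 p = sin (2 * pi * (psi p).2) &
    F = tcst (Num.sqrt 2)^-1 *: (c1 *: vcst r0 + s1 *: vcst r1 + (c2 *: vcst r2 + s2 *: vcst r3))].
Proof.
have s0 : Num.sqrt 2 != 0 :> R by rewrite gt_eqF // sqrtr_gt0.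
pose C k : A := tcst (Num.sqrt 2) * vdot F (vcst (row k M)).
have vv (r : 'rV[R]_5) p : veval (vcst r) p = r by apply/rowP => j; rewrite !mxE.
have CE k p : C k p = Num.sqrt 2 * clifford_torus (psi p) ord0 k.
  by rewrite /C torusM tcstE -dot_veval vv FM dot_row.
exists (C o0), (C o1), (C o2), (C o3); split.
- by move=> p; rewrite !CE !mxE /= !mulVKf.
- by move=> p; rewrite !CE !mxE /= !mulVKf.
apply: veval_inj => p; rewrite vevalZ tcstE !vevalD !vevalZ !vv !CE FM.
rewrite mulmx_sum_row !big_ord_recl big_ord0 addr0 !scalerDr !scalerA !mulKf //.
by rewrite !addrA.
Qed.

Lemma frame_gram (K : comNzRingType) (w x0 y0 x1 y1 : K) :
  w * (x0 * x0 + y0 * y0) * (w * (x1 * x1 + y1 * y1)) - w * (x0 * x1 + y0 * y1) * (w * (x0 * x1 + y0 * y1))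
  = w * w * ((x0 * y1 - x1 * y0) * (x0 * y1 - x1 * y0)).
Proof. ring. Qed.

(** The Gram determinant of the induced metric is a positive multiple of the
    square of this Jacobian. *)
Lemma angle_jacobian c1 s1 c2 s2 (x y : 'I_2 -> A) :
  c1 * c1 + s1 * s1 = 1 -> c2 * c2 + s2 * s2 = 1 ->
  F = tcst (Num.sqrt 2)^-1 *: (c1 *: vcst r0 + s1 *: vcst r1 + (c2 *: vcst r2 + s2 *: vcst r3)) ->
  (forall i, td i c1 = - s1 * x i) -> (forall i, td i s1 = c1 * x i) ->
  (forall i, td i c2 = - s2 * y i) -> (forall i, td i s2 = c2 * y i) ->
  forall p, (x ord0 * y ord_max - x ord_max * y ord0) p != 0.
Proof.
move=> cs1 cs2 FE dc1 ds1 dc2 ds2 p.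
pose U := - s1 *: vcst r0 + c1 *: vcst r1; pose W := - s2 *: vcst r2 + c2 *: vcst r3.
have Fi i : vderiv (Dt i) F = tcst (Num.sqrt 2)^-1 *: (x i *: U + y i *: W).
  rewrite FE; apply: etrans (vderiv_quad (D := Dt i) _ _ _ _ _ (dc1 i) (ds1 i) (dc2 i) (ds2 i)) _.
  have al (K : comNzRingType) (L : lmodType K) (a b g d s t : K) (e0 e1 e2 e3 : L) :
    (- b * s) *: e0 + (a * s) *: e1 + ((- d * t) *: e2 + (g * t) *: e3)
    = s *: (- b *: e0 + a *: e1) + t *: (- d *: e2 + g *: e3).
    by rewrite !scalerDr !scalerA [s * - b]mulrC [s * a]mulrC [t * - d]mulrC [t * g]mulrC.
  by congr (_ *: _); exact: al.
have one : tcst (1%:R : R) = 1 :> A by exact: tcst1.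
have zero : tcst (0%:R : R) = 0 :> A by apply: torus_ext.
have comb (a b a' b' : A) (X Y X' Y' : 'rV[A]_5) : vdot (a *: X + b *: Y) (a' *: X' + b' *: Y')
    = a * a' * vdot X X' + a * b' * vdot X Y' + (b * a' * vdot Y X' + b * b' * vdot Y Y').
  by have := vdot_comb 1 a b 1 a' b' X Y X' Y'; rewrite !scale1r mulr1 mul1r.
have UU : vdot U U = 1.
  rewrite comb !vdot_vcst !row_dots /= one zero -[RHS]cs1.
  by rewrite !mulr0 !mulr1 addr0 add0r mulrNN addrC.
have WW : vdot W W = 1.
  rewrite comb !vdot_vcst !row_dots /= one zero -[RHS]cs2.
  by rewrite !mulr0 !mulr1 addr0 add0r mulrNN addrC.
have UW : vdot U W = 0 by rewrite comb !vdot_vcst !row_dots /= zero !mulr0 !addr0.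
have gE i j : tmetric F i j = tcst (Num.sqrt 2)^-1 * tcst (Num.sqrt 2)^-1 * (x i * x j + y i * y j).
  rewrite /tmetric (Fi i) (Fi j); apply: etrans (vdot_comb _ _ _ _ _ _ _ _ _ _) _.
  rewrite UU WW UW (vdotC W U) UW !mulr1 !mulr0 addr0 add0r.
  by [].
apply/eqP => J0; have := tgram_gt0 imm p; rewrite /tgram !gE frame_gram torusM [X in _ * X]torusM J0.
by rewrite mulr0 mulr0 ltxx.
Qed.

Lemma clifford_index_le k (B : 'I_k -> R * R -> 'rV[R]_5) :
  negative_definite_family (veval F) B -> (k <= 6)%N.
Proof.
move=> nB; have [c1 [s1 [c2 [s2 [E1 E2 FE]]]]] := trig_components.
have cs1 : c1 * c1 + s1 * s1 = 1.
  by apply: torus_ext => p; rewrite torusD !torusM; have [-> ->] := E1 p; rewrite -!expr2 cos2Dsin2.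
have cs2 : c2 * c2 + s2 * s2 = 1.
  by apply: torus_ext => p; rewrite torusD !torusM; have [-> ->] := E2 p; rewrite -!expr2 cos2Dsin2.
have [x [dc1 ds1 clx]] := angle_form cs1; have [y [dc2 ds2 cly]] := angle_form cs2.
have tp : 2 * pi != 0 :> R by rewrite gt_eqF // mulr_gt0 ?pi_gt0.
have sep p q : c1 p = c1 q -> s1 p = s1 q -> c2 p = c2 q -> s2 p = s2 q -> lattice (p - q).
  have [-> ->] := E1 p; have [-> ->] := E1 q; have [-> ->] := E2 p; have [-> ->] := E2 q.
  move=> a1 a2 a3 a4; have [i] := angle_inj a1 a2; have [j] := angle_inj a3 a4.
  rewrite -!mulrBr => /(mulfI tp) jE /(mulfI tp) iE.
  by apply: psi_lattice; split; apply/intrP; [exists i|exists j].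
have J0 := angle_jacobian cs1 cs2 FE dc1 ds1 dc2 ds2.
have rd k' l (kl : k' != l) : dot (row k' M) (row l M) = 0 by rewrite row_dots (negPf kl).
have rn k' : dot (row k' M) (row k' M) = 1 by rewrite row_dots eqxx.
pose Mc : 'M[A]_(4, 4 + 1) := map_mx (@tcst R) (M : 'M[R]_(4, 4 + 1)).
have McM : Mc *m Mc^T = 1%:M.
  apply/matrixP => k' l; rewrite mxE [RHS]mxE.
  transitivity (vdot (vcst (row k' M)) (vcst (row l M))); last by rewrite vdot_vcst row_dots; case: (_ == _); [exact: tcst1|apply: torus_ext].
  have McE i j : Mc i j = tcst (M i j) by exact: mxE.
  by rewrite /vdot -lock; apply: eq_bigr => j _; rewrite [Mc^T _ _]mxE !McE !mxE.
pose r4 : 'rV[R]_5 := cross (M : 'M[R]_(4, 4 + 1)).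
have rowE k' : row k' Mc = vcst (row k' M) by apply/rowP => j; rewrite !mxE.
have cE : cross Mc = vcst r4 by rewrite /Mc -map_cross.
have pars (U W : 'rV[A]_5) := parseval_rows McM U W.
have {}pars (U W : 'rV[A]_5) : vdot U W = vdot U (vcst r0) * vdot W (vcst r0)
  + vdot U (vcst r1) * vdot W (vcst r1) + vdot U (vcst r2) * vdot W (vcst r2)
  + vdot U (vcst r3) * vdot W (vcst r3) + vdot U (vcst r4) * vdot W (vcst r4).
  by rewrite -cE -!rowE [LHS]pars !big_ord_recl big_ord0 addr0 !addrA.
have [Jp|Jn] := constant_sign J0.
  have [T [_ [e1 e2 e3 e4]]] := angle_forms_chart clx cly Jp cs1 cs2 dc1 ds1 dc2 ds2 sep.
  rewrite -e1 -e2 -e3 -e4 in FE.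
  by apply: (clifford_index FE _ _ _ _ _ _ _ _ _ _ pars imm fmin nB); rewrite ?rn ?rd.
have Jp p : 0 < (y ord0 * x ord_max - y ord_max * x ord0) p.
  have := Jn p; rewrite (_ : - _ = y ord0 * x ord_max - y ord_max * x ord0) //.
  by rewrite opprB [y ord0 * _]mulrC [y ord_max * _]mulrC.
have sep' p q : c2 p = c2 q -> s2 p = s2 q -> c1 p = c1 q -> s1 p = s1 q -> lattice (p - q).
  by move=> *; exact: sep.
have [T [_ [e3 e4 e1 e2]]] := angle_forms_chart cly clx Jp cs2 cs1 dc2 ds2 dc1 ds1 sep'.
rewrite -e1 -e2 -e3 -e4 addrC in FE.
have pars' (U W : 'rV[A]_5) : vdot U W = vdot U (vcst r2) * vdot W (vcst r2)
  + vdot U (vcst r3) * vdot W (vcst r3) + vdot U (vcst r0) * vdot W (vcst r0)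
  + vdot U (vcst r1) * vdot W (vcst r1) + vdot U (vcst r4) * vdot W (vcst r4).
  have swap (u v w z : A) : u + v + w + z = w + z + u + v by rewrite -addrA addrC addrA.
  by rewrite pars; congr (_ + _); exact: swap.
by apply: (clifford_index FE _ _ _ _ _ _ _ _ _ _ pars' imm fmin nB); rewrite ?rn ?rd.
Qed.
End CliffordChart.

(** * The theorem *)

Section Assembly.
Context {R : realType}.
Notation A := (torus_fun R).

Lemma conformal_chart n (F : 'rV[A]_n.+1) : immersed_torus (veval F) ->
  exists (c : chart R) (e : A), [/\ forall p, 0 < e p,
    vdot (vderiv (Dx c) F) (vderiv (Dx c) F) = e * e,
    vdot (vderiv (Dy c) F) (vderiv (Dy c) F) = e * e &
    vdot (vderiv (Dx c) F) (vderiv (Dy c) F) = 0].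
Proof.
move=> imm; pose g i j := tmetric F i j.
have gC : g ord_max ord0 = g ord0 ord_max by exact: vdotC.
have det0 p : 0 < (g ord0 ord0 * g ord_max ord_max - g ord0 ord_max * g ord0 ord_max) p.
  exact: tgram_gt0 imm p.
have E0 p : 0 < g ord0 ord0 p.
  rewrite lt_def vdot_ge0 andbT; apply/eqP => z; have := det0 p.
  by rewrite torusB !torusM z mul0r sub0r oppr_gt0 ltNge -expr2 sqr_ge0.
have [c [D [D0 dE1 dE2 dE3]]] := isothermal E0 det0.
have mM p : 0 < (ijac c * D) p.
  rewrite torusM mulr_gt0 //.
  have J := torus_eq (jacV c) p; move: J; rewrite torusM torus1 => J.
  by rewrite -(pmulr_rgt0 _ (chart_det c p : 0 < jac c p)) J.
have [e [ee e0]] := torus_sqrt mM.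
have vX : vderiv (Dx c) F = ijac c *: (cyt c *: vderiv (Dt ord0) F - cys c *: vderiv (Dt ord_max) F).
  by apply/rowP => j; rewrite !(vderiv_entry, mxE) DxE.
have vY : vderiv (Dy c) F = ijac c *: (cxs c *: vderiv (Dt ord_max) F - cxt c *: vderiv (Dt ord0) F).
  by apply/rowP => j; rewrite !(vderiv_entry, mxE) DyE.
have dot2 (a b a' b' : A) (k : A) i j i' j' :
    vdot (k *: (a *: vderiv (Dt i) F - b *: vderiv (Dt j) F))
    (k *: (a' *: vderiv (Dt i') F - b' *: vderiv (Dt j') F))
    = k * k * (a * a' * g i i' - a * b' * g i j' - b * a' * g j i' + b * b' * g j j').
  rewrite !vdotE /g /tmetric.
  by move: (vdot _ _) (vdot _ _) (vdot _ _) (vdot _ _) => *; ring.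
have fin (J : A) : J = jac c * D -> ijac c * ijac c * J = e * e.
  move=> ->; rewrite ee.
  transitivity (jac c * ijac c * (ijac c * D)); last by rewrite jacV mul1r.
  by rewrite mulrACA (mulrC (ijac c) (jac c)).
exists c, e; split=> //.
- rewrite vX dot2 gC; apply: fin; rewrite -dE1.
  by move: (g _ _) (g _ _) (g _ _) (cyt c) (cys c) => *; ring.
- rewrite vY dot2 gC; apply: fin; rewrite -dE2.
  by move: (g _ _) (g _ _) (g _ _) (cxs c) (cxt c) => *; ring.
rewrite vX vY dot2 gC -[RHS](mulr0 (ijac c * ijac c)); congr (_ * _); rewrite -oppr0 -dE3.
by move: (g _ _) (g _ _) (g _ _) (cxs c) (cxt c) (cys c) (cyt c) => *; ring.
Qed.

Lemma morse_index_le n (f : R * R -> 'rV[R]_n.+1) m :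
  (forall k (B : 'I_k -> R * R -> 'rV[R]_n.+1), negative_definite_family f B -> (k <= m)%N) ->
  (morse_index f <= m%:R%:E)%E.
Proof.
move=> H; apply: ge_ereal_sup => _ [k [B nB] <-].
by rewrite lee_fin ler_nat; exact: H nB.
Qed.
End Assembly.

Theorem theorem1p1 (R : realType) (f : R * R -> 'rV[R]_5)
    (f_immersion : immersed_torus f) (f_minimal : minimal f) :
  (6%:E <= morse_index f)%E /\
  (morse_index f = 6%:E <->
   exists (S : set 'rV[R]_5) (iota : 'rV[R]_4 -> 'rV[R]_5),
    [/\ great_sphere 3 S,
    isometry_onto (sphere R 3) S iota &
    congruent f (fun p => iota (clifford_torus p))]).
Proof.
have [sf pf _ _] := f_immersion; have [F fE] := veval_surj sf pf; move: f_immersion f_minimal.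
rewrite fE => imm fmin; rewrite fE in pf.
have [c0 [e [e_gt0 xx yy xy]]] := conformal_chart imm.
have [ie [eie _]] := torus_inv (fun p => negbT (gt_eqF (e_gt0 p))).
have cm0 := minimal_conformal imm e_gt0 xx yy xy eie fmin.
have [c [k [cm k_ge0 PN PPNN]]] := principal_chart cm0.
have H1 : forall j, negative_family (chart_frame c) F e ie (@tcst R : {rmorphism R -> torus_fun R}) (cint c) j ->
    (j%:R%:E <= morse_index (veval F))%E.
  by move=> j; apply: (index_ge_family (erefl _) imm e_gt0 cm).
pose frE := erefl (chart_frame c : frame 'rV[torus_fun R]_5).
have P0 := hopf1_neq0 frE e_gt0 cm k_ge0 PPNN.
have p0 := perpc_eq0 frE e_gt0 cm k_ge0 PN PPNN.
have H6 : 0 < k -> (6%:E <= morse_index (veval F))%E.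
  move=> k0; apply: (H1 6%N).
  exact: (negative6 cm (fX_cst frE) (fY_cst frE) (cintD c) (cintZ c) (cint_fX frE) (cint_fY frE)
    (@vcstD R 5) (@vcstZ R 5) (fr_cstx frE) (fr_csty frE) (cint_Esqr_gt0 frE cm)
    (cint_iEsqr_gt0 frE cm) k_ge0 PN PPNN P0 p0 k0).
have H7 : k = 0 -> (7%:E <= morse_index (veval F))%E.
  move=> k0; apply: (H1 7%N).
  exact: (negative7_superminimal cm (fX_cst frE) (fY_cst frE) (cintD c) (cintZ c) (cint_fX frE) (cint_fY frE)
    (@vcstD R 5) (@vcstZ R 5) (fr_cstx frE) (fr_csty frE) (cint_Esqr_gt0 frE cm)
    (cint_iEsqr_gt0 frE cm) PN PPNN P0 p0 k0).
have i6 : (6%:E <= morse_index (veval F))%E.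
  move: k_ge0; rewrite le_eqVlt => /orP[/eqP/esym/H7|//].
  by apply: le_trans; rewrite lee_fin ler_nat.
split=> //; split=> [ind|[S [iota [gS iso cong]]]].
  have no7 : ~ (7%:E <= morse_index (veval F))%E by rewrite ind lee_fin ler_nat.
  have k_gt0 : 0 < k.
    by rewrite lt_neqAle k_ge0 andbT; apply/eqP => k0; apply: no7; apply: H7.
  by apply: (clifford_of_index frE imm e_gt0 cm k_gt0 PN PPNN) => /H1.
have [M [psi [MM FM lpsi]]] := linear_clifford pf gS iso cong.
apply/eqP; rewrite eq_le i6 andbT; apply: morse_index_le => j B nB.
exact: (clifford_index_le imm fmin MM FM lpsi nB).
Qed.
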